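(* Let $K$ be the cyclic cubic field of discriminant $13^2$ and let $\mathcal{X}(1)$ be the Shimura curve over $\mathbb{Q}$ defined in the context, with its coordinate $\varphi:\mathcal{X}(1)\simeq\mathbb{P}^1_{\mathbb{Q}}$. On $\mathcal{X}(1)$ there are the following CM points defined over $\mathbb{Q}$: 1. the pole of $\varphi$ (the point $\varphi=\infty$), namely the unique elliptic point of order $3$, which is CM by $K(\sqrt{-3})$; 2. the point with $\varphi$-coordinate equal to $\frac{2^4\cdot 3^3\cdot 11}{5^3}$, which is CM by $K(\sqrt{-7})$; 3. the point with $\varphi$-coordinate equal to $-\frac{23549}{5^3}$, which is CM by $K(\sqrt{-2})$.
   Context: Setting. $K$ is the cyclic cubic field of discriminant $13^2$, i.e. $K=\mathbb{Q}(\theta_0)$ with $\theta_0$ a root of $x^3+x^2-4x+1$; its narrow class group is trivial. Let $\sigma_1,\sigma_2,\sigma_3$ be its three real embeddings. $B$ is the quaternion algebra over $K$ ramified exactly at $\sigma_2$ and $\sigma_3$. Fix an embedding $i_\infty : B \hookrightarrow M_2(\mathbb{R})$ restricting to $\sigma_1$ on $K$, a maximal order $\mathcal{O}$ of $B$ (unique up to conjugation), and let $\mathcal{O}^1$ be the group of elements of $\mathcal{O}$ of reduced norm $1$. The prime $2$ is inert in $K$ and $B$ is unramified there; let $\mathbb{Q}_8$ be the completion of $K$ at $2$ with ring of integers $\mathbb{Z}_8$, and fix $i_2 : B \hookrightarrow M_2(\mathbb{Q}_8)$ with $i_2(\mathcal{O})\subset M_2(\mathbb{Z}_8)$ generating $M_2(\mathbb{Z}_8)$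 over $\mathbb{Z}_8$. Put $\Gamma(1)=i_\infty(\mathcal{O}^1)$ and let $\Gamma_0(2)$ be the image under $i_\infty$ of the $\omega\in\mathcal{O}^1$ such that $i_2(\omega)$ is upper triangular modulo $2M_2(\mathbb{Z}_8)$; both are regarded as subgroups of $PSL_2(\mathbb{R})$. With $\mathcal{H}$ the upper half-plane, $\mathcal{X}(1)_{\mathbb{C}}=\Gamma(1)\backslash\mathcal{H}$ and $\mathcal{X}_0(2)_{\mathbb{C}}=\Gamma_0(2)\backslash\mathcal{H}$. $\mathcal{X}(1)_{\mathbb{C}}$ has genus $0$ and exactly four elliptic points: $P_0$ of order $3$ and $P_1,P_2,P_3$ of order $2$. CM points. Let $L/K$ be a CM field (a totally imaginary quadratic extension of $K$) with ring of integers $\mathcal{O}_L$, and $i:L\hookrightarrow B$ a $K$-embedding. It is called optimal if $i^{-1}(i(L)\cap\mathcal{O})=\mathcal{O}_L$. The elements of $i_\infty(i(L))$ share a fixed point $\tau\in\mathcal{H}$; if $i$ is optimal, the class of $\tau$ in $\Gamma(1)\backslash\mathcal{H}$ is called a point of $\mathcal{X}(1)$ that is CM by $L$. Models. By Shimura, $\mathcal{X}_0(2)_{\mathbb{C}}\to\mathcal{X}(1)_{\mathbb{C}}$ has a canonical model over $K$: there is a holomorphic $j:\mathcal{H}\to\mathcal{X}(1)$ inducing $\Gamma(1)\backslash\mathcal{H}\simeq\mathcal{X}(1)\otimes_K\mathbb{C}$ such that, for each CM field $L/K$ optimally embedded in $B$, the points CM by $L$ number $h_L$ (the class number of $L$),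 form a complete set of conjugates over $K$, and each generates over $L$ the Hilbert class field of $L$. This model descends to a cover $\mathcal{X}_0(2)\to\mathcal{X}(1)$ over $\mathbb{Q}$ for which $P_0$ is rational over $\mathbb{Q}$ and $P_1,P_2,P_3$ are conjugate over $\mathbb{Q}$. The coordinate $\varphi$. The cover $\mathcal{X}_0(2)\to\mathcal{X}(1)\simeq\mathbb{P}^1_{\mathbb{Q}}$ is explicitly given as follows: $\mathcal{X}_0(2)$ is the smooth projective curve with affine equation $$f^3 - f^2g - f^2 - \tfrac{25}{84}fg + \tfrac{40}{147}f - \tfrac{625}{702}g^3 + \tfrac{50}{441}g - \tfrac{640}{9261} = 0$$ and the map to $\mathcal{X}(1)\simeq\mathbb{P}^1_{\mathbb{Q}}$ is the degree $9$ function $$\varphi = -\tfrac{241129}{125}f^2g - \tfrac{36309}{125}f^2 + \tfrac{1715}{3}fg^2 + \tfrac{22099}{30}fg - \tfrac{637}{200}f - \tfrac{1715}{9}g^3 + \tfrac{1225}{36}g^2 - \tfrac{1708}{45}g - \tfrac{1301}{75}.$$ In this coordinate $P_0$ is at $\varphi=\infty$ and $P_1,P_2,P_3$ are at the three roots of $x^3-x^2-992x-20736$. *)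

(* Defs.v *)
From HB Require Import structures.
From mathcomp Require Import all_boot all_order all_algebra.
From mathcomp Require Import all_fingroup all_solvable all_field.
From mathcomp Require Import all_classical all_reals all_analysis.
From mathcomp Require Import complex.

Set Implicit Arguments.
Unset Strict Implicit.
Unset Printing Implicit Defensive.

Import Order.TTheory GRing.Theory Num.Theory.
Import numFieldNormedType.Exports.

Local Open Scope classical_set_scope.
Local Open Scope complex_scope.
Local Open Scope ring_scope.

Definition integers (L : fieldType) : set L :=
  [set x | integralOver (intr : int -> L) x].
Arguments integers : clear implicits.

Definition is_nonarch_abs (R : realType) (F : fieldType) (v : F -> R) : Prop :=
  [/\ forall x, 0 <= v x,
      forall x, v x = 0 <-> x = 0,
      forall x y, v (x * y) = v x * v y
    & forall x y, v (x + y) <= Num.max (v x) (v y)].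

Definition nontrivial_abs (R : realType) (F : fieldType) (v : F -> R) : Prop :=
  exists2 x, x != 0 & v x != 1.

(* [F], with embedding [iota] and absolute value [v], is the completion of the
   number field [K] at a finite place.  By Ostrowski, the finite places are the
   classes of nontrivial non-archimedean absolute values. *)
Definition is_finite_completion (R : realType) (K F : fieldType)
    (iota : {rmorphism K -> F}) (v : F -> R) : Prop :=
  [/\ is_nonarch_abs v,
      nontrivial_abs (v \o iota),
      forall (x : F) (e : R), 0 < e -> exists k : K, v (x - iota k) < e
    & forall u : nat -> F,
        (forall e : R, 0 < e -> exists N, forall m n,
           (N <= m)%N -> (N <= n)%N -> v (u m - u n) < e) ->
        exists l : F, forall e : R, 0 < e -> exists N, forall n,
           (N <= n)%N -> v (u n - l) < e].

Definition is_CM_field (R : realType) (K : fieldExtType rat)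
    (L : fieldExtType K) : Prop :=
  \dim {: L} = 2%N /\ ({rmorphism L -> R} -> False).

(* [L = K(sqrt d)] *)
Definition is_sqrt_ext (K : fieldExtType rat) (L : fieldExtType K) (d : int)
    : Prop :=
  exists2 s : L, s ^+ 2 = d%:~R & <<1; s>>%VS = {: L}%VS.

Definition is_ideal (L : fieldType) (I : set L) : Prop :=
  [/\ I `<=` integers L,
      exists2 x, I x & x != 0,
      forall x y, I x -> I y -> I (x + y)
    & forall a x, integers L a -> I x -> I (a * x)].

Definition equiv_ideals (L : fieldType) (I J : set L) : Prop :=
  exists a b : L, [/\ a != 0, b != 0 &
    [set a * x | x in I] = [set b * x | x in J]].

Definition is_class_number (L : fieldType) (h : nat) : Prop :=
  exists I : 'I_h -> set L,
    [/\ forall m, is_ideal (I m),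
        forall m n, equiv_ideals (I m) (I n) -> m = n
      & forall J, is_ideal J -> exists m, equiv_ideals J (I m)].

(* [M / L] is unramified at the finite places: for every place of [M] the value
   groups of [M] and of [L] coincide, that is, the ramification index is 1
   (residue fields are finite, hence perfect). *)
Definition unramified (R : realType) (L : fieldType) (M : fieldExtType L)
    : Prop :=
  forall v : M -> R, is_nonarch_abs v -> nontrivial_abs v ->
  forall x : M, x != 0 -> exists y : L, v x = v y%:A.

Definition unramified_abelian (R : realType) (L : fieldType)
    (M : splittingFieldType L) : Prop :=
  [/\ galois 1 {: M}, abelian 'Gal({: M} / 1) & unramified R M].

(* Only meant for a totally imaginary [L], where the infinite places impose no
   condition. *)
Definition is_hilbert_class_field (R : realType) (L : fieldType)
    (M : splittingFieldType L) : Prop :=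
  unramified_abelian R M /\
  forall M' : splittingFieldType L, unramified_abelian R M' ->
    exists f : {rmorphism M' -> M}, forall x : L, f x%:A = x%:A.

Definition is_central_simple (K : fieldType) (B : falgType K) : Prop :=
  (forall x : B, (forall y, x * y = y * x) -> exists k : K, x = k%:A) /\
  (forall U : {vspace B}, (fullv * U <= U)%VS -> (U * fullv <= U)%VS ->
     U = 0%VS \/ U = fullv).

(* The [F]-algebra [A], with its map [h] from [B], is [B] tensored with [F]:
   the induced map from the tensor product is onto and the dimensions agree. *)
Definition is_base_change (K F : fieldType) (iota : {rmorphism K -> F})
    (B : falgType K) (A : falgType F) (h : {rmorphism B -> A}) : Prop :=
  [/\ forall (k : K) (b : B), h (k *: b) = iota k *: h b,
      \dim {: A} = \dim {: B}
    & forall a : A, exists s : seq (F * B), a = \sum_(p <- s) p.1 *: h p.2].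

Definition split_over (K F : fieldType) (iota : {rmorphism K -> F})
    (B : falgType K) : Prop :=
  exists h : {rmorphism B -> 'M[F]_2}, is_base_change iota h.

Definition division_over (K F : fieldType) (iota : {rmorphism K -> F})
    (B : falgType K) : Prop :=
  exists (A : falgType F) (h : {rmorphism B -> A}),
    is_base_change iota h /\ forall a : A, a != 0 -> a \is a GRing.unit.

(* The quaternion algebra over the totally real cubic field [K] that is
   ramified exactly at the real places [s2] and [s3]; [s1] is the third one. *)
Definition is_quaternion_ramified_at (R : realType) (K : fieldExtType rat)
    (s1 s2 s3 : {rmorphism K -> R}) (B : falgType K) : Prop :=
  [/\ \dim {: B} = 4%N /\ is_central_simple B,
      split_over s1 B,
      division_over s2 B,
      division_over s3 B
    & forall (F : fieldType) (iota : {rmorphism K -> F}) (v : F -> R),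
        is_finite_completion iota v -> split_over iota B].

Definition is_order (K : fieldType) (B : falgType K) (O : set B) : Prop :=
  [/\ O 1,
      forall x y, O x -> O y -> O (x - y),
      forall x y, O x -> O y -> O (x * y)
    & exists2 gens : seq B, <<gens>>%VS = fullv &
        forall b, O b <-> exists c : 'I_(size gens) -> K,
          (forall m, integers K (c m)) /\ b = \sum_m c m *: gens`_m].

Definition is_maximal_order (K : fieldType) (B : falgType K) (O : set B)
    : Prop :=
  is_order O /\ forall O' : set B, is_order O' -> O `<=` O' -> O' `<=` O.

(* [i] maps [B] to 2 x 2 matrices and restricts to [iota] on [K]. *)
Definition restricts_to (K F : fieldType) (iota : {rmorphism K -> F})
    (B : falgType K) (i : {rmorphism B -> 'M[F]_2}) : Prop :=
  forall k : K, i k%:A = (iota k)%:M.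

(* [i2] maps [O] into the matrices over the valuation ring [Z] of [v], and the
   image of [O] generates these matrices over [Z]. *)
Definition is_integral_splitting (R : realType) (K F : fieldType) (v : F -> R)
    (B : falgType K) (O : set B) (i2 : {rmorphism B -> 'M[F]_2}) : Prop :=
  (forall w, O w -> forall m n, v (i2 w m n) <= 1) /\
  (forall X : 'M[F]_2, (forall m n, v (X m n) <= 1) ->
     exists s : seq (F * B),
       (forall p, p \in s -> v p.1 <= 1 /\ O p.2) /\
       X = \sum_(p <- s) p.1 *: i2 p.2).

(* The reduced norm is the determinant in any splitting; [iinf] is one. *)
Definition norm_one (R : realType) (K : fieldType) (B : falgType K)
    (O : set B) (iinf : {rmorphism B -> 'M[R]_2}) : set B :=
  [set w | O w /\ \det (iinf w) = 1].

(* [Gamma1] and [Gamma02] are given by matrices of determinant 1; a matrix and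
   its opposite are the same element of PSL_2(R). *)
Definition Gamma1 (R : realType) (K : fieldType) (B : falgType K)
    (O : set B) (iinf : {rmorphism B -> 'M[R]_2}) : set 'M[R]_2 :=
  [set iinf w | w in norm_one O iinf].

Definition Gamma02 (R : realType) (K F : fieldType) (v : F -> R)
    (B : falgType K) (O : set B) (iinf : {rmorphism B -> 'M[R]_2})
    (i2 : {rmorphism B -> 'M[F]_2}) : set 'M[R]_2 :=
  [set iinf w | w in norm_one O iinf `&`
                     [set w | v (i2 w 1 0) <= v 2%:R]].

Definition upper (R : realType) : set R[i] := [set z | 0 < complex.Im z].
Arguments upper : clear implicits.

Definition mobius (R : realType) (g : 'M[R]_2) (z : R[i]) : R[i] :=
  ((g 0 0)%:C * z + (g 0 1)%:C) / ((g 1 0)%:C * z + (g 1 1)%:C).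

(* The stabilizer of [tau] in the image of [G] in PSL_2(R) has order [e]. *)
Definition has_stabilizer_order (R : realType) (G : set 'M[R]_2) (tau : R[i])
    (e : nat) : Prop :=
  exists s : 'I_e -> 'M[R]_2,
    [/\ forall m, G (s m) /\ mobius (s m) tau = tau,
        forall m n, (s m = s n \/ s m = - s n) -> m = n
      & forall g, G g -> mobius g tau = tau ->
          exists m, g = s m \/ g = - s m].

Definition is_elliptic (R : realType) (G : set 'M[R]_2) (tau : R[i]) (e : nat)
    : Prop :=
  [/\ upper R tau, (1 < e)%N & has_stabilizer_order G tau e].

Definition holomorphic_on_upper (R : realType) (f : R[i] -> R[i]) : Prop :=
  forall z, upper R z -> derivable (f : R[i]^o -> R[i]^o) z 1.

Definition same_point (F : fieldType) (n : nat) (P Q : 'rV[F]_n) : Prop :=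
  exists2 c : F, c != 0 & P = c *: Q.

(* [J], in homogeneous coordinates, induces an isomorphism of the quotient of
   the upper half-plane by [G] with the smooth projective curve [V] in P^n. A
   holomorphic map from the upper half-plane to P^n always lifts globally to
   homogeneous coordinates, and a bijective holomorphic map between Riemann
   surfaces is an isomorphism. *)
Definition uniformizes (R : realType) (G : set 'M[R]_2) (n : nat)
    (V : set 'rV[R[i]]_n) (J : R[i] -> 'rV[R[i]]_n) : Prop :=
  [/\ forall m, holomorphic_on_upper (fun z => J z 0 m),
      forall z, upper R z -> J z != 0 /\ V (J z),
      forall z z', upper R z -> upper R z' ->
        (same_point (J z) (J z') <-> exists2 g, G g & z' = mobius g z)
    & forall P, P != 0 -> V P -> exists2 z, upper R z & same_point (J z) P].

(* Homogenizations, with [w] the third coordinate, of the equation of the curve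
   and of the degree 9 function on it.  The plane cubic is smooth, hence it is
   the smooth projective model; the function is [phi_form / w ^+ 3], and
   [phi_form] does not vanish at the points of the curve at infinity.  Numerals
   above 10000 are split (241129 = 241 * 10 ^+ 3 + 129) since ring numerals are
   unary. *)
Definition curve_form (F : fieldType) (f g w : F) : F :=
  f ^+ 3 - f ^+ 2 * g - f ^+ 2 * w - 25 / 84 * f * g * w
  + 40 / 147 * f * w ^+ 2 - 625 / 702 * g ^+ 3 + 50 / 441 * g * w ^+ 2
  - 640 / 9261 * w ^+ 3.

Definition phi_form (F : fieldType) (f g w : F) : F :=
  - ((241 * 10 ^+ 3 + 129) / 125) * f ^+ 2 * g
  - (36 * 10 ^+ 3 + 309) / 125 * f ^+ 2 * w
  + 1715 / 3 * f * g ^+ 2 + (22 * 10 ^+ 3 + 99) / 30 * f * g * w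
  - 637 / 200 * f * w ^+ 2
  - 1715 / 9 * g ^+ 3 + 1225 / 36 * g ^+ 2 * w - 1708 / 45 * g * w ^+ 2
  - 1301 / 75 * w ^+ 3.

Definition plane_cubic (F : fieldType) : set 'rV[F]_3 :=
  [set P | curve_form (P 0 0) (P 0 1) (P 0 2%:R) = 0].
Arguments plane_cubic : clear implicits.

Definition cover_map (F : fieldType) (P : 'rV[F]_3) : 'rV[F]_2 :=
  \row_m (if m == 0 then phi_form (P 0 0) (P 0 1) (P 0 2%:R)
          else P 0 2%:R ^+ 3).

(* P^1(F) is [option F], with [None] the point at infinity. *)
Definition p1_point (F : fieldType) (P : 'rV[F]_2) : option F :=
  if P 0 1 == 0 then None else Some (P 0 0 / P 0 1).

Definition is_optimal (K : fieldExtType rat) (B : falgType K) (O : set B)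
    (L : fieldExtType K) (i : {lrmorphism L -> B}) : Prop :=
  forall x : L, O (i x) <-> integers L x.

(* The complex point [P] of X(1), in the coordinate [phi], is CM by [L]. *)
Definition is_CM_point (R : realType) (K : fieldExtType rat) (B : falgType K)
    (O : set B) (iinf : {rmorphism B -> 'M[R]_2}) (phi : R[i] -> option R[i])
    (L : fieldExtType K) (P : option R[i]) : Prop :=
  is_CM_field R L /\
  exists (i : {lrmorphism L -> B}) (tau : R[i]),
    [/\ is_optimal O i,
        upper R tau,
        forall x : L, x != 0 -> mobius (iinf (i x)) tau = tau
      & phi tau = P].

(* A complete set of conjugates over [K], embedded in the complex numbers by
   [s]. *)
Definition is_complete_conjugates (R : realType) (K : fieldType)
    (s : {rmorphism K -> R}) (S : set (option R[i])) : Prop :=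
  S = [set None] \/
  exists2 p : {poly K}, irreducible_poly p &
    S = [set Some z | z in [set z : R[i] |
           root (map_poly (fun k => (s k)%:C) p) z]].

(* [P] generates over [L] the Hilbert class field of [L], all fields being
   embedded in the complex numbers compatibly with [s].  (The point at infinity
   is rational and generates the trivial extension, as 0 does.) *)
Definition generates_hilbert_class_field (R : realType)
    (K : fieldExtType rat) (s : {rmorphism K -> R}) (L : fieldExtType K)
    (P : option R[i]) : Prop :=
  exists (M : splittingFieldType L) (e : {rmorphism M -> R[i]}) (y : M),
    [/\ is_hilbert_class_field R M,
        forall k : K, e (k%:A%:A) = (s k)%:C,
        e y = odflt 0 P
      & <<1; y>>%VS = {: M}%VS].

Definition is_canonical_model (R : realType) (K : fieldExtType rat)
    (s : {rmorphism K -> R}) (B : falgType K) (O : set B)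
    (iinf : {rmorphism B -> 'M[R]_2}) (phi : R[i] -> option R[i]) : Prop :=
  forall L : fieldExtType K, is_CM_field R L ->
    (exists i : {lrmorphism L -> B}, is_optimal O i) ->
    let S := is_CM_point O iinf phi L in
    [/\ exists t : seq (option R[i]),
          [/\ uniq t, is_class_number L (size t) & S = [set` t]],
        is_complete_conjugates s S
      & forall P, S P -> generates_hilbert_class_field s L P].

(* Main.v *)
(* The curve X_0(2) is a plane cubic E. With l = 12 f - 17 g - (64/7) w its equation reads
   a f^2 l = p(g, l), so f |-> -f is an involution iota of E, with fixed points the flex
   Q0 = (f : g : l) = (1 : 0 : 0) and the three points Qj with f = 0, which lie over the
   elliptic points of order 2.

   Elements of O of norm 2 that are upper triangular modulo 2 with even diagonal normalize
   Gamma_0(2), and they form one coset; they define the Atkin-Lehner involution of E.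
   Since phi restricted to E is unramified at Qj, the elliptic element i of order 2 at a
   point over Qj lies in Gamma_0(2), and 1 + i is an Atkin-Lehner element fixing that point.
   So the involution fixes Q1, Q2, Q3, and compactness (functions invariant under Gamma_0(2)
   are constant) forces it to preserve (g : l) and to be iota.

   At a point over Q0 there is then an Atkin-Lehner element alpha with a fixed point, whose
   multiplier mu satisfies mu^m = -1. Integrality at 2 of mu^m + mu^-m (times a power
   of 2) makes the trace of alpha even; then alpha^2 / 2 is in O^1 and fixes a point that is
   not elliptic, whence alpha^2 = -2.

   For s^2 = -7 the point P of E with f = 3/7 + s/7, g = -13/50 + 39 s/350, w = 1 satisfies
   phi(P) = phi(iota P) = 4752/125. This gives alpha in O of norm 2 with a fixed point over
   P, and mu^m is the quotient of the derivatives of phi o iota and phi at P, so that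
   mu^m + mu^-m = -3/2; integrality at 2 forces the trace of alpha to be 1 or -1.

   In each case the order generated by these elements over Z_K is the ring of integers of
   the CM field, so the embedding is optimal. *)
Require Import Defs.
From HB Require Import structures.
From mathcomp Require Import all_boot all_order all_algebra.
From mathcomp Require Import all_fingroup all_solvable all_field.
From mathcomp Require Import all_classical all_reals all_analysis.
From mathcomp Require Import complex ring lra zify.
Set Implicit Arguments.
Unset Strict Implicit.
Unset Printing Implicit Defensive.
Import Order.TTheory GRing.Theory Num.Theory.
Local Open Scope classical_set_scope.
Local Open Scope ring_scope.

(** * Complex limits and derivatives *)

(** The exponent [m] in [mu^m] is a vanishing order on the half-plane that is never computed, since
    it depends on ramification that is not known in advance. The arithmetic therefore treats all [m]
    at once: [2] is inert in [K], so evenness of an integer of [K] is a prime condition, and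
    [2^m (mu^m + mu^-m)] obeys a two-term recurrence that becomes a power modulo 2. The multiplier
    [mu] links analysis and algebra: it is the derivative at a fixed point, and also the quotient of
    the two eigenvalues, hence determined by trace and norm.

    Curves are replaced throughout by functions on the upper half-plane, and a statement near one
    point by an identity of holomorphic functions. The complex analysis that this takes is derived
    from Goursat's theorem on squares. Finiteness is drawn from the uniformizations as well:
    compactness from [J] being onto the line, the finite index of [Gamma_0(2)] from the fibre of the
    cubic over [phi = oo], the torsion of stabilizers from vanishing orders. *)

Section ComplexLimits.
Local Open Scope complex_scope.
Variable R : realType.
Local Notation C := R[i].
Implicit Types (z w a b : C) (f g : C -> C) (e d : R).

(** A modulus with values in [R]: the numeric norm of [R[i]] lands in [R[i]], where the estimates
    below could not be handed to [lra]. *)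
Definition nm z : R := Normc.normc z.

Lemma nm_ge0 z : 0 <= nm z.
Proof. by case: z => a b; rewrite /nm /= sqrtr_ge0. Qed.
Lemma nm0 : nm 0 = 0. Proof. exact: Normc.normc0. Qed.
Lemma nm1 : nm 1 = 1. Proof. exact: Normc.normc1. Qed.
Lemma nm_eq0 z : (nm z == 0) = (z == 0).
Proof. by apply/eqP/eqP => [|->]; [exact: Normc.eq0_normc|exact: nm0]. Qed.
Lemma nm_gt0 z : (0 < nm z) = (z != 0).
Proof. by rewrite lt0r nm_eq0 nm_ge0 andbT. Qed.
Lemma nmM z w : nm (z * w) = nm z * nm w. Proof. exact: Normc.normcM. Qed.
Lemma nmV z : nm z^-1 = (nm z)^-1. Proof. exact: Normc.normcV. Qed.
Lemma nmN z : nm (- z) = nm z. Proof. exact: normcN. Qed.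
Lemma nmD z w : nm (z + w) <= nm z + nm w. Proof. exact: le_normcD. Qed.
Lemma nmB z w : nm (z - w) <= nm z + nm w.
Proof. by rewrite -(nmN w); exact: nmD. Qed.
Lemma nm_sub z w : nm (z - w) = nm (w - z).
Proof. by rewrite -nmN opprB. Qed.
Lemma nmX z n : nm (z ^+ n) = nm z ^+ n.
Proof. by elim: n => [|n IH]; rewrite ?expr0 ?nm1// !exprS nmM IH. Qed.
Lemma nm_real (x : R) : nm x%:C = `|x|.
Proof. by rewrite /nm /= expr0n /= addr0 sqrtr_sqr. Qed.
Lemma nm_tri z w a : nm (z - w) <= nm (z - a) + nm (a - w).
Proof. by rewrite (_ : z - w = (z - a) + (a - w)) ?nmD//; ring. Qed.
Lemma nm_low z w : nm z - nm w <= nm (z - w).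
Proof. by have := nmD (z - w) w; rewrite subrK; lra. Qed.
Lemma Re_le_nm z : `|complex.Re z| <= nm z.
Proof.
case: z => x y; rewrite /nm /= -sqrtr_sqr ler_wsqrtr// lerDl.
exact: sqr_ge0.
Qed.
Lemma Im_le_nm z : `|complex.Im z| <= nm z.
Proof.
case: z => x y; rewrite /nm /= -sqrtr_sqr ler_wsqrtr// lerDr.
exact: sqr_ge0.
Qed.
Lemma nm_le_ReIm z : nm z <= `|complex.Re z| + `|complex.Im z|.
Proof.
case: z => x y; rewrite /nm /=.
rewrite -[leRHS]ger0_norm ?addr_ge0// -sqrtr_sqr ler_wsqrtr//.
rewrite sqrrD !real_normK ?num_real//.
have : 0 <= `|x| * `|y| *+ 2 by rewrite mulrn_wge0// mulr_ge0.
lra.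
Qed.
Lemma nm_sqr z : nm z ^+ 2 = complex.Re z ^+ 2 + complex.Im z ^+ 2.
Proof. by case: z => x y; rewrite /nm /= sqr_sqrtr// addr_ge0// sqr_ge0. Qed.

Definition near z (P : C -> Prop) : Prop :=
  exists2 d : R, 0 < d & forall w, nm (w - z) < d -> P w.
Definition pnear z (P : C -> Prop) : Prop := near z (fun w => w != z -> P w).

Lemma near_imp z (P Q : C -> Prop) : (forall w, P w -> Q w) -> near z P -> near z Q.
Proof. by move=> PQ [d d0 H]; exists d => // w /H /PQ. Qed.
Lemma near_and z (P Q : C -> Prop) :
  near z P -> near z Q -> near z (fun w => P w /\ Q w).
Proof.
move=> [d d0 H] [d' d0' H']; exists (Num.min d d'); first by rewrite lt_min d0.
by move=> w; rewrite lt_min => /andP[/H ? /H' ?].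
Qed.
Lemma near_and_imp z (P Q S : C -> Prop) : (forall w, P w -> Q w -> S w) ->
  near z P -> near z Q -> near z S.
Proof. by move=> PQS P1 Q1; apply: near_imp (near_and P1 Q1) => w []; exact: PQS. Qed.
Lemma near_pt z (P : C -> Prop) : near z P -> P z.
Proof. by move=> [d d0 H]; apply: H; rewrite subrr nm0. Qed.
Lemma near_ball z d : 0 < d -> near z (fun w => nm (w - z) < d).
Proof. by exists d. Qed.
Lemma near_all z (P : C -> Prop) : (forall w, P w) -> near z P.
Proof. by exists 1. Qed.
Lemma near_near z (P : C -> Prop) : near z P -> near z (fun w => near w P).
Proof.
move=> [d d0 H]; exists d => // w wz; exists (d - nm (w - z)).
  by rewrite subr_gt0.
by move=> v vw; apply: H; have := nm_tri v z w; lra.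
Qed.
Lemma near_neq z a : a != z -> near z (fun w => w != a).
Proof.
move=> az; exists (nm (a - z)); first by rewrite nm_gt0 subr_eq0.
by move=> w H; apply/eqP => wa; move: H; rewrite wa ltxx.
Qed.
Lemma pnear_pt z (P : C -> Prop) d : 0 < d -> pnear z P ->
  exists w, [/\ w != z, nm (w - z) < d & P w].
Proof.
move=> d0 [d' d0' H]; pose m := Num.min d d' / 2.
have m0 : 0 < m by rewrite divr_gt0// lt_min d0.
have mm : m < Num.min d d' by rewrite /m ltr_pdivrMr// ltr_pMr ?lt_min ?d0// ltr1n.
move: (mm); rewrite lt_min => /andP[m1 m2].
have E : z + m%:C - z = m%:C by ring.
have nz : z + m%:C != z.
  by rewrite -subr_eq0 E -nm_eq0 nm_real normr_eq0 gt_eqF.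
exists (z + m%:C); split=> //; first by rewrite E nm_real gtr0_norm.
by apply: H => //; rewrite E nm_real gtr0_norm.
Qed.

Definition clim f z (l : C) : Prop :=
  forall e, 0 < e -> pnear z (fun w => nm (f w - l) < e).
Definition cont f z : Prop :=
  forall e, 0 < e -> near z (fun w => nm (f w - f z) < e).
Definition cder f z l : Prop := clim (fun w => (f w - f z) / (w - z)) z l.
Definition cdif f z : Prop := exists l, cder f z l.

Lemma clim_ext f g z l : pnear z (fun w => f w = g w) -> clim f z l -> clim g z l.
Proof.
move=> fg fl e /fl; apply: near_and_imp fg => w fg H wz.
by rewrite -(fg wz); exact: H.
Qed.
Lemma clim_cst a z : clim (fun=> a) z a.
Proof. by move=> e e0; apply: near_all => w _; rewrite subrr nm0. Qed.
Lemma clim_id z : clim id z z.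
Proof. by move=> e e0; apply: near_imp (near_ball z e0) => w. Qed.
Lemma climD f g z a b : clim f z a -> clim g z b -> clim (fun w => f w + g w) z (a + b).
Proof.
move=> fa gb e e0; have e20 : 0 < e / 2 by lra.
apply: near_and_imp (fa _ e20) (gb _ e20) => w + + wz => /(_ wz) H /(_ wz) H'.
have -> : f w + g w - (a + b) = (f w - a) + (g w - b) by ring.
by have := nmD (f w - a) (g w - b); lra.
Qed.
Lemma clim_bnd f z a : clim f z a -> pnear z (fun w => nm (f w) < nm a + 1).
Proof.
move=> /(_ 1 ltr01); apply: near_imp => w H /H.
by have := nmD (f w - a) a; rewrite subrK; lra.
Qed.
Lemma climM f g z a b : clim f z a -> clim g z b -> clim (fun w => f w * g w) z (a * b).
Proof.
move=> fa gb e e0; have A0 : 0 < nm b + 1 by have := nm_ge0 b; lra.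
have B0 : 0 < nm a + 1 by have := nm_ge0 a; lra.
have e1 : 0 < e / 2 / (nm b + 1) by rewrite !divr_gt0.
have e2 : 0 < e / 2 / (nm a + 1) by rewrite !divr_gt0.
apply: near_and_imp (near_and (fa _ e1) (gb _ e2)) (clim_bnd gb)
  => w [H1 H2] H3 wz; move/(_ wz): H1; move/(_ wz): H2; move/(_ wz): H3 => H3 H2 H1.
have -> : f w * g w - a * b = (f w - a) * g w + a * (g w - b) by ring.
have N1 : nm ((f w - a) * g w) <= e / 2.
  rewrite nmM; apply: le_trans (_ : e / 2 / (nm b + 1) * (nm b + 1) <= _).
    by rewrite ler_pM ?nm_ge0// ltW.
  by rewrite divfK// gt_eqF.
have N2 : nm (a * (g w - b)) < e / 2.
  rewrite nmM; apply: le_lt_trans (_ : (nm a + 1) * nm (g w - b) < _).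
    by rewrite ler_wpM2r ?nm_ge0// lerDl.
  by rewrite mulrC -ltr_pdivlMr.
by have := nmD ((f w - a) * g w) (a * (g w - b)); lra.
Qed.
Lemma climN f z a : clim f z a -> clim (fun w => - f w) z (- a).
Proof.
by move=> /(climM (clim_cst (-1) z)); rewrite mulN1r; apply: clim_ext;
  apply: near_all => w _; rewrite mulN1r.
Qed.
Lemma climB f g z a b : clim f z a -> clim g z b -> clim (fun w => f w - g w) z (a - b).
Proof. by move=> fa /climN; exact: climD. Qed.
Lemma clim_neq0 f z a : clim f z a -> a != 0 -> pnear z (fun w => nm a / 2 < nm (f w)).
Proof.
move=> fa a0; have A0 : 0 < nm a by rewrite nm_gt0.
have h : 0 < nm a / 2 by lra.
apply: near_imp (fa _ h) => w H /H.
by have := nm_low a (a - f w); rewrite subKr nm_sub; lra.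
Qed.
Lemma climV f z a : a != 0 -> clim f z a -> clim (fun w => (f w)^-1) z a^-1.
Proof.
move=> a0 fa e e0; have A0 : 0 < nm a by rewrite nm_gt0.
have e1 : 0 < e * (nm a * (nm a / 2)) by rewrite !mulr_gt0// invr_gt0.
apply: near_and_imp (fa _ e1) (clim_neq0 fa a0) => w + + wz => /(_ wz) H1 /(_ wz) H2.
have F0 : f w != 0 by rewrite -nm_gt0; lra.
have -> : (f w)^-1 - a^-1 = - (f w - a) / (a * f w) by field; rewrite F0 a0.
rewrite nmM nmV nmN ltr_pdivrMr ?nm_gt0 ?mulf_neq0//.
apply: lt_le_trans H1 _; rewrite ler_pM2l// nmM ler_pM2l// ltW//.
Qed.
Lemma clim_uniq f z a b : clim f z a -> clim f z b -> a = b.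
Proof.
move=> fa fb; apply/eqP; rewrite -subr_eq0 -nm_eq0; apply/negPn/negP => n0.
have e0 : 0 < nm (a - b) / 2 by rewrite divr_gt0// lt0r n0 nm_ge0.
have [w [wz _ [/(_ wz) H1 /(_ wz) H2]]] := pnear_pt ltr01
  (near_imp (fun w H _ => H) (near_and (fa _ e0) (fb _ e0))).
by have := nm_tri a b (f w); rewrite (nm_sub a (f w)); lra.
Qed.
Lemma cont_clim f z : cont f z <-> clim f z (f z).
Proof.
split=> H e e0; first by apply: near_imp (H _ e0) => w.
apply: near_imp (H _ e0) => w; have [->|_] := eqVneq w z; last exact.
by rewrite subrr nm0.
Qed.
Lemma cont_ext f g z : near z (fun w => f w = g w) -> cont f z -> cont g z.
Proof.
move=> fg /cont_clim H; apply/cont_clim; rewrite -(near_pt fg).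
by apply: clim_ext H; apply: near_imp fg.
Qed.
Lemma cont_cst a z : cont (fun=> a) z.
Proof. by apply/cont_clim; exact: clim_cst. Qed.
Lemma cont_id z : cont id z. Proof. by apply/cont_clim; exact: clim_id. Qed.
Lemma contD f g z : cont f z -> cont g z -> cont (fun w => f w + g w) z.
Proof. by rewrite !cont_clim; exact: climD. Qed.
Lemma contB f g z : cont f z -> cont g z -> cont (fun w => f w - g w) z.
Proof. by rewrite !cont_clim; exact: climB. Qed.
Lemma contM f g z : cont f z -> cont g z -> cont (fun w => f w * g w) z.
Proof. by rewrite !cont_clim; exact: climM. Qed.
Lemma contV f z : f z != 0 -> cont f z -> cont (fun w => (f w)^-1) z.
Proof. by rewrite !cont_clim; exact: climV. Qed.
Lemma contX f n z : cont f z -> cont (fun w => f w ^+ n) z.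
Proof.
move=> fc; elim: n => [|n IH]; first exact: cont_cst.
by apply: cont_ext (contM fc IH); apply: near_all => w; rewrite exprS.
Qed.
Lemma near_cont f z (P : C -> Prop) : cont f z -> near (f z) P -> near z (fun w => P (f w)).
Proof. by move=> fc [d d0 H]; apply: near_imp (fc _ d0) => w /H. Qed.
Lemma cont_comp f g z : cont g z -> cont f (g z) -> cont (fun w => f (g w)) z.
Proof. by move=> gc fc e /fc; exact: near_cont. Qed.
Lemma cont_neq0 f z : cont f z -> f z != 0 -> near z (fun w => f w != 0).
Proof.
move=> fc f0; have e0 : 0 < nm (f z) by rewrite nm_gt0.
apply: near_imp (fc _ e0) => w; apply: contraTneq => ->.
by rewrite sub0r nmN ltxx.
Qed.

Lemma cder_ext f g z l : near z (fun w => f w = g w) -> cder f z l -> cder g z l.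
Proof.
move=> fg; apply: clim_ext; have fgz := near_pt fg.
by apply: near_imp fg => w -> _; rewrite fgz.
Qed.
Lemma cdif_ext f g z : near z (fun w => f w = g w) -> cdif f z -> cdif g z.
Proof. by move=> fg [l H]; exists l; exact: cder_ext H. Qed.
Lemma cder_uniq f z a b : cder f z a -> cder f z b -> a = b.
Proof. exact: clim_uniq. Qed.
Lemma cder_cont f z l : cder f z l -> cont f z.
Proof.
move=> fl; apply/cont_clim.
have := climD (climM fl (climB (clim_id z) (clim_cst z z))) (clim_cst (f z) z).
rewrite subrr mulr0 add0r; apply: clim_ext.
by apply: near_all => w wz /=; rewrite divfK ?subrK// subr_eq0.
Qed.
Lemma cdif_cont f z : cdif f z -> cont f z.
Proof. by case=> l; exact: cder_cont. Qed.
Lemma cder_cst a z : cder (fun=> a) z 0.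
Proof. by apply: clim_ext (clim_cst 0 z); apply: near_all => w _; rewrite subrr mul0r. Qed.
Lemma cder_id z : cder id z 1.
Proof.
apply: clim_ext (clim_cst 1 z); apply: near_all => w wz.
by rewrite divff// subr_eq0.
Qed.
Lemma cderD f g z a b : cder f z a -> cder g z b -> cder (fun w => f w + g w) z (a + b).
Proof.
move=> fa gb; apply: clim_ext (climD fa gb); apply: near_all => w _ /=.
by rewrite -mulrDl; congr (_ / _); ring.
Qed.
Lemma cderM f g z a b : cder f z a -> cder g z b ->
  cder (fun w => f w * g w) z (a * g z + f z * b).
Proof.
move=> fa gb; have gc := cder_cont gb; move/cont_clim: gc => gc.
apply: clim_ext (climD (climM fa gc) (climM (clim_cst (f z) z) gb)).
by apply: near_all => w wz /=; rewrite -mulrAC mulrA -mulrDl; congr (_ / _); ring.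
Qed.
Lemma cderV f z a : f z != 0 -> cder f z a ->
  cder (fun w => (f w)^-1) z (- a / f z ^+ 2).
Proof.
move=> f0 fa; have fc := cder_cont fa; have nz := cont_neq0 fc f0.
have := climM (climN fa) (climV f0 (proj1 (cont_clim _ _) fc)).
move/climM => /(_ _ _ (clim_cst (f z)^-1 z)); rewrite -mulrA -expr2 exprVn.
apply: clim_ext; apply: near_imp nz => w fw wz /=.
have := wz; rewrite -subr_eq0 => wz'.
by field; rewrite f0 fw wz'.
Qed.
Lemma cderN f z a : cder f z a -> cder (fun w => - f w) z (- a).
Proof.
move=> /climN; apply: clim_ext; apply: near_all => w _.
by rewrite -mulNr; congr (_ / _); ring.
Qed.
Lemma cdif_cst a z : cdif (fun=> a) z. Proof. by exists 0; exact: cder_cst. Qed.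
Lemma cdif_id z : cdif id z. Proof. by exists 1; exact: cder_id. Qed.
Lemma cdifD f g z : cdif f z -> cdif g z -> cdif (fun w => f w + g w) z.
Proof. by move=> [a fa] [b gb]; exists (a + b); exact: cderD. Qed.
Lemma cdifN f z : cdif f z -> cdif (fun w => - f w) z.
Proof. by move=> [a fa]; exists (- a); exact: cderN. Qed.
Lemma cdifB f g z : cdif f z -> cdif g z -> cdif (fun w => f w - g w) z.
Proof. by move=> fa /cdifN; exact: cdifD. Qed.
Lemma cdifM f g z : cdif f z -> cdif g z -> cdif (fun w => f w * g w) z.
Proof. by move=> [a fa] [b gb]; exists (a * g z + f z * b); exact: cderM. Qed.
Lemma cdifV f z : f z != 0 -> cdif f z -> cdif (fun w => (f w)^-1) z.
Proof. by move=> f0 [a fa]; exists (- a / f z ^+ 2); exact: cderV. Qed.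
Lemma cdifX f n z : cdif f z -> cdif (fun w => f w ^+ n) z.
Proof.
move=> fc; elim: n => [|n IH]; first exact: cdif_cst.
by apply: cdif_ext (cdifM fc IH); apply: near_all => w; rewrite exprS.
Qed.
Lemma cder_bnd f z l : cder f z l -> forall e, 0 < e ->
  near z (fun w => nm (f w - f z - l * (w - z)) <= e * nm (w - z)).
Proof.
move=> fl e /fl; apply: near_imp => w; have [->|wz /(_ isT) H] := eqVneq w z.
  by rewrite !subrr mulr0 subrr nm0 mulr0.
have wz' : w - z != 0 by rewrite subr_eq0.
have -> : f w - f z - l * (w - z) = ((f w - f z) / (w - z) - l) * (w - z).
  by rewrite mulrBl divfK.
by rewrite nmM ler_wpM2r ?nm_ge0// ltW.
Qed.
Lemma cder_comp f g z a b : cder g z a -> cder f (g z) b ->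
  cder (fun w => f (g w)) z (b * a).
Proof.
(* Caratheodory's form of the derivative: the difference quotient of [f] at [g z], completed by [b],
   is continuous there. It does not matter how often [g] takes the value [g z] near [z]. *)
move=> ga fb; pose h v := if v == g z then b else (f v - f (g z)) / (v - g z).
have hc : cont h (g z).
  apply/cont_clim; rewrite {2}/h eqxx; apply: clim_ext fb.
  by apply: near_all => w wz; rewrite /h (negPf wz).
have hb : h (g z) = b by rewrite /h eqxx.
have := climM (proj1 (cont_clim _ _) (cont_comp (cder_cont ga) hc)) ga.
rewrite hb; apply: clim_ext; apply: near_all => w wz.
rewrite /h; case: eqVneq => [->|n]; first by rewrite !subrr !mul0r mulr0.
by rewrite mulrA divfK// subr_eq0.
Qed.
Lemma cdif_comp f g z : cdif g z -> cdif f (g z) -> cdif (fun w => f (g w)) z.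
Proof. by move=> [a ga] [b fb]; exists (b * a); exact: cder_comp. Qed.
End ComplexLimits.
Arguments nm : simpl never.

(** * Contour integrals over squares *)

Section Integral.
Local Open Scope complex_scope.
Variable R : realType.
Local Notation C := R[i].
Local Notation mu := (@lebesgue_measure R).
Implicit Types (g h : R -> C) (a b x r e M m : R).

Definition icont g a b : Prop := forall t, a <= t <= b -> forall e, 0 < e ->
  exists2 d, 0 < d & forall s, a <= s <= b -> `|s - t| < d -> nm (g s - g t) < e.

Definition ricont (f : R -> R) a b : Prop := forall t, a <= t <= b -> forall e, 0 < e ->
  exists2 d, 0 < d & forall s, a <= s <= b -> `|s - t| < d -> `|f s - f t| < e.

Lemma ricont_integrable (f : R -> R) a b : ricont f a b ->
  mu.-integrable `[a, b] (EFin \o f).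
Proof.
move=> H; apply: continuous_compact_integrable; first exact: segment_compact.
apply/subspace_continuousP => t; rewrite /= in_itv /= => tab.
apply/(@cvgrPdist_lt _ R^o) => e e0; have [d d0 Hd] := H _ tab _ e0.
rewrite near_withinE; exists d => //= s; rewrite /ball /= => st.
by rewrite in_itv /= => sab; rewrite distrC; apply: Hd => //; rewrite distrC.
Qed.

Lemma icont_Re g a b : icont g a b -> ricont (fun t => complex.Re (g t)) a b.
Proof.
move=> H t tab e /(H _ tab)[d d0 Hd]; exists d => // s sab /(Hd _ sab).
by apply: le_lt_trans; apply: le_trans (Re_le_nm _); case: (g s) (g t) => ? ? [].
Qed.
Lemma icont_Im g a b : icont g a b -> ricont (fun t => complex.Im (g t)) a b.
Proof.
move=> H t tab e /(H _ tab)[d d0 Hd]; exists d => // s sab /(Hd _ sab).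
by apply: le_lt_trans; apply: le_trans (Im_le_nm _); case: (g s) (g t) => ? ? [].
Qed.

Definition rint (f : R -> R) a b : R := \int[mu]_(t in `[a, b]) f t.

Lemma rintD f1 f2 a b : ricont f1 a b -> ricont f2 a b ->
  rint (fun t => f1 t + f2 t) a b = rint f1 a b + rint f2 a b.
Proof. by move=> c1 c2; apply: RintegralD => //; exact: ricont_integrable. Qed.
Lemma rintZ k f a b : ricont f a b -> rint (fun t => k * f t) a b = k * rint f a b.
Proof. by move=> c1; apply: RintegralZl => //; exact: ricont_integrable. Qed.
Lemma ricont_cst k a b : ricont (fun=> k) a b.
Proof. by move=> t _ e e0; exists 1 => // s _ _; rewrite subrr normr0. Qed.
Lemma rint_cst k a b : a <= b -> rint (fun=> k) a b = k * (b - a).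
Proof.
move=> ab; rewrite /rint Rintegral_cst//= lebesgue_measure_itv /= lte_fin.
by move: ab; rewrite le_eqVlt => /predU1P[->|->]//; rewrite ltxx subrr.
Qed.
Lemma rint_le f1 f2 a b : ricont f1 a b -> ricont f2 a b ->
  (forall t, a <= t <= b -> f1 t <= f2 t) -> rint f1 a b <= rint f2 a b.
Proof.
move=> c1 c2 H; apply: le_Rintegral => //; try exact: ricont_integrable.
Qed.
Lemma rint_bnd f a b M : a <= b -> ricont f a b ->
  (forall t, a <= t <= b -> `|f t| <= M) -> `|rint f a b| <= M * (b - a).
Proof.
move=> ab c H; rewrite ler_norml -mulNr -!rint_cst//; apply/andP; split;
  by apply: rint_le => //; [exact: ricont_cst..|] => t /H; rewrite ler_norml => /andP[].
Qed.
Lemma rint_chasles f a c b : a <= c <= b -> ricont f a b ->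
  rint f a b = rint f a c + rint f c b.
Proof.
move=> /andP[ac cb] cf; have I := ricont_integrable cf.
have I2 : mu.-integrable `[c, b] (EFin \o f).
  by apply: integrableS I => //; apply: subset_itvr; rewrite bnd_simp.
have := @Rintegral_itvB R f (BLeft a) (BRight b) c I.
rewrite !bnd_simp => /(_ ac cb); rewrite -/(rint f a b) -/(rint f a c) => E.
rewrite /rint -(@Rintegral_itv_obnd_cbnd _ c); last first.
  by apply: integrableS I2 => //; apply: subset_itvr; rewrite bnd_simp.
rewrite -E /rint; ring.
Qed.
Lemma rint_ext f1 f2 a b : (forall t, a <= t <= b -> f1 t = f2 t) ->
  rint f1 a b = rint f2 a b.
Proof.
move=> H; apply: eq_Rintegral => t; rewrite inE /= in_itv; exact: H.
Qed.
Definition cint g a b : C :=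
  rint (fun t => complex.Re (g t)) a b +i* rint (fun t => complex.Im (g t)) a b.

Lemma cint_ext g h a b : (forall t, a <= t <= b -> g t = h t) -> cint g a b = cint h a b.
Proof. by move=> H; congr (_ +i* _); apply: rint_ext => t /H ->. Qed.
Lemma cintD g h a b : icont g a b -> icont h a b ->
  cint (fun t => g t + h t) a b = cint g a b + cint h a b.
Proof.
move=> cg ch; rewrite /cint; simpc; congr (_ +i* _).
  by rewrite -rintD; [apply: rint_ext => t _; case: (g t) (h t) => ? ? []|exact: icont_Re..].
by rewrite -rintD; [apply: rint_ext => t _; case: (g t) (h t) => ? ? []|exact: icont_Im..].
Qed.
Lemma ricontZ k f a b : ricont f a b -> ricont (fun t => k * f t) a b.
Proof.
move=> cf t tab e e0; have k0 : 0 < `|k| + 1 by rewrite ltr_wpDl.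
have [d d0 H] := cf t tab (e / (`|k| + 1)) (divr_gt0 e0 k0).
exists d => // s sab /(H s sab); rewrite -mulrBr normrM ltr_pdivlMr// mulrC.
by apply: le_lt_trans; rewrite ler_wpM2r// lerDl.
Qed.
Lemma cintZ k g a b : icont g a b -> cint (fun t => k * g t) a b = k * cint g a b.
Proof.
move=> cg; have cR := icont_Re cg; have cI := icont_Im cg.
case: k => u v; rewrite /cint; simpc; congr (_ +i* _).
  rewrite -mulNr -!rintZ// -rintD; try exact: ricontZ.
  by apply: rint_ext => t _; case: (g t) => ? ? /=; rewrite mulNr.
rewrite -!rintZ// -rintD; try exact: ricontZ.
by apply: rint_ext => t _; case: (g t) => ? ? /=.
Qed.
Lemma icontD g h a b : icont g a b -> icont h a b -> icont (fun t => g t + h t) a b.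
Proof.
move=> cg ch t tab e e0; have e2 : 0 < e / 2 by lra.
have [d d0 H] := cg t tab _ e2; have [d' d0' H'] := ch t tab _ e2.
exists (Num.min d d'); first by rewrite lt_min d0.
move=> s sab; rewrite lt_min => /andP[/(H s sab) A /(H' s sab) B].
have -> : g s + h s - (g t + h t) = (g s - g t) + (h s - h t) by ring.
by have := nmD (g s - g t) (h s - h t); lra.
Qed.
Lemma icontZ k g a b : icont g a b -> icont (fun t => k * g t) a b.
Proof.
move=> cf t tab e e0; have k0 : 0 < nm k + 1 by have := nm_ge0 k; lra.
have [d d0 H] := cf t tab (e / (nm k + 1)) (divr_gt0 e0 k0).
exists d => // s sab /(H s sab); rewrite -mulrBr nmM ltr_pdivlMr// mulrC.
by apply: le_lt_trans; rewrite ler_wpM2r ?nm_ge0// lerDl.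
Qed.
Lemma icont_ext g h a b : (forall t, a <= t <= b -> g t = h t) -> icont g a b -> icont h a b.
Proof.
move=> E cg t tab e /(cg t tab)[d d0 H]; exists d => // s sab; rewrite -!E//; exact: H.
Qed.
Lemma icontB g h a b : icont g a b -> icont h a b -> icont (fun t => g t - h t) a b.
Proof.
move=> cg ch; apply: icont_ext (icontD cg (icontZ (-1) ch)) => t _.
by rewrite mulN1r.
Qed.
Lemma cintB g h a b : icont g a b -> icont h a b ->
  cint (fun t => g t - h t) a b = cint g a b - cint h a b.
Proof.
move=> cg ch; rewrite -mulN1r -cintZ// -cintD//; last exact: icontZ.
by apply: cint_ext => t _; rewrite mulN1r.
Qed.
Lemma cint_cst k a b : a <= b -> cint (fun=> k) a b = k * (b - a)%:C.
Proof.
by move=> ab; rewrite /cint !rint_cst//; case: k => u v; simpc.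
Qed.
(** The factor 2 comes from bounding real and imaginary parts separately; only the shape of the
    bound matters later. *)
Lemma cint_bnd g a b M : a <= b -> icont g a b ->
  (forall t, a <= t <= b -> nm (g t) <= M) -> nm (cint g a b) <= 2 * M * (b - a).
Proof.
move=> ab cg H; apply: le_trans (nm_le_ReIm _) _ => /=.
have A : `|rint (fun t => complex.Re (g t)) a b| <= M * (b - a).
  by apply: rint_bnd => //; [exact: icont_Re|move=> t /H; exact: le_trans (Re_le_nm _)].
have B : `|rint (fun t => complex.Im (g t)) a b| <= M * (b - a).
  by apply: rint_bnd => //; [exact: icont_Im|move=> t /H; exact: le_trans (Im_le_nm _)].
by lra.
Qed.
Lemma cint_chasles g a c b : a <= c <= b -> icont g a b ->
  cint g a b = cint g a c + cint g c b.
Proof.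
move=> acb cg; rewrite /cint; simpc; congr (_ +i* _); apply: rint_chasles => //.
  exact: icont_Re.
exact: icont_Im.
Qed.
Lemma cint_Im_gt0 g a b m : a < b -> icont g a b -> 0 < m ->
  (forall t, a <= t <= b -> m <= complex.Im (g t)) -> 0 < complex.Im (cint g a b).
Proof.
move=> ab cg m0 H /=; apply: lt_le_trans (_ : m * (b - a) <= _).
  by rewrite mulr_gt0// subr_gt0.
rewrite -(rint_cst m (ltW ab)); apply: rint_le => //; first exact: ricont_cst.
exact: icont_Im.
Qed.
End Integral.

(** * Bisection of squares and Goursat's theorem *)

Section Squares.
Local Open Scope complex_scope.
Variable R : realType.
Local Notation C := R[i].
Implicit Types (f g : C -> C) (x y r d e M u v : R) (z w p : C).

Definition sq x y r z : bool :=
  (x <= complex.Re z <= x + r) && (y <= complex.Im z <= y + r).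

Lemma sqP x y r z : reflect [/\ x <= complex.Re z, complex.Re z <= x + r,
  y <= complex.Im z & complex.Im z <= y + r] (sq x y r z).
Proof.
by apply: (iffP idP) => [/andP[/andP[? ?] /andP[? ?]]|[? ? ? ?]];
  [split|apply/andP; split; apply/andP].
Qed.

Lemma sq_nm x y r z w : 0 <= r -> sq x y r z -> sq x y r w -> nm (w - z) <= 2 * r.
Proof.
case: z w => zx zy [wx wy] r0 /sqP[/= ? ? ? ?] /sqP[/= ? ? ? ?].
apply: le_trans (nm_le_ReIm _) _ => /=.
have A : `|wx - zx| <= r by rewrite ler_norml; lra.
have B : `|wy - zy| <= r by rewrite ler_norml; lra.
by lra.
Qed.

Lemma real_small e r : 0 < e -> exists n : nat, r / 2 ^+ n < e.
Proof.
move=> e0; have [n Hn] : exists n : nat, r / e < n%:R.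
  by exists (Num.trunc (Num.max 0 (r / e))).+1; rewrite (le_lt_trans _ (truncnS_gt _)) // le_max lexx orbT.
exists n; rewrite ltr_pdivrMr ?exprn_gt0//.
move: Hn; rewrite ltr_pdivrMr// mulrC => /lt_le_trans; apply.
by rewrite ler_pM2l// -natrX ler_nat ltnW// ltn_expl.
Qed.

(** If [P] failed, it would fail on some quarter at each stage, and the nested bad squares would
    shrink to a point near which [P] holds. This is the compactness of a square in the one form used
    below: for Goursat's theorem, for boundedness and for finite covers. *)
Lemma sq_bisect (P : R -> R -> R -> Prop) x0 y0 r0 : 0 < r0 ->
  (forall x y r, 0 < r -> P x y (r / 2) -> P (x + r / 2) y (r / 2) ->
     P x (y + r / 2) (r / 2) -> P (x + r / 2) (y + r / 2) (r / 2) -> P x y r) ->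
  (forall z, sq x0 y0 r0 z -> exists2 d, 0 < d & forall x y r, 0 < r < d ->
     sq x y r z -> [/\ x0 <= x, x + r <= x0 + r0, y0 <= y & y + r <= y0 + r0] ->
     P x y r) ->
  P x0 y0 r0.
Proof.
move=> r00 HQ HL; apply: contrapT => nP.
pose X (s : R * R * R) := s.1.1; pose Y (s : R * R * R) := s.1.2.
pose bad (s : R * R * R) := ~ P (X s) (Y s) s.2.
pose T (s s' : R * R * R) := 0 < s.2 -> bad s -> [/\ bad s', s'.2 = s.2 / 2,
  X s <= X s' <= X s + s.2 / 2 & Y s <= Y s' <= Y s + s.2 / 2].
have /choice[f Hf] : forall s, exists s', T s s'.
  move=> [[x y] r]; apply: contrapT => /forallNP H.
  have [r1|r1] := ltP 0 r; last by apply: (H (x, y, r)) => /= r2; exfalso; move: r2; rewrite /= ltNge r1.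
  have bP : ~ P x y r by move=> Pxy; apply: (H (x, y, r)) => /= _; case.
  have K s : s.2 = r / 2 -> x <= X s <= x + r / 2 -> y <= Y s <= y + r / 2 ->
      P (X s) (Y s) (r / 2).
    by case: s => s r' /= -> ? ?; apply: contrapT => n; apply: (H (s, r / 2)).
  apply: bP; apply: HQ => //.
  - by apply: (K (x, y, r / 2)) => //=; rewrite /X /Y /=; lra.
  - by apply: (K (x + r / 2, y, r / 2)) => //=; rewrite /X /Y /=; lra.
  - by apply: (K (x, y + r / 2, r / 2)) => //=; rewrite /X /Y /=; lra.
  - by apply: (K (x + r / 2, y + r / 2, r / 2)) => //=; rewrite /X /Y /=; lra.
pose s n := iter n f (x0, y0, r0).
have Hs n : [/\ bad (s n), (s n).2 = r0 / 2 ^+ n & 0 < (s n).2].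
  elim: n => [|n [b e p]]; first by rewrite /s /= expr0 divr1.
  have [b' e' _ _] := Hf _ p b; rewrite /s iterS -/(s n); split=> //.
    by rewrite e' e exprSr invfM mulrA.
  by rewrite e' divr_gt0.
have St n : X (s n) <= X (s n.+1) <= X (s n) + (s n).2 / 2 /\
            Y (s n) <= Y (s n.+1) <= Y (s n) + (s n).2 / 2 /\
            (s n.+1).2 = (s n).2 / 2.
  by have [b e p] := Hs n; have [_ ? ? ?] := Hf _ p b.
have lim (c : nat -> R) : (forall n, c n <= c n.+1 <= c n + (s n).2 / 2) ->
    exists l, forall n, c n <= l <= c n + (s n).2.
  move=> Hc.
  have mono n m : c n <= c (n + m)%N.
    elim: m => [|m IH]; rewrite ?addn0// addnS (le_trans IH)//.
    by case/andP: (Hc (n + m)%N).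
  have dec n m : c (n + m)%N + (s (n + m)%N).2 <= c n + (s n).2.
    elim: m => [|m IH]; rewrite ?addn0// addnS (le_trans _ IH)//.
    have [_ [_ ->]] := St (n + m)%N; have [_ _ ?] := Hs (n + m)%N.
    by have /andP[? ?] := Hc (n + m)%N; lra.
  have up n m : c m <= c n + (s n).2.
    have [_ _ ?] := Hs n; have [_ _ ?] := Hs m; have := mono n (m - n)%N.
    have := dec n (m - n)%N; have := mono m (n - m)%N; have [nm|mn] := leqP n m.
      by rewrite (subnKC nm) => _ ? ?; lra.
    by rewrite (subnKC (ltnW mn)) => ? _ _; lra.
  have hs : has_sup (range c).
    by split; [exists (c 0%N); exists 0%N|exists (c 0%N + (s 0%N).2) => _ [m _ <-]].
  exists (sup (range c)) => n; apply/andP; split.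
    by apply: sup_upper_bound => //; exists n.
  by apply: sup_le_ub; [exists (c 0%N); exists 0%N|move=> _ [m _ <-]].
have [lx Hx] := lim (fun n => X (s n)) (fun n => proj1 (St n)).
have [ly Hy] := lim (fun n => Y (s n)) (fun n => proj1 (proj2 (St n))).
have z0 : sq x0 y0 r0 (lx +i* ly).
  by apply/sqP; have := Hx 0%N; have := Hy 0%N; rewrite /s /X /Y /= => /andP[] ? ? /andP[].
have [d d0 Hd] := HL _ z0.
have [n Hn] := real_small r0 d0.
have [b e p] := Hs n.
have box m : [/\ x0 <= X (s m), X (s m) + (s m).2 <= x0 + r0, y0 <= Y (s m)
    & Y (s m) + (s m).2 <= y0 + r0].
  elim: m => [|m [? ? ? ?]]; first by rewrite /s /X /Y /=.
  by have [/andP[? ?] [/andP[? ?] E]] := St m; have [_ _ ?] := Hs m; rewrite E; split; lra.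
apply: b; apply: (Hd _ _ _ _ _ (box n)); first by rewrite p e.
by apply/sqP; have /andP[] := Hx n; have /andP[] := Hy n.
Qed.

(** The contour integral along the boundary of the square, anticlockwise; the factor ['i] is [dz] on
    the vertical sides. *)
Definition bd f x y r : C :=
  cint (fun t => f (t +i* y)) x (x + r) - cint (fun t => f (t +i* (y + r))) x (x + r)
  + 'i * (cint (fun t => f ((x + r) +i* t)) y (y + r)
          - cint (fun t => f (x +i* t)) y (y + r)).

Definition sqcont f x y r := forall z, sq x y r z -> cont f z.

Lemma icont_h f y a b :
  (forall t, a <= t <= b -> cont f (t +i* y)) -> icont (fun t => f (t +i* y)) a b.
Proof.
move=> H t tab e e0; have [d d0 Hd] := H t tab e e0.
exists d => // s sab st; apply: Hd; have -> : (s +i* y) - (t +i* y) = (s - t)%:C.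
  by apply/eqP; rewrite eq_complex /=; apply/andP; split; apply/eqP; ring.
by rewrite nm_real.
Qed.
Lemma icont_v f x a b :
  (forall t, a <= t <= b -> cont f (x +i* t)) -> icont (fun t => f (x +i* t)) a b.
Proof.
move=> H t tab e e0; have [d d0 Hd] := H t tab e e0.
exists d => // s sab st; apply: Hd; have -> : (x +i* s) - (x +i* t) = 'i * (s - t)%:C.
  by apply/eqP; rewrite eq_complex /=; apply/andP; split; apply/eqP; ring.
rewrite nmM nm_real /nm /= expr0n expr1n add0r sqrtr1 mul1r//.
Qed.

Lemma sqcont_icont f x y r : 0 <= r -> sqcont f x y r ->
  [/\ forall y', y <= y' <= y + r -> icont (fun t => f (t +i* y')) x (x + r)
    & forall x', x <= x' <= x + r -> icont (fun t => f (x' +i* t)) y (y + r)].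
Proof.
move=> r0 H; split=> [y'|x'] /andP[? ?].
  by apply: icont_h => t /andP[? ?]; apply: H; apply/sqP.
by apply: icont_v => t /andP[? ?]; apply: H; apply/sqP.
Qed.

Definition bdr x y r z : bool := sq x y r z &&
  [|| complex.Re z == x, complex.Re z == x + r, complex.Im z == y | complex.Im z == y + r].
(** Continuity on the boundary alone admits kernels with a pole inside the square. *)
Definition bdcont f x y r := forall z, bdr x y r z -> cont f z.

Lemma sqcont_bd f x y r : sqcont f x y r -> bdcont f x y r.
Proof. by move=> H z /andP[/H]. Qed.

Lemma bdr_sides x y r : 0 <= r ->
  [/\ forall t, x <= t <= x + r -> bdr x y r (t +i* y),
      forall t, x <= t <= x + r -> bdr x y r (t +i* (y + r)),
      forall t, y <= t <= y + r -> bdr x y r (x +i* t)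
    & forall t, y <= t <= y + r -> bdr x y r ((x + r) +i* t)].
Proof.
by move=> r0; split=> t /andP[? ?]; apply/andP; split;
  rewrite /= ?eqxx ?orbT//; apply/sqP; split=> /=; lra.
Qed.

Lemma bdcont_icont f x y r : 0 <= r -> bdcont f x y r ->
  [/\ icont (fun t => f (t +i* y)) x (x + r),
      icont (fun t => f (t +i* (y + r))) x (x + r),
      icont (fun t => f (x +i* t)) y (y + r)
    & icont (fun t => f ((x + r) +i* t)) y (y + r)].
Proof.
move=> r0 H; have [h1 h2 v1 v2] := bdr_sides x y r0.
split; [apply: icont_h|apply: icont_h|apply: icont_v|apply: icont_v] => t ?; apply: H; auto.
Qed.

Lemma bd_ext f g x y r : 0 <= r -> (forall z, bdr x y r z -> f z = g z) ->
  bd f x y r = bd g x y r.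
Proof.
move=> r0 H; have [h1 h2 v1 v2] := bdr_sides x y r0.
rewrite /bd; congr (_ - _ + 'i * (_ - _)); apply: cint_ext => t ?; apply: H; auto.
Qed.

Lemma bdB f g x y r : 0 <= r -> bdcont f x y r -> bdcont g x y r ->
  bd (fun z => f z - g z) x y r = bd f x y r - bd g x y r.
Proof.
move=> r0 /(bdcont_icont r0)[? ? ? ?] /(bdcont_icont r0)[? ? ? ?]; rewrite /bd.
by rewrite !cintB//; ring.
Qed.

Lemma bdZ (k : C) f x y r : 0 <= r -> bdcont f x y r ->
  bd (fun z => k * f z) x y r = k * bd f x y r.
Proof.
move=> r0 /(bdcont_icont r0)[? ? ? ?]; rewrite /bd.
by rewrite !cintZ//; ring.
Qed.

Lemma bd_bnd f x y r M : 0 <= r -> bdcont f x y r ->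
  (forall z, bdr x y r z -> nm (f z) <= M) -> nm (bd f x y r) <= 8 * M * r.
Proof.
move=> r0 /(bdcont_icont r0)[c1 c2 c3 c4] H; rewrite /bd.
have [h1 h2 v1 v2] := bdr_sides x y r0.
have nmi : nm 'i = 1 :> R by rewrite /nm /= expr0n expr1n add0r sqrtr1.
have E (a : R) : 2 * M * r = 2 * M * (a + r - a) by ring.
apply: le_trans (nmD _ _) _; rewrite nmM nmi mul1r.
apply: le_trans (lerD (nmB _ _) (nmB _ _)) _.
have A1 : nm (cint (fun t => f (t +i* y)) x (x + r)) <= 2 * M * r.
  by rewrite (E x); apply: cint_bnd; [lra|exact: c1|] => t ?; auto.
have A2 : nm (cint (fun t => f (t +i* (y + r))) x (x + r)) <= 2 * M * r.
  by rewrite (E x); apply: cint_bnd; [lra|exact: c2|] => t ?; auto.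
have A3 : nm (cint (fun t => f ((x + r) +i* t)) y (y + r)) <= 2 * M * r.
  by rewrite (E y); apply: cint_bnd; [lra|exact: c4|] => t ?; auto.
have A4 : nm (cint (fun t => f (x +i* t)) y (y + r)) <= 2 * M * r.
  by rewrite (E y); apply: cint_bnd; [lra|exact: c3|] => t ?; auto.
lra.
Qed.

Lemma bd_quarters f x y r : 0 <= r -> sqcont f x y r ->
  bd f x y r = bd f x y (r / 2) + bd f (x + r / 2) y (r / 2)
    + bd f x (y + r / 2) (r / 2) + bd f (x + r / 2) (y + r / 2) (r / 2).
Proof.
move=> r0 /(sqcont_icont r0)[fh fv]; rewrite /bd.
have E a : a + r / 2 + r / 2 = a + r by field.
rewrite !E.
have Ch y' : y <= y' <= y + r -> cint (fun t => f (t +i* y')) x (x + r) =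
    cint (fun t => f (t +i* y')) x (x + r / 2)
    + cint (fun t => f (t +i* y')) (x + r / 2) (x + r).
  by move=> ?; apply: cint_chasles; [lra|exact: fh].
have Cv x' : x <= x' <= x + r -> cint (fun t => f (x' +i* t)) y (y + r) =
    cint (fun t => f (x' +i* t)) y (y + r / 2)
    + cint (fun t => f (x' +i* t)) (y + r / 2) (y + r).
  by move=> ?; apply: cint_chasles; [lra|exact: fv].
have -> := Ch y ltac:(lra); have -> := Ch (y + r) ltac:(lra).
have -> := Cv x ltac:(lra); have -> := Cv (x + r) ltac:(lra).
by ring.
Qed.

(** On opposite sides the integrands differ by the constants [- l * 'i * r] and [l * r], and the two
    contributions cancel. *)
Lemma bd_linear (k l : C) x y r : 0 <= r -> bd (fun z => k + l * z) x y r = 0.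
Proof.
move=> r0; rewrite /bd.
have lc : sqcont (fun z => k + l * z) x y r.
  by move=> z _; apply: contD; [exact: cont_cst|apply: contM; [exact: cont_cst|exact: cont_id]].
have [fh fv] := sqcont_icont r0 lc.
rewrite -!cintB; try by [apply: fh; lra|apply: fv; lra].
rewrite (@cint_ext _ _ (fun=> - l * 'i * r%:C)); last first.
  by move=> t _; have -> : t +i* (y + r) = (t +i* y) + 'i * r%:C; [by apply/eqP; rewrite eq_complex /=; apply/andP; split; apply/eqP; ring|ring].
rewrite [X in 'i * X](@cint_ext _ _ (fun=> l * r%:C)); last first.
  by move=> t _; have -> : (x + r) +i* t = (x +i* t) + r%:C; [by apply/eqP; rewrite eq_complex /=; apply/andP; split; apply/eqP; ring|ring].
rewrite !cint_cst ?lerDl// !(addrC _ r) !addrK; ring.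
Qed.

(* [sgn u sqrt |u|]: its increments over intervals give an additive measure whose
   square majorises the side of any square containing the exceptional point. *)
Definition ssqrt (u : R) : R := if 0 <= u then Num.sqrt u else - Num.sqrt (- u).

Lemma ssqrt_le u v : u <= v -> ssqrt u <= ssqrt v.
Proof.
move=> uv; rewrite /ssqrt; case: ifP => u0; case: ifP => v0.
- exact: ler_wsqrtr.
- by move: v0; rewrite (le_trans u0 uv).
- by rewrite (le_trans (_ : _ <= 0)) ?oppr_le0// sqrtr_ge0.
- by rewrite lerN2 ler_wsqrtr// lerN2.
Qed.

Lemma ssqrt_cross u r : 0 < r -> u <= 0 <= u + r ->
  Num.sqrt r <= ssqrt (u + r) - ssqrt u.
Proof.
move=> r0 /andP[u0 ur]; have E : ssqrt u = - Num.sqrt (- u).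
  rewrite /ssqrt; case: ifP => // u1; have -> : u = 0 by lra.
  by rewrite oppr0 sqrtr0 oppr0.
rewrite E opprK /ssqrt ur.
have A := sqrtr_ge0 (u + r); have B := sqrtr_ge0 (- u).
rewrite -[leRHS]ger0_norm ?addr_ge0// -sqrtr_sqr ler_wsqrtr//.
have -> : (Num.sqrt (u + r) + Num.sqrt (- u)) ^+ 2 = Num.sqrt (u + r) ^+ 2
  + Num.sqrt (- u) ^+ 2 + 2 * (Num.sqrt (u + r) * Num.sqrt (- u)) by ring.
rewrite !sqr_sqrtr ?oppr_ge0//.
have := mulr_ge0 A B; lra.
Qed.

Definition dsq (p a r : R) : R := ssqrt (a + r - p) - ssqrt (a - p).

Lemma dsq_ge0 (p a r : R) : 0 <= r -> 0 <= dsq p a r.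
Proof. by move=> r0; rewrite subr_ge0; apply: ssqrt_le; lra. Qed.
Lemma dsq_half (p a r : R) : dsq p a r = dsq p a (r / 2) + dsq p (a + r / 2) (r / 2).
Proof. by rewrite /dsq (_ : a + r / 2 + r / 2 - p = a + r - p); [ring|field]. Qed.
Lemma dsq_in (p a r : R) : 0 < r -> a <= p <= a + r -> Num.sqrt r <= dsq p a r.
Proof.
move=> r0 H; rewrite /dsq; have -> : a + r - p = (a - p) + r by ring.
by apply: ssqrt_cross => //; lra.
Qed.

(** Each exceptional point carries the product of its two interval measures. This is additive under
    quartering, and at least [sqrt r * sqrt r = r] on a square of side [r] containing the point, so
    errors of first order in the side can be summed. *)
Definition pmass (S : seq C) x y r : R :=
  \sum_(p <- S) dsq (complex.Re p) x r * dsq (complex.Im p) y r.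

Lemma pmass_ge0 S x y r : 0 <= r -> 0 <= pmass S x y r.
Proof. by move=> r0; apply: sumr_ge0 => p _; rewrite mulr_ge0// dsq_ge0. Qed.
Lemma pmass_quarters S x y r : pmass S x y r = pmass S x y (r / 2)
  + pmass S (x + r / 2) y (r / 2) + pmass S x (y + r / 2) (r / 2)
  + pmass S (x + r / 2) (y + r / 2) (r / 2).
Proof.
rewrite /pmass -!big_split /=; apply: eq_bigr => p _.
by rewrite (dsq_half _ x) (dsq_half _ y); ring.
Qed.
Lemma pmass_in S x y r p : 0 < r -> p \in S -> sq x y r p -> r <= pmass S x y r.
Proof.
move=> r0 pS /sqP[? ? ? ?]; rewrite /pmass (perm_big _ (perm_to_rem pS)) /= big_cons.
rewrite -[leLHS]addr0 lerD//; last by apply: (@pmass_ge0 (rem p S)); exact: ltW.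
apply: le_trans (_ : Num.sqrt r * Num.sqrt r <= _); first by rewrite -expr2 sqr_sqrtr ?lexx// ltW.
by apply: ler_pM; rewrite ?sqrtr_ge0//; apply: dsq_in => //; apply/andP; split.
Qed.

(** The bound [e * (area + mass)] is additive under quartering, so it needs proof only for small
    squares. Near a point outside [S], subtracting the affine approximation leaves an error of order
    [e * r ^+ 2]; near a point of [S], continuity gives [e * r], which the mass pays for. Then [e]
    tends to 0. *)
Lemma goursat f (S : seq C) x y r : 0 < r -> sqcont f x y r ->
  (forall z, sq x y r z -> z \notin S -> cdif f z) -> bd f x y r = 0.
Proof.
move=> r0 fc fd.
have main e : 0 < e -> nm (bd f x y r) <= e * (r ^+ 2 + pmass S x y r).
  move=> e0.
  pose P x1 y1 r1 := sqcont f x1 y1 r1 ->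
    nm (bd f x1 y1 r1) <= e * (r1 ^+ 2 + pmass S x1 y1 r1).
  suff : P x y r by exact.
  apply: (@sq_bisect P) => //.
    move=> x1 y1 r1 r10 P1 P2 P3 P4 c1.
    have sub x2 y2 : x1 <= x2 <= x1 + r1 / 2 -> y1 <= y2 <= y1 + r1 / 2 ->
        sqcont f x2 y2 (r1 / 2).
      by move=> ? ? z /sqP[? ? ? ?]; apply: c1; apply/sqP; split; lra.
    rewrite (bd_quarters (ltW r10) c1) pmass_quarters.
    apply: le_trans (nmD _ _) _; apply: le_trans (lerD (nmD _ _) (lexx _)) _.
    apply: le_trans (lerD (lerD (nmD _ _) (lexx _)) (lexx _)) _.
    have Q1 := P1 (sub _ _ _ _); have Q2 := P2 (sub _ _ _ _).
    have Q3 := P3 (sub _ _ _ _); have Q4 := P4 (sub _ _ _ _).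
    have {}Q1 := Q1 ltac:(lra) ltac:(lra); have {}Q2 := Q2 ltac:(lra) ltac:(lra).
    have {}Q3 := Q3 ltac:(lra) ltac:(lra); have {}Q4 := Q4 ltac:(lra) ltac:(lra).
    apply: le_trans (lerD (lerD (lerD Q1 Q2) Q3) Q4) _.
    by rewrite le_eqVlt; apply/orP; left; apply/eqP; field.
  move=> z zs; have [zS|zS] := boolP (z \in S).
    have e8 : 0 < e / 8 by lra.
    have [d d0 Hd] := fc _ zs _ e8; exists (d / 2); first lra.
    move=> x1 y1 r1 /andP[r1p r1d] z1 _ c1.
    have lc : sqcont (fun w => f z + 0 * w) x1 y1 r1.
      by move=> w _; apply: contD; [exact: cont_cst|apply: contM; [exact: cont_cst|exact: cont_id]].
    have -> : bd f x1 y1 r1 = bd (fun w => f w - (f z + 0 * w)) x1 y1 r1.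
      by rewrite (bdB (ltW r1p) (sqcont_bd c1) (sqcont_bd lc)) (bd_linear _ _ _ _ (ltW r1p)) subr0.
    have H : nm (bd (fun w => f w - (f z + 0 * w)) x1 y1 r1) <= 8 * (e / 8) * r1.
      apply: bd_bnd; [exact: ltW|apply: sqcont_bd => w ws; apply: contB; [exact: c1|exact: lc]|].
      move=> w /andP[ws _]; rewrite mul0r addr0 ltW//; apply: Hd.
      by have := sq_nm (ltW r1p) z1 ws; lra.
    apply: le_trans H _; have := pmass_in r1p zS z1.
    rewrite -(ler_pM2l e0) mulrDr => H.
    have := mulr_ge0 (ltW e0) (sqr_ge0 r1); lra.
  (* The 16 is the 8 of [bd_bnd] times the 2 in the diameter bound [2 * r1] of [sq_nm]. *)
  have [l Hl] := fd _ zs zS; have e16 : 0 < e / 16 by lra.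
  have [d d0 Hd] := cder_bnd Hl e16; exists (d / 2); first lra.
  move=> x1 y1 r1 /andP[r1p r1d] z1 _ c1.
  have lc : sqcont (fun w => (f z - l * z) + l * w) x1 y1 r1.
    by move=> w _; apply: contD; [exact: cont_cst|apply: contM; [exact: cont_cst|exact: cont_id]].
  have -> : bd f x1 y1 r1 = bd (fun w => f w - ((f z - l * z) + l * w)) x1 y1 r1.
    by rewrite (bdB (ltW r1p) (sqcont_bd c1) (sqcont_bd lc)) (bd_linear _ _ _ _ (ltW r1p)) subr0.
  apply: le_trans (_ : 8 * (e / 16 * (2 * r1)) * r1 <= _).
    apply: bd_bnd; [exact: ltW|apply: sqcont_bd => w ws; apply: contB; [exact: c1|exact: lc]|].
    move=> w /andP[ws _]; have E := sq_nm (ltW r1p) z1 ws.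
    have -> : f w - (f z - l * z + l * w) = f w - f z - l * (w - z) by ring.
    by apply: le_trans (Hd w _) _; [lra|rewrite ler_wpM2l// ltW].
  have := mulr_ge0 (ltW e0) (pmass_ge0 S x1 y1 (ltW r1p)).
  have -> : 8 * (e / 16 * (2 * r1)) * r1 = e * r1 ^+ 2 by field.
  by rewrite mulrDr; lra.
apply/eqP; rewrite -nm_eq0; apply/negPn/negP => n0.
have b0 : 0 < nm (bd f x y r) by rewrite lt0r n0 nm_ge0.
have K0 : 0 < r ^+ 2 + pmass S x y r.
  by rewrite ltr_wpDr ?pmass_ge0 ?exprn_gt0// ltW.
have := main (nm (bd f x y r) / (r ^+ 2 + pmass S x y r) / 2).
rewrite mulrAC divfK ?gt_eqF// => H.
by have := H ltac:(by rewrite !divr_gt0); lra.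
Qed.
End Squares.

(** * Cauchy's formula on squares and its consequences *)

Section Cauchy.
Local Open Scope complex_scope.
Variable R : realType.
Local Notation C := R[i].
Implicit Types (f g h : C -> C) (x y r d e M u v : R) (z w a b : C).

Definition ins x y r a : bool :=
  (x < complex.Re a < x + r) && (y < complex.Im a < y + r).

Lemma ins_sq x y r a : ins x y r a -> sq x y r a.
Proof. by move=> /andP[/andP[? ?] /andP[? ?]]; apply/sqP; split; exact: ltW. Qed.
Lemma ins_gt0 x y r a : ins x y r a -> 0 < r.
Proof. by move=> /andP[/andP[? ?] _]; lra. Qed.

Lemma ins_dist x y r a : ins x y r a ->
  exists2 d, 0 < d & forall z, bdr x y r z -> d <= nm (z - a).
Proof.
case: a => ax ay /andP[/= /andP[a1 a2] /andP[a3 a4]].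
pose d := Num.min (Num.min (ax - x) (x + r - ax)) (Num.min (ay - y) (y + r - ay)).
exists d; first by rewrite !lt_min !subr_gt0 a1 a2 a3 a4.
have [d1 d2] : d <= ax - x /\ d <= x + r - ax.
  by rewrite /d; split; rewrite !ge_min lexx ?orbT.
have [d3 d4] : d <= ay - y /\ d <= y + r - ay.
  by rewrite /d; split; rewrite !ge_min lexx ?orbT.
case=> zx zy /andP[_ /= H].
have := Re_le_nm ((zx +i* zy) - (ax +i* ay)); have := Im_le_nm ((zx +i* zy) - (ax +i* ay)).
rewrite /= !ler_norml => /andP[? ?] /andP[? ?].
by case/or4P: H => /eqP ?; lra.
Qed.

Lemma ins_near x y r a : ins x y r a -> near a (fun b => ins x y r b).
Proof.
move=> ia; have [d d0 Hd] := ins_dist ia; have r0 := ins_gt0 ia.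
case: a ia Hd => ax ay /andP[/= /andP[a1 a2] /andP[a3 a4]] Hd.
pose m := Num.min (Num.min (ax - x) (x + r - ax)) (Num.min (ay - y) (y + r - ay)).
exists m; first by rewrite !lt_min !subr_gt0 a1 a2 a3 a4.
case=> zx zy H; have := Re_le_nm ((zx +i* zy) - (ax +i* ay)).
have := Im_le_nm ((zx +i* zy) - (ax +i* ay)).
move: H; rewrite !lt_min /= !ler_norml => /andP[/andP[? ?] /andP[? ?]] /andP[? ?] /andP[? ?].
by apply/andP; split; apply/andP; split => /=; lra.
Qed.

Lemma bdr_neq x y r a z : ins x y r a -> bdr x y r z -> z != a.
Proof.
move=> ia bz; have [d d0 /(_ z bz)] := ins_dist ia.
by move=> H; rewrite -subr_eq0 -nm_gt0; lra.
Qed.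

Lemma cont_kernel a z : z != a -> cont (fun w => (w - a)^-1) z.
Proof.
move=> za; apply: contV; first by rewrite subr_eq0.
by apply: contB; [exact: cont_id|exact: cont_cst].
Qed.

Lemma bdcont_kernel x y r a : ins x y r a -> bdcont (fun z => (z - a)^-1) x y r.
Proof. by move=> ia z bz; apply: cont_kernel; exact: bdr_neq bz. Qed.

Lemma Im_inv u v : complex.Im (u +i* v)^-1 = - (v / (u ^+ 2 + v ^+ 2)).
Proof. by []. Qed.
Lemma Re_inv u v : complex.Re (u +i* v)^-1 = u / (u ^+ 2 + v ^+ 2).
Proof. by []. Qed.

Lemma ImB z w : complex.Im (z - w) = complex.Im z - complex.Im w.
Proof. by case: z w => ? ? []. Qed.
Lemma ReB z w : complex.Re (z - w) = complex.Re z - complex.Re w.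
Proof. by case: z w => ? ? []. Qed.
Lemma ImD z w : complex.Im (z + w) = complex.Im z + complex.Im w.
Proof. by case: z w => ? ? []. Qed.

Lemma ImiM z : complex.Im ('i * z) = complex.Re z.
Proof. by case: z => ? ? /=; rewrite mul0r add0r mul1r. Qed.

Lemma frac_lb u v r : 0 < u <= r -> - r <= v <= r ->
  u / (2 * r ^+ 2) <= u / (u ^+ 2 + v ^+ 2).
Proof.
move=> /andP[u0 ur] /andP[v1 v2]; rewrite ler_pM2l// lef_pV2 ?posrE.
- by nra.
- by rewrite mulr_gt0// exprn_gt0// (lt_le_trans u0).
- by have := exprn_gt0 2 u0; have := sqr_ge0 v; lra.
Qed.

(* The argument of [z - a] increases along the boundary, so all four sides
   contribute positively to the imaginary part. *)
Lemma bd_kernel_neq0 x y r a : ins x y r a -> bd (fun z => (z - a)^-1) x y r != 0.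
Proof.
move=> ia; have r0 := ins_gt0 ia.
have [c1 c2 c3 c4] := bdcont_icont (ltW r0) (bdcont_kernel ia).
suff : 0 < complex.Im (bd (fun z => (z - a)^-1) x y r).
  by apply: contraTneq => ->; rewrite ltxx.
have -> : bd (fun z => (z - a)^-1) x y r =
    cint (fun t => (t +i* y - a)^-1 - (t +i* (y + r) - a)^-1) x (x + r) +
    cint (fun t => 'i * (((x + r) +i* t - a)^-1 - (x +i* t - a)^-1)) y (y + r).
  by rewrite cintZ ?cintB//; exact: icontB.
case: a ia c1 c2 c3 c4 => ax ay ia c1 c2 c3 c4.
have [/andP[a1 a2] /andP[a3 a4]] := andP ia; rewrite /= in a1 a2 a3 a4.
have q0 : 0 < 2 * r ^+ 2 by rewrite mulr_gt0// exprn_gt0.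
have S1 (t : R) s : t +i* s - ax +i* ay = (t - ax) +i* (s - ay) by [].
have I1 : 0 < complex.Im (cint (fun t => (t +i* y - ax +i* ay)^-1
   - (t +i* (y + r) - ax +i* ay)^-1) x (x + r)).
  apply: (@cint_Im_gt0 _ _ _ _ ((ay - y) / (2 * r ^+ 2))); first by lra.
  - exact: icontB.
  - by rewrite divr_gt0//; lra.
  move=> t ?; rewrite !S1 ImB !Im_inv.
  have A : (ay - y) / (2 * r ^+ 2) <= (ay - y) / ((ay - y) ^+ 2 + (t - ax) ^+ 2).
    by apply: frac_lb; lra.
  have B : (y + r - ay) / (2 * r ^+ 2) <= (y + r - ay) / ((y + r - ay) ^+ 2 + (t - ax) ^+ 2).
    by apply: frac_lb; lra.
  have B0 : 0 < (y + r - ay) / (2 * r ^+ 2) by rewrite divr_gt0//; lra.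
  have -> : (t - ax) ^+ 2 + (y - ay) ^+ 2 = (ay - y) ^+ 2 + (t - ax) ^+ 2 by ring.
  rewrite (addrC ((t - ax) ^+ 2)).
  have -> : (y - ay) / ((ay - y) ^+ 2 + (t - ax) ^+ 2) = - ((ay - y) / ((ay - y) ^+ 2 + (t - ax) ^+ 2)).
    by rewrite -mulNr opprB.
  lra.
have I2 : 0 < complex.Im (cint (fun t => 'i * (((x + r) +i* t - ax +i* ay)^-1
   - (x +i* t - ax +i* ay)^-1)) y (y + r)).
  apply: (@cint_Im_gt0 _ _ _ _ ((x + r - ax) / (2 * r ^+ 2))); first by lra.
  - by apply: icontZ; exact: icontB.
  - by rewrite divr_gt0//; lra.
  move=> t ?; rewrite !S1 ImiM ReB !Re_inv.
  have A : (x + r - ax) / (2 * r ^+ 2) <= (x + r - ax) / ((x + r - ax) ^+ 2 + (t - ay) ^+ 2).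
    by apply: frac_lb; lra.
  have B : (ax - x) / (2 * r ^+ 2) <= (ax - x) / ((ax - x) ^+ 2 + (t - ay) ^+ 2).
    by apply: frac_lb; lra.
  have B0 : 0 < (ax - x) / (2 * r ^+ 2) by rewrite divr_gt0//; lra.
  have -> : (x - ax) ^+ 2 = (ax - x) ^+ 2 by ring.
  have -> : (x - ax) / ((ax - x) ^+ 2 + (t - ay) ^+ 2) = - ((ax - x) / ((ax - x) ^+ 2 + (t - ay) ^+ 2)).
    by rewrite -mulNr opprB.
  lra.
by rewrite ImD; exact: addr_gt0 I1 I2.
Qed.

(** Goursat's theorem for the difference quotient of [f] at [a], completed by the derivative:
    continuous, and differentiable off [a :: S]. The integral of the kernel is kept as a factor
    instead of being evaluated to [2 pi i]; its non-vanishing suffices. *)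
Lemma cauchy f (S : seq C) x y r a : sqcont f x y r ->
  (forall z, sq x y r z -> z \notin S -> cdif f z) -> ins x y r a -> cdif f a ->
  bd (fun z => f z / (z - a)) x y r = f a * bd (fun z => (z - a)^-1) x y r.
Proof.
move=> fc fd ia [l fl]; have r0 := ltW (ins_gt0 ia).
pose g z := if z == a then l else (f z - f a) / (z - a).
have gE z : z != a -> near z (fun w => (f w - f a) / (w - a) = g w).
  by move=> za; apply: near_imp (near_neq (_ : a != z)); rewrite 1?eq_sym// => w /negPf wa; rewrite /g wa.
have gc : sqcont g x y r.
  move=> z zs; have [->|za] := eqVneq z a.
    apply/cont_clim; rewrite {2}/g eqxx; apply: clim_ext fl.
    by apply: near_all => w /negPf wa; rewrite /g wa.
  apply: cont_ext (gE _ za) _; apply: contM; last exact: cont_kernel.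
  by apply: contB; [exact: fc|exact: cont_cst].
have gd z : sq x y r z -> z \notin a :: S -> cdif g z.
  move=> zs; rewrite inE negb_or => /andP[za zS]; apply: cdif_ext (gE _ za) _.
  apply: cdifM; first by apply: cdifB; [exact: fd|exact: cdif_cst].
  apply: cdifV; first by rewrite subr_eq0.
  by apply: cdifB; [exact: cdif_id|exact: cdif_cst].
have kc := bdcont_kernel ia.
have fkc : bdcont (fun z => f z / (z - a)) x y r.
  by move=> z bz; apply: contM; [apply: (sqcont_bd fc)|exact: kc].
have kkc : bdcont (fun z => f a * (z - a)^-1) x y r.
  by move=> z bz; apply: contM; [exact: cont_cst|exact: kc].
have := goursat (ins_gt0 ia) gc gd.
rewrite (@bd_ext _ _ (fun z => f z / (z - a) - f a * (z - a)^-1)) //; last first.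
  by move=> z bz; rewrite /g (negPf (bdr_neq ia bz)) mulrBl.
by rewrite bdB// bdZ// => /eqP; rewrite subr_eq0 => /eqP.
Qed.

Lemma sq_split x y r z : 0 < r -> sq x y r z ->
  [\/ sq x y (r / 2) z, sq (x + r / 2) y (r / 2) z, sq x (y + r / 2) (r / 2) z
    | sq (x + r / 2) (y + r / 2) (r / 2) z].
Proof.
move=> r0 /sqP[? ? ? ?].
have [?|?] := leP (complex.Re z) (x + r / 2); have [?|?] := leP (complex.Im z) (y + r / 2).
- by apply: Or41; apply/sqP; split; lra.
- by apply: Or43; apply/sqP; split; lra.
- by apply: Or42; apply/sqP; split; lra.
- by apply: Or44; apply/sqP; split; lra.
Qed.

Lemma sq_bounded g x y r : 0 < r -> sqcont g x y r ->
  exists M, forall z, sq x y r z -> nm (g z) <= M.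
Proof.
move=> r0 gc; apply: (@sq_bisect R (fun x y r => exists M, forall z, sq x y r z -> nm (g z) <= M)) => //.
  move=> x1 y1 r1 r10 [M1 H1] [M2 H2] [M3 H3] [M4 H4].
  exists (Num.max (Num.max M1 M2) (Num.max M3 M4)) => z /(sq_split r10).
  by rewrite !le_max => -[/H1|/H2|/H3|/H4] ->; rewrite ?orbT.
move=> z zs; have [d d0 Hd] := gc z zs 1 ltr01; exists (d / 2); first lra.
move=> x1 y1 r1 /andP[r1p r1d] z1 _; exists (nm (g z) + 1) => w ws.
have := Hd w; have := sq_nm (ltW r1p) z1 ws; have := nm_low (g w) (g z).
by move=> ? ? H; have := H ltac:(lra); lra.
Qed.

(** If the supremum were not attained, the inverse of its distance to [nm (g z)] would be continuous
    on the square, hence bounded, which is absurd. *)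
Lemma sq_max g x y r : 0 < r -> sqcont g x y r ->
  exists2 z0, sq x y r z0 & forall z, sq x y r z -> nm (g z) <= nm (g z0).
Proof.
move=> r0 gc; have [M HM] := sq_bounded r0 gc.
pose A := [set nm (g z) | z in [set z | sq x y r z]].
have zc : sq x y r (x +i* y) by apply/sqP; split=> /=; lra.
have hs : has_sup A by split; [exists (nm (g (x +i* y))); exists (x +i* y)|exists M => _ [z zs <-]; exact: HM].
have up z : sq x y r z -> nm (g z) <= sup A.
  by move=> zs; apply: sup_upper_bound => //; exists z.
apply: contrapT => nE.
have lt z : sq x y r z -> nm (g z) < sup A.
  move=> zs; rewrite lt_neqAle up// andbT; apply/eqP => E; apply: nE.
  by exists z => // w ws; rewrite E; exact: up.
pose h z : C := ((sup A - nm (g z))%:C)^-1.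
have hc : sqcont h x y r.
  move=> z zs; apply: contV.
    by rewrite -nm_gt0 nm_real normr_gt0 subr_eq0 gt_eqF// lt.
  move=> e e0; apply: near_imp (gc z zs e e0) => w.
  rewrite -rmorphB nm_real; apply: le_lt_trans; rewrite opprB addrC addrA subrK.
  rewrite ler_norml; apply/andP; split.
    by have := nm_low (g w) (g z); lra.
  by have := nm_low (g z) (g w); rewrite (nm_sub (g z)).
have [N HN] := sq_bounded r0 hc.
have N0 : 0 < N by apply: lt_le_trans (HN _ zc); rewrite nmV nm_real invr_gt0 normr_gt0 subr_eq0 gt_eqF// lt.
have Ni : 0 < N^-1 by rewrite invr_gt0.
have [_ [z zs <-] zN] := sup_adherent Ni hs.
have := HN z zs; rewrite nmV nm_real gtr0_norm ?subr_gt0 ?lt//.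
have s0 : 0 < sup A - nm (g z) by rewrite subr_gt0 lt.
rewrite -[X in _ <= X]invrK lef_pV2 ?posrE// => ?; lra.
Qed.

Lemma cdif_cauchy_kernel g x y r a : sqcont g x y r -> ins x y r a ->
  cdif (fun b => bd (fun z => g z / (z - b)) x y r) a.
Proof.
move=> gs ia; have r0 := ins_gt0 ia; have [d d0 Hd] := ins_dist ia.
have [M HM'] := sq_bounded r0 gs.
have gc := sqcont_bd gs; have HM z : bdr x y r z -> nm (g z) <= M by move=> /andP[/HM'].
have M0 : 0 <= M.
  have [h1 _ _ _] := bdr_sides x y (ltW r0).
  by apply: le_trans (nm_ge0 _) (HM _ (h1 x _)); lra.
pose l := bd (fun z => g z / (z - a) ^+ 2) x y r.
have cK b : ins x y r b -> bdcont (fun z => g z / (z - b)) x y r.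
  by move=> ib z bz; apply: contM; [exact: gc|exact: (bdcont_kernel ib)].
have cK2 : bdcont (fun z => g z / (z - a) ^+ 2) x y r.
  move=> z bz; apply: cont_ext (contM (cK a ia z bz) (bdcont_kernel ia bz)).
  by apply: near_all => w; rewrite -mulrA -invfM expr2.
exists l => e e0.
(* Subtracting [l] from the difference quotient leaves [b - a] times the integral of
   [g / ((z - a)^2 (z - b))]. On the boundary the first distance is at least [d] and the second at
   least [d / 2], whence [2 * M / d ^+ 3]; [bd_bnd] contributes [8 * r]. *)
pose K := 8 * (2 * M / d ^+ 3) * r.
have d3 : 0 < d ^+ 3 by exact: exprn_gt0.
have K0 : 0 <= K by rewrite /K !mulr_ge0 ?(ltW r0)// invr_ge0 (ltW d3).
have d20 : 0 < d / 2 by lra.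
have eK : 0 < e / (K + 1) by rewrite divr_gt0//; lra.
apply: near_and_imp (near_and (ins_near ia) (near_ball a d20)) (near_ball a eK)
  => b [ib bd2] be ba.
have ba0 : b - a != 0 by rewrite subr_eq0.
have -> : (bd (fun z => g z / (z - b)) x y r - bd (fun z => g z / (z - a)) x y r) / (b - a) - l
  = bd (fun z => (b - a) * (g z / (z - a) ^+ 2 / (z - b))) x y r.
  rewrite -bdB//; [|exact: ltW|exact: cK|exact: cK].
  have c1 : bdcont (fun z => g z / (z - b) - g z / (z - a)) x y r.
    by move=> z bz; apply: contB; [exact: (cK b)|exact: (cK a)].
  rewrite mulrC -bdZ//; last exact: ltW.
  rewrite -bdB//; [|exact: ltW|by move=> z bz; apply: contM; [exact: cont_cst|exact: c1]].
  apply: bd_ext; first exact: ltW.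
  move=> z bz; have za : z - a != 0 by rewrite subr_eq0 (bdr_neq ia bz).
  have zb : z - b != 0 by rewrite subr_eq0 (bdr_neq ib bz).
  by field; rewrite za zb ba0.
have -> : e = e / (K + 1) * (K + 1) by rewrite divfK//; apply: lt0r_neq0; lra.
apply: le_lt_trans (_ : nm (b - a) * K < _); last first.
  by have := nm_ge0 (b - a); nra.
have cc : bdcont (fun z => g z / (z - a) ^+ 2 / (z - b)) x y r.
  by move=> z bz; apply: contM; [exact: cK2|exact: (bdcont_kernel ib)].
rewrite bdZ//; last exact: ltW.
rewrite nmM; apply: ler_wpM2l; first exact: nm_ge0.
apply: bd_bnd => //; first exact: ltW.
move=> z bz; rewrite !nmM !nmV nmX.
have Da := Hd z bz; have Db : d / 2 <= nm (z - b).
  by have := nm_tri z a b; lra.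
have -> : 2 * M / d ^+ 3 = M * (d ^+ 2)^-1 * (d / 2)^-1 by field; rewrite gt_eqF.
apply: ler_pM; rewrite ?invr_ge0 ?nm_ge0 ?mulr_ge0 ?invr_ge0 ?exprn_ge0 ?nm_ge0//.
  apply: ler_pM; rewrite ?invr_ge0 ?nm_ge0 ?exprn_ge0 ?nm_ge0//; first exact: HM.
  by rewrite lef_pV2 ?posrE ?exprn_gt0//; [rewrite lerXn2r ?nnegrE ?nm_ge0// ltW|lra].
by rewrite lef_pV2 ?posrE//; lra.
Qed.
End Cauchy.

(** * Local theory of holomorphic functions *)

Section LocalTheory.
Local Open Scope complex_scope.
Variable R : realType.
Local Notation C := R[i].
Implicit Types (f g h : C -> C) (x y r d e M u v : R) (z w a b : C).

Definition sqhol f x y r := forall z, sq x y r z -> cdif f z.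

Lemma sqhol_cont f x y r : sqhol f x y r -> sqcont f x y r.
Proof. by move=> H z /H; exact: cdif_cont. Qed.

Lemma near_notin (S : seq C) a : pnear a (fun b => b \notin S).
Proof.
elim: S => [|s S IH]; first exact: near_all.
have [->|sa] := eqVneq s a.
  by apply: near_imp IH => b H ba; rewrite inE negb_or ba H.
apply: near_and_imp (near_neq sa) IH => b bs H ba.
by rewrite inE negb_or bs H.
Qed.

(** Near [a] and off [S], Cauchy's formula writes [f] as [N / c], a quotient of parameter integrals
    that are differentiable at [a] with [c a != 0]. Continuity extends the equality to [a] itself,
    even when [a] lies in [S]. *)
Lemma riemann f (S : seq C) x y r a : sqcont f x y r ->
  (forall z, sq x y r z -> z \notin S -> cdif f z) -> ins x y r a -> cdif f a.
Proof.
move=> fc fd ia.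
pose N b := bd (fun z => f z / (z - b)) x y r.
pose c b := bd (fun z => (z - b)^-1) x y r.
have cE b : c b = bd (fun z => (fun=> 1) z / (z - b)) x y r.
  by apply: bd_ext; [exact: ltW (ins_gt0 ia)|move=> z _; rewrite mul1r].
have Nd : cdif N a by exact: cdif_cauchy_kernel.
have cd : cdif c a.
  apply: cdif_ext (@cdif_cauchy_kernel R (fun=> 1) x y r a _ ia).
    by apply: near_all => b; rewrite cE.
  by move=> z _; exact: cont_cst.
have c0 : c a != 0 by exact: bd_kernel_neq0.
have Qd : cdif (fun b => N b / c b) a by apply: cdifM => //; exact: cdifV.
have Qc := proj1 (cont_clim _ _) (cdif_cont Qd).
have pE : pnear a (fun b => N b / c b = f b).
  apply: near_and_imp (near_and (ins_near ia) (near_notin S a)) (near_all _ (fun=> I))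
    => b [ib bS] _ ba.
  have sb := ins_sq ib.
  rewrite /N (cauchy fc fd ib); last by apply: fd => //; exact: bS.
  by rewrite -/(c b) mulfK// bd_kernel_neq0.
apply: cdif_ext Qd; apply: (near_imp _ pE) => b H.
have [->|ba] := eqVneq b a; last exact: H.
apply: clim_uniq Qc _; apply: clim_ext (proj1 (cont_clim _ _) (fc _ (ins_sq ia))).
by apply: near_imp pE => w H' /H' ->.
Qed.

Lemma pow_unbounded (q K : R) : 1 < q -> exists n, K < q ^+ n.+1.
Proof.
move=> q1; have lb n : 1 + n%:R * (q - 1) <= q ^+ n.
  elim: n => [|n IH]; first by rewrite mul0r addr0.
  rewrite exprS; apply: le_trans (_ : q * (1 + n%:R * (q - 1)) <= _); last first.
    by rewrite ler_pM2l//; lra.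
  by rewrite -natr1; have := mulr_ge0 (ler0n R n) (sqr_ge0 (q - 1)); lra.
exists (Num.trunc (Num.max 0 (K / (q - 1)))); apply: lt_le_trans (lb _).
have := truncnS_gt (Num.max 0 (K / (q - 1))).
rewrite gt_max => /andP[_]; rewrite ltr_pdivrMr; lra.
Qed.

(** Cauchy's estimate for [f ^+ n] has a constant independent of [n]; comparing growth in [n]
    removes the constant. *)
Lemma weak_max f x y r M : sqhol f x y r ->
  (forall z, bdr x y r z -> nm (f z) <= M) ->
  forall a, ins x y r a -> nm (f a) <= M.
Proof.
move=> fd HM a ia; rewrite leNgt; apply/negP => MF.
have r0 := ins_gt0 ia; have [d d0 Hd] := ins_dist ia.
have M0 : 0 <= M.
  have [h1 _ _ _] := bdr_sides x y (ltW r0).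
  by apply: le_trans (nm_ge0 _) (HM _ (h1 x _)); lra.
pose c := nm (bd (fun z => (z - a)^-1) x y r).
have c0 : 0 < c by rewrite nm_gt0 bd_kernel_neq0.
have key n : nm (f a) ^+ n * c <= M ^+ n * (8 * d^-1 * r).
  have fnd : sqhol (fun z => f z ^+ n) x y r by move=> z /fd; exact: cdifX.
  rewrite -nmX -nmM -(@cauchy _ _ [::] _ _ _ _ (sqhol_cont fnd))//; first last.
  - by apply: fnd; exact: ins_sq.
  - by move=> z /fnd.
  apply: le_trans (_ : 8 * (M ^+ n * d^-1) * r <= _); last by rewrite le_eqVlt; apply/orP; left; apply/eqP; ring.
  apply: bd_bnd; first exact: ltW.
    move=> z bz; apply: contM; last exact: bdcont_kernel ia _ bz.
    by apply: (sqhol_cont fnd); case/andP: bz.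
  move=> z bz; rewrite nmM nmV nmX; apply: ler_pM; rewrite ?exprn_ge0 ?nm_ge0 ?invr_ge0 ?nm_ge0//.
    by rewrite lerXn2r ?nnegrE ?nm_ge0// HM.
  by rewrite lef_pV2 ?posrE//; [exact: Hd|exact: lt_le_trans (Hd z bz)].
have F0 : 0 < nm (f a) by exact: le_lt_trans MF.
have [M00|M1] := eqVneq M 0.
  by have := key 1%N; rewrite M00 !expr1 mul0r leNgt mulr_gt0.
have {M1}M1 : 0 < M by rewrite lt0r M1.
have [n] := @pow_unbounded (nm (f a) / M) (8 * d^-1 * r / c) ltac:(by rewrite ltr_pdivlMr// mul1r).
rewrite expr_div_n ltr_pdivlMr ?exprn_gt0// mulrAC ltr_pdivrMr//.
by have := key n.+1; rewrite (mulrC (M ^+ _)); lra.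
Qed.

Definition csq (P : (C -> C) -> R -> R -> R -> Prop) f a r :=
  P f (complex.Re a - r) (complex.Im a - r) (2 * r).

Lemma csq_ins a r z : nm (z - a) < r ->
  ins (complex.Re a - r) (complex.Im a - r) (2 * r) z.
Proof.
move=> H; have := Re_le_nm (z - a); have := Im_le_nm (z - a).
rewrite ImB ReB !ler_norml => /andP[? ?] /andP[? ?].
by apply/andP; split; apply/andP; split; lra.
Qed.
Lemma csq_ctr a r : 0 < r -> ins (complex.Re a - r) (complex.Im a - r) (2 * r) a.
Proof. by move=> r0; apply: csq_ins; rewrite subrr nm0. Qed.
Lemma csq_bdr a r z : bdr (complex.Re a - r) (complex.Im a - r) (2 * r) z -> r <= nm (z - a).
Proof.
move=> /andP[_ H]; have := Re_le_nm (z - a); have := Im_le_nm (z - a).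
rewrite ImB ReB !ler_norml => /andP[? ?] /andP[? ?].
by case/or4P: H => /eqP ?; lra.
Qed.
Lemma csq_nm a r z : sq (complex.Re a - r) (complex.Im a - r) (2 * r) z -> nm (z - a) <= 2 * r.
Proof.
move=> /sqP[? ? ? ?]; apply: le_trans (nm_le_ReIm _) _; rewrite ReB ImB.
have A : `|complex.Re z - complex.Re a| <= r by rewrite ler_norml; apply/andP; split; lra.
have B : `|complex.Im z - complex.Im a| <= r by rewrite ler_norml; apply/andP; split; lra.
lra.
Qed.

Lemma near_sqhol f a : near a (cdif f) -> exists2 r, 0 < r & csq sqhol f a r.
Proof.
move=> [d d0 H]; exists (d / 4); first lra.
by move=> z /csq_nm ?; apply: H; lra.
Qed.

Lemma sqhol_div f a x y r : sqhol f x y r -> ins x y r a -> f a = 0 ->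
  exists2 g, sqhol g x y r & forall z, f z = (z - a) * g z.
Proof.
move=> fd ia fa; have [l fl] := fd _ (ins_sq ia).
pose g z := if z == a then l else f z / (z - a).
have gE z : z != a -> near z (fun w => f w / (w - a) = g w).
  by move=> za; apply: near_imp (near_neq (_ : a != z)); rewrite 1?eq_sym// => w /negPf wa; rewrite /g wa.
have gd z : sq x y r z -> z \notin [:: a] -> cdif g z.
  rewrite inE => zs za; apply: cdif_ext (gE _ za) _.
  apply: cdifM; first exact: fd.
  apply: cdifV; first by rewrite subr_eq0.
  by apply: cdifB; [exact: cdif_id|exact: cdif_cst].
have gc : sqcont g x y r.
  move=> z zs; have [->|za] := eqVneq z a; last by apply: cdif_cont; apply: gd; rewrite ?inE.
  apply/cont_clim; rewrite {2}/g eqxx; apply: clim_ext fl.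
  by apply: near_all => w /negPf wa; rewrite /g wa fa subr0.
exists g => [z zs|z]; last first.
  rewrite /g; case: eqVneq => [->|za]; first by rewrite fa subrr mul0r.
  by rewrite mulrC divfK// subr_eq0.
have [->|za] := eqVneq z a; last by apply: gd; rewrite ?inE.
exact: riemann gc gd ia.
Qed.

(** If division by [z - a] never stops, then [f = (z - a)^n g_n] for all [n]. The maximum principle
    bounds [g_n] by [M / r^n], so [f] is at most [(nm (z - a) / r)^n M], which tends to 0. This
    takes the place of Taylor series. *)
Lemma order_dich f a r : 0 < r -> csq sqhol f a r ->
  (forall z, nm (z - a) < r -> f z = 0) \/
  exists (m : nat) h, [/\ csq sqhol h a r, h a != 0 & forall z, f z = (z - a) ^+ m * h z].
Proof.
move=> r0 fd; have [H|nH] := pselect (exists (m : nat) h,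
  [/\ csq sqhol h a r, h a != 0 & forall z, f z = (z - a) ^+ m * h z]); [by right|left].
have all n : exists2 g, csq sqhol g a r & forall z, f z = (z - a) ^+ n * g z.
  elim: n => [|n [g gd gE]]; first by exists f => // z; rewrite expr0 mul1r.
  have ga : g a = 0.
    by apply/eqP/negPn/negP => ga; apply: nH; exists n, g.
  have [k kd kE] := sqhol_div gd (csq_ctr a r0) ga.
  by exists k => // z; rewrite gE kE exprSr mulrA.
have r20 : 0 < 2 * r by lra.
have [M HM] := sq_bounded r20 (sqhol_cont fd).
move=> z zr; apply/eqP; rewrite -nm_eq0; apply/negPn/negP => f0.
have F0 : 0 < nm (f z) by rewrite lt0r f0 nm_ge0.
have M0 : nm (f z) <= M by apply: HM; apply: ins_sq; exact: csq_ins.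
have bnd n : nm (f z) <= (nm (z - a) / r) ^+ n * M.
  have [g gd gE] := all n.
  have H w : bdr (complex.Re a - r) (complex.Im a - r) (2 * r) w -> nm (g w) <= M / r ^+ n.
    move=> bw; have wr := csq_bdr bw; have ws : sq (complex.Re a - r) (complex.Im a - r) (2 * r) w by case/andP: bw.
    rewrite ler_pdivlMr ?exprn_gt0//; apply: le_trans (HM _ ws).
    rewrite gE nmM nmX mulrC; apply: ler_wpM2r; first exact: nm_ge0.
    by rewrite lerXn2r ?nnegrE ?nm_ge0// ltW.
  have := weak_max gd H (csq_ins zr).
  rewrite gE nmM nmX expr_div_n -mulrA (mulrC _^-1) => K.
  by apply: ler_wpM2l => //; rewrite exprn_ge0// nm_ge0.
have [za|za] := eqVneq (nm (z - a)) 0.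
  by have := bnd 1%N; rewrite za mul0r expr1 mul0r; lra.
have q1 : 1 < r / nm (z - a) by rewrite ltr_pdivlMr ?mul1r// lt0r za nm_ge0.
have [n Hn] := @pow_unbounded _ (M / nm (f z)) q1.
have p0 : 0 < (r / nm (z - a)) ^+ n.+1 by rewrite exprn_gt0// (lt_trans ltr01).
have := bnd n.+1; rewrite -[_ / r]invf_div exprVn mulrC ler_pdivlMr// leNgt.
by move: Hn; rewrite ltr_pdivrMr// (mulrC _ (nm _)) => ->.
Qed.

Lemma order_near f a : near a (cdif f) -> f a = 0 ->
  near a (fun z => f z = 0) \/
  exists (m : nat) h, [/\ near a (cdif h), h a != 0 & forall z, f z = (z - a) ^+ m.+1 * h z].
Proof.
move=> /near_sqhol[r r0 fd] fa; have [H|[[|m] [h [hd ha hE]]]] := order_dich r0 fd.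
- by left; exists r.
- by move: ha; rewrite -[h a]mul1r -(expr0 (a - a)) -hE fa eqxx.
- right; exists m, h; split=> //; exists r => // w wr.
  by apply: hd; apply: ins_sq; exact: csq_ins.
Qed.

Lemma isolated_zeros f a : near a (cdif f) -> ~ near a (fun z => f z = 0) ->
  pnear a (fun z => f z != 0).
Proof.
move=> fd nz; have [fa|fa] := eqVneq (f a) 0.
  have [//|[m [h [hd ha hE]]]] := order_near fd fa.
  have := cont_neq0 (cdif_cont (near_pt hd)) ha; apply: near_imp => z hz za.
  by rewrite hE mulf_neq0// expf_neq0// subr_eq0.
by apply: near_imp (cont_neq0 (cdif_cont (near_pt fd)) fa).
Qed.

Definition uhol f := forall z, upper R z -> cdif f z.

Lemma upper_near z : upper R z -> near z (upper R).
Proof.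
rewrite /upper /= => z0; exists (complex.Im z) => // w.
by have := Im_le_nm (w - z); rewrite ImB ler_norml => /andP[? _] ? /=; lra.
Qed.

Lemma uhol_near f z : uhol f -> upper R z -> near z (cdif f).
Proof. by move=> fd /upper_near; apply: near_imp => w; exact: fd. Qed.

(** The centred square of half-side [r] stays in the half-plane whenever [r < Im a], so [order_dich]
    reaches every ball of radius less than [Im a]. *)
Lemma uhol_zero_ball f a : uhol f -> upper R a -> near a (fun z => f z = 0) ->
  forall z, nm (z - a) < complex.Im a -> f z = 0.
Proof.
rewrite /upper /= => fd a0 fz z za.
pose r := (nm (z - a) + complex.Im a) / 2; have := nm_ge0 (z - a) => n0.
have r0 : 0 < r by rewrite /r; lra.
have hd : csq sqhol f a r.
  by move=> w /sqP[_ _ H _]; apply: fd; rewrite /upper /=; move: H; rewrite /r; lra.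
have [H|[m [h [hd' ha hE]]]] := order_dich r0 hd; first by apply: H; rewrite /r; lra.
exfalso; have hn := cont_neq0 (cdif_cont (hd' a (ins_sq (csq_ctr a r0)))) ha.
have [w [wa _ []]] := pnear_pt ltr01 (near_imp (fun w H _ => H) (near_and hn fz)).
by move=> hw; rewrite hE => /eqP; rewrite mulf_eq0 (negPf hw) orbF expf_eq0 subr_eq0 (negPf wa) andbF.
Qed.

(** The zero set spreads along centres [p n] climbing vertically by the factor 3/2: each lies in the
    ball of radius [Im] about the one before, and these balls exhaust the half-plane. *)
Lemma uhol_identity f a : uhol f -> upper R a -> near a (fun z => f z = 0) ->
  forall z, upper R z -> f z = 0.
Proof.
move=> fd a0 fz z z0; pose p n : C := complex.Re a +i* ((3 / 2) ^+ n * complex.Im a).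
have p0 n : upper R (p n).
  by rewrite /upper /= mulr_gt0// exprn_gt0//; lra.
have Hp n : near (p n) (fun z => f z = 0).
  elim: n => [|n IH]; first by rewrite /p expr0 mul1r; case: (a) fz.
  have B := uhol_zero_ball fd (p0 n) IH.
  have pn : nm (p n.+1 - p n) < complex.Im (p n).
    have -> : p n.+1 - p n = 'i * (((3 / 2) ^+ n * complex.Im a) / 2)%:C.
      by apply/eqP; rewrite eq_complex /= exprS; apply/andP; split; apply/eqP; field.
    have nmi : nm 'i = 1 :> R by rewrite /nm /= expr0n expr1n add0r sqrtr1.
    have := p0 n; rewrite /upper /= nmM nmi mul1r nm_real => q0.
    by rewrite gtr0_norm ?divr_gt0//; lra.
  exists (complex.Im (p n) - nm (p n.+1 - p n)); first by rewrite subr_gt0.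
  by move=> w Hw; apply: B; have := nm_tri w (p n) (p n.+1); lra.
(* With [Y] the height of the centre, [z] is in the ball once [(Re z - Re a)^2 + (Im z)^2 < 2 * Im z
   * Y]; the choice of [K] gives this without the factor 2. *)
pose K := ((complex.Re z - complex.Re a) ^+ 2 + complex.Im z ^+ 2) / complex.Im z / complex.Im a.
have [n Hn] := @pow_unbounded (3 / 2) K ltac:(lra).
apply: (uhol_zero_ball fd (p0 n.+1) (Hp n.+1)).
rewrite -(ltr_pXn2r (_ : 0 < 2)%N) ?nnegrE ?nm_ge0 ?(ltW (p0 n.+1))//.
rewrite nm_sqr ReB ImB /=.
move: Hn; rewrite /K ltr_pdivrMr// ltr_pdivrMr//.
set Y := _ * complex.Im a => H; have zi : 0 < complex.Im z by [].
have Y0 : 0 < Y by exact: (p0 n.+1).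
nra.
Qed.

Lemma strong_max f a : near a (cdif f) -> near a (fun z => nm (f z) <= nm (f a)) ->
  near a (fun z => f z = f a).
Proof.
move=> fd fm; have [fa|fa] := eqVneq (f a) 0.
  apply: near_imp fm => z; rewrite fa nm0 => H; apply/eqP.
  by rewrite -nm_eq0 eq_le H nm_ge0.
pose g z := f z - f a.
have gd : near a (cdif g).
  by apply: near_imp fd => z ?; apply: cdifB => //; exact: cdif_cst.
have ga : g a = 0 by rewrite /g subrr.
have [H|[m [h [hd ha hE]]]] := order_near gd ga.
  by apply: near_imp H => z /eqP; rewrite subr_eq0 => /eqP.
(* The direction in which the leading term [(z - a)^(m+1) h a] is a positive multiple of [f a];
   moving along it increases the modulus. *)
exfalso; pose ze : C := m.+1.-root (f a / h a).
have zE : ze ^+ m.+1 = f a / h a by exact: rootCK.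
have z0 : ze != 0.
  apply/eqP => z0; move/eqP: zE; rewrite z0 expr0n eq_sym mulf_eq0 invr_eq0.
  by rewrite (negPf fa) (negPf ha).
have hc : clim (fun z => h z / h a) a 1.
  rewrite -[1](divff ha).
  by apply: climM (clim_cst _ _); apply/cont_clim; exact: cdif_cont (near_pt hd).
have e2 : (0 : R) < 1 / 2 by lra.
have [d d0 Hd] := near_and fm (hc _ e2).
have n0 : 0 < nm ze by rewrite nm_gt0.
pose t := d / nm ze / 2; have t0 : 0 < t by rewrite !divr_gt0.
have nt : nm (t%:C * ze) = d / 2.
  by rewrite nmM nm_real gtr0_norm// /t mulrAC divfK// gt_eqF.
have wa : a + t%:C * ze - a = t%:C * ze by ring.
have wne : a + t%:C * ze != a.
  by rewrite -subr_eq0 wa mulf_neq0// -nm_eq0 nm_real gtr0_norm// gt_eqF.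
have [] := Hd (a + t%:C * ze); first by rewrite wa nt; lra.
move=> H1 /(_ wne) H2.
have E : f (a + t%:C * ze) = f a * (1 + (t ^+ m.+1)%:C * (h (a + t%:C * ze) / h a)).
  rewrite -[LHS](subrK (f a)) -/(g _) hE wa exprMn zE rmorphXn /=.
  by field; exact: ha.
move: H1; rewrite E nmM -ler_pdivlMl ?nm_gt0// mulVf ?nm_eq0//.
have [q qE] : exists q : C, q = h (a + t%:C * ze) / h a by eexists.
rewrite -qE in H2 *.
have q1 : 1 / 2 < complex.Re q.
  have := le_lt_trans (Re_le_nm (q - 1)) H2; rewrite ReB ltr_norml => /andP[+ _].
  by rewrite (_ : complex.Re (1 : C) = 1)//; lra.
have T0 : 0 < t ^+ m.+1 by exact: exprn_gt0.
have := Re_le_nm (1 + (t ^+ m.+1)%:C * q).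
have -> : complex.Re (1 + (t ^+ m.+1)%:C * q) = 1 + t ^+ m.+1 * complex.Re q.
  by case: q {H2 q1 qE} => u v /=; ring.
rewrite ler_norml => /andP[_] H3 H4.
have := le_trans H3 H4; nra.
Qed.

(** If [w] were not taken, [1 / (f - w)] would be holomorphic on the square, at most [1 / e] on its
    boundary and larger than that at the centre, against [weak_max]. *)
Lemma open_mapping f a r0 : near a (cdif f) -> ~ near a (fun z => f z = f a) -> 0 < r0 ->
  exists r, [/\ 0 < r, r < r0 & exists2 e, 0 < e & forall w, nm (w - f a) < e ->
    exists2 z, sq (complex.Re a - r) (complex.Im a - r) (2 * r) z & f z = w].
Proof.
move=> fd nf r00; pose g z := f z - f a.
have gd : near a (cdif g).
  by apply: near_imp fd => z ?; apply: cdifB => //; exact: cdif_cst.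
have ga : g a = 0 by rewrite /g subrr.
have [H|[m [h [hd ha hE]]]] := order_near gd ga.
  by exfalso; apply: nf; apply: near_imp H => z /eqP; rewrite subr_eq0 => /eqP.
have h0 : 0 < nm (h a) / 2 by rewrite divr_gt0// nm_gt0.
have [d d0 Hd] := near_and fd (cdif_cont (near_pt hd) h0).
pose r := Num.min d r0 / 4.
have m0 : 0 < Num.min d r0 by rewrite lt_min d0.
have [rd rr] : r <= d / 4 /\ r <= r0 / 4.
  by rewrite /r; split; rewrite ler_pM2r ?invr_gt0// ge_min lexx ?orbT.
have r1 : 0 < r by rewrite /r divr_gt0.
exists r; split=> //; first by lra.
pose e := r ^+ m.+1 * (nm (h a) / 2) / 2.
have e0 : 0 < e by rewrite divr_gt0// mulr_gt0// exprn_gt0.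
exists e => // w wf; apply: contrapT => nE.
have nw z : sq (complex.Re a - r) (complex.Im a - r) (2 * r) z -> f z - w != 0.
  by move=> zs; rewrite subr_eq0; apply/eqP => E; apply: nE; exists z.
have kd : csq sqhol (fun z => (f z - w)^-1) a r.
  move=> z zs; apply: cdifV; first exact: nw.
  apply: cdifB; last exact: cdif_cst.
  by have [] := Hd z; first by have := csq_nm zs; lra.
have kb z : bdr (complex.Re a - r) (complex.Im a - r) (2 * r) z -> nm ((f z - w)^-1) <= e^-1.
  move=> bz; have zs : sq (complex.Re a - r) (complex.Im a - r) (2 * r) z by case/andP: bz.
  rewrite nmV lef_pV2 ?posrE// ?nm_gt0 ?nw//.
  have [_ hz] := Hd z ltac:(have := csq_nm zs; lra).
  have -> : f z - w = g z - (w - f a) by rewrite /g; ring.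
  apply: le_trans (nm_low _ _).
  have : 2 * e <= nm (g z).
    rewrite hE nmM nmX /e mulrC divfK//; apply: ler_pM.
    - by rewrite exprn_ge0// ltW.
    - exact: ltW.
    - by rewrite lerXn2r ?nnegrE ?nm_ge0 ?(ltW r1)//; exact: csq_bdr.
    - by have := nm_low (h a) (h z); rewrite (nm_sub (h a) (h z)); lra.
  by rewrite nm_sub in wf *; lra.
have := weak_max kd kb (csq_ctr a r1); rewrite nmV lef_pV2 ?posrE//.
  by rewrite nm_sub; lra.
by rewrite nm_gt0 nw//; apply: ins_sq; exact: csq_ctr.
Qed.

(** The mean value inequality on the segment from [a] to [z]: for each [e], the supremum of the
    parameters up to which [f] has grown by at most [e * s] can only be 1. *)
Lemma near_cst_der f a : near a (cdif f) -> near a (fun z => cder f z 0) ->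
  near a (fun z => f z = f a).
Proof.
move=> _ [d d0 Hd]; exists (d / 4); first lra.
move=> z zd.
pose g (t : R) := f (a + t%:C * (z - a)).
have gt (t s : R) : nm (a + t%:C * (z - a) - (a + s%:C * (z - a))) = `|t - s| * nm (z - a).
  by rewrite -nm_real -nmM rmorphB; congr nm; ring.
have bnd e : 0 < e -> nm (f z - f a) <= e.
  move=> e0.
  pose A := [set t : R | 0 <= t <= 1 /\ forall s, 0 <= s <= t -> nm (g s - g 0) <= e * s].
  have g0 : A 0.
    split; first lra. move=> s s0; have -> : s = 0 by lra.
    by rewrite subrr nm0 mulr0.
  have hs : has_sup A by split; [exists 0|exists 1 => t []; lra].
  have n1 : 0 < nm (z - a) + 1 by have := nm_ge0 (z - a); lra.
  have loc t : 0 <= t <= 1 -> exists2 dl, 0 < dl & forall s, `|s - t| < dl ->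
      nm (g s - g t) <= e * `|s - t|.
    move=> t01; have ht : cder f (a + t%:C * (z - a)) 0.
      apply: Hd; rewrite (_ : _ - a = (t%:C * (z - a))); last by ring.
      rewrite nmM nm_real ger0_norm; last by lra.
      by have := nm_ge0 (z - a); nra.
    have e1 : 0 < e / (nm (z - a) + 1) by rewrite divr_gt0.
    have [d1 d10 H1] := cder_bnd ht e1.
    exists (d1 / (nm (z - a) + 1)); first by rewrite divr_gt0.
    move=> s; rewrite ltr_pdivlMr// => st.
    have := H1 (a + s%:C * (z - a)); rewrite gt mul0r subr0 => H.
    apply: le_trans (H _) _.
      by apply: le_lt_trans st; rewrite ler_wpM2l//; lra.
    rewrite mulrAC ler_pdivrMr// mulrA.
    apply: ler_wpM2l; last lra.
    by rewrite mulr_ge0// ltW.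
  have S0 : 0 <= sup A by apply: sup_upper_bound.
  have S1 : sup A <= 1 by apply: sup_le_ub; [exists 0|move=> t []; lra].
  have below s : 0 <= s < sup A -> nm (g s - g 0) <= e * s.
    move=> sA; have ss0 : 0 < sup A - s by lra.
    by have [t [_ Ht] tS] := sup_adherent ss0 hs; apply: Ht; lra.
  have [dl dl0 Hl] := loc (sup A) ltac:(lra).
  have at_ : nm (g (sup A) - g 0) <= e * sup A.
    have [->|Sn] := eqVneq (sup A) 0; first by rewrite subrr nm0 mulr0.
    have Sp : 0 < sup A by rewrite lt0r Sn.
    pose s := Num.max 0 (sup A - dl / 2).
    have sA : 0 <= s < sup A by rewrite /s le_max lexx gt_max Sp /=; lra.
    have sd : `|s - sup A| < dl.
      rewrite ler0_norm; last by lra.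
      have : sup A - dl / 2 <= s by rewrite /s le_max lexx orbT. lra.
    have := Hl s sd; have := below s sA; have := nm_tri (g (sup A)) (g 0) (g s).
    rewrite (nm_sub (g (sup A)) (g s)) ler0_norm; last by lra.
    lra.
  have [S1e|S1n] := eqVneq (sup A) 1.
    move: at_; rewrite S1e mulr1 /g rmorph1 mul1r rmorph0 mul0r addr0.
    by rewrite (_ : a + (z - a) = z); last by ring.
  exfalso; have Sl : sup A < 1 by rewrite lt_neqAle S1n.
  pose t := sup A + Num.min (1 - sup A) (dl / 2).
  have tm : 0 < Num.min (1 - sup A) (dl / 2) by rewrite lt_min; apply/andP; split; lra.
  have [t1 t2] : t <= 1 /\ t <= sup A + dl / 2.
    rewrite /t; split; last by rewrite lerD2l ge_min lexx orbT.
    by rewrite -lerBrDl ge_min lexx.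
  have tp : 0 <= t <= 1 by rewrite t1 andbT addr_ge0// ltW.
  have : A t.
    split=> // s s0.
    have [sA|sA] := ltP s (sup A); first by apply: below; lra.
    have := Hl s; rewrite ger0_norm; last lra.
    move=> H; have := H ltac:(lra); have := nm_tri (g s) (g 0) (g (sup A)); lra.
  by move=> /(sup_upper_bound hs); rewrite /t; lra.
apply/eqP; rewrite -subr_eq0 -nm_eq0; apply/negPn/negP => n0.
have p0 : 0 < nm (f z - f a) / 2 by rewrite divr_gt0// lt0r n0 nm_ge0.
by have := bnd _ p0; lra.
Qed.
End LocalTheory.

(** * Real Moebius transformations *)

Section Mobius.
Local Open Scope complex_scope.
Variable R : realType.
Local Notation C := R[i].
Implicit Types (g h : 'M[R]_2) (z w t : C).

Lemma mulmx2E (F : pzSemiRingType) (g h : 'M[F]_2) i j :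
  (g *m h) i j = g i 0 * h 0 j + g i 1 * h 1 j.
Proof.
rewrite mxE !big_ord_recl big_ord0 addr0.
by congr (_ + g i _ * h _ j); apply: val_inj.
Qed.

Lemma ord2P (P : 'I_2 -> Prop) : P 0 -> P 1 -> forall i, P i.
Proof.
move=> P0 P1 [[|[|//]] Hi]; first by have -> : Ordinal Hi = 0 by apply: val_inj.
by have -> : Ordinal Hi = 1 by apply: val_inj.
Qed.

Lemma det2E (F : comNzRingType) (g : 'M[F]_2) :
  \det g = g 0 0 * g 1 1 - g 0 1 * g 1 0.
Proof.
rewrite (expand_det_row _ 0) !big_ord_recl big_ord0 /cofactor !det_mx11 !mxE /=.
rewrite expr0 expr1 mul1r addr0 mulN1r mulrN.
by congr (_ * g _ _ - g _ _ * g _ _); apply: val_inj.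
Qed.

Definition den g z : C := (g 1 0)%:C * z + (g 1 1)%:C.
Definition num g z : C := (g 0 0)%:C * z + (g 0 1)%:C.

Lemma mobiusE g z : mobius g z = num g z / den g z. Proof. by []. Qed.

Lemma real_lin0 z (a b : R) : upper R z -> a%:C * z + b%:C = 0 -> a = 0 /\ b = 0.
Proof.
case: z => x y; rewrite /upper /= => y0 /eqP; rewrite eq_complex /= => /andP[/eqP A /eqP B].
have a0 : a = 0.
  have /eqP : a * y = 0 by rewrite -[RHS]B; ring.
  by rewrite mulf_eq0 (gt_eqF y0) orbF => /eqP.
by split=> //; rewrite -A a0; ring.
Qed.

Lemma den_neq0 g z : upper R z -> \det g != 0 -> den g z != 0.
Proof.
move=> uz; apply: contraNneq => /(real_lin0 uz)[g10 g11].
by rewrite det2E g10 g11 !mulr0 subrr.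
Qed.

Lemma mobius_sub g z w : den g z != 0 -> den g w != 0 ->
  mobius g z - mobius g w = (\det g)%:C * (z - w) / (den g z * den g w).
Proof.
move=> dz dw; rewrite !mobiusE; apply: (mulIf (mulf_neq0 dz dw)).
rewrite divfK ?mulf_neq0// det2E rmorphB !rmorphM.
have -> : (num g z / den g z - num g w / den g w) * (den g z * den g w)
  = num g z * den g w - num g w * den g z by field; rewrite dz dw.
by rewrite /num /den; ring.
Qed.

Lemma Im_mobius g z : upper R z -> \det g != 0 ->
  complex.Im (mobius g z) = \det g * complex.Im z / nm (den g z) ^+ 2.
Proof.
move=> uz d0; have : nm (den g z) ^+ 2 != 0 by rewrite expf_neq0// nm_eq0 den_neq0.
rewrite nm_sqr mobiusE det2E; case: z {uz} => x y; rewrite /num /den /= => H.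
by field; move: H; congr (~~ (_ == 0)); ring.
Qed.

Lemma mobius_upper g z : 0 < \det g -> upper R z -> upper R (mobius g z).
Proof.
move=> d0 uz; rewrite /upper /= Im_mobius ?gt_eqF//.
have zi : 0 < complex.Im z by [].
by apply: divr_gt0; [exact: mulr_gt0|rewrite exprn_gt0// nm_gt0 den_neq0// gt_eqF].
Qed.

Lemma mobiusM g h z : 0 < \det g -> 0 < \det h -> upper R z ->
  mobius (g *m h) z = mobius g (mobius h z).
Proof.
move=> g0 h0 uz; have dh := den_neq0 uz (lt0r_neq0 h0).
have dg := den_neq0 (mobius_upper h0 uz) (lt0r_neq0 g0).
have gh0 : \det (g *m h) != 0 by rewrite det_mulmx mulf_neq0 ?gt_eqF.
have dgh := den_neq0 uz gh0.
have E1 : num (g *m h) z = num g (mobius h z) * den h z.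
  rewrite {1 2}/num mobiusE mulrDl !mulrA divfK// !mulmx2E !rmorphD !rmorphM /num /den; ring.
have E2 : den (g *m h) z = den g (mobius h z) * den h z.
  rewrite {1 2}/den mobiusE mulrDl !mulrA divfK// !mulmx2E !rmorphD !rmorphM /num /den; ring.
by rewrite [LHS]mobiusE E1 E2 [RHS]mobiusE -mulf_div divff// mulr1.
Qed.

Lemma mobius_scalar (c : R) z : c != 0 -> mobius c%:M z = z.
Proof.
move=> c0; rewrite /mobius !mxE /= !mulr0n !mulr1n !rmorph0 !mul0r addr0 add0r mulrAC divff ?mul1r//.
by rewrite (inj_eq (@complexI R) c 0).
Qed.

Lemma mobius1 z : mobius 1%:M z = z.
Proof. by rewrite mobius_scalar ?oner_neq0. Qed.

Lemma mobiusZ (c : R) g z : c != 0 -> mobius (c *: g) z = mobius g z.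
Proof.
move=> c0; have c0' : c%:C != 0 by rewrite (inj_eq (@complexI R) c 0).
by rewrite /mobius !mxE !rmorphM -!mulrA -!mulrDr -mulf_div divff// mul1r.
Qed.

Lemma mobiusN g z : mobius (- g) z = mobius g z.
Proof. by rewrite -scaleN1r mobiusZ// oppr_eq0 oner_eq0. Qed.

Lemma mobius_inj g z w : 0 < \det g -> upper R z -> upper R w ->
  mobius g z = mobius g w -> z = w.
Proof.
move=> g0 uz uw E; have dz := den_neq0 uz (lt0r_neq0 g0).
have dw := den_neq0 uw (lt0r_neq0 g0).
move/eqP: (mobius_sub dz dw); rewrite E subrr eq_sym !mulf_eq0 invr_eq0 mulf_eq0.
rewrite (negPf dz) (negPf dw) !orbF subr_eq0 => /orP[|/eqP//].
by rewrite (inj_eq (@complexI R) _ 0) gt_eqF.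
Qed.

(** The derivative of [mobius g] at [t]. At a fixed point [den g t] is one eigenvalue, so this is
    the other eigenvalue divided by it. *)
Definition mult g t : C := (\det g)%:C / den g t ^+ 2.

Lemma cder_mobius g t : 0 < \det g -> upper R t -> cder (mobius g) t (mult g t).
Proof.
move=> g0 ut; have dt := den_neq0 ut (lt0r_neq0 g0).
have dc : cont (den g) t.
  by apply: contD; [apply: contM; [exact: cont_cst|exact: cont_id]|exact: cont_cst].
have := climM (clim_cst ((\det g)%:C / den g t) t) (climV dt (proj1 (cont_clim _ _) dc)).
rewrite -mulrA -invfM -expr2; apply: clim_ext.
apply: near_imp (cont_neq0 dc dt) => z dz zt.
by rewrite mobius_sub//; field; rewrite subr_eq0 zt dz dt.
Qed.

Lemma cdif_mobius g t : 0 < \det g -> upper R t -> cdif (mobius g) t.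
Proof. by move=> g0 ut; exists (mult g t); exact: cder_mobius. Qed.

Lemma mult_neq0 g t : 0 < \det g -> upper R t -> mult g t != 0.
Proof.
move=> g0 ut; apply: mulf_neq0; first by rewrite (inj_eq (@complexI R) _ 0) gt_eqF.
by rewrite invr_eq0 expf_neq0// den_neq0// gt_eqF.
Qed.

(* [(t, 1)] is an eigenvector of [g] for the eigenvalue [den g t]. *)
Lemma fix_eigen g t : 0 < \det g -> upper R t -> mobius g t = t ->
  den g t ^+ 2 = (\tr g)%:C * den g t - (\det g)%:C.
Proof.
move=> g0 ut; have dt := den_neq0 ut (lt0r_neq0 g0).
rewrite mobiusE => E; have {}E : num g t = t * den g t by rewrite -[X in X * _]E divfK.
have trE : \tr g = g 0 0 + g 1 1.
  by rewrite /mxtrace !big_ord_recl big_ord0 addr0; congr (_ + g _ _); apply: val_inj.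
rewrite trE det2E rmorphB !rmorphM rmorphD expr2.
have K : (g 1 0)%:C * num g t = (g 1 0)%:C * t * den g t by rewrite E mulrA.
move: K; rewrite {1}/num => K.
have -> : den g t * den g t = (g 1 0)%:C * t * den g t + (g 1 1)%:C * den g t.
  by rewrite {1}/den; ring.
by rewrite -K /den; ring.
Qed.

(** For eigenvalues [l] and [l'] with product [d], [d * (l'/l + l/l') = l^2 + l'^2]. *)
Lemma mult_trace g t : 0 < \det g -> upper R t -> mobius g t = t ->
  (\det g)%:C * (mult g t + (mult g t)^-1) = (\tr g)%:C ^+ 2 - 2 * (\det g)%:C.
Proof.
move=> g0 ut E; have dt := den_neq0 ut (lt0r_neq0 g0).
have g0' : (\det g)%:C != 0 by rewrite (inj_eq (@complexI R) _ 0) gt_eqF.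
have := fix_eigen g0 ut E; rewrite /mult.
move: dt g0'; set l := den g t; set d := (\det g)%:C; set s := (\tr g)%:C => l0 d0 H.
have sE : s = (l ^+ 2 + d) / l by rewrite H subrK mulfK.
by rewrite sE; field; rewrite l0 d0.
Qed.

(** Multiplier 1 means that [den g t] has the positive square [\det g], hence is real, which kills
    the lower left entry. The diagonal entries are then equal, and the remaining translation fixes
    [t], so it is 0. *)
Lemma mult1_scalar g t : 0 < \det g -> upper R t -> mobius g t = t ->
  mult g t = 1 -> exists c, g = c%:M.
Proof.
move=> g0 ut E; have dt := den_neq0 ut (lt0r_neq0 g0).
rewrite /mult => /eqP; rewrite -subr_eq0 -[X in _ - X](divff (expf_neq0 2 dt)) -mulrBl mulf_eq0.
rewrite invr_eq0 expf_eq0 (negPf dt) orbF subr_eq0 => /eqP H.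
have g10 : g 1 0 = 0.
  move: H; rewrite /den; case: t ut {E dt} => x y; rewrite /upper /= => y0.
  move=> /eqP; rewrite eq_complex /= => /andP[/eqP A /eqP B].
  apply/eqP/negPn/negP => c0.
  have e0 : (g 1 0 * x + g 1 1) * (g 1 0 * y) = 0 by apply: (mulfI (_ : 2 != 0 :> R)); [lra|rewrite mulr0 [RHS]B; ring].
  have e1 : g 1 0 * x + g 1 1 = 0.
    by apply/eqP; move/eqP: e0; rewrite !mulf_eq0 (negPf c0) (gt_eqF y0) !orbF.
  have : \det g = - (g 1 0 * y) ^+ 2.
    rewrite A; have -> : g 1 1 = - (g 1 0 * x) by rewrite -[RHS]addr0 -e1; ring.
    by ring.
  by have := sqr_ge0 (g 1 0 * y); lra.
have dE : den g t = (g 1 1)%:C by rewrite /den g10 rmorph0 mul0r add0r.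
have d11 : g 1 1 != 0 by move: dt; rewrite dE (inj_eq (@complexI R) _ 0).
have a11 : g 0 0 = g 1 1.
  move: H; rewrite dE det2E g10 mulr0 subr0 -rmorphXn => /(@complexI R) /=.
  by rewrite expr2 => /(mulIf d11).
have b0 : g 0 1 = 0.
  move: E; rewrite mobiusE dE /num a11 => E.
  have := congr1 (fun x => x * (g 1 1)%:C) E; rewrite divfK; last by rewrite (inj_eq (@complexI R) _ 0).
  rewrite mulrC => /(canRL (addKr _)); rewrite mulrC addNr => /(@complexI R) //.
exists (g 1 1); apply/matrixP; apply: ord2P; apply: ord2P;
  by rewrite !mxE ?a11 ?b0 ?g10.
Qed.

Lemma cont_mobius g t : 0 < \det g -> upper R t -> cont (mobius g) t.
Proof. by move=> g0 ut; apply: cdif_cont; exact: cdif_mobius. Qed.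

Lemma near_mobius g t (P : C -> Prop) : 0 < \det g -> upper R t ->
  near (mobius g t) P -> near t (fun z => P (mobius g z)).
Proof. by move=> g0 ut; apply: near_cont; exact: cont_mobius. Qed.

Lemma pnear_mobius g t (P : C -> Prop) : 0 < \det g -> upper R t ->
  pnear (mobius g t) P -> pnear t (fun z => P (mobius g z)).
Proof.
move=> g0 ut /(near_mobius g0 ut) H.
apply: near_and_imp H (upper_near ut) => z H uz zt; apply: H.
by apply: contraNneq zt => /(mobius_inj g0 uz ut) ->.
Qed.

Lemma clim_mobius f g t l : 0 < \det g -> upper R t ->
  clim f (mobius g t) l -> clim (fun z => f (mobius g z)) t l.
Proof. by move=> g0 ut H e /H; exact: pnear_mobius. Qed.

(** With [A = (z - t)^m h], the quotient [A (g z) / A z] tends to the [m]-th power of the derivative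
    of [g]. The exponent is chosen before [g]: one [m] serves the whole stabilizer. *)
Lemma rot_order (A : C -> C) t : near t (cdif A) -> ~ near t (fun z => A z = 0) ->
  A t = 0 -> exists2 m, (0 < m)%N & forall g, 0 < \det g -> upper R t ->
    mobius g t = t -> clim (fun z => A (mobius g z) / A z) t (mult g t ^+ m).
Proof.
move=> Ad nA At; have [//|[m [h [hd ht hE]]]] := order_near Ad At.
exists m.+1 => // g g0 ut E.
have hc := proj1 (cont_clim _ _) (cdif_cont (near_pt hd)).
have L1 : clim (fun z => (mobius g z - t) / (z - t)) t (mult g t).
  by have := cder_mobius g0 ut; rewrite /cder E.
have L2 : clim (fun z => h (mobius g z) / h z) t 1.
  rewrite -(divff ht); apply: climM; last exact: climV.
  by apply: clim_mobius => //; rewrite E.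
have LX n : clim (fun z => ((mobius g z - t) / (z - t)) ^+ n) t (mult g t ^+ n).
  elim: n => [|n IH]; first exact: clim_cst.
  by rewrite exprS; apply: clim_ext (climM L1 IH); apply: near_all => z _; rewrite exprS.
rewrite -[_ ^+ _]mulr1; apply: clim_ext (climM (LX m.+1) L2).
apply: near_all => z _; rewrite !hE expr_div_n invfM -!mulrA; congr (_ * _).
by rewrite mulrCA.
Qed.

Lemma rot_lim (A : C -> C) g t : 0 < \det g -> upper R t -> mobius g t = t ->
  near t (cdif A) -> ~ near t (fun z => A z = 0) ->
  exists2 m : nat, clim (fun z => A (mobius g z) / A z) t (mult g t ^+ m) &
    (A t = 0 -> (0 < m)%N).
Proof.
move=> g0 ut E Ad nA; have Ac := proj1 (cont_clim _ _) (cdif_cont (near_pt Ad)).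
have [At|At] := eqVneq (A t) 0.
  by have [m m0 Hm] := rot_order Ad nA At; exists m => //; exact: Hm.
exists 0%N => // [|/eqP]; last by rewrite (negPf At).
rewrite expr0 -(divff At); apply: climM; last exact: climV.
by apply: clim_mobius => //; rewrite E.
Qed.
End Mobius.

(** * Functions on the compact quotient *)

Section Compactness.
Local Open Scope complex_scope.
Variable R : realType.
Local Notation C := R[i].

(** Over the field [R[i]] the derivative in direction 1 is the complex derivative; the radii only
    have to be carried between [R] and [R[i]]. *)
Lemma derivable_cdif (f : C -> C) z : derivable (f : C^o -> C^o) z 1 -> cdif f z.
Proof.
move=> /cvg_ex[/= l Hl]; exists l => e e0.
have e0' : (0 : C) < e%:C by rewrite (ltcR 0).
move: Hl => /(@cvgrPdist_lt _ C^o) /(_ _ e0').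
move=> [d /= d0 Hd].
have dr : d = (complex.Re d)%:C by case: (d) d0 => a b; rewrite ltcE /= => /andP[/eqP -> _].
exists (complex.Re d) => [|w wz wne]; first by rewrite -(ltcR 0) -dr.
have nE (u : C) : `|u| = (nm u)%:C by rewrite normc_def; case: u.
have := Hd (w - z); rewrite /ball /= sub0r normrN nE dr ltcR => /(_ wz).
rewrite subr_eq0 => /(_ wne).
rewrite nE ltcR nm_sub; congr (nm (_ - _) < _).
by rewrite /GRing.scale /= mulr1 subrK mulrC.
Qed.

Variables (G1 G0 : set 'M[R]_2) (J : C -> 'rV[C]_2).
Hypothesis G1_1 : G1 1%:M.
Hypothesis G1_M : forall g h, G1 g -> G1 h -> G1 (g *m h).
Hypothesis G1_V : forall g, G1 g -> exists2 h, G1 h & h *m g = 1%:M.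
Hypothesis G1_det : forall g, G1 g -> \det g = 1.
Hypothesis JU : uniformizes G1 [set: 'rV[C]_2] J.

Let det_gt0 g : G1 g -> 0 < \det g.
Proof. by move=> /G1_det ->. Qed.

Lemma J_uhol m : uhol (fun z => J z 0 m).
Proof. by case: JU => H _ _ _ z uz; apply: derivable_cdif; exact: H. Qed.

Lemma J_orbit z g : upper R z -> G1 g -> same_point (J z) (J (mobius g z)).
Proof.
move=> uz g1; case: JU => _ _ H _; apply/H => //; last by exists g.
exact: mobius_upper (det_gt0 g1) uz.
Qed.

(* A linear form vanishing on an open set would vanish at every point of the line, as [J] is onto. *)
Lemma J_lin_nz (a b : C) : (a != 0) || (b != 0) -> forall z, upper R z ->
  ~ near z (fun w => a * J w 0 0 + b * J w 0 1 = 0).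
Proof.
move=> ab z uz Hz.
have hl : uhol (fun w => a * J w 0 0 + b * J w 0 1).
  by move=> w uw; apply: cdifD; apply: cdifM; [exact: cdif_cst|exact: J_uhol|exact: cdif_cst|exact: J_uhol].
have Z := uhol_identity hl uz Hz.
case: JU => _ _ _ S.
have out (P : 'rV[C]_2) : P != 0 -> a * P 0 0 + b * P 0 1 = 0.
  move=> P0; have [w uw [c c0 E]] := S P P0 I.
  have H : c * (a * P 0 0 + b * P 0 1) = 0.
    by rewrite -[RHS](Z w uw) E !mxE; ring.
  by apply/eqP; move/eqP: H; rewrite mulf_eq0 (negPf c0).
have e0 : (\row_j (j == 0)%:R : 'rV[C]_2) != 0.
  by apply/eqP => /rowP /(_ 0); rewrite !mxE /= => /eqP; rewrite oner_eq0.
have e1 : (\row_j (j == 1)%:R : 'rV[C]_2) != 0.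
  by apply/eqP => /rowP /(_ 1); rewrite !mxE /= => /eqP; rewrite oner_eq0.
have := out _ e0; have := out _ e1; rewrite !mxE /= !mulr0 !mulr1 addr0 add0r => b0 a0.
by move: ab; rewrite a0 b0 eqxx.
Qed.

Definition usq (s : R * R * R) : Prop := 0 < s.2 /\ 0 < s.1.2.
Definition insq (s : R * R * R) z := sq s.1.1 s.1.2 s.2 z.

Lemma usq_upper s z : usq s -> insq s z -> upper R z.
Proof. by move=> [_ s0] /sqP[_ _ ? _]; exact: lt_le_trans s0 _. Qed.

(** Each value is reached because [J] is onto, nearby values are reached from a small square by
    [open_mapping], and bisection makes the family of squares finite. *)
Lemma chart_cover (i j : 'I_2) x y r : i != j -> 0 < r -> exists2 L : seq (R * R * R),
  forall s, s \in L -> usq s &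
  forall w, sq x y r w -> exists2 z, exists2 s, s \in L & insq s z &
    J z 0 j != 0 /\ J z 0 i / J z 0 j = w.
Proof.
move=> ij r0.
pose P x y r := exists2 L : seq (R * R * R), forall s, s \in L -> usq s &
  forall w, sq x y r w -> exists2 z, exists2 s, s \in L & insq s z &
    J z 0 j != 0 /\ J z 0 i / J z 0 j = w.
apply: (@sq_bisect R P) => //.
  move=> x1 y1 r1 r10 [L1 U1 H1] [L2 U2 H2] [L3 U3 H3] [L4 U4 H4].
  exists (L1 ++ L2 ++ L3 ++ L4) => [s|w /(sq_split r10)].
    by rewrite !mem_cat => /or4P[/U1|/U2|/U3|/U4].
  by case=> [/H1|/H2|/H3|/H4] [z [s sL sz] zw]; exists z => //; exists s => //;
    rewrite !mem_cat sL ?orbT.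
move=> w0 _; case: JU => _ _ _ S.
have P0 : (\row_k (if k == i then w0 else 1) : 'rV[C]_2) != 0.
  by apply/eqP => /rowP /(_ j); rewrite !mxE eq_sym (negPf ij) => /eqP; rewrite oner_eq0.
have [t ut [c c0 E]] := S _ P0 I.
have Jj : J t 0 j = c by rewrite E !mxE eq_sym (negPf ij) mulr1.
have Ji : J t 0 i = c * w0 by rewrite E !mxE eqxx.
have jc : near t (fun z => J z 0 j != 0).
  by apply: cont_neq0; [apply: cdif_cont; exact: J_uhol|rewrite Jj].
pose F z := J z 0 i / J z 0 j.
have Fd : near t (cdif F).
  apply: near_and_imp jc (upper_near ut) => z jz uz.
  by apply: cdifM; [exact: J_uhol|apply: cdifV => //; exact: J_uhol].
have Ft : F t = w0 by rewrite /F Ji Jj mulrAC divff ?mul1r.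
have Fn : ~ near t (fun z => F z = F t).
  rewrite Ft => H.
  have : near t (fun z => J z 0 i - w0 * J z 0 j = 0).
    by apply: near_and_imp H jc => z <- jz; rewrite /F divfK// subrr.
  have [i0|i0] := eqVneq i 0.
    have j1 : j = 1 by move: ij; rewrite i0; elim/ord2P: j {Jj jc F Fd Ft H P P0 E Ji}; rewrite ?eqxx.
    move=> K; apply: (@J_lin_nz 1 (- w0) _ t ut); first by rewrite oner_eq0.
    by apply: near_imp K => z; rewrite i0 j1 mul1r mulNr.
  have i1 : i = 1 by move: i0; elim/ord2P: i {ij Jj jc F Fd Ft H P P0 E Ji}; rewrite ?eqxx.
  have j0 : j = 0 by move: ij; rewrite i1; elim/ord2P: j {Jj jc F Fd Ft H P P0 E Ji}; rewrite ?eqxx.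
  move=> K; apply: (@J_lin_nz (- w0) 1 _ t ut); first by rewrite oner_eq0 orbT.
  by apply: near_imp K => z; rewrite i1 j0 mul1r mulNr addrC.
have [d d0 Hd] := near_and jc (upper_near ut).
have it : 0 < complex.Im t by [].
have m0 : 0 < Num.min (d / 4) (complex.Im t) by rewrite lt_min it divr_gt0.
have [r1 [r10 r1m [e e0 He]]] := open_mapping Fd Fn m0.
have [r1d r1t] : r1 < d / 4 /\ r1 < complex.Im t by move: r1m; rewrite lt_min => /andP[].
exists (e / 2); first lra.
move=> x1 y1 r2 /andP[r2p r2e] w0s _.
exists [:: (complex.Re t - r1, complex.Im t - r1, 2 * r1)].
  by move=> s; rewrite inE => /eqP ->; rewrite /usq /=; split; lra.
move=> w ws; have [|z zs Fz] := He w; first by rewrite Ft; have := sq_nm (ltW r2p) w0s ws; lra.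
exists z; first by exists (complex.Re t - r1, complex.Im t - r1, 2 * r1); rewrite ?mem_head.
by have [|jz _] := Hd z; first by have := csq_nm zs; lra.
Qed.

(** The projective line is the union of two closed unit discs, one in each chart, and each disc sits
    in a square of side 2. The squares lying over them meet every orbit of [G1], because [J]
    separates the orbits. *)
Lemma compact_fund : exists2 L : seq (R * R * R), forall s, s \in L -> usq s &
  forall z, upper R z -> exists2 g, G1 g & exists2 s, s \in L & insq s (mobius g z).
Proof.
have [L0 U0 H0] := @chart_cover 0 1 (-1) (-1) 2 isT ltac:(lra).
have [L1 U1 H1] := @chart_cover 1 0 (-1) (-1) 2 isT ltac:(lra).
exists (L0 ++ L1) => [s|z uz]; first by rewrite mem_cat => /orP[/U0|/U1].
have unit_sq (w : C) : nm w <= 1 -> sq (-1) (-1) 2 w.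
  move=> w1; have := Re_le_nm w; have := Im_le_nm w.
  by rewrite !ler_norml => /andP[? ?] /andP[? ?]; apply/sqP; split; lra.
case: JU => _ Jn Jo _; have [Jz _] := Jn z uz.
have fin y : upper R y -> same_point (J z) (J y) -> exists2 g, G1 g & y = mobius g z.
  by move=> uy /Jo; apply.
have ext2 (P Q : 'rV[C]_2) : P 0 0 = Q 0 0 -> P 0 1 = Q 0 1 -> P = Q.
  by move=> e0 e1; apply/rowP; apply: ord2P.
have [le|le] := leP (nm (J z 0 0)) (nm (J z 0 1)).
  have z1 : J z 0 1 != 0.
    apply: contraNneq Jz => z1; apply/eqP/ext2; rewrite !mxE// .
    by apply/eqP; rewrite -nm_eq0 eq_le nm_ge0 andbT (le_trans le)// z1 nm0.
  have [|y [s sL sy] [y1 yE]] := H0 (J z 0 0 / J z 0 1).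
    by apply: unit_sq; rewrite nmM nmV ler_pdivrMr ?nm_gt0// mul1r.
  have uy : upper R y by apply: usq_upper sy; exact: U0.
  have [||g g1 E] := fin y => //.
    exists (J z 0 1 / J y 0 1); first by rewrite mulf_neq0// invr_eq0.
    apply: ext2; rewrite !mxE; last by rewrite divfK.
    by rewrite mulrAC -mulrA yE mulrC divfK.
  by exists g => //; rewrite -E; exists s => //; rewrite mem_cat sL.
have z0 : J z 0 0 != 0 by rewrite -nm_gt0 (le_lt_trans _ le)// nm_ge0.
have [|y [s sL sy] [y1 yE]] := H1 (J z 0 1 / J z 0 0).
  by apply: unit_sq; rewrite nmM nmV ler_pdivrMr ?nm_gt0// mul1r ltW.
have uy : upper R y by apply: usq_upper sy; exact: U1.
have [||g g1 E] := fin y => //.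
  exists (J z 0 0 / J y 0 0); first by rewrite mulf_neq0// invr_eq0.
  apply: ext2; rewrite !mxE; first by rewrite divfK.
  by rewrite mulrAC -mulrA yE mulrC divfK.
by exists g => //; rewrite -E; exists s => //; rewrite mem_cat sL orbT.
Qed.

Hypothesis G0_index : exists2 L : seq 'M[R]_2, forall l, l \in L -> G1 l &
  forall g, G1 g -> exists2 h, G0 h & exists2 l, l \in L & g = h *m l.
Hypothesis G0_sub : G0 `<=` G1.

Lemma uhol_invariant_cst (q : C -> C) : uhol q ->
  (forall g z, G0 g -> upper R z -> q (mobius g z) = q z) ->
  exists c, forall z, upper R z -> q z = c.
Proof.
move=> qd qi; have [L UL HL] := compact_fund; have [K KG HK] := G0_index.
have ui : upper R 'i by rewrite /upper /= ltr01.
have qlc s l : usq s -> G1 l -> sqcont (fun z => q (mobius l z)) s.1.1 s.1.2 s.2.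
  move=> us lG z zs; have uz := usq_upper us zs.
  apply: cont_comp; first by apply: cont_mobius => //; exact: det_gt0.
  by apply: cdif_cont; apply: qd; apply: mobius_upper => //; exact: det_gt0.
have mx (T : seq ((R * R * R) * 'M[R]_2)) : (forall p, p \in T -> usq p.1 /\ G1 p.2) ->
    exists2 z0, upper R z0 & forall p, p \in T -> forall z, insq p.1 z ->
      nm (q (mobius p.2 z)) <= nm (q z0).
  elim: T => [|[s l] T IH] HT; first by exists 'i.
  have [z0 uz0 H0] := IH (fun p pT => HT p (mem_behead (s := (s, l) :: T) pT)).
  have [us lG] := HT (s, l) (mem_head _ _).
  have [z1 z1s H1] := sq_max (proj1 us) (qlc s l us lG).
  have uz1 : upper R (mobius l z1).
    by apply: mobius_upper; [exact: det_gt0|exact: usq_upper z1s].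
  have [le|le] := leP (nm (q (mobius l z1))) (nm (q z0)).
    exists z0 => // p; rewrite inE => /predU1P[-> z zs|/H0//].
    exact: le_trans (H1 z zs) le.
  exists (mobius l z1) => // p; rewrite inE => /predU1P[-> //|pT z zs].
  exact: le_trans (H0 p pT z zs) (ltW le).
have [|z0 uz0 H0] := mx [seq (s, l) | s <- L, l <- K].
  by move=> p /allpairsP[[s l] [/= sL lK ->]]; split; [exact: UL|exact: KG].
have top z : upper R z -> nm (q z) <= nm (q z0).
  move=> uz; have [g gG [s sL gz]] := HL z uz.
  have [g' g'G gg] := G1_V gG; have [h hG [l lK E]] := HK g' g'G.
  have ugz : upper R (mobius g z) by apply: mobius_upper => //; exact: det_gt0.
  have -> : z = mobius h (mobius l (mobius g z)).
    rewrite -[LHS](mobius1 z) -gg mobiusM ?det_gt0// E mobiusM ?det_gt0//.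
    - exact: G0_sub.
    - exact: KG.
  rewrite qi//; last by apply: mobius_upper => //; apply: det_gt0; exact: KG.
  by apply: (H0 (s, l)) => //; apply/allpairsP; exists (s, l).
have qn := uhol_near qd uz0.
have qm : near z0 (fun z => nm (q z) <= nm (q z0)) by apply: near_imp (upper_near uz0) => z; exact: top.
have := strong_max qn qm => qc; exists (q z0) => z uz.
have := @uhol_identity R (fun z => q z - q z0) z0 _ uz0 _ z uz.
move=> H; apply/eqP; rewrite -subr_eq0; apply/eqP; apply: H.
  by move=> w uw; apply: cdifB; [exact: qd|exact: cdif_cst].
by apply: near_imp qc => w ->; rewrite subrr.
Qed.

(** Suited to quotients of holomorphic functions, whose values at common zeros mean nothing: [q] is
    replaced by its function of limits, which is holomorphic by [riemann]. *)
Lemma invariant_cst (q : C -> C) :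
  (forall z, upper R z -> pnear z (cdif q) /\ exists l, clim q z l) ->
  (forall g z, G0 g -> upper R z -> pnear z (fun w => q (mobius g w) = q w)) ->
  exists c, forall z, upper R z -> clim q z c.
Proof.
move=> qd qi.
have /choice[p pH] : forall z, exists l, upper R z -> clim q z l.
  move=> z; have [uz|nu] := pselect (upper R z); last by exists 0.
  by have [_ [l Hl]] := qd z uz; exists l.
have pq z : upper R z -> pnear z (fun w => q w = p w).
  move=> uz; have [H _] := qd z uz.
  apply: near_and_imp H (upper_near uz) => w H uw wz.
  exact: clim_uniq (proj1 (cont_clim _ _) (cdif_cont (H wz))) (pH w uw).
have pd z : upper R z -> pnear z (cdif p).
  move=> uz; have [H _] := qd z uz; have E := pq z uz.
  have E2 : pnear z (fun w => near w (fun v => q v = p v)).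
    have [d d0 Hd] := E; exists d => // w wd wz.
    apply: near_and_imp (near_neq (_ : z != w)) (_ : near w (fun v => nm (v - z) < d)).
    - by move=> v vz vd; exact: Hd.
    - by rewrite eq_sym.
    exists (d - nm (w - z)); first by rewrite subr_gt0.
    by move=> v vw; have := nm_tri v z w; lra.
  apply: near_and_imp H E2 => w Hq He wz.
  exact: cdif_ext (He wz) (Hq wz).
have pu : uhol p.
  move=> z uz; have pcz : cont p z.
    apply/cont_clim; apply: clim_ext (pH z uz).
    exact: pq.
  have [d d0 Hd] := pd z uz.
  have d4 : 0 < d / 4 by lra.
  apply: (@riemann R p [:: z] _ _ _ z _ _ (csq_ctr z d4)).
    move=> w ws; have [->//|wz] := eqVneq w z.
    by apply: cdif_cont; apply: Hd => //; have := csq_nm ws; lra.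
  by move=> w ws; rewrite inE => wz; apply: Hd => //; have := csq_nm ws; lra.
have pi g z : G0 g -> upper R z -> p (mobius g z) = p z.
  move=> gG uz; have dg := det_gt0 (G0_sub gG).
  have ugz := mobius_upper dg uz.
  apply: clim_uniq (clim_mobius dg uz (pH _ ugz)) _.
  apply: clim_ext (pH z uz); apply: near_imp (qi g z gG uz) => w H wz.
  by rewrite H.
have [c Hc] := uhol_invariant_cst pu pi.
by exists c => z uz; rewrite -(Hc z uz); exact: pH.
Qed.
End Compactness.

(** * The cubic field *)

Section Integers.
Implicit Types K L : fieldType.

Lemma integers_int K (m : int) : integers K m%:~R.
Proof. exact: (@integral_id _ _ (intr : {rmorphism int -> K})). Qed.
Lemma integers_nat K (m : nat) : integers K m%:R.
Proof. by rewrite pmulrn; exact: integers_int. Qed.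
Lemma integers0 K : integers K 0. Proof. exact: (integers_nat K 0). Qed.
Lemma integers1 K : integers K 1. Proof. exact: (integers_nat K 1). Qed.
Lemma integersD K (x y : K) : integers K x -> integers K y -> integers K (x + y).
Proof. exact: (@integral_add _ _ (intr : {rmorphism int -> K})). Qed.
Lemma integersB K (x y : K) : integers K x -> integers K y -> integers K (x - y).
Proof. exact: (@integral_sub _ _ (intr : {rmorphism int -> K})). Qed.
Lemma integersN K (x : K) : integers K x -> integers K (- x).
Proof. exact: (@integral_opp _ _ (intr : {rmorphism int -> K})). Qed.
Lemma integersM K (x y : K) : integers K x -> integers K y -> integers K (x * y).
Proof. exact: (@integral_mul _ _ (intr : {rmorphism int -> K})). Qed.
Lemma integersX K (x : K) n : integers K x -> integers K (x ^+ n).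
Proof. by move=> ix; elim: n => [|n IH]; [exact: integers1|rewrite exprS; exact: integersM]. Qed.

Lemma integers_root K (p : {poly K}) x : p \is monic -> root p x ->
  (forall i, integers K p`_i) -> integers K x.
Proof.
move=> pm px pi; apply: (@integral_root_monic _ _ (intr : {rmorphism int -> K}) _ p pm px).
by apply/integral_poly.
Qed.

Lemma integers_morph K L (f : {rmorphism K -> L}) x : integers L (f x) <-> integers K x.
Proof.
split=> -[p pm px]; exists p => //; move: px.
  rewrite /root -(fmorph_eq0 f) -horner_map -map_poly_comp.
  by rewrite (eq_map_poly (rmorph_int f)).
rewrite /root => /eqP H; rewrite -(eq_map_poly (rmorph_int f)) map_poly_comp horner_map H.
by rewrite rmorph0.
Qed.

Lemma integers_rat (a : rat) : integers rat a -> exists m : int, a = m%:~R.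
Proof.
move=> [p pm pa]; have Ha : ratr a \in Aint.
  apply: (@root_monic_Aint (map_poly intr p)).
  - rewrite /root -(eq_map_poly (rmorph_int (ratr : {rmorphism rat -> algC}))) map_poly_comp.
    by rewrite horner_map (eqP pa) rmorph0.
  - exact: monic_map.
  - by apply/polyOverP => i; rewrite coef_map; exact: intr_int.
have /intrP[m Hm] := Cint_rat_Aint (Crat_rat a) Ha.
by exists m; apply: (fmorph_inj (ratr : {rmorphism rat -> algC})); rewrite rmorph_int.
Qed.
End Integers.

Section CubicField.
Variables (R : realType) (K : fieldExtType rat) (th : K).
Hypothesis th_root : th ^+ 3 + th ^+ 2 - 4 * th + 1 = 0.
Hypothesis th_gen : <<1; th>>%VS = {: K}%VS.
Variables (s1 s2 s3 : {rmorphism K -> R}).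
Hypothesis s12 : s1 <> s2 :> (K -> R).
Hypothesis s13 : s1 <> s3 :> (K -> R).
Hypothesis s23 : s2 <> s3 :> (K -> R).

Lemma th3 : th ^+ 3 = - th ^+ 2 + 4 * th - 1.
Proof. by rewrite -[RHS]addr0 -th_root; ring. Qed.

Local Notation ia := (GRing.in_alg K).
Definition cub (a b c : rat) : K := ia a + ia b * th + ia c * th ^+ 2.

Lemma cub_all x : exists a b c, x = cub a b c.
Proof.
have xK : x \in <<1; th>>%VS by rewrite th_gen memvf.
rewrite -(Fadjoin_poly_eq xK).
have /polyOver1P[q ->] := Fadjoin_polyOver 1%VS th x.
elim/poly_ind: q => [|q d [a [b [c E]]]].
  by exists 0, 0, 0; rewrite rmorph0 horner0 /cub !rmorph0 !mul0r !addr0.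
exists (d - c), (a + 4 * c), (b - c).
rewrite rmorphD rmorphM /= map_polyX map_polyC hornerD hornerM hornerX hornerC E /cub.
transitivity (ia a * th + ia b * th ^+ 2 + ia c * th ^+ 3 + ia d); first by ring.
by rewrite th3; ring.
Qed.

Lemma s_cub (s : {rmorphism K -> R}) a b c :
  s (cub a b c) = ratr a + ratr b * s th + ratr c * s th ^+ 2.
Proof.
have E d : s (ia d) = ratr d by rewrite /= rmorphZ_num rmorph1 mulr1.
by rewrite /cub -!E; ring.
Qed.

Lemma s_th_neq (s s' : {rmorphism K -> R}) : s <> s' :> (K -> R) -> s th - s' th != 0.
Proof.
move=> n; rewrite subr_eq0; apply/eqP => E; apply: n; apply/funext => x.
by have [a [b [c ->]]] := cub_all x; rewrite !s_cub E.
Qed.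

Lemma s_th_root (s : {rmorphism K -> R}) : s th ^+ 3 + s th ^+ 2 - 4 * s th + 1 = 0.
Proof.
by rewrite -(rmorph0 s) -th_root; ring.
Qed.

(** The conjugates of [th] are distinct, so divided differences of its equation may be taken; they
    give the sum, and then the sum of squares. *)
Lemma power_sums : s1 th + s2 th + s3 th = - 1 /\
  s1 th ^+ 2 + s2 th ^+ 2 + s3 th ^+ 2 = 9.
Proof.
have [n12 n13 n23] := And3 (s_th_neq s12) (s_th_neq s13) (s_th_neq s23).
have [r1 r2 r3] := And3 (s_th_root s1) (s_th_root s2) (s_th_root s3).
move: (s1 th) (s2 th) (s3 th) n12 n13 n23 r1 r2 r3 => x y z n12 n13 n23 r1 r2 r3.
have A : x ^+ 2 + x * y + y ^+ 2 + x + y - 4 = 0.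
  by apply: (mulfI n12); rewrite mulr0; lra.
have B : x ^+ 2 + x * z + z ^+ 2 + x + z - 4 = 0.
  by apply: (mulfI n13); rewrite mulr0; lra.
have S : x + y + z + 1 = 0.
  by apply: (mulfI n23); rewrite mulr0; lra.
have zE : z = - 1 - x - y by lra.
by split; rewrite zE; [ring|lra].
Qed.

(** The combination is the trace of [cub a b c], as [1], [th], [th ^+ 2] have traces 3, -1, 9. *)
Lemma trace_int a b c : integers K (cub a b c) ->
  exists m : int, 3 * a - b + 9 * c = m%:~R.
Proof.
move=> H; apply: integers_rat; apply/(integers_morph (ratr : {rmorphism rat -> R})).
have [p1 p2] := power_sums.
rewrite [X in integers R X](_ : _ = s1 (cub a b c) + s2 (cub a b c) + s3 (cub a b c)).
  by apply: integersD; [apply: integersD|]; apply/(integers_morph _).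
rewrite !s_cub; transitivity (3 * ratr a - ratr b + 9 * ratr c : R); first by ring.
by rewrite -p2 -[- ratr b]mulrN1 -p1; ring.
Qed.

Lemma integers_th : integers K th.
Proof.
apply: (@integers_root _ (Poly [:: 1; - 4; 1; 1])).
- by rewrite monicE lead_coefE (@PolyK _ 0) ?oner_neq0.
- by rewrite /root horner_Poly /=; apply/eqP; rewrite -[RHS]th_root; ring.
- move=> [|[|[|[|i]]]]; rewrite coef_Poly /= ?nth_nil; try exact: integers1; try exact: integers0.
  by apply: integersN; exact: integers_nat.
Qed.

Definition oz (a b c : int) : K := a%:~R + b%:~R * th + c%:~R * th ^+ 2.

Lemma oz_cub a b c : oz a b c = cub a%:~R b%:~R c%:~R.
Proof.
by rewrite /oz /cub !rmorph_int.
Qed.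

Lemma oz_int a b c : integers K (oz a b c).
Proof.
have h := integers_th; apply: integersD; first apply: integersD.
- exact: integers_int.
- by apply: integersM => //; exact: integers_int.
- by apply: integersM; [exact: integers_int|exact: integersX].
Qed.

Lemma cub_th a b c : cub a b c * th = cub (- c) (a + 4 * c) (b - c).
Proof.
rewrite /cub; transitivity (ia a * th + ia b * th ^+ 2 + ia c * th ^+ 3); first by ring.
by rewrite th3; ring.
Qed.

(* 169 is the discriminant of [Z[th]]: it is the determinant of the trace form. *)
Lemma oz169 x : integers K x -> exists a b c, 169 * x = oz a b c.
Proof.
move=> xi; have [a [b [c E]]] := cub_all x.
have x1 := integersM xi integers_th; have x2 := integersM x1 integers_th.
rewrite E in xi; rewrite E cub_th in x1; rewrite E !cub_th in x2.
have [m0 M0] := trace_int xi; have [m1 M1] := trace_int x1; have [m2 M2] := trace_int x2.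
(* The coefficients form the adjugate of the matrix of traces of [th^(i+j)]; [m0], [m1], [m2] are
   the traces of [x], [x th], [x th^2]. *)
exists (221 * m0 - 91 * m1 - 65 * m2), (- 91 * m0 + 78 * m1 + 39 * m2), (- 65 * m0 + 39 * m1 + 26 * m2).
have A : (221 * m0 - 91 * m1 - 65 * m2)%:~R = 169 * a.
  transitivity (221 * m0%:~R - 91 * m1%:~R - 65 * m2%:~R : rat); first by ring.
  by rewrite -M0 -M1 -M2; ring.
have B : (- 91 * m0 + 78 * m1 + 39 * m2)%:~R = 169 * b.
  transitivity (- 91 * m0%:~R + 78 * m1%:~R + 39 * m2%:~R : rat); first by ring.
  by rewrite -M0 -M1 -M2; ring.
have D : (- 65 * m0 + 39 * m1 + 26 * m2)%:~R = 169 * c.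
  transitivity (- 65 * m0%:~R + 39 * m1%:~R + 26 * m2%:~R : rat); first by ring.
  by rewrite -M0 -M1 -M2; ring.
by rewrite oz_cub A B D E /cub; ring.
Qed.

Lemma cub_eq0 a b c : cub a b c = 0 -> [/\ a = 0, b = 0 & c = 0].
Proof.
move=> E; have H (s : {rmorphism K -> R}) : ratr a + ratr b * s th + ratr c * s th ^+ 2 = 0 :> R.
  by rewrite -s_cub E rmorph0.
have [n12 n13 n23] := And3 (s_th_neq s12) (s_th_neq s13) (s_th_neq s23).
have A : ratr b + ratr c * (s1 th + s2 th) = 0 :> R.
  by apply: (mulfI n12); have := H s1; have := H s2; rewrite mulr0; lra.
have B : ratr b + ratr c * (s1 th + s3 th) = 0 :> R.
  by apply: (mulfI n13); have := H s1; have := H s3; rewrite mulr0; lra.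
have c0 : ratr c = 0 :> R.
  by apply: (mulfI n23); rewrite mulr0; lra.
have b0 : ratr b = 0 :> R by move: A; rewrite c0 mul0r addr0.
have a0 : ratr a = 0 :> R by have := H s1; rewrite c0 b0 !mul0r !addr0.
by split; apply: (fmorph_inj (ratr : {rmorphism rat -> R})); rewrite rmorph0.
Qed.

Lemma oz_inj a b c d e f : oz a b c = oz d e f -> [/\ a = d, b = e & c = f].
Proof.
move/eqP; rewrite -subr_eq0 => /eqP E.
have : cub (a - d)%:~R (b - e)%:~R (c - f)%:~R = 0.
  by rewrite -oz_cub -E /oz !rmorphB /=; ring.
by move=> /cub_eq0[/eqP + /eqP + /eqP]; rewrite !intr_eq0 !subr_eq0 => /eqP-> /eqP-> /eqP->.
Qed.

Lemma ozM a b c d e f : oz a b c * oz d e f =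
  oz (a * d - (b * f + c * e) + c * f) (a * e + b * d + 4 * (b * f + c * e) - 5 * (c * f))
     (a * f + b * e + c * d - (b * f + c * e) + 5 * (c * f)).
Proof.
have t4 : th ^+ 4 = 5 * th ^+ 2 - 5 * th + 1 by transitivity (th * th ^+ 3); [ring|rewrite th3; transitivity (- th ^+ 3 + 4 * th ^+ 2 - th); [ring|rewrite th3; ring]].
rewrite /oz; transitivity (a%:~R * d%:~R + (a%:~R * e%:~R + b%:~R * d%:~R) * th
  + (a%:~R * f%:~R + b%:~R * e%:~R + c%:~R * d%:~R) * th ^+ 2
  + (b%:~R * f%:~R + c%:~R * e%:~R) * th ^+ 3 + c%:~R * f%:~R * th ^+ 4); first by ring.
by rewrite t4 th3; ring.
Qed.
End CubicField.

(** * The order [Z[th]] modulo 2, 3 and 7 *)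

Section Inert.
Variables (R : realType) (K : fieldExtType rat) (th : K).
Hypothesis th_root : th ^+ 3 + th ^+ 2 - 4 * th + 1 = 0.
Hypothesis th_gen : <<1; th>>%VS = {: K}%VS.
Variables (s1 s2 s3 : {rmorphism K -> R}).
Hypothesis s12 : s1 <> s2 :> (K -> R).
Hypothesis s13 : s1 <> s3 :> (K -> R).
Hypothesis s23 : s2 <> s3 :> (K -> R).

Local Notation zo := (oz th).
Let o_int := oz_int th_root.
Let o169 := oz169 th_root th_gen s12 s13 s23.
Let o_inj := oz_inj th_root th_gen s12 s13 s23.
Let oM := ozM th_root.

(** States that [Z[th] / p] has no nonzero element of square zero, that is, that [p] is unramified.
    The three congruences are the coordinates of [(a + b th + c th^2)^2], with negative terms moved
    to the other side to stay in [nat]. *)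
Definition sq_check (p : nat) : bool :=
  all (fun a => all (fun b => all (fun c =>
    [&& a * a + c * c == 2 * b * c %[mod p],
        2 * a * b + 8 * b * c == 5 * c * c %[mod p] &
        2 * a * c + b * b + 5 * c * c == 2 * b * c %[mod p]]
    ==> [&& a == 0, b == 0 & c == 0])%N (iota 0 p)) (iota 0 p)) (iota 0 p).

Lemma natr_neq0 (p : nat) : (0 < p)%N -> p%:R != 0 :> K.
Proof.
by move=> p0; rewrite -(rmorph_nat (GRing.in_alg K)) fmorph_eq0 pnatr_eq0 -lt0n.
Qed.

Lemma dvdz_nat_mod (p x y : nat) : (p%:Z %| x%:Z - y%:Z)%Z = (x == y %[mod p])%N.
Proof. by rewrite -eqz_mod_dvd !modz_nat eqz_nat. Qed.

Lemma sq_checkP (p : nat) (A B C : int) : (0 < p)%N -> sq_check p ->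
  (p%:Z %| A * A - (B * C + C * B) + C * C)%Z ->
  (p%:Z %| A * B + B * A + 4 * (B * C + C * B) - 5 * (C * C))%Z ->
  (p%:Z %| A * C + B * B + C * A - (B * C + C * B) + 5 * (C * C))%Z ->
  [/\ (p%:Z %| A)%Z, (p%:Z %| B)%Z & (p%:Z %| C)%Z].
Proof.
move=> p0 chk H0 H1 H2.
have red (X : int) : exists2 x : nat, (x < p)%N & exists q : int, X = x%:Z + p%:Z * q.
  have pz : p%:Z != 0 by rewrite eqz_nat -lt0n.
  exists `|(X %% p%:Z)%Z|%N; first by rewrite -ltz_nat gez0_abs ?modz_ge0// ltz_pmod.
  by exists (X %/ p%:Z)%Z; rewrite gez0_abs ?modz_ge0// {1}(divz_eq X p%:Z) addrC mulrC.
have [a ap [A' EA]] := red A; have [b bp [B' EB]] := red B; have [c cp [C' EC]] := red C.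
have tr (X Y q : int) : X = Y + p%:Z * q -> (p%:Z %| X)%Z -> (p%:Z %| Y)%Z.
  by move=> -> /dvdzP[m H]; apply/dvdzP; exists (m - q); rewrite mulrBl -H; ring.
have D0 : (p%:Z %| (a * a + c * c)%N%:Z - (2 * b * c)%N%:Z)%Z.
  apply: (tr _ _ (A' * (2 * a%:Z + p%:Z * A') - 2 * (B' * c%:Z + b%:Z * C' + p%:Z * B' * C') + C' * (2 * c%:Z + p%:Z * C')) _ H0).
  by rewrite EA EB EC !(PoszD, PoszM); ring.
have D1 : (p%:Z %| (2 * a * b + 8 * b * c)%N%:Z - (5 * c * c)%N%:Z)%Z.
  apply: (tr _ _ (2 * (A' * b%:Z + a%:Z * B' + p%:Z * A' * B') + 8 * (B' * c%:Z + b%:Z * C' + p%:Z * B' * C') - 5 * (C' * (2 * c%:Z + p%:Z * C'))) _ H1).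
  by rewrite EA EB EC !(PoszD, PoszM); ring.
have D2 : (p%:Z %| (2 * a * c + b * b + 5 * c * c)%N%:Z - (2 * b * c)%N%:Z)%Z.
  apply: (tr _ _ (2 * (A' * c%:Z + a%:Z * C' + p%:Z * A' * C') + B' * (2 * b%:Z + p%:Z * B') - 2 * (B' * c%:Z + b%:Z * C' + p%:Z * B' * C') + 5 * (C' * (2 * c%:Z + p%:Z * C'))) _ H2).
  by rewrite EA EB EC !(PoszD, PoszM); ring.
move: chk D0 D1 D2; rewrite !dvdz_nat_mod => chk D0 D1 D2.
have := allP (allP (allP chk a _) b _) c; rewrite !mem_iota !add0n /= ap bp cp.
move=> /(_ isT isT isT); rewrite D0 D1 D2 /= => /and3P[/eqP a0 /eqP b0 /eqP c0].
by rewrite EA EB EC a0 b0 c0 !add0r !dvdz_mulr.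
Qed.

(** [169 * x] lies in [Z[th]], where [Z[th] / p] being reduced makes it divisible by [p]; a Bezout
    relation between [p] and 169 returns to [x]. *)
Lemma div_of_sqr (p : nat) (x y : K) : (0 < p)%N -> coprime p 169 -> sq_check p ->
  integers K x -> integers K y -> x ^+ 2 = p%:R * y -> exists2 z, integers K z & x = p%:R * z.
Proof.
move=> p0 cop chk xi yi xy.
have [A [B [C EX]]] := o169 xi; have [D [E [F EY]]] := o169 yi.
have : zo A B C * zo A B C = zo (169 * p%:Z * D) (169 * p%:Z * E) (169 * p%:Z * F).
  rewrite -EX; transitivity (169 * p%:R * zo D E F).
    rewrite -EY; transitivity (169 * 169 * x ^+ 2); first by ring.
    by rewrite xy; ring.
  by rewrite /oz  !rmorphM /= -!pmulrn; ring.
rewrite oM => /o_inj[H0 H1 H2].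
have dv (m : int) : (p%:Z %| 169 * p%:Z * m)%Z by rewrite mulrAC dvdz_mull.
have [] := @sq_checkP p A B C p0 chk; rewrite ?H0 ?H1 ?H2 //.
move=> /dvdzP[A' EA] /dvdzP[B' EB] /dvdzP[C' EC].
have EP : 169 * x = p%:R * zo A' B' C'.
  by rewrite EX EA EB EC /oz  !rmorphM /= -!pmulrn; ring.
have /coprimezP[[u w] /= uw] : coprimez p%:Z 169 by [].
exists (w%:~R * zo A' B' C' + u%:~R * x).
  by apply: integersD; [apply: (integersM (integers_int _ _)); exact: o_int|exact: (integersM (integers_int _ _))].
have one : u%:~R * p%:R + w%:~R * 169 = 1 :> K.
  transitivity ((u * p%:Z + w * 169)%:~R : K); last by rewrite uw.
  by rewrite pmulrn; ring.
transitivity (u%:~R * p%:R * x + w%:~R * (169 * x)); last by rewrite EP; ring.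
by rewrite mulrA -mulrDl one mul1r.
Qed.

(** [2] is inert: [Z[th] / 2] is the field with eight elements, and 169 is odd, so integers of [K]
    have the same residues. *)
Lemma inv2 x : integers K x -> (exists2 z, integers K z & x = 2 * z) \/
  exists y z, [/\ integers K y, integers K z & x * y = 1 + 2 * z].
Proof.
move=> xi; have [A [B [C EX]]] := o169 xi.
have par (X : int) : X = 2 * (X %/ 2)%Z \/ X = 2 * (X %/ 2)%Z + 1 by lia.
have [HE|HO] : (exists A' B' C', [/\ A = 2 * A', B = 2 * B' & C = 2 * C']) \/
   exists D E F G H I, zo A B C * zo D E F = 1 + 2 * zo G H I.
  have ex2 (G H I : int) : zo (1 + 2 * G) (0 + 2 * H) (0 + 2 * I) = 1 + 2 * zo G H I.
    by rewrite /oz; ring.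
  have fin (D E F : int) :
      ((A * D - (B * F + C * E) + C * F) %% 2 = 1)%Z ->
      ((A * E + B * D + 4 * (B * F + C * E) - 5 * (C * F)) %% 2 = 0)%Z ->
      ((A * F + B * E + C * D - (B * F + C * E) + 5 * (C * F)) %% 2 = 0)%Z ->
      exists D E F G H I, zo A B C * zo D E F = 1 + 2 * zo G H I.
    move=> e0 e1 e2.
    have half (X r : int) : (X %% 2)%Z = r -> X = r + 2 * (X %/ 2)%Z by lia.
    exists D, E, F; rewrite oM (half _ _ e0) (half _ _ e1) (half _ _ e2).
    by do 3 eexists; exact: ex2.
  (* The seven nonzero residue classes, each with its inverse in the field with eight elements. *)
  case: (par A) => EA; case: (par B) => EB; case: (par C) => EC.
  - by left; do 3 eexists; split; [exact: EA|exact: EB|exact: EC].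
  - by right; apply: (fin 1 1 0); lia.
  - by right; apply: (fin 0 1 1); lia.
  - by right; apply: (fin 0 1 0); lia.
  - by right; apply: (fin 1 0 0); lia.
  - by right; apply: (fin 1 1 1); lia.
  - by right; apply: (fin 0 0 1); lia.
  - by right; apply: (fin 1 0 1); lia.
  left; have [A' [B' [C' [EA EB EC]]]] := HE.
  exists (zo A' B' C' - 84 * x).
    by apply: integersB; [exact: o_int|apply: integersM => //; exact: integers_nat].
  transitivity (169 * x - 168 * x); first by ring.
  by rewrite EX EA EB EC /oz ; ring.
right; have [D [E [F [G [H [I HI]]]]]] := HO.
exists (169 * zo D E F), (zo G H I); split; [|exact: o_int|].
  by apply: integersM; [exact: integers_nat|exact: o_int].
by rewrite -HI -EX; ring.
Qed.
End Inert.

(** * Traces and norms in the quaternion algebra *)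

Section ReducedTrace.
Variables (K F : fieldType) (iota : {rmorphism K -> F}) (B : falgType K).
Variable i2 : {rmorphism B -> 'M[F]_2}.
Hypothesis two_neq0 : (2 : K) != 0.
Hypothesis dimB : \dim {: B} = 4%N.
Hypothesis i2_iota : restricts_to iota i2.
Hypothesis i2_span : forall X : 'M[F]_2, exists s : seq (F * B), X = \sum_(p <- s) p.1 *: i2 p.2.

Lemma restricts_scale (F' : fieldType) (io : {rmorphism K -> F'}) (i : {rmorphism B -> 'M[F']_2}) :
  restricts_to io i -> forall k x, i (k *: x) = io k *: i x.
Proof. by move=> H k x; rewrite -mulr_algl rmorphM /= H; exact: mul_scalar_mx. Qed.

Lemma mxtrace_lin_mulmx (X : 'M[F]_2) : \tr (lin_mx (@mulmx _ 2 2 2 X)) = 2 * \tr X.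
Proof.
rewrite /mxtrace (reindex (uncurry (@mxvec_index 2 2))) /=; last exact: curry_mxvec_bij.
rewrite (eq_bigr (fun p => lin_mx (@mulmx _ 2 2 2 X) (mxvec_index p.1 p.2) (mxvec_index p.1 p.2))); last by case.
rewrite -(pair_bigA _ (fun i j => lin_mx (@mulmx _ 2 2 2 X) (mxvec_index i j) (mxvec_index i j))) /=.
rewrite mulr_sumr; apply: eq_bigr => i _.
rewrite (eq_bigr (fun=> X i i)) => [|j _].
  by rewrite sumr_const card_ord mulr_natl.
rewrite mxE /= vec_mx_delta mxvecE mxE (bigD1 i) //= big1 ?addr0 => [|k ki].
  by rewrite mxE !eqxx mulr1.
by rewrite mxE (negPf ki) mulr0.
Qed.

Lemma i2_basis : exists e : (2 * 2).-tuple B, basis_of fullv e /\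
  \matrix_(k < 2 * 2) mxvec (i2 e`_k) \in unitmx.
Proof.
have [e eb] : exists e : (2 * 2).-tuple B, basis_of fullv e.
  by rewrite -[(2 * 2)%N]dimB; exists (vbasis fullv); exact: vbasisP.
exists e; split=> //; rewrite -row_full_unit -sub1mx; apply/row_subP => k.
set M := \matrix_k _.
rewrite row1 -[delta_mx _ _]vec_mxK; set X := vec_mx _.
have [s ->] := i2_span X; rewrite linear_sum; apply: summx_sub => p _.
rewrite linearZ scalemx_sub //.
rewrite (coord_basis eb (memvf p.2)) rmorph_sum linear_sum; apply: summx_sub => j _.
rewrite (restricts_scale i2_iota) linearZ scalemx_sub//.
have -> : M = \matrix_k mxvec (i2 e`_k) by [].
by have := row_sub j (\matrix_(k < 2 * 2) mxvec (i2 e`_k)); rewrite rowK.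
Qed.

Lemma i2_inj : injective i2.
Proof.
have [e [eb Mu]] := i2_basis.
apply: raddf_inj => b ib.
have E : \row_k iota (coord e k b) *m (\matrix_(k < 2 * 2) mxvec (i2 e`_k)) = 0.
  rewrite mulmx_sum_row; transitivity (mxvec (i2 b)); last by rewrite ib linear0.
  rewrite {2}(coord_basis eb (memvf b)) rmorph_sum linear_sum; apply: eq_bigr => k _.
  by rewrite (restricts_scale i2_iota) linearZ rowK mxE.
have /rowP R0 : \row_k iota (coord e k b) = 0.
  by rewrite -[LHS](mulmxK Mu) E mul0mx.
rewrite (coord_basis eb (memvf b)) big1// => k _.
by have := R0 k; rewrite !mxE => /eqP; rewrite fmorph_eq0 => /eqP ->; rewrite scale0r.
Qed.

(** Left multiplication by [b] on [B] has a matrix over [K]. A [K]-basis of [B] remains a basis of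
    the 2 x 2 matrices over [F], where the trace of left multiplication is twice the trace of
    [i2 b]. *)
Lemma i2_trace b : exists t, iota t = \tr (i2 b).
Proof.
have [e [eb Mu]] := i2_basis; set M := \matrix_k _ in Mu.
pose L : 'M[K]_(2 * 2) := \matrix_(k, j) coord e j (b * e`_k).
have E : M *m lin_mx (@mulmx _ 2 2 2 (i2 b)) = map_mx iota L *m M.
  apply/row_matrixP => k; rewrite !row_mul rowK mul_vec_lin /=.
  rewrite (_ : i2 b *m i2 e`_k = i2 (b * e`_k)); last by rewrite rmorphM.
  rewrite (coord_basis eb (memvf (b * e`_k))) rmorph_sum linear_sum mulmx_sum_row.
  by apply: eq_bigr => j _; rewrite (restricts_scale i2_iota) linearZ rowK !mxE.
have Etr : \tr (lin_mx (@mulmx _ 2 2 2 (i2 b))) = iota (\tr L).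
  by rewrite -(mulKmx Mu (lin_mx _)) E mxtrace_mulC -mulmxA mulmxV// mulmx1 /mxtrace rmorph_sum; apply: eq_bigr => k _; rewrite mxE.
exists (\tr L / 2); rewrite fmorph_div -Etr mxtrace_lin_mulmx rmorph_nat mulrC mulKf//.
by rewrite -(rmorph_nat iota 2) fmorph_eq0.
Qed.
End ReducedTrace.

(** * Reduced trace and norm compared in the two splittings *)

Section QuadraticElements.
Variables (K F F' : fieldType) (iota : {rmorphism K -> F}) (sg : {rmorphism K -> F'}).
Variables (B : falgType K) (i2 : {rmorphism B -> 'M[F]_2}) (ii : {rmorphism B -> 'M[F']_2}).
Hypothesis two_neq0 : (2 : K) != 0.
Hypothesis dimB : \dim {: B} = 4%N.
Hypothesis i2_iota : restricts_to iota i2.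
Hypothesis ii_sg : restricts_to sg ii.
Hypothesis i2_span : forall X : 'M[F]_2, exists s : seq (F * B), X = \sum_(p <- s) p.1 *: i2 p.2.

Lemma tr2E (L : comNzRingType) (X : 'M[L]_2) : \tr X = X 0 0 + X 1 1.
Proof.
by rewrite /mxtrace !big_ord_recl big_ord0 addr0; congr (_ + X _ _); apply: val_inj.
Qed.

Lemma cayley2 (L : comNzRingType) (X : 'M[L]_2) : X *m X = \tr X *: X - (\det X)%:M.
Proof.
rewrite tr2E det2E; apply/matrixP; apply: ord2P; apply: ord2P;
  by rewrite !mulmx2E !mxE /= ?mulr0n ?mulr1n; ring.
Qed.

Lemma trM2 (L : comNzRingType) (X : 'M[L]_2) : \tr (X *m X) = \tr X ^+ 2 - 2 * \det X.
Proof. by rewrite !tr2E det2E !mulmx2E; ring. Qed.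

Definition trn (b : B) (t n : K) : Prop := iota t = \tr (i2 b) /\ iota n = \det (i2 b).

(** The norm is [(t^2 - u) / 2] with [u] the trace of [b * b], so rationality of traces suffices. *)
Lemma trn_ex b : exists t n, trn b t n.
Proof.
have [t Ht] := i2_trace two_neq0 dimB i2_iota i2_span b.
have [u Hu] := i2_trace two_neq0 dimB i2_iota i2_span (b * b).
exists t, ((t ^+ 2 - u) / 2); split=> //.
have F2 : (2 : F) != 0 by rewrite -(rmorph_nat iota 2) fmorph_eq0.
rewrite fmorph_div rmorphB rmorphXn /= Ht Hu rmorph_nat.
rewrite (_ : i2 (b * b) = i2 b *m i2 b); last by rewrite rmorphM.
by rewrite trM2; field.
Qed.

Lemma trn_quad b t n : trn b t n -> b * b = t *: b - n%:A.
Proof.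
case=> Ht Hn; apply: (i2_inj dimB i2_iota i2_span).
rewrite rmorphM rmorphB /= (restricts_scale i2_iota) i2_iota Ht Hn.
exact: cayley2.
Qed.

Lemma trnD b c t n u m w l : trn b t n -> trn c u m -> trn (b + c) w l -> w = t + u.
Proof.
move=> [a _] [d _] [e _]; apply: (fmorph_inj iota).
by rewrite rmorphD /= a d e rmorphD linearD.
Qed.

Lemma ii_quad b t n : trn b t n -> ii b *m ii b = sg t *: ii b - (sg n)%:M.
Proof.
move=> /trn_quad E; have := congr1 ii E.
by rewrite rmorphM rmorphB /= (restricts_scale ii_sg) ii_sg.
Qed.

(** A non-scalar matrix is a root of only one monic quadratic polynomial, so the image of [trn_quad]
    is the Cayley-Hamilton equation. *)
Lemma ii_trn_nonscalar b t n : trn b t n -> (forall c, ii b <> c%:M) ->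
  sg t = \tr (ii b) /\ sg n = \det (ii b).
Proof.
move=> H ns; have := ii_quad H; rewrite cayley2 => E.
have E' : (\tr (ii b) - sg t) *: ii b = (\det (ii b) - sg n)%:M.
  by rewrite scalerBl raddfB /= -[_ *: _ in X in X - _](subrK (\det (ii b))%:M) E; apply/matrixP => i j; rewrite !mxE; ring.
have t0 : \tr (ii b) - sg t = 0.
  apply/eqP/negPn/negP => n0; apply: (ns ((\tr (ii b) - sg t)^-1 * (\det (ii b) - sg n))).
  by rewrite -[LHS]scale1r -(mulVf n0) -scalerA E' scale_scalar_mx.
move: E'; rewrite t0 scale0r => /matrixP /(_ 0 0); rewrite !mxE /= mulr1n => /eqP.
by rewrite eq_sym subr_eq0 => /eqP ->; split=> //; apply/eqP; rewrite eq_sym -subr_eq0 t0.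
Qed.

Variable d : B.
Hypothesis d_ns : forall c, ii d <> c%:M.

(** If [ii b] is scalar, then [d] and [b + d] are not, and traces subtract. The norm follows from
    the traces of [b] and [b * b]. *)
Lemma ii_trn b t n : trn b t n -> sg t = \tr (ii b) /\ sg n = \det (ii b).
Proof.
have T x s m : trn x s m -> sg s = \tr (ii x).
  move=> H; have [[c Hc]|ns] := pselect (exists c, ii x = c%:M); last first.
    by have [] := ii_trn_nonscalar H (fun c E => ns (ex_intro _ c E)).
  have [u [l Hd]] := trn_ex d; have [w [k Hs]] := trn_ex (x + d).
  have [Tu _] := ii_trn_nonscalar Hd d_ns.
  have nxd e : ii (x + d) <> e%:M.
    rewrite rmorphD /= Hc => E; apply: (d_ns (c := e - c)).
    by apply: (@addrI _ c%:M); rewrite E -raddfD /= addrC subrK.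
  have [Tw _] := ii_trn_nonscalar Hs nxd.
  have := trnD H Hd Hs; move/(congr1 sg); rewrite rmorphD /= Tw Tu rmorphD linearD /=.
  by move/addIr.
move=> H; split; first exact: T H.
have [u [l H2]] := trn_ex (b * b).
have F2 : (2 : F') != 0 by rewrite -(rmorph_nat sg 2) fmorph_eq0.
apply: (mulfI F2).
have nE : 2 * n = t ^+ 2 - u.
  case: H => Ht Hn; case: H2 => Hu _; apply: (fmorph_inj iota).
  rewrite rmorphB rmorphM rmorphXn rmorph_nat /= Ht Hn Hu.
  rewrite (_ : i2 (b * b) = i2 b *m i2 b); last by rewrite rmorphM.
  by rewrite trM2; ring.
rewrite -(rmorph_nat sg 2) -rmorphM /= nE rmorphB rmorphXn /= (T _ _ _ H) (T _ _ _ H2).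
rewrite (_ : ii (b * b) = ii b *m ii b); last by rewrite rmorphM.
by rewrite trM2 rmorph_nat; ring.
Qed.

(** By non-degeneracy of the trace form: [ii b = 0] makes the trace of [x * b] vanish for every [x],
    and the elements [i2 x] span all matrices. *)
Lemma ii_inj : injective ii.
Proof.
apply: raddf_inj => b ib; apply: (i2_inj dimB i2_iota i2_span); rewrite rmorph0.
have T0 x : \tr (i2 (x * b)) = 0.
  have [t [n H]] := trn_ex (x * b); have [S _] := ii_trn H.
  case: H => <- _; move: S; rewrite rmorphM ib mulr0 => S.
  by apply/eqP; rewrite fmorph_eq0 -(fmorph_eq0 sg) S /= raddf0.
have TX (X : 'M[F]_2) : \tr (X *m i2 b) = 0.
  have [s ->] := i2_span X; rewrite mulmx_suml linear_sum big1// => p _.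
  rewrite -scalemxAl linearZ /= (_ : i2 p.2 *m i2 b = i2 (p.2 * b)); last by rewrite rmorphM.
  by rewrite T0 mulr0.
apply/matrixP => i j; rewrite mxE.
have := TX (delta_mx j i); rewrite /mxtrace (bigD1 j) //= big1 ?addr0 => [|k kj].
  rewrite mxE (bigD1 i) //= big1 ?addr0 => [|k ki]; first by rewrite mxE !eqxx mul1r.
  by rewrite mxE (negPf ki) andbF mul0r.
by rewrite mxE big1// => l _; rewrite mxE (negPf kj) mul0r.
Qed.

Lemma ii_scalar b c : ii b = c%:M -> exists k : K, b = k%:A.
Proof.
move=> E; have [t [n H]] := trn_ex b; have [Tt Tn] := ii_trn H.
exists (t / 2); apply: ii_inj; rewrite ii_sg E fmorph_div rmorph_nat Tt E tr2E !mxE /= !mulr1n.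
have F2 : (2 : F') != 0 by rewrite -(rmorph_nat sg 2) fmorph_eq0.
by congr (_%:M); field.
Qed.
End QuadraticElements.

(** * Integrality of traces and norms on an order *)

Section Integrality.
Local Open Scope complex_scope.
Variables (R : realType) (K : fieldType) (sg : {rmorphism K -> R}) (B : falgType K).
Variables (ii : {rmorphism B -> 'M[R]_2}) (O : set B).
Hypothesis ii_sg : restricts_to sg ii.
Hypothesis O_order : is_order O.

Definition pint (L : fieldType) (p : {poly L}) := forall i, integers L p`_i.

Lemma pintM (L : fieldType) (p q : {poly L}) : pint p -> pint q -> pint (p * q).
Proof.
move=> hp hq i; rewrite coefM; elim/big_ind: _ => [|x y|j _].
- exact: integers0.
- exact: integersD.
- exact: integersM.
Qed.

Lemma char_poly_int (L : fieldType) m (S : 'M[L]_m) :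
  (forall i j, integers L (S i j)) -> pint (char_poly S).
Proof.
move=> HS; rewrite /char_poly /determinant => k.
elim/big_rec: _ k => [k|s p _ IH k]; first by rewrite coef0; exact: integers0.
rewrite coefD; apply: integersD => //; move: k; apply: pintM.
  move=> k; case: odd_perm; rewrite ?expr0 ?expr1 ?coefN coef1.
    by apply: integersN; exact: integers_nat.
  exact: integers_nat.
elim/big_rec: _ => [k|i q _ IHq]; first by rewrite coef1; exact: integers_nat.
apply: pintM => // k; rewrite !mxE coefB coefMn coefX coefC.
apply: integersB; first by rewrite -mulrnA; exact: integers_nat.
by case: eqP => _; [exact: HS|exact: integers0].
Qed.

(** Left multiplication by [b] sends each generator of the order to an integral combination of
    generators, described by a matrix [S]. Pairing the generators with a left eigenvector of [b]
    turns [la] into an eigenvalue of [S], hence a root of a monic integral polynomial. The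
    generators need not be independent. *)
Lemma eigen_integers b (la : R[i]) : O b ->
  la ^+ 2 - (\tr (ii b))%:C * la + (\det (ii b))%:C = 0 -> integers _ la.
Proof.
move=> Ob E; case: O_order => O1 OB OM [gens gspan Ospan].
set m := size gens in Ospan *.
have gO (k : 'I_m) : O gens`_k.
  apply/Ospan; exists (fun j => (j == k)%:R); split.
    by move=> j; exact: integers_nat.
  rewrite (bigD1 k) //= eqxx scale1r big1 ?addr0 // => j /negPf ->.
  by rewrite scale0r.
have /choice[c Hc] : forall k : 'I_m, exists c : 'I_m -> K,
    (forall j, integers K (c j)) /\ b * gens`_k = \sum_j c j *: gens`_j.
  by move=> k; apply/Ospan; exact: OM.
pose X := map_mx (real_complex R) (ii b).
have : \det (X - la%:M) == 0.
  apply/eqP; rewrite -[RHS]E !det2E tr2E !mxE /= !mulr0n !mulr1n !subr0 !rmorphD /= rmorphN !rmorphM /=.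
  by ring.
move=> /det0P[l l0 lE].
have {}lE : l *m X = la *: l.
  by apply/eqP; rewrite -subr_eq0 -mul_mx_scalar -mulmxBr lE.
pose G k := map_mx (real_complex R) (ii gens`_k).
pose S : 'M[R[i]]_m := \matrix_(k, j) (sg (c j k))%:C.
have wS (k : 'I_m) : la *: (l *m G k) = \sum_j (sg (c k j))%:C *: (l *m G j).
  rewrite scalemxAl -lE -mulmxA -map_mxM /= (_ : ii b *m ii gens`_k = ii (b * gens`_k)); last by rewrite rmorphM.
  rewrite (Hc k).2 rmorph_sum raddf_sum mulmx_sumr; apply: eq_bigr => j _.
  by rewrite (restricts_scale ii_sg) /= map_mxZ -scalemxAr.
(* Not every pairing vanishes: [1] is a combination of the generators, and it pairs to the
   eigenvector itself. *)
have [j wj] : exists j, \row_k (l *m G (k : 'I_m)) 0 j != 0.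
  apply: contrapT => /forallNP nz; move/eqP: l0; apply.
  have /Ospan[c1 [_ E1]] := O1.
  have -> : l = l *m map_mx (real_complex R) (ii 1) by rewrite rmorph1 map_mx1 mulmx1.
  rewrite E1 rmorph_sum raddf_sum mulmx_sumr big1// => k _.
  rewrite (restricts_scale ii_sg) /= map_mxZ -scalemxAr.
  apply/rowP => j; rewrite !mxE; move/negP/negPn/eqP/rowP: (nz j) => /(_ k); rewrite !mxE => ->.
  by rewrite mulr0.
have : eigenvalue S la.
  apply/eigenvalueP; exists (\row_k (l *m G k) 0 j) => //.
  apply/rowP => k; rewrite [RHS]mxE [X in _ = _ * X]mxE.
  have -> : la * (l *m G k) 0 j = (la *: (l *m G k)) 0 j by rewrite [RHS]mxE.
  rewrite wS summxE [LHS]mxE; apply: eq_bigr => i _.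
  by rewrite [X in X * _]mxE [S i k]mxE [RHS]mxE mulrC.
rewrite eigenvalue_root_char => rt.
apply: integers_root (char_poly_monic S) rt _.
apply: char_poly_int => k i; rewrite mxE.
apply/(@integers_morph _ _ (real_complex R : {rmorphism R -> R[i]})).
by apply/integers_morph; exact: (Hc i).1.
Qed.

Lemma order_tr_det b (t n : K) : O b -> sg t = \tr (ii b) -> sg n = \det (ii b) ->
  integers K t /\ integers K n.
Proof.
move=> Ob Ht Hn.
pose T : R[i] := (\tr (ii b))%:C; pose D : R[i] := (\det (ii b))%:C.
pose s := sqrtc (T ^+ 2 - 4 * D).
have sE : s ^+ 2 = T ^+ 2 - 4 * D by exact: sqr_sqrtc.
have i1 : integers _ ((T + s) / 2).
  apply: (eigen_integers Ob); rewrite -/T -/D.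
  transitivity ((s ^+ 2 - (T ^+ 2 - 4 * D)) / 4); first by field.
  by rewrite sE subrr mul0r.
have i2 : integers _ ((T - s) / 2).
  apply: (eigen_integers Ob); rewrite -/T -/D.
  transitivity ((s ^+ 2 - (T ^+ 2 - 4 * D)) / 4); first by field.
  by rewrite sE subrr mul0r.
have iT : integers _ T.
  by rewrite (_ : T = (T + s) / 2 + (T - s) / 2); [exact: integersD|field].
have iD : integers _ D.
  rewrite (_ : D = (T + s) / 2 * ((T - s) / 2)); first exact: integersM.
  transitivity ((T ^+ 2 - s ^+ 2) / 4); last by field.
  by rewrite sE; field.
split; apply/(integers_morph sg); apply/(@integers_morph _ _ (real_complex R : {rmorphism R -> R[i]})).
  by rewrite Ht.
by rewrite Hn.
Qed.
End Integrality.

(** * The place above 2 *)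

Section TwoAdic.
Variables (R : realType) (K F : fieldType) (iota : {rmorphism K -> F}) (v : F -> R).
Hypothesis v_abs : is_nonarch_abs v.
Hypothesis v2_lt1 : v 2 < 1.
Hypothesis two_neq0 : (2 : K) != 0.
Hypothesis inv2 : forall x : K, integers K x -> (exists2 z, integers K z & x = 2 * z) \/
  exists y z, [/\ integers K y, integers K z & x * y = 1 + 2 * z].
Hypothesis denom : forall x : K, exists2 N : nat, (0 < N)%N & integers K (N%:R * x).

Lemma v_ge0 x : 0 <= v x. Proof. by case: v_abs. Qed.
Lemma vM x y : v (x * y) = v x * v y. Proof. by case: v_abs. Qed.
Lemma v_eq0 x : v x = 0 <-> x = 0. Proof. by case: v_abs. Qed.
Lemma v0 : v 0 = 0. Proof. exact/v_eq0. Qed.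
Lemma v_gt0 x : x != 0 -> 0 < v x.
Proof. by move=> x0; rewrite lt0r v_ge0 andbT; apply: contra x0 => /eqP/v_eq0 ->. Qed.
Lemma v1 : v 1 = 1.
Proof.
have := vM 1 1; rewrite mulr1 => /eqP; rewrite -subr_eq0 -[X in X - _]mulr1 -mulrBr mulf_eq0.
by rewrite (gt_eqF (v_gt0 (oner_neq0 _))) subr_eq0 eq_sym => /eqP.
Qed.
Lemma vN x : v (- x) = v x.
Proof.
have N1 : v (-1) = 1.
  have : v (-1) ^+ 2 = 1 by rewrite expr2 -vM mulrNN mulr1 v1.
  by move/eqP; rewrite sqrf_eq1 => /orP[/eqP//|/eqP E]; have := v_ge0 (-1); rewrite E; lra.
by rewrite -mulN1r vM N1 mul1r.
Qed.
Lemma vD_le x y c : v x <= c -> v y <= c -> v (x + y) <= c.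
Proof.
move=> xc yc; case: v_abs => _ _ _ H; apply: le_trans (H x y) _.
by rewrite ge_max xc.
Qed.
Lemma vD_lt x y c : v x < c -> v y < c -> v (x + y) < c.
Proof.
move=> xc yc; case: v_abs => _ _ _ H; apply: le_lt_trans (H x y) _.
by rewrite gt_max xc.
Qed.
Lemma vB_le x y c : v x <= c -> v y <= c -> v (x - y) <= c.
Proof. by move=> xc yc; apply: vD_le; rewrite ?vN. Qed.
Lemma vM_le x y c : v x <= 1 -> v y <= c -> v (x * y) <= c.
Proof.
move=> x1 yc; rewrite vM; apply: le_trans yc.
by rewrite -[leRHS]mul1r ler_wpM2r ?v_ge0.
Qed.
Lemma vM_ler x y c : v x <= c -> v y <= 1 -> v (x * y) <= c.
Proof. by move=> xc y1; rewrite mulrC; exact: vM_le. Qed.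
Lemma v_sum (I : Type) (r : seq I) (P : pred I) (f : I -> F) c : 0 <= c ->
  (forall i, P i -> v (f i) <= c) -> v (\sum_(i <- r | P i) f i) <= c.
Proof. by move=> c0 H; elim/big_ind: _ => [|x y|//]; [rewrite v0|exact: vD_le]. Qed.
Lemma v_nat n : v n%:R <= 1.
Proof.
elim: n => [|n IH]; first by rewrite v0.
by rewrite -natr1; apply: vD_le => //; rewrite v1.
Qed.
Lemma v_int (m : int) : v m%:~R <= 1.
Proof. by case: m => n; rewrite ?NegzE ?rmorphN ?vN; exact: v_nat. Qed.
Lemma vX x n : v (x ^+ n) = v x ^+ n.
Proof. by elim: n => [|n IH]; rewrite ?expr0 ?v1// !exprS vM IH. Qed.
Lemma F2_neq0 : (2 : F) != 0.
Proof. by rewrite -(rmorph_nat iota 2) fmorph_eq0. Qed.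
Lemma v2_gt0 : 0 < v 2. Proof. exact: v_gt0 F2_neq0. Qed.

Lemma v_integers (x : F) : integers F x -> v x <= 1.
Proof.
case=> p pm /rootP; set q := map_poly _ p => q0.
have qm : q \is monic by exact: monic_map.
rewrite leNgt; apply/negP => x1.
have [n qn] : exists n, size q = n.+1.
  by exists (size q).-1; rewrite prednK// size_poly_gt0 monic_neq0.
have qi i : v q`_i <= 1 by rewrite coef_map; exact: v_int.
have := q0; rewrite horner_coef qn big_ord_recr /=.
rewrite (_ : q`_n = 1); last by move/monicP: qm; rewrite /lead_coef qn.
rewrite mul1r addrC => /eqP; rewrite addr_eq0 => /eqP E.
case: n qn E => [|n] qn E.
  by move: E; rewrite expr0 big_ord0 oppr0 => /eqP; rewrite oner_eq0.
have : v (x ^+ n.+1) <= v x ^+ n.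
  rewrite E vN; apply: v_sum => [|i _]; first by rewrite exprn_ge0 ?v_ge0.
  apply: vM_le => //; rewrite vX; apply: ler_weXn2l; first exact: ltW.
  by rewrite -ltnS.
by rewrite vX exprS leNgt ltr_pMl ?x1// exprn_gt0// (lt_trans ltr01).
Qed.

Lemma v_iota x : integers K x -> v (iota x) <= 1.
Proof. by move=> xi; apply: v_integers; apply/integers_morph. Qed.

Lemma v_one_add2 z : integers K z -> v (iota (1 + 2 * z)) = 1.
Proof.
move=> zi; have lt : v (iota (2 * z)) < 1.
  rewrite rmorphM rmorph_nat vM; apply: le_lt_trans v2_lt1.
  by rewrite -[leRHS]mulr1 ler_wpM2l ?v_ge0// v_iota.
apply/eqP; rewrite eq_le v_iota//=.
- rewrite leNgt; apply/negP => H.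
  have : v (iota (1 + 2 * z) - iota (2 * z)) < 1 by apply: vD_lt => //; rewrite vN.
  by rewrite -rmorphB addrK rmorph1 v1 ltxx.
- by apply: integersD; [exact: integers1|apply: integersM => //; exact: integers_nat].
Qed.

Lemma v_lt1_div2 x : integers K x -> v (iota x) < 1 -> exists2 z, integers K z & x = 2 * z.
Proof.
move=> xi x1; have [//|[y [z [yi zi E]]]] := inv2 xi.
have := v_one_add2 zi; rewrite -E rmorphM vM => H.
have : v (iota x) * v (iota y) < 1.
  apply: le_lt_trans x1; rewrite -[leRHS]mulr1 ler_wpM2l ?v_ge0//; exact: v_iota.
by rewrite H ltxx.
Qed.

(** As long as the natural denominator [N] is even, [N * c] is an integer of value less than 1,
    hence even, and [N] can be halved. *)
Lemma clear_denom c : v (iota c) <= 1 ->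
  exists D, [/\ integers K D, v (iota D) = 1 & integers K (D * c)].
Proof.
move=> c1; have [N N0 Ni] := denom c.
elim/ltn_ind: N N0 Ni => N IH N0 Ni.
have [oN|eN] := boolP (odd N).
  exists N%:R; split=> //; first exact: integers_nat.
  rewrite -(odd_double_half N) oN natrD -mul2n natrM.
  exact: v_one_add2 (integers_nat _ _).
have NE : N = (2 * N./2)%N by rewrite mul2n -[LHS](odd_double_half N) (negPf eN).
have M0 : (0 < N./2)%N by rewrite half_gt0; case: N N0 eN {IH Ni NE} => [|[|]].
apply: (IH N./2) => //; first by rewrite [X in (_ < X)%N]NE mul2n -addnn -[X in (X < _)%N]addn0 ltn_add2l.
have [|z zi E] := v_lt1_div2 Ni.
  rewrite NE natrM -mulrA rmorphM rmorph_nat vM; apply: le_lt_trans v2_lt1.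
  rewrite -[leRHS]mulr1 ler_wpM2l ?v_ge0// rmorphM rmorph_nat.
  by apply: vM_le => //; exact: v_nat.
suff -> : N./2%:R * c = z by [].
by apply: (mulfI two_neq0); rewrite -E [in RHS]NE natrM mulrA.
Qed.

Hypothesis dense : forall (x : F) (e : R), 0 < e -> exists k : K, v (x - iota k) < e.

(** The valuation is discrete with uniformizer 2: by density and [clear_denom] the claim reduces to
    integers of [K], where it is inertness. *)
Lemma v_lt1 z : v z < 1 -> v z <= v 2.
Proof.
move=> z1; have [k Hk] := dense z v2_gt0.
have kz : v (iota k) < 1.
  rewrite -[iota k](subrK z); apply: vD_lt => //.
  by rewrite -opprB vN; exact: lt_trans v2_lt1.
have [D [Di D1 Dk]] := clear_denom (ltW kz).
have [|w wi E] := v_lt1_div2 Dk; first by rewrite rmorphM vM D1 mul1r.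
have k2 : v (iota k) <= v 2.
  rewrite -[leLHS]mul1r -D1 -vM -rmorphM E rmorphM rmorph_nat.
  by apply: vM_ler => //; exact: v_iota.
by rewrite -[z](subrK (iota k)); apply: vD_le => //; exact: ltW.
Qed.

Lemma v_det_le1 m (A : 'M[F]_m) : (forall i j, v (A i j) <= 1) -> v (\det A) <= 1.
Proof.
move=> H; apply: v_sum => // s _; apply: vM_le.
  by rewrite vX vN v1 expr1n.
by elim/big_ind: _ => [|x y x1 y1|i _]; [rewrite v1|exact: vM_le|exact: H].
Qed.

Lemma row_replace m (A : 'M[F]_m) (r : 'I_m) (u : 'rV[F]_m) :
  \det (\matrix_(k < m) (if k == r then u else row k A)) =
  \sum_j u 0 j * cofactor A r j.
Proof.
rewrite (expand_det_row _ r); apply: eq_bigr => j _; rewrite !mxE eqxx; congr (_ * _).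
rewrite /cofactor; congr (_ * \det _); apply/matrixP => i k; rewrite !mxE.
by rewrite eq_sym (negPf (neq_lift r i)) mxE.
Qed.

Variables (B : falgType K) (i2 : {rmorphism B -> 'M[F]_2}) (O : set B).
Hypothesis dimB : \dim {: B} = 4%N.
Hypothesis i2_iota : restricts_to iota i2.
Hypothesis i2_int : is_integral_splitting v O i2.
Hypothesis O_order : is_order O.

(** The rows of the identity matrix are exchanged one at a time for elements of [O]. The determinant
    is linear in the row concerned, so by the ultrametric inequality one of the elements of [O] in
    the expansion keeps its value at least 1. *)
Lemma integral_basis : exists h : 'I_(2 * 2) -> B, (forall k, O (h k)) /\
  1 <= v (\det (\matrix_k mxvec (i2 (h k)))).
Proof.
have [_ gen] := i2_int.
pose M (r : nat) (h : 'I_(2 * 2) -> B) : 'M[F]_(2 * 2) :=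
  \matrix_k (if (k < r)%N then mxvec (i2 (h k)) else delta_mx 0 k).
have step (r : nat) : (r <= 2 * 2)%N -> exists h : 'I_(2 * 2) -> B,
    (forall k : 'I_(2 * 2), (k < r)%N -> O (h k)) /\ 1 <= v (\det (M r h)).
  elim: r => [|r IH] rn.
    exists (fun=> 0); split=> //; rewrite (_ : M 0%N _ = 1%:M) ?det1 ?v1//.
    by apply/row_matrixP => k; rewrite rowK row1.
  have [h [hO hM]] := IH (ltnW rn); pose k0 := Ordinal rn.
  have [|s [sO sE]] := gen (vec_mx (delta_mx 0 k0)).
    by move=> i j; rewrite !mxE; case: (_ && _); rewrite ?v1 ?v0.
  have E : M r h = \matrix_k (if k == k0 then \sum_(p <- s) p.1 *: mxvec (i2 p.2) else row k (M r h)).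
    apply/row_matrixP => k; rewrite [RHS]rowK; case: eqP => [->|//].
    rewrite rowK ltnn -[LHS]vec_mxK sE linear_sum; apply: eq_bigr => p _.
    by rewrite linearZ.
  move: hM; rewrite E row_replace => hM.
  have [p ps pv] : exists2 p, p \in s &
      1 <= v (\sum_j mxvec (i2 p.2) 0 j * cofactor (M r h) k0 j).
    apply: contrapT => nE; move: hM; apply/negP; rewrite -ltNge.
    rewrite (eq_bigr (fun j => \sum_(p <- s) p.1 * (mxvec (i2 p.2) 0 j * cofactor (M r h) k0 j))); last first.
      by move=> j _; rewrite summxE mulr_suml; apply: eq_bigr => p _; rewrite mxE mulrA.
    rewrite exchange_big /= big_seq; elim/big_ind: _ => [|x y|p ps]; [by rewrite v0|exact: vD_lt|].
    rewrite -mulr_sumr vM ltNge; apply/negP => H; apply: nE; exists p => //.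
    apply: le_trans H _; rewrite -[leRHS]mul1r ler_wpM2r ?v_ge0//.
    by have [] := sO p ps.
  exists (fun k => if k == k0 then p.2 else h k); split.
    move=> k; have [_ _|kk0] := eqVneq k k0; first by have [] := sO p ps.
    by rewrite ltnS leq_eqVlt => /orP[kr|/hO//]; case/negP: kk0.
  rewrite (_ : M r.+1 _ = \matrix_k (if k == k0 then mxvec (i2 p.2) else row k (M r h))) ?row_replace//.
  apply/row_matrixP => k; rewrite !rowK; case: eqP => [->|kk0]; first by rewrite ltnSn.
  by rewrite ltnS leq_eqVlt; case: eqP => // kr; case: kk0; exact: val_inj.
have [h [hO hM]] := step (2 * 2)%N (leqnn _).
exists h; split=> [k|]; first exact: hO.
rewrite (_ : \matrix_k _ = M (2 * 2)%N h)//; apply/row_matrixP => k.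
by rewrite !rowK ltn_ord.
Qed.

Lemma order_scale c b : integers K c -> O b -> O (c *: b).
Proof.
case: O_order => _ _ _ [g _ H] ci /H[a [ai ->]]; apply/H.
exists (fun k => c * a k); split=> [k|]; first exact: integersM.
by rewrite scaler_sumr; apply: eq_bigr => k _; rewrite scalerA.
Qed.
Lemma order0 : O 0.
Proof. by case: O_order => O1 OB _ _; rewrite -(subrr 1); exact: OB. Qed.
Lemma orderD x y : O x -> O y -> O (x + y).
Proof.
move=> Ox Oy; case: O_order => _ OB _ _; rewrite -[y]opprK; apply: (OB) => //.
by rewrite -sub0r; apply: (OB) => //; exact: order0.
Qed.

(** By Cramer's rule the coordinates of [y] in an [integral_basis] have value at most [v 2].
    Multiplied by a common denominator [DD] of value 1 they become even integers, so [DD *: y] is in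
    [2 O]. *)
Lemma order_div2 y : O y -> (forall i j, v (i2 y i j) <= v 2) ->
  exists2 x, O x & y = 2 *: x.
Proof.
move=> Oy y2; have [h [hO hv]] := integral_basis; set M := \matrix_k _ in hv.
have [int _] := i2_int.
have M1 i j : v (M i j) <= 1.
  by rewrite mxE; case/mxvec_indexP: j => k l; rewrite mxvecE; apply: int.
have dM : \det M != 0.
  by apply: contraTneq hv => ->; rewrite v0 -ltNge ltr01.
have Mu : M \in unitmx by rewrite unitmxE unitfE.
have lin (c : 'I_(2 * 2) -> K) : mxvec (i2 (\sum_k c k *: h k)) = \row_k iota (c k) *m M.
  rewrite rmorph_sum linear_sum mulmx_sum_row; apply: eq_bigr => k _.
  by rewrite (restricts_scale i2_iota) linearZ rowK mxE.
pose t := [tuple h k | k < 2 * 2].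
have tE (k : 'I_(2 * 2)) : t`_k = h k by rewrite -tnth_nth tnth_mktuple.
have ft : free t.
  apply/freeP => c; under eq_bigr do rewrite tE; move=> E k.
  have /rowP/(_ k) : \row_k iota (c k) = 0.
    by rewrite -[LHS](mulmxK Mu) -lin E rmorph0 linear0 mul0mx.
  by rewrite !mxE => /eqP; rewrite fmorph_eq0 => /eqP.
have bt : basis_of fullv t by rewrite basisEfree ft subvf size_tuple dimB.
pose c k := coord t k y.
have yE : y = \sum_k c k *: h k.
  by rewrite {1}(coord_basis bt (memvf y)); apply: eq_bigr => k _; rewrite tE.
have c2 k : v (iota (c k)) <= v 2.
  have -> : iota (c k) = (mxvec (i2 y) *m invmx M) 0 k.
    by rewrite {1}yE lin mulmxK// mxE.
  rewrite mxE; apply: v_sum => [|j _]; first exact: v_ge0.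
  apply: vM_ler; first by case/mxvec_indexP: j => a b; rewrite mxvecE.
  rewrite /invmx Mu !mxE vM.
  have -> : v (\det M)^-1 = (v (\det M))^-1.
    apply: (mulfI (lt0r_neq0 (v_gt0 dM))).
    by rewrite -vM !divff ?v1// gt_eqF// v_gt0.
  rewrite mulrC ler_pdivrMr ?v_gt0// mul1r; apply: le_trans hv.
  apply: vM_le; first by rewrite vX vN v1 expr1n.
  by apply: v_det_le1 => a b; rewrite !mxE; case/mxvec_indexP: (lift j b) => ? ?; rewrite mxvecE; exact: int.
have /choice[D HD] : forall k, exists D, [/\ integers K D, v (iota D) = 1 & integers K (D * c k)].
  by move=> k; apply: clear_denom; exact: le_trans (c2 k) (ltW v2_lt1).
pose DD := \prod_k D k.
have DDi : integers K DD.
  by apply: (big_ind (fun x => integers K x)) => [|a b|k _]; [exact: integers1|exact: integersM|have [] := HD k].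
have DDv : v (iota DD) = 1.
  rewrite /DD rmorph_prod; apply: (big_ind (fun x => v x = 1)) => [|a b ha hb|k _]; rewrite ?v1//.
    by rewrite vM ha hb mulr1.
  by have [] := HD k.
have DDc k : integers K (DD * c k).
  rewrite /DD (bigD1 k) //= mulrAC; apply: integersM; first by have [] := HD k.
  by apply: (big_ind (fun x => integers K x)) => [|a b|j _]; [exact: integers1|exact: integersM|have [] := HD j].
have /choice[e He] : forall k, exists e, integers K e /\ DD * c k = 2 * e.
  move=> k; have [|e ei E] := v_lt1_div2 (DDc k); last by exists e.
  by rewrite rmorphM vM DDv mul1r; exact: le_lt_trans (c2 k) v2_lt1.
pose w := \sum_k e k *: h k.
have Ow : O w.
  apply: (big_ind (fun x => O x)) => [|a b|k _]; [exact: order0|exact: orderD|].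
  by apply: order_scale => //; have [] := He k.
have yw : DD *: y = 2 *: w.
  rewrite yE !scaler_sumr; apply: eq_bigr => k _; rewrite !scalerA.
  by have [_ ->] := He k.
(* [DD] is odd, so [DD * E = 1 + 2 * z] recovers [y] as [E DD y - 2 z y], both terms of which lie in
   [2 O]. *)
have [[z zi E]|[E [z [Ei zi EE]]]] := inv2 DDi.
  have : v (iota DD) < 1.
    rewrite E rmorphM rmorph_nat; apply: le_lt_trans v2_lt1.
    by apply: vM_ler => //; exact: v_iota.
  by rewrite DDv ltxx.
exists (E *: w - z *: y).
  by case: O_order => _ OB _ _; apply: OB; exact: order_scale.
rewrite scalerBr (scalerA 2 E) (mulrC 2 E) -scalerA -yw (scalerA E) mulrC EE.
by rewrite scalerDl scale1r scalerA addrK.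
Qed.
End TwoAdic.

(** * Elements of norm 2 and the parity of their traces *)

Section Arithmetic.
Local Open Scope complex_scope.
Variables (R : realType) (K : fieldExtType rat) (theta0 : K).
Hypothesis theta0_root : theta0 ^+ 3 + theta0 ^+ 2 - 4 * theta0 + 1 = 0.
Hypothesis theta0_gen : <<1; theta0>>%VS = {: K}%VS.
Variables sigma1 sigma2 sigma3 : {rmorphism K -> R}.
Hypothesis sigma12 : sigma1 <> sigma2 :> (K -> R).
Hypothesis sigma13 : sigma1 <> sigma3 :> (K -> R).
Hypothesis sigma23 : sigma2 <> sigma3 :> (K -> R).
Variables (B : falgType K) (dimB : \dim {: B} = 4%N).
Variable i_inf : {rmorphism B -> 'M[R]_2}.
Hypothesis i_inf_sigma1 : restricts_to sigma1 i_inf.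
Variables (OB : set B) (OB_order : is_order OB).
Variables (Q8 : fieldType) (iota2 : {rmorphism K -> Q8}) (v : Q8 -> R).
Hypothesis v_abs : is_nonarch_abs v.
Hypothesis dense : forall (x : Q8) (e : R), 0 < e -> exists k : K, v (x - iota2 k) < e.
Hypothesis v_at_2 : v 2%:R < 1.
Variable i_2 : {rmorphism B -> 'M[Q8]_2}.
Hypothesis i_2_iota2 : restricts_to iota2 i_2.
Hypothesis i_2_integral : is_integral_splitting v OB i_2.
Variable d : B.
Hypothesis d_ns : forall c, i_inf d <> c%:M.

Lemma K2_neq0 : (2 : K) != 0. Proof. exact: natr_neq0. Qed.

Let Kinv2 := inv2 theta0_root theta0_gen sigma12 sigma13 sigma23.

Lemma K_denom (x : K) : exists2 N : nat, (0 < N)%N & integers K (N%:R * x).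
Proof.
have [a [b [c ->]]] := cub_all theta0_root theta0_gen x.
have cl (q : rat) : exists2 N : nat, (0 < N)%N & exists m : int, N%:R * q = m%:~R.
  exists `|denq q|%N; first by rewrite absz_gt0 denq_neq0.
  exists (numq q); rewrite pmulrn gez0_abs ?ltW ?denq_gt0//.
  by rewrite -{2}(divq_num_den q) mulrC divfK// intr_eq0 denq_neq0.
have [na a0 [ma Ea]] := cl a; have [nb b0 [mb Eb]] := cl b; have [nc c0 [mc Ec]] := cl c.
exists (na * nb * nc)%N; first by rewrite !muln_gt0 a0 b0 c0.
have -> : (na * nb * nc)%:R * cub theta0 a b c =
    oz theta0 (ma * (nb * nc)%N%:Z) (mb * (na * nc)%N%:Z) (mc * (na * nb)%N%:Z).
  have E1 : (ma * (nb * nc)%N%:Z)%:~R = (na * nb * nc)%:R * a :> rat.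
    by rewrite rmorphM /= -Ea -pmulrn !natrM; ring.
  have E2 : (mb * (na * nc)%N%:Z)%:~R = (na * nb * nc)%:R * b :> rat.
    by rewrite rmorphM /= -Eb -pmulrn !natrM; ring.
  have E3 : (mc * (na * nb)%N%:Z)%:~R = (na * nb * nc)%:R * c :> rat.
    by rewrite rmorphM /= -Ec -pmulrn !natrM; ring.
  by rewrite oz_cub E1 E2 E3 /cub; move: (na * nb * nc)%N => N; ring.
exact: oz_int.
Qed.

Lemma i2_span (X : 'M[Q8]_2) : exists s : seq (Q8 * B), X = \sum_(p <- s) p.1 *: i_2 p.2.
Proof.
have [_ gen] := i_2_integral.
have D i j : exists s : seq (Q8 * B), delta_mx i j = \sum_(p <- s) p.1 *: i_2 p.2.
  have [|s [_ E]] := gen (delta_mx i j); last by exists s.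
  by move=> k l; rewrite mxE; case: (_ && _); rewrite ?(v1 v_abs) ?(v0 v_abs).
have Z c A : (exists s : seq (Q8 * B), A = \sum_(p <- s) p.1 *: i_2 p.2) ->
    exists s : seq (Q8 * B), c *: A = \sum_(p <- s) p.1 *: i_2 p.2.
  case=> s ->; exists [seq (c * p.1, p.2) | p <- s].
  by rewrite big_map scaler_sumr; apply: eq_bigr => p _; rewrite scalerA.
rewrite (matrix_sum_delta X).
apply: (big_ind (fun A => exists s : seq (Q8 * B), A = \sum_(p <- s) p.1 *: i_2 p.2)) => [|A A' [s ->] [s' ->]|i _].
- by exists [::]; rewrite big_nil.
- by exists (s ++ s'); rewrite big_cat.
apply: (big_ind (fun A => exists s : seq (Q8 * B), A = \sum_(p <- s) p.1 *: i_2 p.2)) => [|A A' [s ->] [s' ->]|j _].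
- by exists [::]; rewrite big_nil.
- by exists (s ++ s'); rewrite big_cat.
exact: Z (D i j).
Qed.

Lemma OB_trn y : OB y -> exists t n, [/\ integers K t, integers K n,
  trn iota2 i_2 y t n, sigma1 t = \tr (i_inf y) & sigma1 n = \det (i_inf y)].
Proof.
move=> Oy; have [t [n H]] := trn_ex K2_neq0 dimB i_2_iota2 i2_span y.
have [Ht Hn] := ii_trn K2_neq0 dimB i_2_iota2 i_inf_sigma1 i2_span d_ns H.
have [ti ni] := order_tr_det i_inf_sigma1 OB_order Oy Ht Hn.
by exists t, n.
Qed.

Lemma OB_scalar k : integers K k -> OB k%:A.
Proof. by move=> ki; apply: (order_scale OB_order) => //; case: OB_order. Qed.
Lemma OB1 : OB 1. Proof. by case: OB_order. Qed.
Lemma OB_B x y : OB x -> OB y -> OB (x - y). Proof. by case: OB_order => _ H _ _; exact: H. Qed.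
Lemma OB_M x y : OB x -> OB y -> OB (x * y). Proof. by case: OB_order => _ _ H _; exact: H. Qed.
Lemma OB_D x y : OB x -> OB y -> OB (x + y). Proof. exact: orderD OB_order _ _. Qed.
Lemma OB_N x : OB x -> OB (- x).
Proof. by move=> Ox; rewrite -sub0r; apply: OB_B => //; exact: order0 OB_order. Qed.

Lemma i2M x y : i_2 (x * y) = i_2 x *m i_2 y. Proof. exact: rmorphM. Qed.
Lemma iiM x y : i_inf (x * y) = i_inf x *m i_inf y. Proof. exact: rmorphM. Qed.

Lemma i2_le1 w : OB w -> forall m n, v (i_2 w m n) <= 1.
Proof. by case: i_2_integral => H _; exact: H. Qed.

Definition unit_norm w := OB w /\ \det (i_inf w) = 1.
Definition lower_even w := v (i_2 w 1 0) <= v 2%:R.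
Definition AL y := [/\ OB y, \det (i_inf y) = 2, v (i_2 y 0 0) <= v 2%:R,
  v (i_2 y 1 0) <= v 2%:R & v (i_2 y 1 1) <= v 2%:R].

Lemma unit_normM x y : unit_norm x -> unit_norm y -> unit_norm (x * y).
Proof.
move=> [Ox dx] [Oy dy]; split; first exact: OB_M.
by rewrite iiM det_mulmx dx dy mulr1.
Qed.

Lemma conj_ex y : OB y -> exists y', [/\ OB y', y * y' = y' * y,
  i_2 y' = (\tr (i_2 y))%:M - i_2 y & forall n : nat, \det (i_inf y) = n%:R -> y * y' = n%:R].
Proof.
move=> Oy; have [t [n [ti ni H Ht Hn]]] := OB_trn Oy.
exists (t%:A - y); split.
- by apply: OB_B => //; exact: OB_scalar.
- by rewrite mulrBr mulrBl mulr_algl mulr_algr.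
- by rewrite rmorphB /= i_2_iota2; case: H => ->.
move=> m; rewrite -Hn -(rmorph_nat sigma1 m) => /(fmorph_inj sigma1) E.
rewrite mulrBr mulr_algr (trn_quad dimB i_2_iota2 i2_span H) opprB addrC subrK.
by rewrite E scaler_nat.
Qed.

Lemma unit_norm_inv x : unit_norm x -> exists y, [/\ unit_norm y, x * y = 1, y * x = 1 &
  (lower_even x -> lower_even y)].
Proof.
move=> [Ox dx]; have [y [Oy C E P]] := conj_ex Ox.
have xy : x * y = 1 by rewrite (P 1%N dx).
have yx : y * x = 1 by rewrite -C.
exists y; split=> //; first split=> //.
  have := congr1 (fun b => \det (i_inf b)) xy.
  by rewrite iiM det_mulmx dx mul1r rmorph1 det1.
by rewrite /lower_even E !mxE /= mulr0n sub0r (vN v_abs).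
Qed.

Lemma AL_mulG y g : AL y -> unit_norm g -> lower_even g -> AL (y * g).
Proof.
move=> [Oy dy y00 y10 y11] [Og dg] g10; split; first exact: OB_M.
- by rewrite iiM det_mulmx dy dg mulr1.
- rewrite i2M mulmx2E; apply: (vD_le v_abs).
    by apply: (vM_ler v_abs) => //; exact: i2_le1.
  by apply: (vM_le v_abs) => //; exact: i2_le1.
- rewrite i2M mulmx2E; apply: (vD_le v_abs); apply: (vM_ler v_abs) => //; exact: i2_le1.
- rewrite i2M mulmx2E; apply: (vD_le v_abs); apply: (vM_ler v_abs) => //; exact: i2_le1.
Qed.

(** For [w] the conjugate of [y'], all entries of [y * w] are even, so [g = y * w / 2] is again in
    the order, and it has norm 1. *)
Lemma AL_quot y y' : AL y -> AL y' ->
  exists g, [/\ unit_norm g, lower_even g & y = g * y'].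
Proof.
move=> [Oy dy y00 y10 y11] [Oy' dy' z00 z10 z11].
have [w [Ow C E P]] := conj_ex Oy'.
have y'w : y' * w = 2 by exact: P 2%N dy'.
have wy' : w * y' = 2 by rewrite -C.
have trE : \tr (i_2 y') = i_2 y' 0 0 + i_2 y' 1 1 by exact: tr2E.
have w00 : i_2 w 0 0 = i_2 y' 1 1 by rewrite E !mxE /= mulr1n trE; ring.
have w01 : i_2 w 0 1 = - i_2 y' 0 1 by rewrite E !mxE /= mulr0n sub0r.
have w10 : i_2 w 1 0 = - i_2 y' 1 0 by rewrite E !mxE /= mulr0n sub0r.
have w11 : i_2 w 1 1 = i_2 y' 0 0 by rewrite E !mxE /= mulr1n trE; ring.
have O1 := i2_le1 Oy; have O1' := i2_le1 Oy'.
have e2 : forall i j, v (i_2 (y * w) i j) <= v 2.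
  apply: ord2P; apply: ord2P; rewrite i2M mulmx2E ?w00 ?w01 ?w10 ?w11; apply: (vD_le v_abs);
    first [by apply: (vM_ler v_abs); rewrite ?(vN v_abs)|by apply: (vM_le v_abs); rewrite ?(vN v_abs)].
have [g Og yw] := order_div2 v_abs v_at_2 K2_neq0 Kinv2 K_denom dimB i_2_iota2 i_2_integral OB_order (OB_M Oy Ow) e2.
have yE : y = g * y'.
  have B2 : (2 : K) != 0 := K2_neq0.
  apply: (scalerI B2); rewrite scalerAl -yw -mulrA wy' mulr_natr scaler_nat //.
exists g; split=> //.
  split=> //; have := congr1 (fun b => \det (i_inf b)) yE.
  by rewrite iiM det_mulmx dy dy' => H; lra.
(* Each term of the lower left entry of [y * w] is a product of two even numbers, so evenness
   survives the division by 2. *)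
rewrite /lower_even -(ler_pM2l (v2_gt0 iota2 v_abs K2_neq0)) -!(vM v_abs).
have -> : 2 * i_2 g 1 0 = i_2 (y * w) 1 0.
  by rewrite yw (restricts_scale i_2_iota2) mxE rmorph_nat.
rewrite i2M mulmx2E w00 w10; apply: (vD_le v_abs); rewrite !(vM v_abs) ?(vN v_abs);
  by apply: ler_pM; rewrite ?(v_ge0 v_abs).
Qed.

(** [i] has trace 0 and norm 1, so [1 + i] has norm 2. With an even lower left entry the first
    diagonal entry [a] satisfies that [(a + 1)^2] is even, hence so is [a + 1], and the other
    diagonal entry of [1 + i] is [2 - (a + 1)]. *)
Lemma AL_one_plus i : OB i -> i * i = -1 -> lower_even i -> AL (1 + i).
Proof.
move=> Oi ii i10; have [t [n [ti ni H Ht Hn]]] := OB_trn Oi.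
have X2 : i_inf i *m i_inf i = (-1)%:M by rewrite -iiM ii rmorphN rmorph1 raddfN.
have ns c : i_inf i <> c%:M.
  move=> E; move: X2; rewrite E -scalar_mxM => /matrixP /(_ 0 0).
  by rewrite !mxE /= !mulr1n => c2; have := sqr_ge0 c; rewrite expr2 c2; lra.
have tr0 : \tr (i_inf i) = 0.
  apply/eqP/negPn/negP => t0; have := cayley2 (i_inf i); rewrite X2 => E.
  have E' : \tr (i_inf i) *: i_inf i = (\det (i_inf i) - 1)%:M.
    apply/matrixP => k l; move/matrixP/(_ k l): E; rewrite !mxE.
    by case: (k == l); rewrite /= ?mulr1n ?mulr0n; lra.
  apply: (ns ((\tr (i_inf i))^-1 * (\det (i_inf i) - 1))).
  by rewrite -scale_scalar_mx -E' scalerA mulVf// scale1r.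
have d1 : \det (i_inf i) = 1.
  have := cayley2 (i_inf i); rewrite X2 tr0 scale0r sub0r => /matrixP /(_ 0 0).
  by rewrite !mxE /= !mulr1n => /oppr_inj.
have t0 : t = 0 by apply: (fmorph_inj sigma1); rewrite Ht tr0 rmorph0.
have n1 : n = 1 by apply: (fmorph_inj sigma1); rewrite Hn d1 rmorph1.
have [] := H; rewrite t0 n1 rmorph0 rmorph1 tr2E det2E => /esym S /esym D.
have O1 := i2_le1 Oi.
have a1 : v (i_2 i 0 0 + 1) <= v 2.
  apply: (v_lt1 v_abs v_at_2 K2_neq0 Kinv2 K_denom dense).
  rewrite ltNge; apply/negP => H1.
  have : v ((i_2 i 0 0 + 1) ^+ 2) <= v 2.
    have -> : (i_2 i 0 0 + 1) ^+ 2 = 2 * i_2 i 0 0 - i_2 i 0 1 * i_2 i 1 0.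
      have E11 : i_2 i 1 1 = - i_2 i 0 0 by apply/eqP; rewrite -addr_eq0 addrC S.
      move: D; rewrite E11 => D; transitivity (i_2 i 0 0 ^+ 2 + 2 * i_2 i 0 0 + (i_2 i 0 0 * - i_2 i 0 0 - i_2 i 0 1 * i_2 i 1 0)); last by ring.
      by rewrite D; ring.
    apply: (vB_le v_abs); first exact: (vM_ler v_abs).
    exact: (vM_le v_abs).
  rewrite (vX v_abs) => H2.
  have : 1 <= v (i_2 i 0 0 + 1) ^+ 2 by rewrite exprn_ege1.
  by move=> H3; have := le_lt_trans (le_trans H3 H2) v_at_2; rewrite ltxx.
split.
- by apply: OB_D => //; exact: OB1.
- rewrite rmorphD rmorph1 det2E !mxE /= !mulr1n !mulr0n.
  by move: tr0 d1; rewrite tr2E det2E; lra.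
- by rewrite rmorphD rmorph1 !mxE /= mulr1n addrC.
- by rewrite rmorphD rmorph1 !mxE /= mulr0n add0r.
rewrite rmorphD rmorph1 !mxE /= mulr1n.
have -> : 1 + i_2 i 1 1 = 2 - (i_2 i 0 0 + 1).
  have -> : i_2 i 1 1 = - i_2 i 0 0 by apply/eqP; rewrite -addr_eq0 addrC S.
  ring.
exact: (vB_le v_abs).
Qed.

Lemma prime2 x y : integers K x -> integers K y ->
  (exists2 z, integers K z & x * y = 2 * z) ->
  (exists2 z, integers K z & x = 2 * z) \/ (exists2 z, integers K z & y = 2 * z).
Proof.
move=> xi yi [u ui E]; have [|[w [z [wi zi W]]]] := Kinv2 xi; [by left|right].
exists (u * w - z * y); first by apply: integersB; exact: integersM.
rewrite mulrBr mulrA -E; transitivity ((x * w - 2 * z) * y); last by ring.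
by rewrite W addrK mul1r.
Qed.

Lemma even_sqr x : integers K x -> (exists2 z, integers K z & x * x = 2 * z) ->
  exists2 z, integers K z & x = 2 * z.
Proof. by move=> xi H; case: (prime2 xi xi H). Qed.

Lemma not_even_half k : ~ exists2 z, integers K z & 2 * z = 1 + 2 * k :> K /\ integers K k.
Proof.
move=> [z zi [E ki]].
have z1 : v (iota2 z) <= 1 := v_iota iota2 v_abs zi.
have := v_one_add2 iota2 v_abs v_at_2 ki; rewrite -E rmorphM rmorph_nat (vM v_abs).
move=> H; have := vM_ler v_abs (lexx (v 2)) z1; rewrite (vM v_abs) H => H2.
by have := le_lt_trans H2 v_at_2; rewrite ltxx.
Qed.

Lemma sqrt2_notin (k : K) : k ^+ 2 <> 2.
Proof.
move=> E; have ki : integers K k.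
  apply: (@integers_root _ (Poly [:: - 2; 0; 1])).
  - by rewrite monicE lead_coefE (@PolyK _ 0) ?oner_neq0.
  - rewrite /root horner_Poly /=; apply/eqP; transitivity (k ^+ 2 - 2); first by ring.
    by rewrite E subrr.
  - move=> [|[|[|i]]]; rewrite coef_Poly /= ?nth_nil; try exact: integers1; try exact: integers0.
    by apply: integersN; exact: integers_nat.
have [z zi Z] : exists2 z, integers K z & k = 2 * z.
  by apply: even_sqr => //; exists 1; [exact: integers1|rewrite -expr2 E mulr1].
apply: (@not_even_half 0); exists (z ^+ 2); first exact: integersX.
split; last exact: integers0.
by apply: (mulfI K2_neq0); rewrite mulr0 addr0 mulr1 -[RHS]E Z; ring.
Qed.

Variables (t : K) (mu : R[i]).
Hypothesis ti : integers K t.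
Hypothesis mu0 : mu != 0.
Hypothesis mu_t : 2 * (mu + mu^-1) = (sigma1 (t ^+ 2 - 4))%:C.

Let A := t ^+ 2 - 4.
Let Ai : integers K A.
Proof. by apply: integersB; [exact: integersX|exact: integers_nat]. Qed.

Let csM x y : (sigma1 (x * y))%:C = (sigma1 x)%:C * (sigma1 y)%:C.
Proof. by rewrite !rmorphM. Qed.
Let csB x y : (sigma1 (x - y))%:C = (sigma1 x)%:C - (sigma1 y)%:C.
Proof. by rewrite !rmorphB. Qed.
Let csN x : (sigma1 (- x))%:C = - (sigma1 x)%:C.
Proof. by rewrite !rmorphN. Qed.
Let csn n : (sigma1 n%:R)%:C = n%:R.
Proof. by rewrite !rmorph_nat. Qed.
Let csX x n : (sigma1 (x ^+ n))%:C = (sigma1 x)%:C ^+ n.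
Proof. by rewrite !rmorphXn. Qed.
Let cs1 : (sigma1 1)%:C = 1.
Proof. by rewrite !rmorph1. Qed.
Let muA : (sigma1 A)%:C = 2 * (mu + mu^-1).
Proof. by rewrite mu_t. Qed.

(** The numbers [V_m = 2^m (mu^m + mu^-m)] satisfy [V_(m+2) = A V_(m+1) - 4 V_m] with [V_0 = 2] and
    [V_1 = A]. Thus [V_m] is congruent to [A^m] modulo 2 for [m > 0], and is not even unless [A]
    is. *)
Lemma cheb m : exists2 V, integers K V & (sigma1 V)%:C = 2 ^+ m * (mu ^+ m + mu ^- m) /\
  ((0 < m)%N -> ~ (exists2 z, integers K z & A = 2 * z) -> ~ (exists2 z, integers K z & V = 2 * z)).
Proof.
suff [V [W [Vi Wi [HV HW] NV]]] : exists V W, [/\ integers K V, integers K W,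
   (sigma1 V)%:C = 2 ^+ m * (mu ^+ m + mu ^- m) /\ (sigma1 W)%:C = 2 ^+ m.+1 * (mu ^+ m.+1 + mu ^- m.+1) &
   ~ (exists2 z, integers K z & A = 2 * z) ->
     ((0 < m)%N -> ~ (exists2 z, integers K z & V = 2 * z)) /\ ~ (exists2 z, integers K z & W = 2 * z)].
  by exists V => //; split=> // m0 /NV[+ _]; apply.
elim: m => [|m [V [W [Vi Wi [HV HW] NV]]]].
  exists 2, A; split=> //; first exact: integers_nat.
    split; first by rewrite csn !expr0 invr1 mul1r.
    by rewrite !expr1 muA.
exists W, (A * W - 4 * V); split=> //.
- by apply: integersB; apply: integersM => //; exact: integers_nat.
- split=> //; rewrite csB !csM csn HV HW muA.
  by rewrite !exprS; field; rewrite ?expf_neq0 ?mu0.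
move=> nA; have [_ nW] := NV nA; split=> // -[z zi E].
have H : exists2 z, integers K z & A * W = 2 * z.
  exists (z + 2 * V); first by apply: integersD => //; apply: integersM => //; exact: integers_nat.
  by rewrite mulrDr -E; ring.
by case: (prime2 Ai Wi H).
Qed.

(** Here [V_m = - 2^(m+1)] is even, hence [t^2 - 4] is, hence [t]. *)
Lemma cheb_neg m : mu ^+ m = -1 -> (0 < m)%N -> exists2 z, integers K z & t = 2 * z.
Proof.
move=> mm m0; have [V Vi [HV NV]] := cheb m.
have [[z zi E]|nA] := pselect (exists2 z, integers K z & A = 2 * z).
  apply: even_sqr => //; exists (z + 2).
    by apply: integersD => //; exact: integers_nat.
  by rewrite -expr2 mulrDr -E /A; ring.
exfalso; apply: (NV m0 nA); exists (- 2 ^+ m).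
  by apply: integersN; apply: integersX; exact: integers_nat.
have cinj : injective (fun x : K => (sigma1 x)%:C) by move=> x y /(@complexI R)/(fmorph_inj sigma1).
by apply: cinj; rewrite HV mm invrN1 csM csN csX !csn; ring.
Qed.

(** If [t] were even, [mu + mu^-1] would be integral and with it [mu^m + mu^-m], unlike -3/2. So
    [V_m] is not even for [m > 0], while [V_m = - 3 * 2^(m-1)]: this leaves [m = 1] and
    [t^2 - 4 = -3]. For [m = 0] the sum would be 2. *)
Lemma cheb_pos m : mu ^+ m + mu ^- m = - 3 / 2 -> t ^+ 2 = 1.
Proof.
move=> mm; have cinj : injective (fun x : K => (sigma1 x)%:C) by move=> x y /(@complexI R)/(fmorph_inj sigma1).
have C2 : (2 : R[i]) != 0 by rewrite pnatr_eq0.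
have [[z zi E]|nA] := pselect (exists2 z, integers K z & A = 2 * z).
  exfalso; have [t' t'i tE] : exists2 z, integers K z & t = 2 * z.
    apply: even_sqr => //; exists (z + 2).
      by apply: integersD => //; exact: integers_nat.
    by rewrite -expr2 mulrDr -E /A; ring.
  pose A' := 2 * (t' ^+ 2 - 1).
  have A'i : integers K A'.
    by apply: integersM; [exact: integers_nat|apply: integersB; [exact: integersX|exact: integers1]].
  have A'E : (sigma1 A')%:C = mu + mu^-1.
    by apply: (mulfI C2); rewrite -muA /A tE /A' csB !csX !csM csB csX !csn cs1; ring.
  have [V [W [Vi _ [HV _]]]] : exists V W, [/\ integers K V, integers K W &
     (sigma1 V)%:C = mu ^+ m + mu ^- m /\ (sigma1 W)%:C = mu ^+ m.+1 + mu ^- m.+1].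
    elim: m {mm} => [|m [V [W [Vi Wi [HV HW]]]]].
      exists 2, A'; split=> //; first exact: integers_nat.
      by rewrite csn !expr0 invr1 !expr1.
    exists W, (A' * W - V); split=> //; first by apply: integersB => //; exact: integersM.
    split=> //; rewrite csB csM HV HW A'E.
    by rewrite !exprS; field; rewrite ?expf_neq0 ?mu0.
  apply: (@not_even_half (-2)); exists V => //; split; last by apply: integersN; exact: integers_nat.
  have -> : 1 + 2 * -2 = - 3 :> K by ring.
  by apply: cinj; rewrite csM HV mm csN !csn; field.
have [V Vi [HV NV]] := cheb m.
case: m mm HV NV => [|[|m]] mm HV NV.
- exfalso; move: mm; rewrite !expr0 invr1 => /eqP.
  rewrite -subr_eq0 (_ : _ - _ = 7 / 2); last by field.
  by rewrite mulf_eq0 invr_eq0 !pnatr_eq0.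
- have VA : V = A by apply: cinj; rewrite HV !expr1 muA.
  apply: cinj; move: HV; rewrite VA mm /A !expr1 rmorphB rmorphB /= !rmorph_nat => /(canRL (subrK _)) ->.
  by rewrite !rmorph1; field.
exfalso; apply: (NV isT nA); exists (- 3 * 2 ^+ m).
  by apply: integersM; [apply: integersN; exact: integers_nat|apply: integersX; exact: integers_nat].
by apply: cinj; rewrite HV mm !csM csN csX !csn !exprS; field.
Qed.
End Arithmetic.

(** * Optimal embeddings *)

Section QuadraticExtension.
Variables (R : realType) (K : fieldExtType rat) (sg : {rmorphism K -> R}).
Variables (L : fieldExtType K) (s : L) (c : nat).
Hypothesis c_gt0 : (0 < c)%N.
Hypothesis s_sqr : s ^+ 2 = (- c%:Z)%:~R.
Hypothesis s_gen : <<1; s>>%VS = {: L}%VS.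

Lemma s_sqr_nat : s * s = - c%:R.
Proof. by rewrite -expr2 s_sqr rmorphN /= -pmulrn. Qed.

Lemma quad_all (x : L) : exists a b : K, x = a%:A + b *: s.
Proof.
have xL : x \in <<1; s>>%VS by rewrite s_gen memvf.
rewrite -(Fadjoin_poly_eq xL).
have /polyOver1P[q ->] := Fadjoin_polyOver 1%VS s x.
elim/poly_ind: q => [|q d [a [b E]]].
  by exists 0, 0; rewrite rmorph0 horner0 !scale0r addr0.
exists (d - b * c%:R), a.
rewrite rmorphD rmorphM /= map_polyX map_polyC hornerD hornerM hornerX hornerC E /=.
have kc k : k *: (- c%:R : L) = (- (k * c%:R))%:A.
  by rewrite scalerN scaleNr mulr_natr -scalerMnl scalerMnr.
rewrite mulrDl -scalerAl mul1r -scalerAl s_sqr_nat kc scalerDl.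
by rewrite -addrA addrC; congr (_ + _); rewrite addrC.
Qed.

Lemma no_real (f : {rmorphism L -> R}) : False.
Proof.
have : f s ^+ 2 = - c%:R by rewrite -rmorphXn /= expr2 s_sqr_nat rmorphN rmorph_nat.
have := sqr_ge0 (f s); have : 0 < c%:R :> R by rewrite ltr0n.
by move=> ? ? ?; lra.
Qed.

Lemma s_notin (k : K) : s <> k%:A.
Proof.
move=> E; have : k ^+ 2 = - c%:R.
  apply: (fmorph_inj (GRing.in_alg L)); rewrite rmorphXn rmorphN rmorph_nat /= -E expr2.
  exact: s_sqr_nat.
move/(congr1 sg); rewrite rmorphXn rmorphN rmorph_nat => H.
have := sqr_ge0 (sg k); have : 0 < c%:R :> R by rewrite ltr0n.
by clear E; move=> ? ?; lra.
Qed.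

Let X := [tuple s; 1 : L].

Lemma quad_free : free X.
Proof.
rewrite free_cons seq1_free oner_neq0 andbT span_seq1.
by apply/negP => /vlineP[k E]; exact: (s_notin E).
Qed.

Lemma quad_dim : \dim {: L} = 2%N.
Proof.
have <- : <<X>>%VS = {: L}%VS.
  apply/eqP; rewrite eqEsubv subvf /=; apply/subvP => x _.
  have [a [b ->]] := quad_all x; apply: memvD; apply: memvZ; apply: memv_span;
    by rewrite !inE eqxx ?orbT.
by have /eqnP := quad_free; rewrite size_tuple.
Qed.

Let cs (x : L) : K := coord X 0 x.
Let c1 (x : L) : K := coord X 1 x.

Lemma quad_coord a b : cs (a%:A + b *: s) = b /\ c1 (a%:A + b *: s) = a.
Proof.
have E0 (i : 'I_2) : coord X i s = (0 == i)%:R by exact: (coord_free 0 i quad_free).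
have E1 (i : 'I_2) : coord X i 1 = (1 == i)%:R by exact: (coord_free 1 i quad_free).
rewrite /cs /c1 !linearD !linearZ /= !E0 !E1 /=.
by rewrite !mulr0 !mulr1 add0r addr0.
Qed.

Lemma quad_morph (A : falgType K) (al : A) : al * al = - c%:R ->
  exists f : {lrmorphism L -> A}, forall a b, f (a%:A + b *: s) = a%:A + b *: al.
Proof.
move=> al2; pose f0 (x : L) : A := (c1 x)%:A + cs x *: al.
have fE a b : f0 (a%:A + b *: s) = a%:A + b *: al.
  by rewrite /f0; have [-> ->] := quad_coord a b.
have f_lin : linear f0.
  move=> k x y.
  have e i : coord X i (k *: x + y) = k * coord X i x + coord X i y by rewrite linearP.
  by rewrite /f0 /cs /c1 !e scalerDr !scalerDl !scalerA addrACA.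
have f_mul : monoid_morphism f0.
  split; first by rewrite -[1](_ : 1%:A + 0 *: s = 1) ?fE ?scale0r ?addr0 ?scale1r.
  move=> x y; have [a [b ->]] := quad_all x; have [e [g ->]] := quad_all y.
  have mulE (A' : falgType K) (u : A') : u * u = - c%:R ->
      (a%:A + b *: u) * (e%:A + g *: u) = (a * e - b * g * c%:R)%:A + (a * g + b * e) *: u.
    have kc k : k *: (- c%:R : A') = (- (k * c%:R))%:A.
      by rewrite scalerN scaleNr mulr_natr -scalerMnl scalerMnr.
    move=> u2; rewrite mulrDl !mulrDr !mulr_algl -!scalerAl -!scalerAr mulr1 u2 !scalerA kc.
    by rewrite [X in _ + X]addrC addrACA -!scalerDl.
  by rewrite (mulE L s s_sqr_nat) !fE (mulE A al al2).
pose f : {lrmorphism L -> A} := HB.pack f0 (GRing.isLinear.Build K L A *:%R f0 f_lin)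
  (GRing.isMonoidMorphism.Build L A f0 f_mul).
by exists f.
Qed.

Lemma quad_conj_int a b : integers L (a%:A + b *: s) ->
  integers K (2 * a) /\ integers K (a ^+ 2 + b ^+ 2 * c%:R).
Proof.
move=> xi; have [|f fE] := @quad_morph L (- s); first by rewrite mulrNN s_sqr_nat.
have xi' : integers L (a%:A + b *: - s) by rewrite -fE; apply/integers_morph.
split; apply/(integers_morph (GRing.in_alg L)).
  rewrite [X in integers L X](_ : _ = (a%:A + b *: s) + (a%:A + b *: - s)); first exact: integersD.
  by rewrite scalerN addrACA subrr addr0 -mulr2n rmorphM rmorph_nat /= mulr_natl.
rewrite [X in integers L X](_ : _ = (a%:A + b *: s) * (a%:A + b *: - s)); first exact: integersM.
transitivity (GRing.in_alg L a ^+ 2 + GRing.in_alg L b ^+ 2 * c%:R); first by ring.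
rewrite /= -[b *: s]mulr_algl -[b *: - s]mulr_algl; move: (a%:A) (b%:A) => u w; transitivity (u ^+ 2 - w ^+ 2 * (s * s)); last by ring.
by rewrite s_sqr_nat; ring.
Qed.

Variables (B : falgType K) (i_inf : {rmorphism B -> 'M[R]_2}) (OB : set B).
Hypothesis i_sg : restricts_to sg i_inf.
Hypothesis OBD : forall x y, OB x -> OB y -> OB (x + y).
Hypothesis OBZ : forall k x, integers K k -> OB x -> OB (k *: x).
Hypothesis OB_1 : OB 1.
Hypothesis OB_quad : forall y, OB y ->
  exists t n, [/\ integers K t, integers K n & y * y = t *: y - n%:A].
Hypothesis even_sqr : forall x : K, integers K x ->
  (exists2 z, integers K z & x * x = 2 * z) -> exists2 z, integers K z & x = 2 * z.

(** Four times the norm is [(2a)^2 + c (2b)^2], so [(c * 2b)^2] is [c] times an integer; [div_sqr]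
    then lets [c] be cancelled. *)
Lemma quad_int_coords (div_sqr : forall x y : K, integers K x -> integers K y ->
    x ^+ 2 = c%:R * y -> exists2 z, integers K z & x = c%:R * z) a b :
  integers L (a%:A + b *: s) -> integers K (2 * a) /\ integers K (2 * b).
Proof.
move=> /quad_conj_int[Ai Ni]; split=> //.
have c0 : c%:R != 0 :> K by exact: natr_neq0.
pose w := 4 * (a ^+ 2 + b ^+ 2 * c%:R) - (2 * a) ^+ 2.
have wi : integers K w.
  by apply: integersB; [apply: integersM => //; exact: integers_nat|exact: integersX].
have y2 : (c%:R * (2 * b)) ^+ 2 = c%:R * w by rewrite /w; ring.
have yi : integers K (c%:R * (2 * b)).
  apply: (@integers_root _ (Poly [:: - (c%:R * w); 0; 1])).
  - by rewrite monicE lead_coefE (@PolyK _ 0) ?oner_neq0.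
  - rewrite /root horner_Poly /=; apply/eqP.
    transitivity ((c%:R * (2 * b)) ^+ 2 - c%:R * w); first by ring.
    by rewrite y2 subrr.
  - move=> [|[|[|i]]]; rewrite coef_Poly /= ?nth_nil; try exact: integers1; try exact: integers0.
    by apply: integersN; apply: integersM => //; exact: integers_nat.
by have [z zi /(mulfI c0) ->] := div_sqr _ _ yi wi y2.
Qed.

(** The vector [(t, 1)] is an eigenvector of [M], hence of every [a + b M]. *)
Lemma fix_combination (M : 'M[R]_2) (a b : R) t : 0 < \det M -> upper R t ->
  mobius M t = t -> \det (a%:M + b *: M) != 0 -> mobius (a%:M + b *: M) t = t.
Proof.
move=> M0 ut E d0; have dM := den_neq0 ut (lt0r_neq0 M0).
have nM : num M t = t * den M t by rewrite -[X in X * _]E mobiusE divfK.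
have dD := den_neq0 ut d0.
rewrite mobiusE; apply: (mulIf dD); rewrite divfK//.
have -> : den (a%:M + b *: M) t = (real_complex R a) + (real_complex R b) * den M t.
  by rewrite /den !mxE /= mulr1n mulr0n add0r !(rmorphD, rmorphM) /=; ring.
transitivity ((real_complex R a) * t + (real_complex R b) * num M t); last by rewrite nM; ring.
by rewrite /num !mxE /= mulr1n mulr0n add0r !(rmorphD, rmorphM) /=; ring.
Qed.

(** Optimality is reduced to one inclusion, the hypothesis on integers of [L]. For the other, an
    element whose image lies in the order satisfies a monic quadratic equation with integral
    coefficients. *)
Lemma CM_of_embedding (al : B) (phi : R[i] -> option R[i]) t : al * al = - c%:R ->
  0 < \det (i_inf al) -> upper R t -> mobius (i_inf al) t = t ->
  (forall a b, integers L (a%:A + b *: s) -> OB (a%:A + b *: al)) ->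
  is_CM_point OB i_inf phi L (phi t).
Proof.
move=> al2 d0 ut fx HO; split; first by split; [exact: quad_dim|exact: no_real].
have [f fE] := quad_morph al2; exists f, t; split=> //.
- move=> x; have [a [b xE]] := quad_all x; split=> [Ofx|xi]; last first.
    by rewrite xE fE; apply: HO; rewrite -xE.
  have [u [n [ui ni E]]] := OB_quad Ofx.
  have Ex : x * x = u *: x - n%:A.
    by apply: (fmorph_inj f); rewrite rmorphM E rmorphB /= !linearZ /= rmorph1.
  apply: (@integers_root _ (Poly [:: n%:A; - u%:A; 1])).
  - by rewrite monicE lead_coefE (@PolyK _ 0) ?oner_neq0.
  - rewrite /root horner_Poly /=; apply/eqP.
    transitivity (x * x - u%:A * x + n%:A); first by ring.
    by rewrite Ex mulr_algl; ring.
  - move=> [|[|[|i]]]; rewrite coef_Poly /= ?nth_nil; try exact: integers1; try exact: integers0.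
      exact/(integers_morph (GRing.in_alg L)).
    by apply: integersN; exact/(integers_morph (GRing.in_alg L)).
move=> x x0; have dx : \det (i_inf (f x)) != 0.
  have := congr1 (fun b => \det (i_inf (f b))) (divff x0).
  rewrite !rmorphM /= !rmorph1 det1.
  rewrite (_ : i_inf (f x) * i_inf (f x^-1) = i_inf (f x) *m i_inf (f x^-1)) // det_mulmx.
  by apply: contra_eq_neq => ->; rewrite mul0r eq_sym oner_neq0.
move: dx; have [a [b ->]] := quad_all x; rewrite fE rmorphD /= i_sg.
rewrite (restricts_scale i_sg).
exact: fix_combination.
Qed.
End QuadraticExtension.

(** * Integers of the three CM fields *)

Section CMPoints.
Variables (R : realType) (K : fieldExtType rat) (sg : {rmorphism K -> R}).
Variables (B : falgType K) (i_inf : {rmorphism B -> 'M[R]_2}) (OB : set B).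
Hypothesis i_sg : restricts_to sg i_inf.
Hypothesis OBD : forall x y, OB x -> OB y -> OB (x + y).
Hypothesis OBZ : forall k x, integers K k -> OB x -> OB (k *: x).
Hypothesis OB_1 : OB 1.
Hypothesis OB_quad : forall y, OB y ->
  exists t n, [/\ integers K t, integers K n & y * y = t *: y - n%:A].
Hypothesis even_sqr : forall x : K, integers K x ->
  (exists2 z, integers K z & x * x = 2 * z) -> exists2 z, integers K z & x = 2 * z.

(** The integers of [L] have integral coordinates on [1, s]: from [4 N = (2a)^2 + 2 (2b)^2] the
    integer [2a] is even, and then [(2b)^2 = 2 (N - a^2)] makes [2b] even. *)
Lemma CM_sqrt2 (L : fieldExtType K) (al : B) phi t : is_sqrt_ext L (- 2) ->
  OB al -> al * al = - 2 -> 0 < \det (i_inf al) -> upper R t ->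
  mobius (i_inf al) t = t -> is_CM_point OB i_inf phi L (phi t).
Proof.
move=> [s s2 sg'] Oal al2 d0 ut fx.
apply: (@CM_of_embedding R K sg L s 2 isT s2 sg' B i_inf OB i_sg OB_quad al) => // a b xi.
have dv x y : integers K x -> integers K y -> x ^+ 2 = 2 * y -> exists2 z, integers K z & x = 2 * z.
  by move=> xi' yi E; apply: even_sqr => //; exists y.
have [Ai Bi] := quad_int_coords sg (isT : (0 < 2)%N) s2 sg' dv xi.
have [_ Ni] := quad_conj_int sg (isT : (0 < 2)%N) s2 sg' xi.
have K2 : (2 : K) != 0 by exact: natr_neq0.
have [u ui E] : exists2 z, integers K z & 2 * a = 2 * z.
  apply: even_sqr => //; exists (2 * (a ^+ 2 + b ^+ 2 * 2) - (2 * b) ^+ 2).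
    by apply: integersB; [apply: integersM => //; exact: integers_nat|exact: integersX].
  by ring.
have {}E : a = u by exact: (mulfI K2).
have [w wi E'] : exists2 z, integers K z & 2 * b = 2 * z.
  apply: even_sqr => //; exists ((a ^+ 2 + b ^+ 2 * 2) - a ^+ 2).
    by apply: integersB => //; rewrite E; exact: integersX.
  by ring.
have {}E' : b = w by exact: (mulfI K2).
by apply: OBD; apply: OBZ => //; rewrite ?E ?E'.
Qed.

(** The integers of [L] have integral coordinates on [1, (1 + s) / 2]: writing [p = 2 q + 1], the
    square of [2a - 2b] is even, so [a - b] is integral. *)
Lemma CM_sqrt_odd (p : nat) (L : fieldExtType K) (om : B) phi t :
  (p = 3 \/ p = 7)%N ->
  (forall x y : K, integers K x -> integers K y -> x ^+ 2 = p%:R * y ->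
     exists2 z, integers K z & x = p%:R * z) ->
  is_sqrt_ext L (- p%:Z) -> OB om -> (2 * om - 1) * (2 * om - 1) = - p%:R ->
  0 < \det (i_inf (2 * om - 1)) -> upper R t ->
  mobius (i_inf (2 * om - 1)) t = t -> is_CM_point OB i_inf phi L (phi t).
Proof.
move=> p37 dv [s s2 sg'] Oom al2 d0 ut fx.
have p0 : (0 < p)%N by case: p37 => ->.
apply: (@CM_of_embedding R K sg L s p p0 s2 sg' B i_inf OB i_sg OB_quad (2 * om - 1)) => // a b xi.
have [Ai Bi] := quad_int_coords sg p0 s2 sg' dv xi.
have [_ Ni] := quad_conj_int sg p0 s2 sg' xi.
have K2 : (2 : K) != 0 by exact: natr_neq0.
have [u ui E] : exists2 z, integers K z & 2 * a - 2 * b = 2 * z.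
  apply: even_sqr; first exact: integersB.
  have [q qE] : exists q : nat, p%:R = 2 * q%:R + 1 :> K.
    by case: p37 => ->; [exists 1%N|exists 3%N]; ring.
  exists (2 * (a ^+ 2 + b ^+ 2 * p%:R) - q%:R * (2 * b) ^+ 2 - (2 * a) * (2 * b)).
    apply: integersB; last exact: integersM.
    by apply: integersB; apply: integersM => //; try exact: integers_nat; exact: integersX.
  by rewrite qE; ring.
have -> : a%:A + b *: (2 * om - 1) = u%:A + (2 * b) *: om.
  have {}E : a = u + b by apply: (mulfI K2); rewrite mulrDr -E; ring.
  have e : b *: (2 * om) = (2 * b) *: om by rewrite mulr_natl -scaler_nat scalerA mulrC.
  by rewrite E scalerBr e scalerDl -addrA [b%:A + _]addrC subrK.
by apply: OBD; apply: OBZ.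
Qed.
End CMPoints.

(** * The cover of the upper half-plane *)

Section Cover.
Local Open Scope complex_scope.

Lemma same_point_sym (F : fieldType) n (P Q : 'rV[F]_n) : same_point P Q -> same_point Q P.
Proof. by case=> c c0 ->; exists c^-1; rewrite ?invr_neq0// scalerA mulVf// scale1r. Qed.

Lemma same_point_trans (F : fieldType) n (P Q S : 'rV[F]_n) :
  same_point P Q -> same_point Q S -> same_point P S.
Proof. by case=> c c0 -> [d d0 ->]; exists (c * d); rewrite ?mulf_neq0// scalerA. Qed.

Lemma same_point_ratio (F : fieldType) n (P Q : 'rV[F]_n) m k :
  same_point P Q -> P 0 m / P 0 k = Q 0 m / Q 0 k.
Proof. by case=> c c0 ->; rewrite !mxE -mulf_div divff// mul1r. Qed.

Lemma ord3P (P : 'I_3 -> Prop) : P 0 -> P 1 -> P 2%:R -> forall i, P i.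
Proof.
move=> P0 P1 P2 [[|[|[|//]]] i].
- by rewrite (_ : Ordinal i = 0)//; apply/val_inj.
- by rewrite (_ : Ordinal i = 1)//; apply/val_inj.
- by rewrite (_ : Ordinal i = 2%:R)//; apply/val_inj.
Qed.

Definition row3 (F : fieldType) (a b c : F) : 'rV[F]_3 :=
  \row_m (if m == 0 then a else if m == 1 then b else c).

Lemma row3E (F : fieldType) (a b c : F) :
  (row3 a b c 0 0 = a) * (row3 a b c 0 1 = b) * (row3 a b c 0 2%:R = c).
Proof. by rewrite !mxE. Qed.

Variable R : realType.
Local Notation C := R[i].

Lemma uhol_nz (f : C -> C) a : uhol f -> upper R a -> f a != 0 ->
  forall z, upper R z -> ~ near z (fun w => f w = 0).
Proof.
move=> fu ua fa z uz H; have := uhol_identity fu uz H ua.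
by move/eqP; rewrite (negPf fa).
Qed.

Lemma uhol_mul_eq0 (f g : C -> C) : uhol f -> uhol g ->
  (forall z, upper R z -> f z * g z = 0) ->
  (forall z, upper R z -> f z = 0) \/ (forall z, upper R z -> g z = 0).
Proof.
move=> fu gu E; have [?|nf] := pselect (forall z, upper R z -> f z = 0); [by left|right].
have [a [ua fa]] : exists a, upper R a /\ f a != 0.
  apply: contrapT => H; apply: nf => z uz; apply/eqP/negPn/negP => fz.
  by apply: H; exists z.
apply: (uhol_identity gu ua).
apply: near_and_imp (cont_neq0 (cdif_cont (fu a ua)) fa) (upper_near ua) => z fz uz.
by have /eqP := E z uz; rewrite mulf_eq0 (negPf fz) => /eqP.
Qed.

Variables (G1 G0 : set 'M[R]_2) (J : C -> 'rV[C]_2) (J0 : C -> 'rV[C]_3).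
Variable phi : C -> option C.
Hypothesis G1_det : forall g, G1 g -> \det g = 1.
Hypothesis JU : uniformizes G1 [set: 'rV[C]_2] J.
Hypothesis G0_V : forall g, G0 g -> exists2 h, G0 h & h *m g = 1%:M.
Hypothesis G0_sub : G0 `<=` G1.
Hypothesis J0U : uniformizes G0 (plane_cubic C) J0.
Hypothesis J0_cover : forall t, upper R t -> same_point (J t) (cover_map (J0 t)).
Hypothesis phi_def : forall t, phi t = p1_point (J t).

Let F z := J0 z 0 0.
Let G z := J0 z 0 1.
Let W z := J0 z 0 2%:R.

Definition eqv z z' := same_point (J0 z) (J0 z').

Lemma J0_uhol m : uhol (fun z => J0 z 0 m).
Proof. by case: J0U => H _ _ _ z uz; apply: derivable_cdif; exact: H. Qed.

Lemma J0_neq0 z : upper R z -> J0 z != 0.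
Proof. by case: J0U => _ H _ _ /H[]. Qed.

Lemma J0_curve z : upper R z -> curve_form (F z) (G z) (W z) = 0.
Proof. by case: J0U => _ H _ _ /H[]. Qed.

Lemma eqv_orbit z z' : upper R z -> upper R z' ->
  (eqv z z' <-> exists2 g, G0 g & z' = mobius g z).
Proof. by case: J0U => _ _ H _; exact: H. Qed.

Lemma eqv_G0 z g : upper R z -> G0 g -> eqv z (mobius g z).
Proof.
move=> uz gG; apply/eqv_orbit => //; last by exists g.
by apply: mobius_upper; rewrite // (G1_det (G0_sub gG)).
Qed.

Lemma J0_onto f g w : row3 f g w != 0 -> curve_form f g w = 0 ->
  exists2 z, upper R z & same_point (J0 z) (row3 f g w).
Proof. by move=> n0 E; case: J0U => _ _ _; apply=> //; rewrite /plane_cubic /= !row3E. Qed.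

Lemma phi_W z : upper R z ->
  phi z = if W z == 0 then None else Some (phi_form (F z) (G z) (W z) / W z ^+ 3).
Proof.
move=> uz; rewrite phi_def /p1_point; have [c c0 ->] := J0_cover uz.
rewrite !mxE /= mulf_eq0 (negPf c0) expf_eq0 /=.
by case: ifP => // _; congr Some; rewrite -mulf_div divff// mul1r.
Qed.

Lemma phi_J z z' : upper R z -> upper R z' -> (phi z = phi z' <-> same_point (J z) (J z')).
Proof.
case: JU => _ N _ _ /N[n _] /N[n' _]; rewrite !phi_def /p1_point; split; last first.
  case=> c c0 ->; rewrite !mxE mulf_eq0 (negPf c0) /=; case: ifP => // _.
  by congr Some; rewrite -mulf_div divff// mul1r.
have nz (P : 'rV[C]_2) : P != 0 -> P 0 1 = 0 -> P 0 0 != 0.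
  move=> /eqP P0 P1; apply/eqP => P00; apply: P0; apply/rowP; apply: ord2P; by rewrite mxE.
have [E|E] := eqVneq (J z 0 1) 0; have [E'|E'] := eqVneq (J z' 0 1) 0 => // H.
  exists (J z 0 0 / J z' 0 0); first by rewrite mulf_neq0// ?invr_neq0// nz.
  by apply/rowP; apply: ord2P; rewrite !mxE ?divfK ?nz// E E' mulr0.
exists (J z 0 1 / J z' 0 1); first by rewrite mulf_neq0// invr_neq0.
case: H => H; apply/rowP; apply: ord2P; rewrite !mxE ?divfK//.
by rewrite -[LHS](divfK E) H; ring.
Qed.

Lemma phi_orbit z z' : upper R z -> upper R z' ->
  (phi z = phi z' <-> exists2 g, G1 g & z' = mobius g z).
Proof. by move=> uz uz'; rewrite (phi_J uz uz'); case: JU => _ _ H _; exact: H. Qed.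

Lemma eqv_phi z z' : upper R z -> upper R z' -> eqv z z' -> phi z = phi z'.
Proof.
move=> uz uz' /(eqv_orbit uz uz')[g gG ->]; apply/phi_orbit => //; last by exists g => //; exact: G0_sub.
by apply: mobius_upper; rewrite // (G1_det (G0_sub gG)).
Qed.

Lemma phi_nonconst t : upper R t -> ~ near t (fun z => phi z = phi t).
Proof.
move=> ut H; have [_ N _ _] := JU; have [n _] := N t ut.
have ab : (J t 0 1 != 0) || (- J t 0 0 != 0).
  rewrite -negb_and oppr_eq0; apply/negP => /andP[/eqP a /eqP b]; case/eqP: n.
  by apply/rowP; apply: ord2P; rewrite mxE.
apply: (J_lin_nz JU ab ut); apply: near_and_imp H (upper_near ut) => z Hz uz.
have [c c0 ->] := proj1 (phi_J uz ut) Hz; rewrite !mxE; ring.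
Qed.

(** Some coordinate ratio [x m] of the cubic has nonzero derivative at a point [u] near [t], since
    otherwise [phi] would be locally constant. An element [g] of [G0] takes [b u] back to [u], and
    [g *m b] preserves [x m] near [u]. By the chain rule its multiplier at [u] is 1, so it is
    scalar. *)
Lemma rigid b t : 0 < \det b -> upper R t -> near t (fun z => eqv (mobius b z) z) ->
  exists g c, G0 g /\ b = c *: g.
Proof.
move=> b0 ut Hb.
have [k tk] : exists k, J0 t 0 k != 0.
  apply: contrapT => H; case/eqP: (J0_neq0 ut); apply/rowP => k; rewrite mxE.
  by apply/eqP/negPn/negP => E; apply: H; exists k.
pose x m z := J0 z 0 m / J0 z 0 k.
have nk := cont_neq0 (cdif_cont (J0_uhol k ut)) tk.
have xd m z : upper R z -> J0 z 0 k != 0 -> cdif (x m) z.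
  by move=> uz zk; apply: cdifM; [|apply: cdifV => //]; exact: J0_uhol.
have [m Hm] : exists m, ~ near t (fun z => cder (x m) z 0).
  apply: contrapT => H.
  have Hn m : near t (fun z => x m z = x m t).
    apply: near_cst_der; last by apply: contrapT => N; apply: H; exists m.
    by apply: near_and_imp nk (upper_near ut) => z zk uz; exact: xd.
  apply: (phi_nonconst ut).
  apply: near_and_imp (near_and (Hn 0) (near_and (Hn 1) (Hn 2%:R))) (near_and nk (upper_near ut)).
  move=> z [E0 [E1 E2]] [zk uz]; apply: eqv_phi => //.
  exists (J0 z 0 k / J0 t 0 k); first by rewrite mulf_neq0 ?invr_neq0.
  have E m : x m z = x m t -> J0 z 0 m = J0 z 0 k / J0 t 0 k * J0 t 0 m.
    move=> Em; rewrite -[LHS](divfK zk) -/(x m z) Em /x; ring.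
  by apply/rowP; apply: ord3P; rewrite mxE; apply: E.
have [u [[[zk uz] Hu] Nu]] : exists u, ((J0 u 0 k != 0 /\ upper R u) /\
    near u (fun z => eqv (mobius b z) z)) /\ ~ cder (x m) u 0.
  apply: contrapT => H; apply: Hm.
  apply: near_imp (near_and (near_and nk (upper_near ut)) (near_near Hb)) => z Hz.
  by apply: contrapT => N; apply: H; exists z.
have ubu := mobius_upper b0 uz.
have [g gG E] := proj1 (eqv_orbit ubu uz) (near_pt Hu).
have g1 := G1_det (G0_sub gG); have g0 : 0 < \det g by rewrite g1.
have d0 : 0 < \det (g *m b) by rewrite det_mulmx g1 mul1r.
have fixu : mobius (g *m b) u = u by rewrite mobiusM.
have [D HD] := xd m u uz zk.
have HD2 : cder (fun z => x m (mobius (g *m b) z)) u (D * mult (g *m b) u).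
  by apply: cder_comp; [exact: cder_mobius|rewrite fixu].
have HD3 : cder (x m) u (D * mult (g *m b) u).
  apply: cder_ext HD2; apply: near_and_imp Hu (upper_near uz) => z Hz vz.
  apply: same_point_ratio; apply: same_point_trans Hz; apply: same_point_sym.
  by rewrite mobiusM//; apply: eqv_G0 => //; exact: mobius_upper.
have D0 : D != 0 by apply/eqP => D0; apply: Nu; rewrite -D0.
have M1 : mult (g *m b) u = 1.
  by apply: (mulfI D0); rewrite mulr1; exact: cder_uniq HD3 HD.
have [c Ec] := mult1_scalar d0 uz fixu M1; have [h hG hg] := G0_V gG.
exists h, c; split=> //; rewrite -[b]mul1mx -hg -mulmxA Ec.
by rewrite mul_mx_scalar.
Qed.
End Cover.

(** * The Atkin-Lehner action on the cubic *)

Section Involution.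
Local Open Scope complex_scope.
Variable R : realType.
Local Notation C := R[i].
Variables (G1 G0 : set 'M[R]_2) (J : C -> 'rV[C]_2) (J0 : C -> 'rV[C]_3).
Variable phi : C -> option C.
Hypothesis G1_V : forall g, G1 g -> exists2 h, G1 h & h *m g = 1%:M.
Hypothesis G1_det : forall g, G1 g -> \det g = 1.
Hypothesis JU : uniformizes G1 [set: 'rV[C]_2] J.
Hypothesis G0_V : forall g, G0 g -> exists2 h, G0 h & h *m g = 1%:M.
Hypothesis G0_sub : G0 `<=` G1.
Hypothesis G0_index : exists2 L : seq 'M[R]_2, forall l, l \in L -> G1 l &
  forall g, G1 g -> exists2 h, G0 h & exists2 l, l \in L & g = h *m l.
Hypothesis J0U : uniformizes G0 (plane_cubic C) J0.
Hypothesis phi_def : forall t, phi t = p1_point (J t).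

Let F z := J0 z 0 0.
Let G z := J0 z 0 1.
Let W z := J0 z 0 2%:R.
Variables cf cg cw : C.
Hypothesis cw0 : cw != 0.
Let L z := cf * F z + cg * G z + cw * W z.
Variables a0 p0 p1 p2 p3 : C.
Hypotheses (a0_neq0 : a0 != 0) (p3_neq0 : p3 != 0).
Hypothesis curve : forall z, upper R z ->
  a0 * F z ^+ 2 * L z = p3 * G z ^+ 3 + p2 * G z ^+ 2 * L z + p1 * G z * L z ^+ 2 + p0 * L z ^+ 3.
Let Fu : uhol F := J0_uhol J0U 0.
Let Gu : uhol G := J0_uhol J0U 1.

Let Lu : uhol L.
Proof.
have c (k : C) m : uhol (fun z => k * J0 z 0 m).
  by move=> z uz; apply: cdifM; [exact: cdif_cst|exact: (J0_uhol J0U)].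
by move=> z uz; apply: cdifD; [apply: cdifD|]; apply: (c).
Qed.

Let coord0 z : upper R z -> F z = 0 -> G z = 0 -> L z = 0 -> False.
Proof.
move=> /(J0_neq0 J0U) /eqP N F0 G0' L0; apply: N; apply/rowP; apply: ord3P; rewrite !mxE //.
by move: L0; rewrite /L F0 G0' !mulr0 !add0r => /eqP; rewrite mulf_eq0 (negPf cw0) => /eqP.
Qed.

Let WL y : J0 y 0 2%:R = (L y - cf * F y - cg * G y) / cw.
Proof. by apply: (canRL (mulfK cw0)); rewrite /L -/(W y); ring. Qed.

Variable b : 'M[R]_2.
Hypothesis b0 : 0 < \det b.
Hypothesis b_eqv : forall z z', upper R z -> upper R z' -> eqv J0 z z' ->
  eqv J0 (mobius b z) (mobius b z').
Hypothesis b_inv : forall z, upper R z -> eqv J0 (mobius b (mobius b z)) z.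
Hypothesis b_G0 : ~ exists g c, G0 g /\ b = c *: g.
Variables t1 t2 t3 : C.
Hypotheses (ut1 : upper R t1) (ut2 : upper R t2) (ut3 : upper R t3).
Hypotheses (F1 : F t1 = 0) (F2 : F t2 = 0).
Hypotheses (b1 : eqv J0 (mobius b t1) t1) (b2 : eqv J0 (mobius b t2) t2)
  (b3 : eqv J0 (mobius b t3) t3).
(** The line joining the flex [(1 : 0 : 0)] to [J0 t]. When [F t = 0] it is tangent to the cubic at
    that point, so [u t1 / u t2] has divisor [2 Q1 - 2 Q2]. *)
Let u t z := L t * G z - G t * L z.
Hypotheses (d12 : u t1 t2 != 0) (d13 : u t1 t3 != 0) (d23 : u t2 t3 != 0).

Let ub z : upper R z -> upper R (mobius b z) := mobius_upper b0.

Lemma uhol_mobius (f : C -> C) : uhol f -> uhol (fun z => f (mobius b z)).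
Proof. by move=> fu z uz; apply: cdif_comp; [exact: cdif_mobius|apply: fu; exact: ub]. Qed.

Lemma L_neq0 t : upper R t -> F t = 0 -> L t != 0.
Proof.
move=> ut Ft; apply/eqP => Lt; apply: (coord0 ut Ft _ Lt).
have := curve ut; rewrite Ft Lt !expr0n /= !mulr0 !addr0 => /esym/eqP.
by rewrite mulf_eq0 (negPf p3_neq0) expf_eq0 /= => /eqP.
Qed.

(** Where [(G : L)] agrees with its value at [t], the right side of the equation vanishes as it does
    at [t], so [F z = 0]; only the flex, with [G = L = 0], escapes. *)
Lemma zero_u t z : upper R t -> F t = 0 -> upper R z -> u t z = 0 ->
  (G z = 0 /\ L z = 0) \/ eqv J0 z t.
Proof.
move=> ut Ft uz /eqP; rewrite subr_eq0 => /eqP E; have Lt := L_neq0 ut Ft.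
have [Lz|Lz] := eqVneq (L z) 0.
  left; split=> //; move: E; rewrite Lz mulr0 => /eqP.
  by rewrite mulf_eq0 (negPf Lt) => /eqP.
right; pose k := L z / L t; have k0 : k != 0 by rewrite mulf_neq0// invr_neq0.
have Lk : L z = k * L t by rewrite divfK.
have Gk : G z = k * G t by apply: (mulfI Lt); rewrite E Lk; ring.
have Fz : F z = 0.
  have : a0 * F z ^+ 2 * L z = k ^+ 3 * (a0 * F t ^+ 2 * L t).
    rewrite (curve ut) (curve uz) Lk Gk.
    by move: (k) (G t) (L t) => x y w; ring.
  rewrite Ft expr0n /= !(mulr0, mul0r) => /eqP; rewrite mulf_eq0 (negPf Lz) orbF mulf_eq0 expf_eq0 /=.
  by rewrite (negPf a0_neq0) => /eqP.
exists k => //; apply/rowP; apply: ord3P; rewrite mxE //.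
- by rewrite -/(F z) -/(F t) Fz Ft mulr0.
- by rewrite !WL Fz Ft Gk Lk; ring.
Qed.

Lemma u_uhol t : uhol (u t).
Proof.
by move=> z uz; apply: cdifB; apply: cdifM; [exact: cdif_cst|exact: Gu|exact: cdif_cst|exact: Lu].
Qed.

Lemma u1_nz z : upper R z -> ~ near z (fun w => u t1 w = 0).
Proof. exact: uhol_nz (u_uhol t1) ut3 d13 z. Qed.

Lemma u2_nz z : upper R z -> ~ near z (fun w => u t2 w = 0).
Proof. exact: uhol_nz (u_uhol t2) ut3 d23 z. Qed.

Let r z := u t1 z / u t2 z.

Lemma r_eqv z z' : eqv J0 z z' -> r z = r z'.
Proof.
case=> c c0 E; have uE t : u t z = c * u t z'.
  by rewrite /u /L /F /G /W E !mxE; ring.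
by rewrite /r !uE -mulf_div divff// mul1r.
Qed.

Lemma r_lim z : upper R z -> ~ eqv J0 z t1 -> ~ eqv J0 z t2 -> exists2 c, c != 0 & clim r z c.
Proof.
move=> uz n1 n2.
have [[Gz Lz]|nQ] := pselect (G z = 0 /\ L z = 0); last first.
  have z1 : u t1 z != 0 by apply/eqP => /(zero_u ut1 F1 uz)[].
  have z2 : u t2 z != 0 by apply/eqP => /(zero_u ut2 F2 uz)[].
  exists (r z); first exact: mulf_neq0 z1 (invr_neq0 z2).
  apply/cont_clim; apply: contM; first exact/cdif_cont/(u_uhol t1).
  by apply: (contV z2); exact/cdif_cont/(u_uhol t2).
have L1 := L_neq0 ut1 F1; have L2 := L_neq0 ut2 F2.
exists (L t1 / L t2); first exact: mulf_neq0 L1 (invr_neq0 L2).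
(* At the flex both lines vanish. The equation reads [L * Y = p3 * G ^+ 3] with [Y z != 0], so [L]
   is of third order in [G]. Dividing both lines by [G] leaves factors that tend to [L t1] and
   [L t2]. *)
pose Y w := a0 * F w ^+ 2 - p2 * G w ^+ 2 - p1 * G w * L w - p0 * L w ^+ 2.
have YE w : upper R w -> L w * Y w = p3 * G w ^+ 3.
  move=> uw; have Hw := curve uw.
  have -> : L w * Y w = a0 * F w ^+ 2 * L w - p2 * G w ^+ 2 * L w
    - p1 * G w * L w ^+ 2 - p0 * L w ^+ 3 by rewrite /Y; ring.
  by rewrite Hw; move: (G w) (L w) => x y; ring.
have Yz : Y z != 0.
  apply/eqP; rewrite /Y Gz Lz !expr0n /= !mulr0 !subr0 => /eqP.
  rewrite mulf_eq0 expf_eq0 (negPf a0_neq0) /= => /eqP Fz.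
  exact: (coord0 uz Fz Gz Lz).
have Yc : cont Y z.
  have kc (f : C -> C) (k : C) : cont f z -> cont (fun w => k * f w) z.
    by move=> fc; apply: contM => //; exact: cont_cst.
  have Fc := cdif_cont (Fu uz); have Gc := cdif_cont (Gu uz); have Lc := cdif_cont (Lu uz).
  apply: contB; [apply: contB; [apply: contB|]|]; try by apply: (kc); apply: contX.
  by apply: contM => //; exact: kc.
pose s t w := L t - G t * (p3 * G w ^+ 2 / Y w).
have sL t : clim (s t) z (L t).
  rewrite -[L t]subr0; apply: climB; first exact: clim_cst.
  rewrite -(mulr0 (G t)); apply: climM; first exact: clim_cst.
  rewrite -(mul0r (Y z)^-1); apply: climM; last by apply: climV => //; exact/cont_clim.
  rewrite -(mulr0 (p3 : C)); apply: climM; first exact: clim_cst.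
  have := proj1 (cont_clim _ _) (contX 2 (cdif_cont (Gu uz))).
  by rewrite Gz expr0n.
apply: clim_ext (climM (sL t1) (climV L2 (sL t2))).
have Gnz : ~ near z (fun w => G w = 0).
  have [g0|g0] := eqVneq (G t1) 0; last exact: uhol_nz Gu ut1 g0 z uz.
  have g0' : G t2 != 0 by apply: contraNneq d12 => e; rewrite /u e g0 mulr0 mul0r subrr.
  exact: uhol_nz Gu ut2 g0' z uz.
apply: near_and_imp (isolated_zeros (uhol_near Gu uz) Gnz)
  (near_and (cont_neq0 Yc Yz) (upper_near uz)) => w Gw [Yw uw] wz.
have {Gw} Gw := Gw wz.
have E t : u t w = G w * s t w.
  have Lw : L w = p3 * G w ^+ 3 / Y w by rewrite -YE// mulfK.
  by rewrite /u Lw /s; field.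
by rewrite /r !E -mulf_div divff// mul1r.
Qed.

Lemma eqv_fixed z : upper R z -> eqv J0 (mobius b z) z -> exists a,
  [/\ 0 < \det a, mobius a z = z &
      forall w, upper R w -> eqv J0 (mobius b w) (mobius a w)].
Proof.
move=> uz /(eqv_orbit J0U (ub uz) uz)[g gG E]; have g1 := G1_det (G0_sub gG).
have g0 : 0 < \det g by rewrite g1.
exists (g *m b); split=> [||w uw]; first by rewrite det_mulmx g1 mul1r.
  by rewrite mobiusM.
by rewrite mobiusM//; apply: (eqv_G0 G1_det G0_sub J0U) => //; exact: ub.
Qed.

Let q z := r (mobius b z) / r z.

(** At a point fixed on the cubic, [r] may have a zero or a pole, and [rot_lim] provides the limit
    of each factor. At any other point both [z] and its image avoid [Q1] and [Q2], where alone [r]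
    degenerates. *)
Lemma q_lim z : upper R z -> exists c, clim q z c.
Proof.
move=> uz; have [E|nE] := pselect (eqv J0 (mobius b z) z).
  have [a [da fixa aE]] := eqv_fixed uz E.
  have [m Hm _] := rot_lim da uz fixa (uhol_near (u_uhol t1) uz) (u1_nz uz).
  have [n Hn _] := rot_lim da uz fixa (uhol_near (u_uhol t2) uz) (u2_nz uz).
  have k0 : mult a z ^+ n != 0 by rewrite expf_neq0// mult_neq0.
  exists (mult a z ^+ m / mult a z ^+ n); apply: clim_ext (climM Hm (climV k0 Hn)).
  apply: near_imp (upper_near uz) => w uw _.
  by rewrite /q (r_eqv (aE w uw)) /r !invfM !invrK; ring.
have tr := same_point_trans; have sy := same_point_sym.
have n t : upper R t -> eqv J0 (mobius b t) t -> ~ eqv J0 z t.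
  move=> ut bt H; apply: nE.
  exact: tr (tr _ _ _ _ _ (b_eqv uz ut H) bt) (sy _ _ _ _ H).
have n' t : upper R t -> eqv J0 (mobius b t) t -> ~ eqv J0 (mobius b z) t.
  move=> ut bt H; apply: nE; apply: (tr _ _ _ _ _ H).
  apply: (tr _ _ _ _ _ (sy _ _ _ _ bt)); apply: (tr _ _ _ _ _ (sy _ _ _ _ (b_eqv (ub uz) ut H))).
  exact: b_inv.
have [c c0 Hc] := r_lim uz (n _ ut1 b1) (n _ ut2 b2).
have [c' _ Hc'] := r_lim (ub uz) (n' _ ut1 b1) (n' _ ut2 b2).
exists (c' / c); apply: climM; last exact: climV.
exact: clim_mobius.
Qed.

Let P z := u t1 z * u t2 z * (u t1 (mobius b z) * u t2 (mobius b z)).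

Lemma P_uhol : uhol P.
Proof.
move=> z uz; apply: cdifM; apply: cdifM.
- exact: (u_uhol t1 uz).
- exact: (u_uhol t2 uz).
- exact: (uhol_mobius (u_uhol t1) uz).
- exact: (uhol_mobius (u_uhol t2) uz).
Qed.

Lemma P_pnear z : upper R z -> pnear z (fun w => P w != 0).
Proof.
move=> uz; have bz := ub uz.
have H1 := isolated_zeros (uhol_near (u_uhol t1) uz) (u1_nz uz).
have H2 := isolated_zeros (uhol_near (u_uhol t2) uz) (u2_nz uz).
have H3 := pnear_mobius b0 uz (isolated_zeros (uhol_near (u_uhol t1) bz) (u1_nz bz)).
have H4 := pnear_mobius b0 uz (isolated_zeros (uhol_near (u_uhol t2) bz) (u2_nz bz)).
apply: near_and_imp (near_and H1 H2) (near_and H3 H4) => w [K1 K2] [K3 K4] wz.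
by rewrite /P !mulf_neq0 ?K1 ?K2 ?K3 ?K4.
Qed.

Lemma q_cdif z : upper R z -> P z != 0 -> cdif q z.
Proof.
move=> uz; rewrite /P !mulf_eq0 !negb_or => /andP[/andP[n1 n2] /andP[n3 n4]].
apply: cdifM.
  apply: cdifM; first exact: (uhol_mobius (u_uhol t1) uz).
  by apply: cdifV => //; exact: (uhol_mobius (u_uhol t2) uz).
apply: cdifV; first by rewrite mulf_neq0// invr_neq0.
by apply: cdifM; [|apply: cdifV => //]; exact: (u_uhol _ uz).
Qed.

(** [q] is invariant under [G0] because [b] respects the fibres of [J0], hence it is constant. Its
    value is read off at the third fixed point, where [r] is finite and nonzero. *)
Lemma q_cst z : upper R z -> clim q z 1.
Proof.
have [c Hc] : exists c, forall z, upper R z -> clim q z c.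
  apply: (invariant_cst G1_V G1_det JU G0_index G0_sub).
    move=> w uw; split; last exact: q_lim.
    by apply: near_and_imp (P_pnear uw) (upper_near uw) => y Py uy yw; apply: q_cdif => //; exact: Py.
  move=> g w gG uw; apply: near_imp (upper_near uw) => y uy _.
  have E := eqv_G0 G1_det G0_sub J0U uy gG.
  have uy' : upper R (mobius g y) by apply: mobius_upper => //; rewrite (G1_det (G0_sub gG)).
  by rewrite /q -(r_eqv E) -(r_eqv (b_eqv uy uy' E)).
suff <- : c = 1 by exact: Hc.
have r3 : r t3 != 0 by rewrite mulf_neq0// invr_neq0.
have rc : cont r t3.
  apply: contM; first exact/cdif_cont/(u_uhol t1).
  by apply: contV => //; exact/cdif_cont/(u_uhol t2).
have [a [da fixa aE]] := eqv_fixed ut3 b3.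
apply: clim_uniq (Hc t3 ut3) _; rewrite -(divff r3).
have rl := proj1 (cont_clim _ _) rc.
apply: clim_ext (climM (_ : clim (fun w => r (mobius a w)) t3 _) (climV r3 rl)).
  by apply: near_imp (upper_near ut3) => w uw _; rewrite /q (r_eqv (aE w uw)).
by apply: clim_mobius => //; rewrite fixa.
Qed.

(** [r] is a homography of [G / L], invertible because [u t1 t2 != 0], so preserving [r] means
    preserving [(G : L)]. The function [P] collects the denominators. *)
Lemma GL_inv z : upper R z -> G (mobius b z) * L z = L (mobius b z) * G z.
Proof.
pose S z := G (mobius b z) * L z - L (mobius b z) * G z.
have Su : uhol S.
  move=> w uw; apply: cdifB; apply: cdifM.
  - exact: (uhol_mobius Gu uw).
  - exact: (Lu uw).
  - exact: (uhol_mobius Lu uw).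
  - exact: (Gu uw).
have PS w : upper R w -> P w * S w = 0.
  move=> uw; have [->|Pw] := eqVneq (P w) 0; first by rewrite mul0r.
  have q1 : q w = 1.
    by apply: clim_uniq _ (q_cst uw); apply/cont_clim/cdif_cont/q_cdif.
  move: (Pw); rewrite /P !mulf_eq0 !negb_or => /andP[/andP[n1 n2] /andP[n3 n4]].
  have E : u t1 (mobius b w) * u t2 w = u t2 (mobius b w) * u t1 w.
    have r0 : r w != 0 by rewrite mulf_neq0// invr_neq0.
    have : r (mobius b w) = r w by rewrite -[LHS](divfK r0) -/(q w) q1 mul1r.
    by rewrite /r => /eqP; rewrite eqr_div// => /eqP ->; rewrite mulrC.
  have : u t1 t2 * S w = 0.
    have -> : u t1 t2 * S w = u t2 (mobius b w) * u t1 w - u t1 (mobius b w) * u t2 w.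
      by rewrite /u /S; ring.
    by rewrite E subrr.
  by move=> /eqP; rewrite mulf_eq0 (negPf d12) => /eqP ->; rewrite mulr0.
have [P0|S0] := uhol_mul_eq0 P_uhol Su PS; last first.
  by move=> uz; apply/eqP; rewrite -subr_eq0; apply/eqP; exact: S0.
have [w [_ _ [Pw uw]]] := pnear_pt ltr01 (near_and_imp (fun w H1 H2 wz => conj (H1 wz) H2)
  (P_pnear ut1) (upper_near ut1)).
by move: Pw; rewrite (P0 w uw) eqxx.
Qed.

(** By the equation [(F / L)^2] depends on [(G : L)] only, so it is preserved and [A * S = 0], where
    [A = 0] says that [F / L] is preserved and [S = 0] that it changes sign. One factor vanishes
    identically. If it were [A], then [b] would act trivially on the cubic, which [rigid] and [b_G0]
    exclude. *)
Lemma involution : forall z, upper R z -> let z' := mobius b z in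
  [/\ F z' * L z + L z' * F z = 0, G z' * L z = L z' * G z & F z' * G z + G z' * F z = 0].
Proof.
have Fbu := uhol_mobius Fu; have Gbu := uhol_mobius Gu; have Lbu := uhol_mobius Lu.
pose A z := F (mobius b z) * L z - L (mobius b z) * F z.
pose S z := F (mobius b z) * L z + L (mobius b z) * F z.
have Au : uhol A.
  by move=> w uw; apply: cdifB; apply: cdifM; [exact: Fbu|exact: Lu|exact: Lbu|exact: Fu].
have Su : uhol S.
  by move=> w uw; apply: cdifD; apply: cdifM; [exact: Fbu|exact: Lu|exact: Lbu|exact: Fu].
have LLu : uhol (fun z => L z * L (mobius b z)).
  by move=> w uw; apply: cdifM; [exact: Lu|exact: Lbu].
have ASu : uhol (fun z => A z * S z) by move=> w uw; apply: cdifM; [exact: Au|exact: Su].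
have Lb1 : L (mobius b t1) != 0.
  have [c c0 E] := b1; have -> : L (mobius b t1) = c * L t1.
    by rewrite /L /F /G /W E !mxE; ring.
  exact: mulf_neq0 c0 (L_neq0 ut1 F1).
have S0 : forall z, upper R z -> S z = 0.
  have LAS z : upper R z -> L z * L (mobius b z) * (A z * S z) = 0.
    move=> uz; have uz' := ub uz.
    have Hz := curve uz; have Hz' := curve uz'.
    have := GL_inv uz; rewrite /A /S.
    move: Hz Hz'; move: (F z) (G z) (L z) (F (mobius b z)) (G (mobius b z)) (L (mobius b z)) => f g l f' g' l' Hz Hz' E.
    apply: (mulfI a0_neq0); rewrite mulr0.
    have -> : a0 * (l * l' * ((f' * l - l' * f) * (f' * l + l' * f))) =
      (a0 * f' ^+ 2 * l') * l ^+ 3 - (a0 * f ^+ 2 * l) * l' ^+ 3 by ring.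
    rewrite Hz Hz'.
    have -> : (p3 * g' ^+ 3 + p2 * g' ^+ 2 * l' + p1 * g' * l' ^+ 2
        + p0 * l' ^+ 3) * l ^+ 3 =
      p3 * (g' * l) ^+ 3 + p2 * (g' * l) ^+ 2 * (l' * l)
      + p1 * (g' * l) * (l' * l) ^+ 2 + p0 * (l' * l) ^+ 3 by ring.
    by rewrite E; ring.
  have AS0 z : upper R z -> A z * S z = 0.
    have [H|H] := uhol_mul_eq0 LLu ASu LAS; last exact: H.
    by have := H t1 ut1; move/eqP; rewrite mulf_eq0 (negPf (L_neq0 ut1 F1)) (negPf Lb1).
  have [H|//] := uhol_mul_eq0 Au Su AS0.
  exfalso; apply: b_G0; apply: (rigid G1_det JU G0_V G0_sub J0U phi_def b0 ut1).
  apply: near_and_imp (upper_near ut1) (cont_neq0 (cdif_cont (Lu ut1)) (L_neq0 ut1 F1)) => z uz Lz.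
  have Lz' : L (mobius b z) != 0.
    apply/eqP => L'; apply: (coord0 (ub uz)) => //.
      have := H z uz; rewrite /A L' mul0r subr0 => /eqP.
      by rewrite mulf_eq0 (negPf Lz) orbF => /eqP.
    have := GL_inv uz; rewrite L' mul0r => /eqP.
    by rewrite mulf_eq0 (negPf Lz) orbF => /eqP.
  pose k := L (mobius b z) / L z.
  have Lk : L (mobius b z) = k * L z by rewrite divfK.
  have Fk : F (mobius b z) = k * F z.
    apply: (mulIf Lz); have := H z uz => /eqP; rewrite subr_eq0 => /eqP ->.
    by rewrite Lk; ring.
  have Gk : G (mobius b z) = k * G z by apply: (mulIf Lz); rewrite GL_inv// Lk; ring.
  exists k; first by rewrite mulf_neq0// invr_neq0.
  by apply/rowP; apply: ord3P; rewrite mxE // !WL Fk Gk Lk; ring.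
pose T z := F (mobius b z) * G z + G (mobius b z) * F z.
have Tu : uhol T.
  by move=> w uw; apply: cdifD; apply: cdifM; [exact: Fbu|exact: Gu|exact: Gbu|exact: Fu].
have LT z : upper R z -> L z * T z = 0.
  move=> uz; have S1 := S0 z uz; have G2 := GL_inv uz.
  have -> : L z * T z = G z * S z + F z * (G (mobius b z) * L z - L (mobius b z) * G z).
    by rewrite /T /S; ring.
  by rewrite S1 G2 subrr !mulr0 addr0.
have [H|T0] := uhol_mul_eq0 Lu Tu LT.
  by have := H t1 ut1; move/eqP; rewrite (negPf (L_neq0 ut1 F1)).
by move=> z uz /=; split; [exact: S0|exact: GL_inv|exact: T0].
Qed.
End Involution.

(** * Divided differences of plane cubics *)

Section PlaneCubics.
Variable F : comNzRingType.

Definition cub2 (c : nat -> F) x y : F :=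
  c 0 * x ^+ 3 + c 1 * x ^+ 2 * y + c 2 * x * y ^+ 2 + c 3 * y ^+ 3 + c 4 * x ^+ 2
  + c 5 * x * y + c 6 * y ^+ 2 + c 7 * x + c 8 * y + c 9.

(* Divided differences in each variable; on the diagonal, the partial derivatives. *)
Definition ddx (c : nat -> F) x x' y : F :=
  c 0 * (x ^+ 2 + x * x' + x' ^+ 2) + c 1 * (x + x') * y + c 2 * y ^+ 2
  + c 4 * (x + x') + c 5 * y + c 7.
Definition ddy (c : nat -> F) x' y y' : F :=
  c 1 * x' ^+ 2 + c 2 * x' * (y + y') + c 3 * (y ^+ 2 + y * y' + y' ^+ 2)
  + c 5 * x' + c 6 * (y + y') + c 8.

Lemma cub2_sub c x y x' y' : cub2 c x y - cub2 c x' y' =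
  (x - x') * ddx c x x' y + (y - y') * ddy c x' y y'.
Proof. by rewrite /cub2 /ddx /ddy; ring. Qed.

Definition jac c d x y x' y' := ddx c x x' y * ddy d x' y y' - ddx d x x' y * ddy c x' y y'.

(** Along the curve [a = const] the differences of [c] and [d] are in the ratio of two determinants.
    On the diagonal this becomes the quotient of derivatives along the curve, so such quotients are
    obtained as limits of an exact identity. *)
Lemma jac_ratio a c d x y x' y' : cub2 a x y = cub2 a x' y' ->
  (cub2 d x y - cub2 d x' y') * jac c a x y x' y' =
  (cub2 c x y - cub2 c x' y') * jac d a x y x' y'.
Proof.
move=> /eqP; rewrite -subr_eq0 (cub2_sub a) => /eqP E; rewrite !cub2_sub /jac.
move: (ddx a x x' y) (ddy a x' y y') (ddx c x x' y) (ddy c x' y y') E => a1 a2 c1 c2 E.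
move: (ddx d x x' y) (ddy d x' y y') => d1 d2.
apply/eqP; rewrite -subr_eq0; apply/eqP.
transitivity (((x - x') * a1 + (y - y') * a2) * (c1 * d2 - d1 * c2)); first by ring.
by rewrite E mul0r.
Qed.
End PlaneCubics.

(** The differences of coordinates solve a homogeneous linear system of determinant [jac]: local
    injectivity without the inverse function theorem. *)
Lemma jac_inj (F : fieldType) c d (x y x' y' : F) : cub2 c x y = cub2 c x' y' ->
  cub2 d x y = cub2 d x' y' -> jac c d x y x' y' != 0 -> x = x' /\ y = y'.
Proof.
move=> /eqP; rewrite -subr_eq0 (cub2_sub c) => /eqP E /eqP; rewrite -subr_eq0 (cub2_sub d) => /eqP E'.
rewrite /jac; move: (ddx c x x' y) (ddy c x' y y') (ddx d x x' y) (ddy d x' y y') E E'.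
move=> c1 c2 d1 d2 E E' n.
suff [/eqP A /eqP B] : (x - x') * (c1 * d2 - d1 * c2) = 0 /\ (y - y') * (c1 * d2 - d1 * c2) = 0.
  by split; apply/eqP; rewrite -subr_eq0; move: A B; rewrite !mulf_eq0 (negPf n) !orbF.
split.
  transitivity (((x - x') * c1 + (y - y') * c2) * d2 - ((x - x') * d1 + (y - y') * d2) * c2).
    by ring.
  by rewrite E E' !mul0r subrr.
transitivity (((x - x') * d1 + (y - y') * d2) * c1 - ((x - x') * c1 + (y - y') * c2) * d1).
  by ring.
by rewrite E E' !mul0r subrr.
Qed.

Ltac cont_tac := lazymatch goal with
  | |- cont (fun w => @?f w + @?g w) _ => apply: contD; cont_tac
  | |- cont (fun w => @?f w * @?g w) _ => apply: contM; cont_tac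
  | |- cont (fun w => @?f w ^+ _) _ => apply: contX; cont_tac
  | |- _ => first [assumption | exact: cont_cst]
  end.
Ltac cdif_tac := lazymatch goal with
  | |- cdif (fun w => @?f w + @?g w) _ => apply: cdifD; cdif_tac
  | |- cdif (fun w => @?f w * @?g w) _ => apply: cdifM; cdif_tac
  | |- cdif (fun w => @?f w ^+ _) _ => apply: cdifX; cdif_tac
  | |- _ => first [assumption | exact: cdif_cst]
  end.

(** * The cover near a fixed point *)

Section LocalCover.
Local Open Scope complex_scope.
Variable R : realType.
Local Notation C := R[i].
Variables (G1 G0 : set 'M[R]_2) (J : C -> 'rV[C]_2) (J0 : C -> 'rV[C]_3).
Variable phi : C -> option C.
Hypothesis G1_det : forall g, G1 g -> \det g = 1.
Hypothesis JU : uniformizes G1 [set: 'rV[C]_2] J.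
Hypothesis G0_V : forall g, G0 g -> exists2 h, G0 h & h *m g = 1%:M.
Hypothesis G0_sub : G0 `<=` G1.
Hypothesis J0U : uniformizes G0 (plane_cubic C) J0.
Hypothesis phi_def : forall t, phi t = p1_point (J t).

Let F z := J0 z 0 0.
Let G z := J0 z 0 1.
Let W z := J0 z 0 2%:R.
Let X z := F z / W z.
Let Y z := G z / W z.
Variables cc pc : nat -> C.
Hypothesis on_curve : forall z, upper R z -> W z != 0 -> cub2 cc (X z) (Y z) = 0.
Hypothesis phiXY : forall z, upper R z -> W z != 0 -> phi z = Some (cub2 pc (X z) (Y z)).

Lemma cont_XY z : upper R z -> W z != 0 -> cont X z /\ cont Y z.
Proof.
move=> uz Wz; have Wc := cdif_cont (J0_uhol J0U 2%:R uz).
by split; apply: contM; try exact: (contV Wz Wc); apply/cdif_cont/(J0_uhol J0U).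
Qed.

Lemma cont_jac c d (x y x' y' : C -> C) z : cont x z -> cont y z -> cont x' z -> cont y' z ->
  cont (fun w => jac c d (x w) (y w) (x' w) (y' w)) z.
Proof.
move=> xc yc xc' yc'.
have dx e : cont (fun w => ddx e (x w) (x' w) (y w)) z.
  by rewrite /ddx; cont_tac.
have dy e : cont (fun w => ddy e (x' w) (y w) (y' w)) z.
  by rewrite /ddy; cont_tac.
by apply: contB; apply: contM; [exact: dx|exact: dy|exact: dx|exact: dy].
Qed.

(** The element [i] preserves [phi] and moves points near [t] only slightly. Where the Jacobian is
    nonzero, [phi] separates nearby points of the cubic, so [i] is trivial on the cubic near [t],
    and [rigid] applies. *)
Lemma stab_in_G0 t i : upper R t -> W t != 0 -> jac cc pc (X t) (Y t) (X t) (Y t) != 0 ->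
  G1 i -> mobius i t = t -> exists g c, G0 g /\ i = c *: g.
Proof.
move=> ut Wt nj iG fixi; have i1 := G1_det iG; have i0 : 0 < \det i by rewrite i1.
apply: (rigid G1_det JU G0_V G0_sub J0U phi_def i0 ut).
have [Xc Yc] := cont_XY ut Wt; have ic := cont_mobius i0 ut.
have Wc : cont W t := cdif_cont (J0_uhol J0U 2%:R ut).
have comp f : cont f t -> cont (fun z => f (mobius i z)) t.
  by move=> fc; apply: cont_comp => //; rewrite fixi.
have Jc := cont_jac cc pc (comp _ Xc) (comp _ Yc) Xc Yc.
have Jn := cont_neq0 Jc; rewrite fixi in Jn.
have Wn := cont_neq0 (comp _ Wc); rewrite fixi in Wn.
apply: near_and_imp (near_and (Jn nj) (upper_near ut)) (near_and (cont_neq0 Wc Wt) (Wn Wt)).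
move=> z [nz uz] [Wz Wz']; have uz' := mobius_upper i0 uz.
have E : phi (mobius i z) = phi z by apply/esym/(proj2 (phi_orbit JU phi_def uz uz')); exists i.
have [EX EY] := jac_inj (etrans (on_curve uz' Wz') (esym (on_curve uz Wz)))
  (Some_inj (etrans (esym (phiXY uz' Wz')) (etrans E (phiXY uz Wz)))) nz.
exists (W (mobius i z) / W z); first exact: mulf_neq0 Wz' (invr_neq0 Wz).
apply/rowP; apply: ord3P; rewrite mxE.
- by rewrite -/(F _) -/(F z) -[LHS](divfK Wz') -/(X _) EX /X; ring.
- by rewrite -/(G _) -/(G z) -[LHS](divfK Wz') -/(Y _) EY /Y; ring.
- by rewrite -/(W _) -/(W z) divfK.
Qed.

Variables (b : 'M[R]_2) (k : C).
Hypothesis b0 : 0 < \det b.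
Hypothesis b_iota : forall z, upper R z -> exists e : C, [/\ e != 0, F (mobius b z) = - e * F z,
  G (mobius b z) = e * G z & W (mobius b z) = e * (W z + k * F z)].

(** The function [G / F] vanishes at the flex and changes sign under the involution. Its quotient by
    itself is -1 on one side and tends to a power of the multiplier on the other. *)
Lemma flex_rotation t a : upper R t -> F t != 0 -> G t = 0 -> ~ near t (fun z => G z = 0) ->
  0 < \det a -> mobius a t = t -> (forall w, upper R w -> eqv J0 (mobius b w) (mobius a w)) ->
  exists2 m, (0 < m)%N & mult a t ^+ m = -1.
Proof.
move=> ut Ft Gt nG a0 fixa aE.
pose xi z := G z / F z.
have Fn := cont_neq0 (cdif_cont (J0_uhol J0U 0 ut)) Ft.
have xd : near t (cdif xi).
  apply: near_and_imp Fn (upper_near ut) => z Fz uz.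
  by apply: cdifM; [exact: (J0_uhol J0U)|apply: (cdifV Fz); exact: (J0_uhol J0U)].
have xn : ~ near t (fun z => xi z = 0).
  move=> H; apply: nG; apply: near_and_imp H Fn => z /eqP + Fz.
  by rewrite mulf_eq0 invr_eq0 (negPf Fz) orbF => /eqP.
have [m Hm m0] := rot_lim a0 ut fixa xd xn.
exists m; first by apply: m0; rewrite /xi Gt mul0r.
apply: clim_uniq Hm _; apply: clim_ext (clim_cst (-1) t).
apply: near_and_imp (isolated_zeros xd xn) (upper_near ut) => z H uz zt.
have xz := H zt; apply: (canRL (mulfK xz)).
have -> : xi (mobius a z) = xi (mobius b z) by apply/esym/same_point_ratio/aE.
have [e [e0 Fe Ge _]] := b_iota uz.
by rewrite /xi Fe Ge (mulNr e) invrN mulrN -mulf_div divff// mul1r mulN1r.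
Qed.

Variables (ic : nat -> C) (p : C).
Hypothesis icE : forall x y, 1 + k * x != 0 ->
  cub2 ic x y = (cub2 pc (- x / (1 + k * x)) (y / (1 + k * x)) - p) * (1 + k * x) ^+ 3.

(** For [A = phi - p], invariance under [G1] lets [a] be replaced by [b] in [A (a z) / A z], and
    then [jac_ratio] expresses this quotient near [t]. The exponent [m] is the vanishing order of
    [A] at [t]. *)
Lemma double_rotation t a : upper R t -> W t != 0 -> cub2 pc (X t) (Y t) = p ->
  cub2 ic (X t) (Y t) = 0 -> 1 + k * X t != 0 -> jac pc cc (X t) (Y t) (X t) (Y t) != 0 ->
  0 < \det a -> mobius a t = t -> (forall w, upper R w -> phi (mobius b w) = phi (mobius a w)) ->
  exists m, mult a t ^+ m = jac ic cc (X t) (Y t) (X t) (Y t) /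
    (jac pc cc (X t) (Y t) (X t) (Y t) * (1 + k * X t) ^+ 3).
Proof.
move=> ut Wt pt it kt jt a0 fixa aE.
pose A z := cub2 pc (X z) (Y z) - p.
have Wc : cont W t := cdif_cont (J0_uhol J0U 2%:R ut).
have Wn := cont_neq0 Wc Wt.
have [Xc Yc] := cont_XY ut Wt.
have Ad : near t (cdif A).
  apply: near_and_imp Wn (upper_near ut) => z Wz uz.
  have Wd := cdifV Wz (J0_uhol J0U 2%:R uz).
  have Xd : cdif X z by apply: cdifM; [exact: (J0_uhol J0U)|].
  have Yd : cdif Y z by apply: cdifM; [exact: (J0_uhol J0U)|].
  apply: cdifB; last exact: cdif_cst.
  by rewrite /cub2; cdif_tac.
have An : ~ near t (fun z => A z = 0).
  move=> H; apply: (phi_nonconst JU phi_def ut).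
  apply: near_and_imp (near_and H Wn) (upper_near ut) => z [/eqP Az Wz] uz.
  by rewrite !phiXY// pt; congr Some; apply/eqP; rewrite -subr_eq0.
have [m Hm _] := rot_lim a0 ut fixa Ad An; exists m.
apply: clim_uniq Hm _.
have J1 := cont_jac ic cc Xc Yc (cont_cst (X t) t) (cont_cst (Y t) t).
have J2 := cont_jac pc cc Xc Yc (cont_cst (X t) t) (cont_cst (Y t) t).
have kc : cont (fun z => 1 + k * X z) t.
  by apply: contD; [exact: cont_cst|apply: contM; [exact: cont_cst|]].
have kX := cont_neq0 kc kt.
have J2n := cont_neq0 J2 jt.
have lim : cont (fun z => jac ic cc (X z) (Y z) (X t) (Y t) /
    (jac pc cc (X z) (Y z) (X t) (Y t) * (1 + k * X z) ^+ 3)) t.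
  apply: (contM J1); apply: contV; first exact: mulf_neq0 jt (expf_neq0 3 kt).
  by apply: (contM J2); exact: contX.
have W' : cont (fun z => W (mobius a z)) t.
  by apply: cont_comp; [exact: cont_mobius|rewrite fixa].
have Wn' := cont_neq0 W'; rewrite fixa in Wn'.
move/cont_clim: lim; apply: clim_ext.
apply: near_and_imp (near_and (near_and (isolated_zeros Ad An) (Wn' Wt)) (upper_near ut))
  (near_and Wn (near_and kX J2n)) => z [[H Waz] uz] [Wz [kz jz]] zt.
have Az := H zt; have uaz := mobius_upper a0 uz; have ubz := mobius_upper b0 uz.
have [e [e0 Fe Ge We]] := b_iota uz.
have WE : W z + k * F z = W z * (1 + k * X z).
  by rewrite /X mulrDr mulr1 mulrCA; congr (_ + k * _); rewrite mulrC divfK.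
have Wbz : W (mobius b z) != 0 by rewrite We WE !mulf_neq0.
have Aa : A (mobius a z) * (1 + k * X z) ^+ 3 = cub2 ic (X z) (Y z).
  have -> : A (mobius a z) = A (mobius b z).
    have := aE z uz; rewrite !phiXY// => -[E]; by rewrite /A E.
  rewrite (icE _ kz) /A; congr ((cub2 pc _ _ - p) * _).
    by rewrite [LHS]/X Fe We WE !mulNr -mulf_div divff// mul1r invfM mulrA.
  by rewrite [LHS]/Y Ge We WE -mulf_div divff// mul1r invfM mulrA.
have cE := etrans (on_curve uz Wz) (esym (on_curve ut Wt)).
have := jac_ratio pc ic cE; rewrite it pt subr0 -/(A z) -Aa => E.
have kz3 := expf_neq0 3 kz.
apply: (mulIf (mulf_neq0 jz kz3)); rewrite divfK ?mulf_neq0//.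
apply: (mulfI Az); rewrite -E.
move: (jac pc _ _ _ _ _) (_ ^+ 3) => D w; rewrite mulrA (mulrCA _ (A (mobius a z))) divff// mulr1.
by rewrite mulrAC mulrA.
Qed.
End LocalCover.

(** * Equations of the curve and of the cover *)

Section Equations.
Variable F : numFieldType.

Lemma curve_fgl (f g w : F) : curve_form f g w = 0 ->
  let l := 12 * f + (- 17) * g + (- (64 / 7)) * w in
  9 / 128 * f ^+ 2 * l = 45 / 832 * g ^+ 3 + (- (255 / 2048)) * g ^+ 2 * l
    + (- (55 / 9216)) * g * l ^+ 2 + (- (5 / (54 * 1024))) * l ^+ 3.
Proof.
move=> H l; rewrite /curve_form in H; apply/eqP; rewrite -subr_eq0; apply/eqP.
by rewrite -[RHS](mulr0 1) -H /l; field.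
Qed.

Definition curve_coef : nat -> F := nth 0
  [:: 1; (- 1); 0; (- (625 / 702)); (- 1); (- (25 / 84)); 0; (40 / 147); (50 / 441); (- (640 / (9 * 10 ^+ 3 + 261)))].

Definition phi_coef : nat -> F := nth 0
  [:: 0; (- ((241 * 10 ^+ 3 + 129) / 125)); (1715 / 3); (- (1715 / 9)); (- ((36 * 10 ^+ 3 + 309) / 125)); ((22 * 10 ^+ 3 + 99) / 30); (1225 / 36); (- (637 / 200)); (- (1708 / 45)); (- (1301 / 75))].

(* The dehomogenized [phi_form - p * w ^+ 3] at [(- f, g, w - 21 / 8 * f)], for [p = 4752 / 125]. *)
Definition iota_coef : nat -> F := nth 0
  [:: (((3 * 10 ^+ 3 + 571) * 10 ^+ 3 + 659) / 2000); (- ((256 * 10 ^+ 3 + 907) / 1000)); (- ((63 * 10 ^+ 3 + 455) / 96)); (- (1715 / 9)); (- (((11 * 10 ^+ 3 + 613) * 10 ^+ 3 + 147) / (8 * 10 ^+ 3))); (- ((16 * 10 ^+ 3 + 121) / 30)); (1225 / 36); ((219 * 10 ^+ 3 + 583) / 500); (- (1708 / 45)); (- ((20 * 10 ^+ 3 + 761) / 375))].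

Lemma curve_affine (f g w : F) : w != 0 ->
  cub2 curve_coef (f / w) (g / w) = curve_form f g w / w ^+ 3.
Proof. by move=> w0; rewrite /cub2 /curve_coef /curve_form /=; field. Qed.

Lemma phi_affine (f g w : F) : w != 0 ->
  cub2 phi_coef (f / w) (g / w) = phi_form f g w / w ^+ 3.
Proof. by move=> w0; rewrite /cub2 /phi_coef /phi_form /=; field. Qed.

Lemma iota_affine (x y : F) : let w := 1 + - (21 / 8) * x in w != 0 ->
  cub2 iota_coef x y = (cub2 phi_coef (- x / w) (y / w) - 4752 / 125) * w ^+ 3.
Proof.
move=> w w0; have -> : (cub2 phi_coef (- x / w) (y / w) - 4752 / 125) * w ^+ 3 =
    phi_form (- x) y w - 4752 / 125 * w ^+ 3.
  by rewrite phi_affine// mulrBl divfK// expf_neq0.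
by rewrite /cub2 /iota_coef /phi_form /w /=; field.
Qed.

Lemma curve_f0 (g : F) : cub2 curve_coef 0 g = - 625 / 702 * g ^+ 3 + 50 / 441 * g - 640 / (9 * 10 ^+ 3 + 261).
Proof. by rewrite /cub2 /curve_coef /=; field. Qed.

Lemma jac_f0 (g : F) : cub2 curve_coef 0 g = 0 -> jac curve_coef phi_coef 0 g 0 g != 0.
Proof.
rewrite curve_f0 => H; have -> : jac curve_coef phi_coef 0 g 0 g =
    ((1 * 10 ^+ 3 + 71) * 10 ^+ 3 + 875) / 702 * g ^+ 4 + ((1 * 10 ^+ 3 + 500) * 10 ^+ 3 + 625) / 702 * g ^+ 3 - (35 * 10 ^+ 3 + 875) / 144 * g ^+ 2 - 1450 / 27 * g - (7 * 10 ^+ 3 + 535) / 756.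
  by rewrite /jac /ddx /ddy /curve_coef /phi_coef /=; field.
apply/eqP => H'; have /eqP := oner_neq0 F; apply.
(* A Bezout relation between this Jacobian and the cubic in [g]: they have no common root. *)
transitivity ((- 49 / (15 * 10 ^+ 3 + 552) * g - 7 / 1215) * (((1 * 10 ^+ 3 + 71) * 10 ^+ 3 + 875) / 702 * g ^+ 4 + ((1 * 10 ^+ 3 + 500) * 10 ^+ 3 + 625) / 702 * g ^+ 3 - (35 * 10 ^+ 3 + 875) / 144 * g ^+ 2 - 1450 / 27 * g - (7 * 10 ^+ 3 + 535) / 756)
  + (- (84 * 10 ^+ 3 + 35) / (15 * 10 ^+ 3 + 552) * g ^+ 2 - (271 * 10 ^+ 3 + 313) / (15 * 10 ^+ 3 + 552) * g - ((8 * 10 ^+ 3 + 484) * 10 ^+ 3 + 791) / (622 * 10 ^+ 3 + 80)) * (- 625 / 702 * g ^+ 3 + 50 / 441 * g - 640 / (9 * 10 ^+ 3 + 261))); first by field.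
by rewrite H H' !mulr0 addr0.
Qed.

(** This separates the three fixed points with [f = 0]. *)
Lemma curve_f0_simple (g : F) : cub2 curve_coef 0 g = 0 -> - 625 / 234 * g ^+ 2 + 50 / 441 != 0.
Proof.
rewrite curve_f0 => H; apply/eqP => H'; have /eqP := oner_neq0 F; apply.
(* A Bezout relation between the cubic in [g] and its derivative: the three roots are distinct. *)
transitivity ((2401 / 432 * g ^+ 2 + 686 / 135 * g - 637 / 1350) * (- 625 / 234 * g ^+ 2 + 50 / 441)
  + (- 2401 / 144 * g - 686 / 45) * (- 625 / 702 * g ^+ 3 + 50 / 441 * g - 640 / (9 * 10 ^+ 3 + 261))); first by field.
by rewrite H H' !mulr0 addr0.
Qed.

(** Modulo the cubic in [g], [phi] is quadratic in [g], and the elliptic polynomial evaluated there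
    is a multiple of that cubic. The points with [f = 0] thus lie over elliptic points of order
    2. *)
Lemma phi_f0 (g : F) : cub2 curve_coef 0 g = 0 -> let z := cub2 phi_coef 0 g in
  z ^+ 3 - z ^+ 2 - 992 * z - (20 * 10 ^+ 3 + 736) = 0.
Proof.
rewrite curve_f0 => H z; have {z}-> : z = 1225 / 36 * g ^+ 2 - 560 / 9 * g - 23 / 9.
  transitivity (1225 / 36 * g ^+ 2 - 560 / 9 * g - 23 / 9 + ((26 * 10 ^+ 3 + 754) / 125) * (- 625 / 702 * g ^+ 3 + 50 / 441 * g - 640 / (9 * 10 ^+ 3 + 261))).
    by rewrite /z /cub2 /phi_coef /=; field.
  by rewrite H mulr0 addr0.
set z := (X in X ^+ 3).
transitivity ((- ((38 * 10 ^+ 3 + 235) * 10 ^+ 3 + 925) / 864 * g ^+ 3 + ((2 * 10 ^+ 3 + 184) * 10 ^+ 3 + 910) / 9 * g ^+ 2 - ((10 * 10 ^+ 3 + 518) * 10 ^+ 3 + 781) / 24 * g + ((35 * 10 ^+ 3 + 600) * 10 ^+ 3 + 656) / 135) * (- 625 / 702 * g ^+ 3 + 50 / 441 * g - 640 / (9 * 10 ^+ 3 + 261))); first by rewrite /z; field.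
by rewrite H mulr0.
Qed.

Definition p7x (s : F) := 3 / 7 + 1 / 7 * s.
Definition p7y (s : F) := - (13 / 50) + 39 / 350 * s.

(** Here and in the evaluations that follow, the second summand is a multiple of [s ^+ 2 + 7] whose
    cofactor comes from polynomial division. *)
Lemma p7_curve (s : F) : s ^+ 2 = - 7 -> cub2 curve_coef (p7x s) (p7y s) = 0.
Proof.
move=> s2; transitivity (0 + (s ^+ 2 + 7) * (- 81 / (137 * 10 ^+ 3 + 200) * s + 27 / (19 * 10 ^+ 3 + 600))).
  by rewrite /p7x /p7y /jac /ddx /ddy /cub2 /curve_coef /phi_coef /iota_coef /=; field.
by rewrite s2 addNr mul0r addr0.
Qed.

Lemma p7_phi (s : F) : s ^+ 2 = - 7 -> cub2 phi_coef (p7x s) (p7y s) = 4752 / 125.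
Proof.
move=> s2; transitivity (4752 / 125 + (s ^+ 2 + 7) * (- (90 * 10 ^+ 3 + 909) / (25 * 10 ^+ 3) * s - (485 * 10 ^+ 3 + 433) / (50 * 10 ^+ 3))).
  by rewrite /p7x /p7y /jac /ddx /ddy /cub2 /curve_coef /phi_coef /iota_coef /=; field.
by rewrite s2 addNr mul0r addr0.
Qed.

Lemma p7_iota (s : F) : s ^+ 2 = - 7 -> cub2 iota_coef (p7x s) (p7y s) = 0.
Proof.
move=> s2; transitivity (0 + (s ^+ 2 + 7) * (((1 * 10 ^+ 3 + 274) * 10 ^+ 3 + 481) / (400 * 10 ^+ 3) * s + ((4 * 10 ^+ 3 + 303) * 10 ^+ 3 + 611) / (400 * 10 ^+ 3))).
  by rewrite /p7x /p7y /jac /ddx /ddy /cub2 /curve_coef /phi_coef /iota_coef /=; field.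
by rewrite s2 addNr mul0r addr0.
Qed.

Lemma p7_jac (s : F) : s ^+ 2 = - 7 -> jac phi_coef curve_coef (p7x s) (p7y s) (p7x s) (p7y s) = 2232 / 875 * s - 2232 / 125.
Proof.
move=> s2; transitivity (2232 / 875 * s - 2232 / 125 + (s ^+ 2 + 7) * ((104 * 10 ^+ 3 + 733) / (28 * 10 ^+ 3) * s ^+ 2 + 2673 / 350 * s + (88 * 10 ^+ 3 + 857) / (8 * 10 ^+ 3))).
  by rewrite /p7x /p7y /jac /ddx /ddy /cub2 /curve_coef /phi_coef /iota_coef /=; field.
by rewrite s2 addNr mul0r addr0.
Qed.

Lemma p7_jac_iota (s : F) : s ^+ 2 = - 7 -> jac iota_coef curve_coef (p7x s) (p7y s) (p7x s) (p7y s) = (50 * 10 ^+ 3 + 499) / (7 * 10 ^+ 3) * s + 279 / 1000.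
Proof.
move=> s2; transitivity ((50 * 10 ^+ 3 + 499) / (7 * 10 ^+ 3) * s + 279 / 1000 + (s ^+ 2 + 7) * (- ((3 * 10 ^+ 3 + 582) * 10 ^+ 3 + 549) / (896 * 10 ^+ 3) * s ^+ 2 - ((4 * 10 ^+ 3 + 85) * 10 ^+ 3 + 397) / (448 * 10 ^+ 3) * s - ((1 * 10 ^+ 3 + 204) * 10 ^+ 3 + 119) / (128 * 10 ^+ 3))).
  by rewrite /p7x /p7y /jac /ddx /ddy /cub2 /curve_coef /phi_coef /iota_coef /=; field.
by rewrite s2 addNr mul0r addr0.
Qed.

Lemma p7_w3 (s : F) : s ^+ 2 = - 7 -> (1 + - (21 / 8) * p7x s) ^+ 3 = 45 / 128 * s + 47 / 128.
Proof.
move=> s2; transitivity (45 / 128 * s + 47 / 128 + (s ^+ 2 + 7) * (- 27 / 512 * s - 27 / 512)).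
  by rewrite /p7x /p7y /jac /ddx /ddy /cub2 /curve_coef /phi_coef /iota_coef /=; field.
by rewrite s2 addNr mul0r addr0.
Qed.

End Equations.

(** * Stabilizers *)

Section Stabilizers.
Local Open Scope complex_scope.
Variable R : realType.
Local Notation C := R[i].

Lemma mult_mul (g h : 'M[R]_2) (t : C) : 0 < \det g -> 0 < \det h -> upper R t ->
  mobius h t = t -> mult (g *m h) t = mult g t * mult h t.
Proof.
move=> g0 h0 ut E; have gh0 : 0 < \det (g *m h) by rewrite det_mulmx mulr_gt0.
apply: cder_uniq (cder_mobius gh0 ut) _.
apply: (@cder_ext _ (fun z => mobius g (mobius h z))).
  by apply: near_imp (upper_near ut) => z uz; rewrite mobiusM.
by apply: cder_comp; [exact: cder_mobius|rewrite E; exact: cder_mobius].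
Qed.

Lemma multN (g : 'M[R]_2) (t : C) : mult (- g) t = mult g t.
Proof.
rewrite /mult /den !mxE !det2E !mxE !mulNr !mulrN !opprK !rmorphN /=.
by rewrite mulNr -opprD sqrrN.
Qed.

Lemma mult1 (t : C) : mult 1%:M t = 1.
Proof. by rewrite /mult /den det1 !mxE /= rmorph0 mul0r add0r rmorph1 expr1n divr1. Qed.

Lemma det_scalar_eq1 (c : R) : \det (c%:M : 'M[R]_2) = 1 -> c = 1 \/ c = -1.
Proof.
rewrite det_scalar => /eqP; rewrite sqrf_eq1 => /orP[/eqP|/eqP]; by [left|right].
Qed.

Variable G : set 'M[R]_2.
Hypothesis G_1 : G 1%:M.
Hypothesis G_M : forall g h, G g -> G h -> G (g *m h).
Hypothesis G_V : forall g, G g -> exists2 h, G h & h *m g = 1%:M.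
Hypothesis G_det : forall g, G g -> \det g = 1.

Let det_gt0 g : G g -> 0 < \det g.
Proof. by move=> /G_det ->. Qed.

Variables (t : C) (ut : upper R t).

Lemma mult_inj g h : G g -> G h -> mobius g t = t -> mobius h t = t ->
  mult g t = mult h t -> g = h \/ g = - h.
Proof.
move=> gG hG gt ht E; have [h' hG' hh] := G_V hG.
have ht' : mobius h' t = t.
  by rewrite -[in LHS]ht -mobiusM ?det_gt0// hh mobius1.
have gt' : mobius (h' *m g) t = t by rewrite mobiusM ?det_gt0// gt.
have [|c Ec] := mult1_scalar (det_gt0 (G_M hG' gG)) ut gt'.
  rewrite mult_mul ?det_gt0// E -mult_mul ?det_gt0// hh; exact: mult1.
have gE : g = c *: h.
  by rewrite -[g]mul1mx -(mulmx1C hh) -mulmxA Ec mul_mx_scalar.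
have := G_det (G_M hG' gG); rewrite Ec gE => /det_scalar_eq1[->|->]; [left|right].
  by rewrite scale1r.
by rewrite scaleN1r.
Qed.

(** Lagrange's theorem by the usual product: multiplication by [g] permutes the representatives up
    to sign, and multipliers ignore signs. *)
Lemma mult_order e g : has_stabilizer_order G t e -> G g -> mobius g t = t ->
  mult g t ^+ e = 1.
Proof.
case=> s [sG s_inj s_all] gG gt.
have /choice[f Hf] : forall m, exists n, g *m s m = s n \/ g *m s m = - s n.
  move=> m; have [smG smt] := sG m.
  by apply: s_all; [exact: G_M|rewrite mobiusM ?det_gt0// smt].
have [g' _ gg] := G_V gG.
have cancel_g x y : g *m x = g *m y -> x = y.
  by move=> E; rewrite -[x]mul1mx -gg -mulmxA E mulmxA gg mul1mx.
have f_inj : injective f.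
  move=> m n E; apply: s_inj; case: (Hf m) (Hf n) => [Em|Em] [En|En]; [left|right|right|left];
    apply: cancel_g; rewrite ?mulmxN Em En E ?opprK//.
have mE m : mult (s (f m)) t = mult g t * mult (s m) t.
  have [smG smt] := sG m; rewrite -mult_mul ?det_gt0//.
  by case: (Hf m) => ->; rewrite ?multN.
pose P := \prod_m mult (s m) t.
have P0 : P != 0.
  by apply/prodf_neq0 => m _; apply: mult_neq0 => //; apply: det_gt0; case: (sG m).
have : P = mult g t ^+ e * P.
  rewrite {1}/P (reindex_inj f_inj) /=; under eq_bigr do rewrite mE.
  by rewrite big_split /= prodr_const card_ord.
by rewrite -{1}[P]mul1r => /(mulIf P0) ->.
Qed.

Lemma stabilizer_nonscalar e : (1 < e)%N -> has_stabilizer_order G t e ->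
  exists g, [/\ G g, mobius g t = t & forall c, g <> c%:M].
Proof.
move=> e1 [s [sG s_inj _]]; apply: contrapT => H.
have sc m : s m = 1%:M \/ s m = - 1%:M.
  have [smG smt] := sG m; have [c Ec] : exists c, s m = c%:M.
    by apply: contrapT => N; apply: H; exists (s m); split=> // c Ec; apply: N; exists c.
  have := G_det smG; rewrite Ec => /det_scalar_eq1[->|->]; [by left|right].
  by rewrite raddfN.
have := s_inj (Ordinal (ltnW e1)) (Ordinal e1).
case: (sc (Ordinal (ltnW e1))) (sc (Ordinal e1)) => -> [] -> E;
  by have /(congr1 val) : Ordinal (ltnW e1) = Ordinal e1 by apply: E; rewrite ?opprK; auto.
Qed.

Lemma mult_neq1 g : G g -> mobius g t = t -> (forall c, g <> c%:M) -> mult g t != 1.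
Proof.
move=> gG gt ns; apply/eqP => E.
by have [c] := mult1_scalar (det_gt0 gG) ut gt E; exact: ns.
Qed.

Lemma stabilizer2 : has_stabilizer_order G t 2 ->
  exists g, [/\ G g, mobius g t = t & g *m g = - 1%:M].
Proof.
move=> H; have [g [gG gt ns]] := stabilizer_nonscalar (ltnSn 1) H; exists g; split=> //.
have := mult_order H gG gt => /eqP; rewrite sqrf_eq1 (negPf (mult_neq1 gG gt ns)) /= => /eqP M.
have := mult_trace (det_gt0 gG) ut gt; rewrite M G_det// rmorph1 invrN invr1 mulr1 => T.
have /eqP : (\tr g)%:C ^+ 2 = 0 :> C by apply: (addIr (- 2)); rewrite -T; ring.
rewrite expf_eq0 /= (inj_eq (@complexI R) _ 0) => /eqP tr0.
by rewrite cayley2 tr0 G_det// scale0r add0r.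
Qed.

(** The multiplier is a primitive cube root of unity, so the trace is 1 or -1; passing to [- g] if
    needed makes it -1. *)
Lemma stabilizer3 : has_stabilizer_order G t 3 -> G (- 1%:M) ->
  exists g, [/\ G g, mobius g t = t & g *m g + g + 1%:M = 0].
Proof.
move=> H N1; have [g [gG gt ns]] := stabilizer_nonscalar (isT : (1 < 3)%N) H.
have n1 := mult_neq1 gG gt ns; have m0 := mult_neq0 (det_gt0 gG) ut.
have m3 := mult_order H gG gt.
have M : mult g t ^+ 2 + mult g t + 1 = 0.
  apply/eqP; rewrite -[_ == 0]orFb -(negPf n1) -subr_eq0 -mulf_eq0; apply/eqP.
  by transitivity (mult g t ^+ 3 - 1); [ring|rewrite m3 subrr].
have := mult_trace (det_gt0 gG) ut gt; rewrite G_det// rmorph1 mul1r mulr1 => T.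
have MV : mult g t + (mult g t)^-1 = - 1.
  by apply: (mulIf m0); rewrite mulrDl mulVf//; apply/eqP; rewrite -subr_eq0 -M; apply/eqP; ring.
have /eqP : (\tr g)%:C ^+ 2 = 1 :> C by apply: (addIr (- 2)); rewrite -T MV; ring.
rewrite -rmorphXn -(rmorph1 (real_complex R)) (inj_eq (@complexI R)) sqrf_eq1 => /orP[] /eqP tr1.
  exists (- g); split; [|by rewrite mobiusN|].
    by rewrite -[g]mul1mx -mulNmx; exact: G_M.
  by rewrite [- g *m _]mulNmx mulmxN opprK cayley2 tr1 G_det// scale1r addrAC subrK subrr.
by exists g; split=> //; rewrite cayley2 tr1 G_det// scaleN1r addrAC subrK addNr.
Qed.

(** Up to sign an element is determined by its multiplier, a [k]-th root of unity. Choosing one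
    element for each value that occurs lists the stabilizer. *)
Lemma finite_stabilizer k : (0 < k)%N ->
  (forall g, G g -> mobius g t = t -> mult g t ^+ k = 1) ->
  (exists g, [/\ G g, mobius g t = t & forall c, g <> c%:M]) ->
  exists2 e, (1 < e)%N & has_stabilizer_order G t e.
Proof.
move=> k0 mk [g1 [g1G g1t g1n]].
have [rs rsE] := closed_field_poly_normal ('X^k - 1 : {poly C}).
have pn : 'X^k - 1 != 0 :> {poly C} by rewrite -size_poly_eq0 size_XnsubC.
pose att x := `[< exists g, [/\ G g, mobius g t = t & mult g t = x] >].
pose T := undup [seq x <- rs | att x].
have inT g : G g -> mobius g t = t -> mult g t \in T.
  move=> gG gt; rewrite mem_undup mem_filter; apply/andP; split; first by apply/asboolP; exists g.
  have : root ('X^k - 1) (mult g t) by rewrite /root !hornerE mk// subrr.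
  rewrite rsE rootZ ?root_prod_XsubC//; by rewrite lead_coef_eq0.
have /choice[s Hs] : forall m : 'I_(size T), exists g, [/\ G g, mobius g t = t & mult g t = T`_m].
  move=> m; have := mem_nth 0 (ltn_ord m); rewrite mem_undup mem_filter => /andP[/asboolP //].
exists (size T).
  have I1 := inT _ G_1 (mobius1 t); have I2 := inT _ g1G g1t.
  have U : uniq [:: mult 1%:M t; mult g1 t].
    by rewrite /= inE mult1 eq_sym (mult_neq1 g1G g1t g1n).
  by apply: (uniq_leq_size U) => x; rewrite !inE => /orP[] /eqP ->.
exists s; split=> [m|m n E|g gG gt].
- by case: (Hs m).
- have [_ _ Em] := Hs m; have [_ _ En] := Hs n.
  apply/val_inj/eqP; rewrite -(nth_uniq 0 (ltn_ord m) (ltn_ord n) (undup_uniq _)) -/T -Em -En.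
  by case: E => ->; rewrite ?multN.
- have I := inT g gG gt; pose m := Ordinal (etrans (index_mem _ _) I : (index (mult g t) T < size T)%N).
  exists m; have [sG st sm] := Hs m; apply: mult_inj => //.
  by rewrite sm /= nth_index.
Qed.
End Stabilizers.

(** * Special points of the cubic *)

Section Points.
Variable F : numFieldType.

(** The flex in affine coordinates: [g = 0] and [l = 0] give [w = (21/16) f]. *)
Lemma q0_curve : cub2 (curve_coef F) (1 / (21 / 16)) 0 = 0.
Proof. by rewrite /cub2 /curve_coef /=; field. Qed.

Lemma q0_phi : cub2 (phi_coef F) (1 / (21 / 16)) 0 = - ((23 * 10 ^+ 3 + 549) / 125).
Proof. by rewrite /cub2 /phi_coef /=; field. Qed.

(** The quotient is [- (3 + s) / 4]. Its norm is [(9 + 7) / 16 = 1], so its inverse is its conjugate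
    and the sum is -3/2. *)
Lemma p7_rho (s mu : F) : s ^+ 2 = - 7 ->
  mu = jac (iota_coef F) (curve_coef F) (p7x s) (p7y s) (p7x s) (p7y s) /
    (jac (phi_coef F) (curve_coef F) (p7x s) (p7y s) (p7x s) (p7y s)
     * (1 + - (21 / 8) * p7x s) ^+ 3) -> mu + mu^-1 = - 3 / 2.
Proof.
move=> s2 ->; rewrite p7_jac// p7_jac_iota// p7_w3//.
pose r := - (3 + s) / 4; pose r' := - (3 - s) / 4.
have rr : r * r' = 1.
  transitivity (1 - (s ^+ 2 + 7) / 16); first by rewrite /r /r'; field.
  by rewrite s2 addNr mul0r subr0.
have r0 : r != 0 by apply: contra_eq_neq rr => ->; rewrite mul0r eq_sym oner_eq0.
pose D := (2232 / 875 * s - 2232 / 125) * (45 / 128 * s + 47 / 128) : F.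
have ND : (50 * 10 ^+ 3 + 499) / (7 * 10 ^+ 3) * s + 279 / 1000 = r * D.
  apply/eqP; rewrite -subr_eq0; apply/eqP.
  transitivity ((s ^+ 2 + 7) * (2511 / (11 * 10 ^+ 3 + 200) * s - (5 * 10 ^+ 3 + 301) / (8 * 10 ^+ 3))); first by rewrite /r /D; field.
  by rewrite s2 addNr mul0r.
have D0 : D != 0.
  have : D * ((8 * 10 ^+ 3 + 375) / (571 * 10 ^+ 3 + 392) * s - (20 * 10 ^+ 3 + 125) / (571 * 10 ^+ 3 + 392)) = 1.
    transitivity (1 + (s ^+ 2 + 7) * (3015 / (229 * 10 ^+ 3 + 376) * s - (25 * 10 ^+ 3 + 201) / (229 * 10 ^+ 3 + 376))); first by rewrite /D; field.
    by rewrite s2 addNr mul0r addr0.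
  by move=> E; apply/eqP => D0; move/eqP: E; rewrite D0 mul0r eq_sym oner_eq0.
rewrite -/D ND mulfK// (_ : r^-1 = r'); first by rewrite /r /r'; field.
by apply: (mulfI r0); rewrite mulfV.
Qed.

Lemma p7_neq0 (s : F) : s ^+ 2 = - 7 -> 1 + - (21 / 8) * p7x s != 0 /\
  jac (phi_coef F) (curve_coef F) (p7x s) (p7y s) (p7x s) (p7y s) != 0.
Proof.
move=> s2; rewrite (p7_jac s2).
have unit (x y : F) : x * y = 1 -> x != 0.
  by move=> E; apply: contra_eq_neq E => ->; rewrite mul0r eq_sym oner_eq0.
split.
  apply: (unit _ ((- 1 + 3 * s) / 8)).
  transitivity (1 + (s ^+ 2 + 7) * (- 9 / 64)); first by rewrite /p7x; field.
  by rewrite s2 addNr mul0r addr0.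
apply: (unit _ ((s + 7) * (- 125 / (17 * 10 ^+ 3 + 856)))).
transitivity (1 + (s ^+ 2 + 7) * (- 1 / 56)); first by field.
by rewrite s2 addNr mul0r addr0.
Qed.

Lemma p7_phi_iota (s : F) : s ^+ 2 = - 7 -> let w := 1 + - (21 / 8) * p7x s in
  cub2 (phi_coef F) (- p7x s / w) (p7y s / w) = 4752 / 125.
Proof.
move=> s2; have [w0 _] := p7_neq0 s2; have := iota_affine (p7y s) w0.
by rewrite (p7_iota s2) => /esym/eqP; rewrite mulf_eq0 expf_eq0 (negPf w0) orbF subr_eq0 => /eqP.
Qed.

Lemma curve_w0 (f g : F) : curve_form f g 0 = 0 -> g = 0 -> f = 0.
Proof.
move=> H g0; move: H; rewrite g0 /curve_form !expr0n /= !(mulr0, subr0, addr0) => /eqP.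
by rewrite expf_eq0 => /eqP.
Qed.

Lemma curve_w0_root (f g : F) : curve_form f g 0 = 0 -> g != 0 ->
  root ('X^3 - 'X^2 - (625 / 702)%:P) (f / g).
Proof.
move=> H g0; rewrite /root !hornerE; apply/eqP.
by rewrite -[RHS](mul0r (g ^+ 3)^-1) -H /curve_form; field.
Qed.
End Points.

(** After a root [x], the second is a root [y] of the quadratic cofactor, and the third is
    [- x - y], as there is no term in [x ^+ 2]. *)
Lemma three_roots (F : closedFieldType) (a b c : F) : a != 0 ->
  (forall x, a * x ^+ 3 + b * x + c = 0 -> 3 * a * x ^+ 2 + b != 0) ->
  exists x y z, [/\ a * x ^+ 3 + b * x + c = 0, a * y ^+ 3 + b * y + c = 0,
    a * z ^+ 3 + b * z + c = 0 & [/\ x != y, x != z & y != z]].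
Proof.
move=> a0 sep.
have [x Ex] := solve_monicpoly (nth 0 [:: - (c / a); - (b / a); 0]) (isT : (0 < 3)%N).
have [y Ey] := solve_monicpoly (nth 0 [:: - (x ^+ 2 + b / a); - x]) (isT : (0 < 2)%N).
move: Ex Ey; rewrite !big_ord_recr !big_ord0 /= !add0r !mul0r addr0 expr0 expr1 !mulr1 => Ex Ey.
have ba : b = a * (b / a) by rewrite mulrCA divff// mulr1.
have ca : c = a * (c / a) by rewrite mulrCA divff// mulr1.
have px : a * x ^+ 3 + b * x + c = 0.
  by rewrite Ex {2}ba {2}ca; ring.
have py : a * y ^+ 3 + b * y + c = 0.
  rewrite -[RHS]px; apply/eqP; rewrite -subr_eq0; apply/eqP.
  transitivity (a * (y - x) * (y ^+ 2 + x * y + x ^+ 2 + b / a)); first by rewrite {1 2}ba; ring.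
  by rewrite Ey; ring.
have pz : a * (- x - y) ^+ 3 + b * (- x - y) + c = 0.
  rewrite -[RHS]px; apply/eqP; rewrite -subr_eq0; apply/eqP.
  transitivity (a * (- y - 2 * x) * (y ^+ 2 + x * y + x ^+ 2 + b / a)); first by rewrite {1 2}ba; ring.
  by rewrite Ey; ring.
have qE : y ^+ 2 + x * y + x ^+ 2 + b / a = 0 by rewrite Ey; ring.
have xy : x != y.
  apply: contraTneq (sep x px) => e; rewrite negbK; apply/eqP.
  transitivity (a * (y ^+ 2 + x * y + x ^+ 2 + b / a)); last by rewrite qE mulr0.
  by rewrite -e {1}ba; ring.
have dE u v w : u + v + w = 0 -> u ^+ 2 + u * v + v ^+ 2 + b / a = 0 -> v = w -> 3 * a * v ^+ 2 + b = 0.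
  move=> s q e; have -> : b = a * (u ^+ 2 + u * v + v ^+ 2 + b / a) - a * (u ^+ 2 + u * v + v ^+ 2).
    by rewrite {1}ba; ring.
  have -> : u = - v - v by rewrite -[RHS]addr0 -s -e; ring.
  by have := q; rewrite (_ : u = - v - v); [move=> ->; ring|rewrite -[RHS]addr0 -s -e; ring].
exists x, y, (- x - y); split=> //; split=> //.
  apply: contraTneq (sep x px) => e; rewrite negbK; apply/eqP.
  by apply: (dE y x (- x - y)) => //; [ring|rewrite -[RHS]qE; ring].
apply: contraTneq (sep y py) => e; rewrite negbK; apply/eqP.
by apply: (dE x y (- x - y)) => //; [ring|rewrite -[RHS]qE; ring].
Qed.

Lemma iota_scale (F : fieldType) (f g l f' g' l' : F) :
  ~ (f = 0 /\ g = 0 /\ l = 0) -> ~ (f' = 0 /\ g' = 0 /\ l' = 0) ->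
  f' * l + l' * f = 0 -> g' * l = l' * g -> f' * g + g' * f = 0 ->
  exists2 e, e != 0 & [/\ f' = - e * f, g' = e * g & l' = e * l].
Proof.
move=> n n' E1 E2 E3.
have [l0|l0] := eqVneq l 0; last first.
  have fE : f' = - (l' / l) * f.
    apply: (mulIf l0); apply/eqP; rewrite -subr_eq0 -E1; apply/eqP; field.
    by rewrite l0.
  have gE : g' = l' / l * g by apply: (mulIf l0); rewrite E2 mulrAC divfK.
  have lE : l' = l' / l * l by rewrite divfK.
  exists (l' / l); last by split.
  by apply/eqP => e0; apply: n'; rewrite fE e0 oppr0 mul0r gE e0 mul0r lE e0 mul0r.
have [f0|f0] := eqVneq f 0.
  have g0 : g != 0 by apply/eqP => g0; apply: n.
  have f'0 : f' = 0 by move/eqP: E3; rewrite f0 mulr0 addr0 mulf_eq0 (negPf g0) orbF => /eqP.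
  have l'0 : l' = 0 by move/eqP: E2; rewrite l0 mulr0 eq_sym mulf_eq0 (negPf g0) orbF => /eqP.
  exists (g' / g); last by rewrite divfK// f0 l0 !mulr0.
  by apply/eqP => e0; apply: n'; split=> //; split=> //; rewrite -[g'](divfK g0) e0 mul0r.
have l'0 : l' = 0 by move/eqP: E1; rewrite l0 mulr0 add0r mulf_eq0 (negPf f0) orbF => /eqP.
have fE : f' = - (- f' / f) * f by rewrite -mulNr opprK divfK.
have gE : g' = - f' / f * g.
  by apply: (mulIf f0); rewrite mulrAC divfK//; apply/eqP; rewrite -subr_eq0 -E3; apply/eqP; ring.
exists (- f' / f); last by rewrite l0 mulr0.
by apply/eqP => e0; apply: n'; rewrite fE e0 oppr0 mul0r gE e0 mul0r.
Qed.

(** * Torsion of stabilizers *)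

Section RealMatrices.
Local Open Scope complex_scope.
Variable R : realType.
Local Notation C := R[i].

Lemma neg_sqr_det (M : 'M[R]_2) (p : R) : 0 < p -> M *m M = (- p)%:M -> 0 < \det M.
Proof.
move=> p0 /matrixP E; move: (E 0 0) (E 0 1) (E 1 0) (E 1 1).
rewrite !mulmx2E !mxE /= !mulr1n !mulr0n det2E.
move: (M 0 0) (M 0 1) (M 1 0) (M 1 1) => a b c d E00 E01 E10 E11.
have [s|s] := eqVneq (a + d) 0.
  have -> : d = - a by lra.
  nra.
have b0 : b = 0 by apply: (mulIf s); rewrite mul0r -E01; ring.
by move: E00; rewrite b0 mul0r addr0 => E00; have := sqr_ge0 a; nra.
Qed.

Lemma mult_scalar (c : R) (t : C) : c != 0 -> mult c%:M t = 1.
Proof.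
move=> c0; have c0' : c%:C != 0 by rewrite (inj_eq (@complexI R) _ 0).
by rewrite /mult /den det_scalar !mxE /= mulr0n mulr1n rmorph0 mul0r add0r rmorphXn divff// expf_neq0.
Qed.

Variables (G1 : set 'M[R]_2) (J : C -> 'rV[C]_2).
Hypothesis G1_det : forall g, G1 g -> \det g = 1.
Hypothesis JU : uniformizes G1 [set: 'rV[C]_2] J.

(** A local function built from [J] vanishes at [t] and is invariant under [G1], so a power of each
    multiplier, to its vanishing order, equals 1. Discreteness of the group is thereby read off its
    uniformization. *)
Lemma stabilizer_torsion t : upper R t -> exists2 m, (0 < m)%N &
  forall g, G1 g -> mobius g t = t -> mult g t ^+ m = 1.
Proof.
move=> ut; have [_ N _ _] := JU; have [n _] := N t ut.
have Ju m := J_uhol JU m.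
have [k tk] : exists k, J t 0 k != 0.
  apply: contrapT => H; case/eqP: n; apply/rowP => k; rewrite mxE.
  by apply/eqP/negPn/negP => E; apply: H; exists k.
pose f z := J t 0 1 * J z 0 0 + - J t 0 0 * J z 0 1; pose A z := f z / J z 0 k.
have kn := cont_neq0 (cdif_cont (Ju k t ut)) tk.
have Ad : near t (cdif A).
  apply: near_and_imp kn (upper_near ut) => z zk uz.
  apply: cdifM; last by apply: (cdifV zk); exact: Ju.
  by apply: cdifD; apply: cdifM; try exact: cdif_cst; exact: Ju.
have ab : (J t 0 1 != 0) || (- J t 0 0 != 0).
  rewrite -negb_and oppr_eq0; apply/negP => /andP[/eqP a /eqP b]; case/eqP: n.
  by apply/rowP; apply: ord2P; rewrite mxE.
have An : ~ near t (fun z => A z = 0).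
  move=> H; apply: (J_lin_nz JU ab ut); apply: near_and_imp H kn => z /eqP + zk.
  by rewrite mulf_eq0 invr_eq0 (negPf zk) orbF => /eqP.
have At : A t = 0.
  by rewrite /A (_ : f t = 0) ?mul0r// /f; ring.
have [m m0 Hm] := rot_order Ad An At; exists m => // g gG gt.
have g0 : 0 < \det g by rewrite G1_det.
apply: clim_uniq (Hm g g0 ut gt) _; apply: clim_ext (clim_cst 1 t).
apply: near_and_imp (isolated_zeros Ad An) (upper_near ut) => z H uz zt.
have Az := H zt; have [c c0 E] := J_orbit G1_det JU uz gG.
have -> : A (mobius g z) = A z by rewrite /A /f E !mxE !(mulrCA _ c) -mulrDr -mulf_div divff// mul1r.
by rewrite divff.
Qed.
End RealMatrices.

(** * Finite index of the subgroup *)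

Section FiniteIndex.
Local Open Scope complex_scope.
Variable R : realType.
Local Notation C := R[i].
Variables (G1 G0 : set 'M[R]_2) (J : C -> 'rV[C]_2) (J0 : C -> 'rV[C]_3).
Variable phi : C -> option C.
Hypothesis G1_1 : G1 1%:M.
Hypothesis G1_M : forall g h, G1 g -> G1 h -> G1 (g *m h).
Hypothesis G1_V : forall g, G1 g -> exists2 h, G1 h & h *m g = 1%:M.
Hypothesis G1_det : forall g, G1 g -> \det g = 1.
Hypothesis JU : uniformizes G1 [set: 'rV[C]_2] J.
Hypothesis G0_N : forall g, G0 g -> G0 (- g).
Hypothesis G0_sub : G0 `<=` G1.
Hypothesis J0U : uniformizes G0 (plane_cubic C) J0.
Hypothesis J0_cover : forall t, upper R t -> same_point (J t) (cover_map (J0 t)).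
Hypothesis phi_def : forall t, phi t = p1_point (J t).
Variables (t : C) (e : nat).
Hypotheses (ut : upper R t) (phi_t : phi t = None) (stab : has_stabilizer_order G1 t e).

Let det_gt0 g : G1 g -> 0 < \det g.
Proof. by move=> /G1_det ->. Qed.

(** Every [g t] is a point of the cubic at infinity, and those are told apart by [F / G], a root of
    a fixed cubic polynomial. Elements with the same root differ by [G0] on the left and by the
    finite stabilizer of [t] on the right. *)
Lemma finite_index : exists2 L : seq 'M[R]_2, forall l, l \in L -> G1 l &
  forall g, G1 g -> exists2 h, G0 h & exists2 l, l \in L & g = h *m l.
Proof.
pose x g := J0 (mobius g t) 0 0 / J0 (mobius g t) 0 1.
have at_oo g : G1 g -> [/\ upper R (mobius g t), J0 (mobius g t) 0 2%:R = 0 &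
    J0 (mobius g t) 0 1 != 0].
  move=> gG; have ug := mobius_upper (det_gt0 gG) ut.
  have E : phi (mobius g t) = None.
    by rewrite -phi_t; apply/esym/(proj2 (phi_orbit JU phi_def ut ug)); exists g.
  have W0 : J0 (mobius g t) 0 2%:R = 0.
    by move: E; rewrite (phi_W J0_cover phi_def ug); case: eqP.
  split=> //; apply/eqP => g0; have := J0_neq0 J0U ug; apply/negP; rewrite negbK; apply/eqP.
  have := J0_curve J0U ug; rewrite W0 => H; have f0 := curve_w0 H g0.
  by apply/rowP; apply: ord3P; rewrite mxE.
have [s [sG _ s_all]] := stab.
have [rs rsE] := closed_field_poly_normal ('X^3 - 'X^2 - (625 / 702)%:P : {poly C}).
have p0 : 'X^3 - 'X^2 - (625 / 702)%:P != 0 :> {poly C}.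
  apply/eqP => /(congr1 (fun q : {poly C} => q`_3)).
  by rewrite !coefB !coefXn coefC /= !subr0 coef0 => /eqP; rewrite oner_eq0.
have x_rs g : G1 g -> x g \in rs.
  move=> gG; have [ug W0 g0] := at_oo g gG.
  have := curve_w0_root (_ : curve_form (J0 (mobius g t) 0 0) (J0 (mobius g t) 0 1) 0 = 0) g0.
  rewrite rsE rootZ ?lead_coef_eq0// root_prod_XsubC; apply.
  by have := J0_curve J0U ug; rewrite W0.
have /choice[l Hl] : forall y, exists l, G1 l /\ forall g, G1 g -> x g = y -> x l = y.
  move=> y; have [[g [gG gy]]|N] := pselect (exists g, G1 g /\ x g = y).
    by exists g; split.
  by exists 1%:M; split=> // g gG gy; case: N; exists g.
exists [seq l y *m s m | y <- rs, m <- enum 'I_e].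
  by move=> _ /allpairsP[[y m] [_ _ ->]] /=; apply: G1_M; [case: (Hl y)|case: (sG m)].
move=> g gG; have [lG lx] := Hl (x g); have {lx} lx := lx g gG erefl.
have [ug Wg Gg] := at_oo g gG; have [ul Wl Gl] := at_oo _ lG.
have E : eqv J0 (mobius (l (x g)) t) (mobius g t).
  exists (J0 (mobius (l (x g)) t) 0 1 / J0 (mobius g t) 0 1).
    exact: mulf_neq0 Gl (invr_neq0 Gg).
  apply/rowP; apply: ord3P; rewrite mxE.
  - by rewrite -[LHS](divfK Gl) -/(x _) lx /x; ring.
  - by rewrite divfK.
  - by rewrite Wl Wg mulr0.
have [h hG hE] := proj1 (eqv_orbit J0U ul ug) E.
have hG1 := G0_sub hG; have [h' hG' hh] := G1_V hG1; have [l' lG' ll] := G1_V lG.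
have kG := G1_M lG' (G1_M hG' gG).
have [|m km] := s_all _ kG.
  have canc a b z : G1 a -> G1 b -> b *m a = 1%:M -> upper R z -> mobius b (mobius a z) = z.
    by move=> aG bG ba uz; rewrite -mobiusM ?det_gt0// ba mobius1.
  have d' := det_gt0 hG'; have d'' := det_gt0 lG'; have dk := det_gt0 (G1_M hG' gG).
  by rewrite (mobiusM d'' dk ut) (mobiusM d' (det_gt0 gG) ut) hE (canc _ _ _ hG1 hG' hh ul) (canc _ _ _ lG lG' ll ut).
have gE : g = h *m l (x g) *m (l' *m (h' *m g)).
  by rewrite mulmxA -[h *m l _ *m l']mulmxA (mulmx1C ll) mulmx1 mulmxA (mulmx1C hh) mul1mx.
have inL : l (x g) *m s m \in [seq l y *m s m | y <- rs, m <- enum 'I_e].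
  by apply/allpairsP; exists (x g, m); rewrite /= x_rs// mem_enum.
case: km => km; [exists h => //|exists (- h); first exact: G0_N];
  exists (l (x g) *m s m) => //; rewrite {1}gE km mulmxA ?mulmxN ?mulNmx//.
Qed.
End FiniteIndex.

(** * CM points *)

Lemma involution_w (F : numFieldType) (e f g w w' : F) :
  12 * (- e * f) + (- 17) * (e * g) + (- (64 / 7)) * w' =
    e * (12 * f + (- 17) * g + (- (64 / 7)) * w) -> w' = e * (w + - (21 / 8) * f).
Proof.
move=> H; transitivity (- (7 / 64) * (12 * (- e * f) + (- 17) * (e * g) + (- (64 / 7)) * w'
  - 12 * (- e * f) + 17 * (e * g))); first by field.
by rewrite H; field.
Qed.

Lemma tangent_det (F : fieldType) (a b c w1 w2 g1 g2 : F) : c != 0 -> w1 != 0 -> w2 != 0 ->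
  g1 != g2 -> (a * 0 + b * (w1 * g1) + c * w1) * (w2 * g2)
    - (w1 * g1) * (a * 0 + b * (w2 * g2) + c * w2) != 0.
Proof.
move=> c0 w10 w20 gg; have -> : (a * 0 + b * (w1 * g1) + c * w1) * (w2 * g2)
    - (w1 * g1) * (a * 0 + b * (w2 * g2) + c * w2) = - (c * w1 * w2 * (g1 - g2)) by ring.
by rewrite oppr_eq0 !mulf_neq0// subr_eq0.
Qed.

Lemma frac_neq0 (F : numFieldType) (m n : nat) :
  (0 < m)%N -> (0 < n)%N -> m%:R / n%:R != 0 :> F.
Proof. by move=> m0 n0; rewrite mulf_neq0 ?invr_eq0 ?pnatr_eq0 -?lt0n. Qed.

Lemma quadratic_sqr (A : nzRingType) (x : A) (c : nat) : x * x = x - c%:R ->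
  (2 * x - 1) * (2 * x - 1) = 1 - (4 * c)%:R.
Proof.
move=> E; rewrite !mulr_natl mulrBl mulrBr mulr1 mul1r mulrnAr mulrnAl E.
rewrite -mulrnA mulrnBl opprB [in LHS](mulrnDr x 2 2 : x *+ (2 * 2) = _).
rewrite -[c%:R *+ _]mulr_natr -natrM mulnC [_ - (4 * c)%:R - _]addrAC addrK.
by rewrite addrAC -addrA addrCA addrA subrK addrC.
Qed.

Lemma q0_iota (F : numFieldType) (w : F) : w + - (21 / 8) * (w * (1 / (21 / 16))) = - w.
Proof. by field. Qed.

Lemma p7y_neq0 (F : numFieldType) (s : F) : s ^+ 2 = - 7 -> p7y s != 0.
Proof.
move=> s2; have : p7y s * (s + 7 / 3) = (s ^+ 2 + 7) * (39 / 350) - 104 / 75.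
  by rewrite /p7y; field.
rewrite s2 addNr mul0r sub0r => E; apply: contra_eq_neq E => ->.
by rewrite mul0r eq_sym oppr_eq0; exact: (@frac_neq0 F 104 75).
Qed.

Lemma q0_not_elliptic (F : numFieldType) (z : F) : z = - ((23 * 10 ^+ 3 + 549) / 125) ->
  z ^+ 3 - z ^+ 2 - 992 * z - (20 * 10 ^+ 3 + 736) != 0.
Proof.
move=> ->; have -> : (- ((23 * 10 ^+ 3 + 549) / 125)) ^+ 3 - (- ((23 * 10 ^+ 3 + 549) / 125)) ^+ 2
    - 992 * (- ((23 * 10 ^+ 3 + 549) / 125)) - (20 * 10 ^+ 3 + 736) =
  - (2 * 3 ^+ 6 * 7 ^+ 2 * 13 * 47 ^+ 2 * 79 ^+ 2) / 5 ^+ 9 :> F by field.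
by rewrite mulNr oppr_eq0 !mulf_eq0 invr_eq0 !expf_eq0 !pnatr_eq0.
Qed.

(** * The three CM points *)

Section Shimura.
Local Open Scope complex_scope.
Variables (R : realType) (K : fieldExtType rat) (theta0 : K).
Hypothesis theta0_root : theta0 ^+ 3 + theta0 ^+ 2 - 4 * theta0 + 1 = 0.
Hypothesis theta0_gen : <<1; theta0>>%VS = {: K}%VS.
Variables sigma1 sigma2 sigma3 : {rmorphism K -> R}.
Hypothesis sigma12 : sigma1 <> sigma2 :> (K -> R).
Hypothesis sigma13 : sigma1 <> sigma3 :> (K -> R).
Hypothesis sigma23 : sigma2 <> sigma3 :> (K -> R).
Variables (B : falgType K) (dimB : \dim {: B} = 4%N).
Variable i_inf : {rmorphism B -> 'M[R]_2}.
Hypothesis i_inf_sigma1 : restricts_to sigma1 i_inf.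
Variables (OB : set B) (OB_order : is_order OB).
Variables (Q8 : fieldType) (iota2 : {rmorphism K -> Q8}) (v : Q8 -> R).
Hypothesis v_abs : is_nonarch_abs v.
Hypothesis dense : forall (x : Q8) (e : R), 0 < e -> exists k : K, v (x - iota2 k) < e.
Hypothesis v_at_2 : v 2%:R < 1.
Variable i_2 : {rmorphism B -> 'M[Q8]_2}.
Hypothesis i_2_iota2 : restricts_to iota2 i_2.
Hypothesis i_2_integral : is_integral_splitting v OB i_2.
Variable d : B.
Hypothesis d_ns : forall c, i_inf d <> c%:M.
Local Notation C := R[i].
Local Notation G1 := (Gamma1 OB i_inf).
Local Notation G0 := (Gamma02 v OB i_inf i_2).
Local Notation un := (unit_norm i_inf OB).
Local Notation lev := (lower_even v i_2).
Local Notation al := (AL i_inf OB v i_2).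

Let span := i2_span v_abs i_2_integral.

Lemma i_inf_inj : injective i_inf.
Proof. by apply: (ii_inj _ dimB i_2_iota2 i_inf_sigma1 span d_ns); exact: K2_neq0. Qed.

Lemma i_inf_scalar b c : i_inf b = c%:M -> exists k, b = k%:A.
Proof. by apply: (ii_scalar _ dimB i_2_iota2 i_inf_sigma1 span d_ns); exact: K2_neq0. Qed.

Lemma OB_char y n : OB y -> \det (i_inf y) = n%:R -> exists t,
  [/\ integers K t, y * y = t *: y - n%:R%:A & sigma1 t = \tr (i_inf y)].
Proof.
move=> yO dy; have [t [m [ti mi tm St Sm]]] :=
  OB_trn dimB i_inf_sigma1 OB_order v_abs i_2_iota2 i_2_integral d_ns yO.
exists t; split=> //; rewrite (trn_quad dimB i_2_iota2 span tm).
congr (_ - _%:A); apply: (fmorph_inj sigma1); rewrite Sm dy rmorph_nat //.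
Qed.

Lemma Gamma1_det g : G1 g -> \det g = 1.
Proof. by case=> w [_ wd] <-. Qed.

Lemma Gamma1_1 : G1 1%:M.
Proof.
exists 1; last exact: rmorph1.
by split; [exact: OB1 OB_order|rewrite rmorph1 det1].
Qed.

Lemma Gamma1_M g h : G1 g -> G1 h -> G1 (g *m h).
Proof.
case=> w wn <- [w' wn' <-]; exists (w * w'); last exact: iiM.
exact: (unit_normM OB_order wn wn').
Qed.

Let un_inv := unit_norm_inv dimB i_inf_sigma1 OB_order v_abs i_2_iota2 i_2_integral d_ns.

Lemma Gamma1_V g : G1 g -> exists2 h, G1 h & h *m g = 1%:M.
Proof.
case=> w wn <-; have [y [yn _ yw _]] := un_inv wn.
by exists (i_inf y); [exists y|rewrite -iiM yw rmorph1].
Qed.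

Lemma Gamma02_V g : G0 g -> exists2 h, G0 h & h *m g = 1%:M.
Proof.
case=> w [wn wl] <-; have [y [yn _ yw yl]] := un_inv wn.
by exists (i_inf y); [exists y => //; split => //; exact: yl|rewrite -iiM yw rmorph1].
Qed.

Lemma Gamma02_sub : G0 `<=` G1.
Proof. by move=> _ [w [wn _] <-]; exists w. Qed.

Lemma det2N (g : 'M[R]_2) : \det (- g) = \det g.
Proof. by rewrite !det2E !mxE !mulrNN. Qed.

Lemma Gamma02_N g : G0 g -> G0 (- g).
Proof.
case=> w [[wO wd] wl] <-; have wO' := OB_N OB_order wO.
exists (- w); last exact: rmorphN.
split; last by rewrite /= rmorphN !mxE (vN v_abs).
by split=> //; rewrite rmorphN det2N.
Qed.

Lemma Gamma1_N1 : G1 (- 1%:M).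
Proof.
have N1 := OB_N OB_order (OB1 OB_order).
exists (- 1); last by rewrite rmorphN rmorph1.
by split=> //; rewrite rmorphN rmorph1 det2N det1.
Qed.

Lemma AL_normalizes b g : al b -> un g -> lev g ->
  exists g', [/\ un g', lev g' & b * g = g' * b].
Proof.
move=> bA gn gl; have bgA := AL_mulG OB_order v_abs i_2_integral bA gn gl.
exact: (AL_quot theta0_root theta0_gen sigma12 sigma13 sigma23 dimB i_inf_sigma1 OB_order
  v_abs v_at_2 i_2_iota2 i_2_integral d_ns bgA bA).
Qed.

(** Otherwise [b] times the inverse of an element of norm 1 would be a scalar in [K] of square 2. *)
Lemma AL_not_scaled b : al b -> ~ exists g c, G0 g /\ i_inf b = c *: g.
Proof.
case=> bO bd _ _ _ [g [c [[w [wn _] wg] bE]]].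
have [y [yn wy _ _]] := un_inv wn.
have E : i_inf (b * y) = c%:M.
  by rewrite iiM bE -wg -scalemxAl -iiM wy rmorph1 scalemx1.
have [k kE] := i_inf_scalar E.
have : \det (i_inf (b * y)) = 2 by rewrite iiM det_mulmx bd (proj2 yn) mulr1.
rewrite kE i_inf_sigma1 det_scalar -rmorphXn -(rmorph_nat sigma1) => /fmorph_inj.
exact: (sqrt2_notin theta0_root theta0_gen sigma12 sigma13 sigma23 iota2 v_abs v_at_2).
Qed.
Variables (J : C -> 'rV[C]_2) (J0 : C -> 'rV[C]_3) (phi : C -> option C).
Hypothesis JU : uniformizes G1 [set: 'rV[C]_2] J.
Hypothesis J0U : uniformizes G0 (plane_cubic C) J0.
Hypothesis J0_cover : forall t, upper R t -> same_point (J t) (cover_map (J0 t)).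
Hypothesis phi_def : forall t, phi t = p1_point (J t).
Hypothesis elliptic_points : forall tau (e : nat), upper R tau -> (1 < e)%N ->
  (is_elliptic G1 tau e <->
     (e = 3%N /\ phi tau = None) \/
     (e = 2%N /\ exists2 z, phi tau = Some z &
                 z ^+ 3 - z ^+ 2 - 992 * z - (20 * 10 ^+ 3 + 736) = 0)).
Variables (t_oo : C) (ut_oo : upper R t_oo) (phi_oo : phi t_oo = None).

Let stab_oo : has_stabilizer_order G1 t_oo 3.
Proof. by have [_ _] : is_elliptic G1 t_oo 3 by apply/(elliptic_points ut_oo (isT : (1 < 3)%N)); left. Qed.

Let index := finite_index Gamma1_1 Gamma1_M Gamma1_V Gamma1_det JU Gamma02_N Gamma02_sub
  J0U J0_cover phi_def ut_oo phi_oo stab_oo.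

Local Notation F z := (J0 z 0 0).
Local Notation G z := (J0 z 0 1).
Local Notation W z := (J0 z 0 2%:R).
Local Notation cc := (curve_coef C).
Local Notation pc := (phi_coef C).

Lemma on_curve z : upper R z -> W z != 0 -> cub2 cc (F z / W z) (G z / W z) = 0.
Proof. by move=> uz Wz; rewrite curve_affine// (J0_curve J0U uz) mul0r. Qed.

Lemma phi_XY z : upper R z -> W z != 0 -> phi z = Some (cub2 pc (F z / W z) (G z / W z)).
Proof. by move=> uz Wz; rewrite (phi_W J0_cover phi_def uz) (negPf Wz) phi_affine. Qed.

Lemma affine_point f g : cub2 cc f g = 0 -> exists t,
  [/\ upper R t, W t != 0, F t = W t * f & G t = W t * g].
Proof.
move=> H; have n0 : row3 f g 1 != 0 :> 'rV[C]_3.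
  by apply/eqP => /rowP /(_ 2%:R); rewrite !mxE /= => /eqP; rewrite oner_eq0.
have cE : curve_form f g 1 = 0.
  by have := curve_affine f g (oner_neq0 C); rewrite !divr1 expr1n divr1 H => <-.
have [t ut [c c0 E]] := J0_onto J0U n0 cE.
by exists t; rewrite E !mxE /= !mulr1.
Qed.

Lemma over_elliptic g : cub2 cc 0 g = 0 -> exists t w,
  [/\ [/\ upper R t, F t = 0, W t != 0 & G t = W t * g], un w, lev w, w * w = -1 &
      al (1 + w) /\ mobius (i_inf (1 + w)) t = t].
Proof.
move=> g0; have [t [ut Wt Ft Gt]] := affine_point g0; rewrite mulr0 in Ft.
have Xt : F t / W t = 0 by rewrite Ft mul0r.
have Yt : G t / W t = g by rewrite Gt mulrC mulKf.
have ph := phi_XY ut Wt; rewrite Xt Yt in ph.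
have [_ _ st] : is_elliptic G1 t 2.
  apply/(elliptic_points ut (ltnSn 1)); right; split=> //.
  by exists (cub2 pc 0 g) => //; exact: phi_f0 g0.
have [i [iG it ii]] := stabilizer2 Gamma1_M Gamma1_V Gamma1_det ut st.
have jn : jac cc pc (F t / W t) (G t / W t) (F t / W t) (G t / W t) != 0.
  by rewrite Xt Yt; exact: jac_f0 g0.
have [h [c [hG hE]]] := stab_in_G0 Gamma1_det JU Gamma02_V Gamma02_sub J0U phi_def
  on_curve phi_XY ut Wt jn iG it.
have iG0 : G0 i.
  have := Gamma1_det iG; rewrite hE detZ (Gamma1_det (Gamma02_sub hG)) mulr1 => /eqP.
  rewrite sqrf_eq1 => /orP[] /eqP ->; rewrite ?scale1r ?scaleN1r //.
  exact: Gamma02_N.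
have [w [wn wl] wi] := iG0.
have ww : w * w = -1.
  by apply: i_inf_inj; rewrite rmorphM rmorphN rmorph1 wi.
have wA : al (1 + w).
  exact: (AL_one_plus theta0_root theta0_gen sigma12 sigma13 sigma23 dimB i_inf_sigma1 OB_order
    v_abs dense v_at_2 i_2_iota2 i_2_integral d_ns (proj1 wn) ww wl).
exists t, w; split=> //; split=> //.
have wE : i_inf (1 + w) = 1%:M + 1 *: i by rewrite rmorphD rmorph1 wi scale1r.
rewrite wE; apply: fix_combination => //; first by rewrite Gamma1_det.
by rewrite -wE; case: wA => _ -> _ _ _; rewrite pnatr_eq0.
Qed.

(* [1 + w] acts as the involution [(f, g, l) |-> (- f, g, l)] of the cubic, where
   [l = 12 f - 17 g - 64 / 7 w]. *)
Lemma AL_involution : exists2 b, al b & forall z, upper R z -> exists e : C, [/\ e != 0,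
  F (mobius (i_inf b) z) = - e * F z, G (mobius (i_inf b) z) = e * G z &
  W (mobius (i_inf b) z) = e * (W z + - (21 / 8) * F z)].
Proof.
pose q (x : C) := - (625 / 702) * x ^+ 3 + 50 / 441 * x + - (640 / (9 * 10 ^+ 3 + 261)).
have qE x : q x = cub2 cc 0 x by rewrite curve_f0 /q !mulNr.
have [||x [y [z [qx qy qz [xy xz yz]]]]] := @three_roots C (- (625 / 702)) (50 / 441)
    (- (640 / (9 * 10 ^+ 3 + 261))).
- by rewrite oppr_eq0; exact: (@frac_neq0 C 625 702).
- move=> x /eqP; rewrite -/(q x) qE => /eqP /curve_f0_simple.
  by congr (_ != 0); congr (_ * _ + _); field.
have [t1 [w1 [[ut1 F1 W1 G1'] w1n w1l w1w [b1A b1t]]]] := over_elliptic (etrans (esym (qE x)) qx).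
have [t2 [w2 [[ut2 F2 W2 G2] _ _ _ [b2A b2t]]]] := over_elliptic (etrans (esym (qE y)) qy).
have [t3 [w3 [[ut3 F3 W3 G3] _ _ _ [b3A b3t]]]] := over_elliptic (etrans (esym (qE z)) qz).
exists (1 + w1) => //; set bm := i_inf (1 + w1).
have bd : 0 < \det bm by case: b1A => _ -> _ _ _; rewrite ltr0n.
have un_gt0 g : un g -> 0 < \det (i_inf g) by case=> _ ->.
have G0_un g : un g -> lev g -> G0 (i_inf g) by move=> gn gl; exists g.
have b_eqv z1 z2 : upper R z1 -> upper R z2 -> eqv J0 z1 z2 ->
    eqv J0 (mobius bm z1) (mobius bm z2).
  move=> u1 u2 /(eqv_orbit J0U u1 u2)[_ [g [gn gl] <-] ->].
  have [g' [gn' gl' E]] := AL_normalizes b1A gn gl.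
  have -> : mobius bm (mobius (i_inf g) z1) = mobius (i_inf g') (mobius bm z1).
    by rewrite -(mobiusM bd (un_gt0 g gn) u1) -(mobiusM (un_gt0 g' gn') bd u1) -!iiM E.
  by apply: (eqv_G0 Gamma1_det Gamma02_sub J0U (mobius_upper bd u1)); exact: G0_un.
have b_inv u : upper R u -> eqv J0 (mobius bm (mobius bm u)) u.
  move=> uu; rewrite -(mobiusM bd bd uu) -iiM.
  (* As [w1 * w1 = -1], the square of [1 + w1] is twice an element of [Gamma_0(2)], which acts
     trivially on the cubic. *)
  have -> : (1 + w1) * (1 + w1) = w1 + w1.
    by rewrite mulrDl !mulrDr !mul1r mulr1 w1w addrC addrA subrK.
  rewrite rmorphD -mulr2n -scaler_nat mobiusZ ?pnatr_eq0//.
  by apply: same_point_sym; apply: (eqv_G0 Gamma1_det Gamma02_sub J0U uu); exact: G0_un.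
have b_fix w u : al (1 + w) -> upper R u -> mobius (i_inf (1 + w)) u = u -> eqv J0 (mobius bm u) u.
  move=> wA uu wu; have [g [gn gl E]] := AL_quot theta0_root theta0_gen sigma12 sigma13 sigma23
    dimB i_inf_sigma1 OB_order v_abs v_at_2 i_2_iota2 i_2_integral d_ns b1A wA.
  have wd : 0 < \det (i_inf (1 + w)) by case: wA => _ -> _ _ _; rewrite ltr0n.
  rewrite /bm E iiM (mobiusM (un_gt0 g gn) wd uu) wu.
  by apply: same_point_sym; apply: (eqv_G0 Gamma1_det Gamma02_sub J0U uu); exact: G0_un.
have cw0 : - (64 / 7) != 0 :> C by rewrite oppr_eq0; exact: (@frac_neq0 C 64 7).
have a0 : 9 / 128 != 0 :> C := @frac_neq0 C 9 128 isT isT.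
have p3 : 45 / 832 != 0 :> C := @frac_neq0 C 45 832 isT isT.
have det0 a1 a2 g1 g2 : F a1 = 0 -> F a2 = 0 -> W a1 != 0 -> W a2 != 0 -> g1 != g2 ->
    G a1 = W a1 * g1 -> G a2 = W a2 * g2 ->
    (12 * F a1 + (- 17) * G a1 + (- (64 / 7)) * W a1) * G a2
      - G a1 * (12 * F a2 + (- 17) * G a2 + (- (64 / 7)) * W a2) != 0.
  by move=> -> -> n1 n2 gg -> ->; exact: tangent_det.
have curve u := fun uu => curve_fgl (@J0_curve R G0 J0 J0U u uu).
have inv := involution Gamma1_V Gamma1_det JU Gamma02_V Gamma02_sub index J0U phi_def cw0 a0 p3
  curve bd b_eqv b_inv (AL_not_scaled b1A) ut1 ut2 ut3 F1 F2 (b_fix _ _ b1A ut1 b1t)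
  (b_fix _ _ b2A ut2 b2t) (b_fix _ _ b3A ut3 b3t)
  (det0 _ _ _ _ F1 F2 W1 W2 xy G1' G2) (det0 _ _ _ _ F1 F3 W1 W3 xz G1' G3)
  (det0 _ _ _ _ F2 F3 W2 W3 yz G2 G3).
move=> u uu; have [E1 E2 E3] := inv u uu; have ub := mobius_upper bd uu.
have nz s : upper R s -> ~ (F s = 0 /\ G s = 0 /\
    12 * F s + (- 17) * G s + (- (64 / 7)) * W s = 0).
  move=> us [Fs [Gs Ls]]; have := J0_neq0 J0U us; apply/negP; rewrite negbK; apply/eqP.
  apply/rowP; apply: ord3P; rewrite mxE //; apply: (mulfI cw0).
  by move: Ls; rewrite Fs Gs !mulr0 !add0r.
have [e e0 [Fe Ge Le]] := iota_scale (nz u uu) (nz _ ub) E1 E2 E3.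
exists e; split=> //; move: Le; rewrite Fe Ge; exact: involution_w.
Qed.

Let OBZ k x : integers K k -> OB x -> OB (k *: x).
Proof. by move=> ki xO; exact: (order_scale OB_order). Qed.

Let OB_quad y : OB y ->
  exists t n, [/\ integers K t, integers K n & y * y = t *: y - n%:A].
Proof.
move=> yO; have [t [m [ti mi tm _ _]]] :=
  OB_trn dimB i_inf_sigma1 OB_order v_abs i_2_iota2 i_2_integral d_ns yO.
by exists t, m; split=> //; rewrite (trn_quad dimB i_2_iota2 span tm).
Qed.

Let ev := even_sqr theta0_root theta0_gen sigma12 sigma13 sigma23.

Lemma det2_fixed al t : OB al -> \det (i_inf al) = 2 -> upper R t ->
  mobius (i_inf al) t = t -> exists2 x, integers K x & al * al = x *: al - 2 /\
    2 * (mult (i_inf al) t + (mult (i_inf al) t)^-1) = (sigma1 (x ^+ 2 - 4))%:C.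
Proof.
move=> aO da ut fa; have [x [xi E Sx]] := OB_char aO da.
exists x => //; split; first by rewrite E scaler_nat.
have a0 : 0 < \det (i_inf al) by rewrite da ltr0n.
have := mult_trace a0 ut fa; rewrite da -Sx => H.
transitivity ((sigma1 x)%:C ^+ 2 - 2 * (2%:R)%:C); last first.
  by rewrite rmorphB rmorphXn rmorph_nat /= rmorphB rmorphXn /= !rmorph_nat -natrM.
by rewrite -H rmorph_nat.
Qed.

Lemma p7_point : exists t (s : C), [/\ s ^+ 2 = - 7, upper R t, W t != 0,
  F t = W t * p7x s & G t = W t * p7y s].
Proof.
have s2 : sqrtC (- 7) ^+ 2 = - 7 :> C := sqrtCK _.
have [t [ut Wt Ft Gt]] := affine_point (p7_curve s2).
by exists t, (sqrtC (- 7)).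
Qed.

Lemma CM2 L : is_sqrt_ext L (- 2) ->
  is_CM_point OB i_inf phi L (Some (- ((23 * 10 ^+ 3 + 549) / 125))).
Proof.
move=> Ls; have [b bA bI] := AL_involution.
have [bO bdet _ _ _] := bA; have bd : 0 < \det (i_inf b) by rewrite bdet ltr0n.
have [t [ut Wt Ft Gt]] := affine_point (q0_curve C).
have pt : phi t = Some (- ((23 * 10 ^+ 3 + 549) / 125)).
  by rewrite (phi_XY ut Wt) Ft Gt !(mulrC (W t)) !(mulfK Wt) q0_phi.
rewrite mulr0 in Gt.
have ubt := mobius_upper bd ut.
(* At the flex [W - (21/8) F = - W], so the involution multiplies the whole coordinate vector by
   [- e]. *)
have E : eqv J0 (mobius (i_inf b) t) t.
  have [e [e0 Fe Ge We]] := bI t ut; exists (- e); first by rewrite oppr_eq0.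
  apply/rowP; apply: ord3P; rewrite mxE //; first by rewrite Ge Gt !mulr0.
  by rewrite We Ft q0_iota mulrN mulNr.
have [_ [g [gn gl] <-] tE] := proj1 (eqv_orbit J0U ubt ut) E.
have g0 : 0 < \det (i_inf g) by case: gn => _ ->.
pose al := g * b; have aE : i_inf al = i_inf g *m i_inf b by exact: iiM.
have aO : OB al := OB_M OB_order (proj1 gn) bO.
have da : \det (i_inf al) = 2 by rewrite aE det_mulmx bdet (proj2 gn) mul1r.
have a0 : 0 < \det (i_inf al) by rewrite da ltr0n.
have fa : mobius (i_inf al) t = t by rewrite aE mobiusM.
have ab w : upper R w -> eqv J0 (mobius (i_inf b) w) (mobius (i_inf al) w).
  move=> uw; rewrite aE mobiusM//.
  by apply: (eqv_G0 Gamma1_det Gamma02_sub J0U (mobius_upper bd uw)); exists g.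
have F0 : F t != 0.
  apply/eqP => Ft0; move: (q0_iota (W t)); rewrite -Ft Ft0 mulr0 addr0 => /eqP.
  by rewrite -subr_eq0 opprK -mulr2n mulrn_eq0 (negPf Wt).
have nG : ~ near t (fun z => G z = 0).
  have [u [s [s2 uu Wu _ Gu]]] := p7_point.
  by apply: (uhol_nz (J0_uhol J0U 1) uu _ ut); rewrite Gu; exact: mulf_neq0 Wu (p7y_neq0 s2).
have [m m0 Hm] := flex_rotation J0U bI ut F0 Gt nG a0 fa ab.
have mu0 := mult_neq0 a0 ut.
have [x xi [quad tr]] := det2_fixed aO da ut fa.
have [z zi xz] := cheb_neg theta0_root theta0_gen sigma12 sigma13 sigma23 xi mu0 tr Hm m0.
(* [y] is [al^2 / 2], since [al] has trace [2 z] and norm 2. *)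
pose y := z *: al - 1.
have yy : al * al = 2 * y.
  by rewrite quad xz /y mulrBr mulr1 mulr_natl -scalerMnl mulr_natl.
have yO : OB y := OB_B OB_order (OBZ zi aO) (OB1 OB_order).
have iy : i_inf al *m i_inf al = 2 *: i_inf y.
  by rewrite -iiM yy mulr_natl rmorphMn scaler_nat.
have yn : un y.
  split=> //; have := congr1 (fun M : 'M[R]_2 => \det M) iy.
  rewrite det_mulmx detZ da => /esym; rewrite -[X in _ = X]mulr1 => /mulfI; apply.
  by rewrite expf_neq0// pnatr_eq0.
have y0 : 0 < \det (i_inf y) by case: yn => _ ->.
have fy : mobius (i_inf y) t = t.
  by rewrite -(@mobiusZ _ 2) ?pnatr_eq0// -iy mobiusM// fa.
(* A non-scalar [y] would give [t] a finite stabilizer of order greater than 1; but the value of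
   [phi] at [t] is not that of an elliptic point. *)
have [c yc] : exists c, i_inf y = c%:M.
  apply: contrapT => N; have [k k0 Hk] := stabilizer_torsion Gamma1_det JU ut.
  have [|e e1 st] := finite_stabilizer Gamma1_1 Gamma1_M Gamma1_V Gamma1_det ut k0 Hk.
    by exists (i_inf y); split=> // [|c Ec]; [exists y|apply: N; exists c].
  have : is_elliptic G1 t e by [].
  rewrite elliptic_points// pt => -[[]//|[_ [q [qE]]]]; apply/eqP.
  exact: q0_not_elliptic (esym qE).
have c1 : c = -1.
  (* If [al^2] were 2, the trace times [al] would be 4, so [al] would be scalar with multiplier 1,
     whereas a power of the multiplier is -1. *)
  have := proj2 yn; rewrite yc => /det_scalar_eq1[c1|//].
  exfalso; move: iy; rewrite yc c1 => iy.
  have := cayley2 (i_inf al); rewrite iy da => tE2.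
  have sE : \tr (i_inf al) *: i_inf al = 4%:M.
    by rewrite -[LHS](subrK 2%:M) -tE2 scalemx1 -raddfD -natrD.
  have tr0 : \tr (i_inf al) != 0.
    apply/eqP => T; move: sE; rewrite T scale0r => /(congr1 (fun M : 'M[R]_2 => M 0 0)).
    by rewrite !mxE /= => /esym/eqP; rewrite mulr1n pnatr_eq0.
  have ac : i_inf al = ((\tr (i_inf al))^-1 * 4)%:M.
    by rewrite -scale_scalar_mx -sE scalerA mulVf// scale1r.
  have := Hm; rewrite ac mult_scalar ?mulf_neq0 ?invr_neq0 ?pnatr_eq0// expr1n => /eqP.
  by rewrite -subr_eq0 opprK -(natrD _ 1 1) pnatr_eq0.
have y1 : y = -1 by apply: i_inf_inj; rewrite yc c1 !rmorphN1.
rewrite -pt; apply: (CM_sqrt2 i_inf_sigma1 (OB_D OB_order) OBZ (OB1 OB_order) OB_quad ev phi Ls aO _ a0 ut fa).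
by rewrite yy y1 mulrN1.
Qed.

Lemma CM_of_quadratic (p : nat) (om : B) (a b : R) (M : 'M[R]_2) t L :
  (p = 3 \/ p = 7)%N -> is_sqrt_ext L (- p%:Z) -> OB om ->
  (2 * om - 1) * (2 * om - 1) = - p%:R -> i_inf (2 * om - 1) = a%:M + b *: M ->
  0 < \det M -> upper R t -> mobius M t = t -> is_CM_point OB i_inf phi L (phi t).
Proof.
move=> p37 Ls oO sq iE M0 ut Mt.
have p0 : (0 < p)%N by case: p37 => ->.
have i0 : 0 < \det (i_inf (2 * om - 1)).
  apply: (@neg_sqr_det R _ p%:R); first by rewrite ltr0n.
  by rewrite -iiM sq !rmorphN !rmorph_nat.
have div (x y : K) : integers K x -> integers K y -> x ^+ 2 = p%:R * y ->
    exists2 z, integers K z & x = p%:R * z.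
  move=> xi yi; apply: (div_of_sqr theta0_root theta0_gen sigma12 sigma13 sigma23 p0) => //.
    by case: p37 => ->.
  by case: p37 => ->; vm_compute.
apply: (CM_sqrt_odd i_inf_sigma1 (OB_D OB_order) OBZ (OB1 OB_order) OB_quad ev phi p37 div Ls oO sq i0 ut).
by rewrite iE; apply: fix_combination => //; rewrite -iE gt_eqF.
Qed.

Lemma CM3 L : is_sqrt_ext L (- 3) -> is_CM_point OB i_inf phi L None.
Proof.
move=> Ls; have [_ [[w [wO wd] <-] wt ww]] :=
  stabilizer3 Gamma1_M Gamma1_V Gamma1_det ut_oo stab_oo Gamma1_N1.
have w2 : w * w = - w - 1.
  apply: i_inf_inj; apply/eqP; rewrite -subr_eq0 !rmorphB /= !rmorphN rmorph1 opprD !opprK.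
  by apply/eqP; rewrite -[RHS]ww addrA rmorphM.
(* [w] is a primitive cube root of unity, so [w + 1] is a primitive sixth root and [2 * (w + 1) - 1]
   has square -3. *)
have om2 : (w + 1) * (w + 1) = (w + 1) - 1%:R.
  by rewrite mulrDl mulrDr mul1r !mulr1 w2 [- w - 1]addrC addrNK addrC.
rewrite -phi_oo.
have oO : OB (w + 1) := OB_D OB_order wO (OB1 OB_order).
apply: (@CM_of_quadratic 3 (w + 1) 1 2 (i_inf w)) => //; first by left.
- rewrite (quadratic_sqr om2); apply/eqP; rewrite subr_eq addrC; apply/eqP.
  by rewrite -[(4 * 1)%N]/(1 + 3)%N natrD addrK.
- rewrite mulrDr mulr1 -addrA (_ : 2 - 1 = 1); last by rewrite -[2]/(1 + 1) addrK.
  by rewrite rmorphD rmorph1 mulr_natl rmorphMn scaler_nat addrC.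
- by rewrite wd.
Qed.

Lemma CM7 L : is_sqrt_ext L (- 7) -> is_CM_point OB i_inf phi L (Some (4752 / 125)).
Proof.
move=> Ls; have [b bA bI] := AL_involution.
have [bO bdet _ _ _] := bA; have bd : 0 < \det (i_inf b) by rewrite bdet ltr0n.
have [t [s [s2 ut Wt Ft Gt]]] := p7_point.
have Xt : F t / W t = p7x s by rewrite Ft mulrC mulKf.
have Yt : G t / W t = p7y s by rewrite Gt mulrC mulKf.
have [k0 j0] := p7_neq0 s2.
have ubt := mobius_upper bd ut.
have pt : phi t = Some (4752 / 125) by rewrite phi_XY// Xt Yt p7_phi.
have pbt : phi (mobius (i_inf b) t) = phi t.
  have [e [e0 Fe Ge We]] := bI t ut.
  have WE : W (mobius (i_inf b) t) = e * W t * (1 + - (21 / 8) * p7x s).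
    by rewrite We Ft; ring.
  have eW : e * W t != 0 by rewrite mulf_neq0.
  have EX : F (mobius (i_inf b) t) / W (mobius (i_inf b) t) = - p7x s / (1 + - (21 / 8) * p7x s).
    rewrite WE Fe Ft (_ : - e * _ = e * W t * - p7x s); last by ring.
    by rewrite -mulf_div divff// mul1r.
  have EY : G (mobius (i_inf b) t) / W (mobius (i_inf b) t) = p7y s / (1 + - (21 / 8) * p7x s).
    by rewrite WE Ge Gt mulrA -mulf_div divff// mul1r.
  rewrite pt phi_XY//; last by rewrite WE mulf_neq0.
  by rewrite EX EY p7_phi_iota.
have [_ [g gn <-] tE] := proj1 (phi_orbit JU phi_def ubt ut) pbt.
have g0 : 0 < \det (i_inf g) by case: gn => _ ->.
pose al := g * b; have aE : i_inf al = i_inf g *m i_inf b by exact: iiM.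
have aO : OB al := OB_M OB_order (proj1 gn) bO.
have da : \det (i_inf al) = 2 by rewrite aE det_mulmx bdet (proj2 gn) mul1r.
have a0 : 0 < \det (i_inf al) by rewrite da ltr0n.
have fa : mobius (i_inf al) t = t by rewrite aE mobiusM.
have ab w : upper R w -> phi (mobius (i_inf b) w) = phi (mobius (i_inf al) w).
  move=> uw; have ub := mobius_upper bd uw; rewrite aE mobiusM//.
  apply: (proj2 (phi_orbit JU phi_def ub (mobius_upper g0 ub))).
  by exists (i_inf g) => //; exists g.
have mu0 := mult_neq0 a0 ut.
have [x xi [quad tr]] := det2_fixed aO da ut fa.
have := double_rotation JU J0U phi_def on_curve phi_XY bd bI (@iota_affine C) ut Wt.
rewrite Xt Yt => /(_ _ (p7_phi s2) (p7_iota s2) k0 j0 a0 fa ab)[m Hm].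
have x2 := cheb_pos theta0_root theta0_gen sigma12 sigma13 sigma23 iota2 v_abs v_at_2 xi mu0 tr
  (p7_rho s2 Hm).
(* As [x ^+ 2 = 1], multiplying [al] by its own trace [x] normalizes the trace to 1. *)
have oO : OB (x *: al) := OBZ xi aO.
have om2 : (x *: al) * (x *: al) = x *: al - 2%:R.
  rewrite -scalerAl -scalerAr scalerA -expr2 x2 scale1r; exact: quad.
rewrite -pt; apply: (@CM_of_quadratic 7 (x *: al) (- 1) (2 * sigma1 x) (i_inf al)) => //.
- by right.
- rewrite (quadratic_sqr om2); apply/eqP; rewrite subr_eq addrC; apply/eqP.
  by rewrite -[(4 * 2)%N]/(1 + 7)%N natrD addrK.
rewrite rmorphB rmorph1 mulr_natl rmorphMn /= (restricts_scale i_inf_sigma1).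
by rewrite addrC -scaler_nat scalerA rmorphN1.
Qed.
End Shimura.

Lemma ratr_phi2 (F : numFieldType) :
  ratr (- ((23 * 10 ^+ 3 + 549) / 5 ^+ 3)) = - ((23 * 10 ^+ 3 + 549) / 125) :> F.
Proof.
have -> : (23 * 10 ^+ 3 + 549) / 5 ^+ 3 = (23 * 10 ^+ 3 + 549) / 125 :> rat by field.
rewrite rmorphN fmorph_div; congr (- (_ / _)); last exact: ratr_nat.
by rewrite rmorphD rmorphM rmorphXn; congr (_ * _ ^+ _ + _); exact: ratr_nat.
Qed.

Lemma ratr_phi7 (F : numFieldType) : ratr (2 ^+ 4 * 3 ^+ 3 * 11 / 5 ^+ 3) = 4752 / 125 :> F.
Proof.
have -> : 2 ^+ 4 * 3 ^+ 3 * 11 / 5 ^+ 3 = 4752 / 125 :> rat by field.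
by rewrite fmorph_div; congr (_ / _); exact: ratr_nat.
Qed.

Theorem proposition6 (R : realType)
    (K : fieldExtType rat) (theta0 : K)
    (theta0_root : theta0 ^+ 3 + theta0 ^+ 2 - 4 * theta0 + 1 = 0)
    (theta0_gen : <<1; theta0>>%VS = {: K}%VS)
    (sigma1 sigma2 sigma3 : {rmorphism K -> R})
    (sigma12 : sigma1 <> sigma2 :> (K -> R))
    (sigma13 : sigma1 <> sigma3 :> (K -> R))
    (sigma23 : sigma2 <> sigma3 :> (K -> R))
    (B : falgType K)
    (B_ram : is_quaternion_ramified_at sigma1 sigma2 sigma3 B)
    (i_inf : {rmorphism B -> 'M[R]_2})
    (i_inf_sigma1 : restricts_to sigma1 i_inf)
    (OB : set B) (OB_max : is_maximal_order OB)
    (Q8 : fieldType) (iota2 : {rmorphism K -> Q8}) (v : Q8 -> R)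
    (Q8_completion : is_finite_completion iota2 v) (v_at_2 : v 2%:R < 1)
    (i_2 : {rmorphism B -> 'M[Q8]_2})
    (i_2_iota2 : restricts_to iota2 i_2)
    (i_2_integral : is_integral_splitting v OB i_2)
    (J : R[i] -> 'rV[R[i]]_2)
    (J_uniformizes : uniformizes (Gamma1 OB i_inf) [set: 'rV[R[i]]_2] J)
    (phi : R[i] -> option R[i])
    (phi_def : forall tau, phi tau = p1_point (J tau))
    (J_canonical : is_canonical_model sigma1 OB i_inf phi)
    (J0 : R[i] -> 'rV[R[i]]_3)
    (J0_uniformizes :
      uniformizes (Gamma02 v OB i_inf i_2) (plane_cubic R[i]) J0)
    (J0_cover : forall tau, upper R tau ->
      same_point (J tau) (cover_map (J0 tau)))
    (elliptic_points : forall tau (e : nat), upper R tau -> (1 < e)%N ->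
      (is_elliptic (Gamma1 OB i_inf) tau e <->
         (e = 3%N /\ phi tau = None) \/
         (e = 2%N /\ exists2 z, phi tau = Some z &
                     z ^+ 3 - z ^+ 2 - 992 * z - (20 * 10 ^+ 3 + 736) = 0))) :
  let CM_point := is_CM_point OB i_inf phi in
  (* the embedding of the rational points of X(1) in its complex points *)
  let of_rational := omap (ratr : rat -> R[i]) in
  [/\ (forall tau, upper R tau ->
         (phi tau = of_rational None <->
          is_elliptic (Gamma1 OB i_inf) tau 3)) /\
      (forall L : fieldExtType K, is_sqrt_ext L (- 3) ->
         CM_point L (of_rational None)),
      forall L : fieldExtType K, is_sqrt_ext L (- 7) ->
        CM_point L (of_rational (Some (2 ^+ 4 * 3 ^+ 3 * 11 / 5 ^+ 3)))
    & forall L : fieldExtType K, is_sqrt_ext L (- 2) ->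
        CM_point L
          (of_rational (Some (- ((23 * 10 ^+ 3 + 549) / 5 ^+ 3))))].
Proof.
move=> CM_point of_rational.
have [[dimB _] _ _ _ _] := B_ram; have OB_order := proj1 OB_max.
have [v_abs _ dense _] := Q8_completion.
have [t_oo ut_oo phi_oo] : exists2 t, upper R t & phi t = None.
  have [_ _ _ onto] := J_uniformizes.
  have n0 : (\row_m (m == 0)%:R : 'rV[R[i]]_2) != 0.
    by apply/eqP => /rowP /(_ 0); rewrite !mxE /= => /eqP; rewrite oner_eq0.
  have [t ut [c _ E]] := onto _ n0 I; exists t => //.
  by rewrite phi_def /p1_point E !mxE /= mulr0 eqxx.
have [_ _ stab] : is_elliptic (Gamma1 OB i_inf) t_oo 3.
  by apply/(elliptic_points _ _ ut_oo (isT : (1 < 3)%N)); left.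
have det1 g : Gamma1 OB i_inf g -> \det g = 1 by case=> w [_ wd] <-.
(* The elliptic point of order 3 supplies the non-scalar element on which the comparison of traces
   in the two splittings rests. *)
have [_ [[d _ <-] _ d_ns]] := stabilizer_nonscalar det1 (isT : (1 < 3)%N) stab.
split; [split| |] => [t ut|L Ls|L Ls|L Ls]; rewrite /CM_point /of_rational /=.
- have H := elliptic_points t 3 ut isT.
  split=> [p|/H[[_ p]|[e3 _]]]; [by apply/H; left|exact: p|discriminate e3].
- exact: (CM3 theta0_root theta0_gen sigma12 sigma13 sigma23 dimB i_inf_sigma1 OB_order v_abs
    i_2_iota2 i_2_integral d_ns elliptic_points ut_oo phi_oo Ls).
- rewrite ratr_phi7; exact: (CM7 theta0_root theta0_gen sigma12 sigma13 sigma23 dimB i_inf_sigma1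
    OB_order v_abs dense v_at_2 i_2_iota2 i_2_integral d_ns J_uniformizes J0_uniformizes J0_cover
    phi_def elliptic_points ut_oo phi_oo Ls).
- rewrite ratr_phi2; exact: (CM2 theta0_root theta0_gen sigma12 sigma13 sigma23 dimB i_inf_sigma1
    OB_order v_abs dense v_at_2 i_2_iota2 i_2_integral d_ns J_uniformizes J0_uniformizes J0_cover
    phi_def elliptic_points ut_oo phi_oo Ls).
Qed.
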